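(* Let $d\ge2$, let $\nu>0$ be fixed, let $(\mathcal V,w)$ be an isotropic lattice in $\mathbf R^d$ associated with the speed of sound $c_s>0$, let $0<\varepsilon<1$ be fixed and let $m\in\mathbf N$ with $m>d$. Then for any $g^{0,\varepsilon}\in H^m_xL^2_{v,w}$ there exist constants $T_0=T_0(g^{0,\varepsilon},\mathcal V,c_s,m,d)>0$ and $c_0=c_0(\mathcal V,c_s,m,d)>0$ such that the approximate LBGK Boltzmann equation on $(\mathcal V,w)$ with initial data $\Lambda_\varepsilon(g^{0,\varepsilon})$ is locally well-posed (existence, uniqueness and continuous dependence on the initial data on $[0,T_0]$). In particular, the unique local solution $g^\varepsilon\in L^\infty([0,T_0];H^m_xL^2_{v,w})$ satisfies $g^\varepsilon|_{t=0}=\Lambda_\varepsilon(g^{0,\varepsilon})$, $g^\varepsilon=\Lambda_\varepsilon(g^\varepsilon)$ and the local energy inequality $$\sup_{t\in[0,T_0]}\|g^\varepsilon(t)\|^2_{H^m_xL^2_{v,w}}+\frac1{\varepsilon^2}\int_0^{T_0}\|\mathcal G^\varepsilon_{eq}(s)-g^\varepsilon(s)\|^2_{H^m_xL^2_{v,w}}ds\le\frac{(\nu+\nu^2)\|\Lambda_\varepsilon(g^{0,\varepsilon})\|^2_{H^m_xL^2_{v,w}}}{\nu-c_0T_0\|\Lambda_\varepsilon(g^{0,\varepsilon})\|^2_{H^m_xL^2_{v,w}}}-\nu\|\Lambda_\varepsilon(g^{0,\varepsilon})\|^2_{H^m_xL^2_{v,w}} .$$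
   Context: Lattice: $\mathcal V=\{v_0=0,v_1,\dots,v_n\}\subset\mathbf R^d$ is a set of pairwise distinct velocities ($n\in\mathbf N$) and $w=(w_0,\dots,w_n)$ a vector of strictly positive weights. The lattice $(\mathcal V,w)$ is isotropic with speed of sound $c_s>0$ if for all indices $\alpha,\beta,\gamma,\zeta\in\{1,\dots,d\}$ ($v_{i,\alpha}$ is the $\alpha$-component of $v_i$): $\sum_i w_i=1$, $\sum_i w_iv_{i,\alpha}=0$, $\sum_i w_iv_{i,\alpha}v_{i,\beta}=c_s^2\delta_{\alpha\beta}$, $\sum_i w_iv_{i,\alpha}v_{i,\beta}v_{i,\gamma}=0$, $\sum_i w_iv_{i,\alpha}v_{i,\beta}v_{i,\gamma}v_{i,\zeta}=c_s^4(\delta_{\alpha\beta}\delta_{\gamma\zeta}+\delta_{\alpha\gamma}\delta_{\beta\zeta}+\delta_{\alpha\zeta}\delta_{\beta\gamma})$. Norm: for $f=(f_0,\dots,f_n)$ with $f_i\in H^m(\mathbf R^d)$, $\|f\|_{H^m_xL^2_{v,w}}^2=\sum_{i=0}^nw_i\|f_i\|_{H^m(\mathbf R^d)}^2$; $H_x^mL^2_{v,w}$ is the space of such $f$. Cutoff: for $h\in L^2(\mathbf R^d)$, $\Lambda_\varepsilon(h)$ is the function whose Fourier transform is $1_{|\xi|<1/\varepsilon}\,\widehat h(\xi)$, where $\widehat h(\xi)=\int h(x)e^{-2\pi ix\cdot\xi}dx$ (applied componentwise to vectors). Approximate LBGK Boltzmann equation: for $0\le i\le n$, $$\varepsilon\partial_t\Lambda_\varepsilon(g_i^\varepsilon)+v_i\cdot\nabla_x\Lambda_\varepsilon(g_i^\varepsilon)=\frac1{\varepsilon\nu}\big(\mathcal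 G^\varepsilon_{i,eq}-\Lambda_\varepsilon(g^\varepsilon_i)\big),\qquad \Lambda_\varepsilon(g_i^\varepsilon)|_{t=0}=\Lambda_\varepsilon(g_i^{0,\varepsilon}),$$ $$\mathcal G_{i,eq}^\varepsilon=\Lambda_\varepsilon(\rho^\varepsilon)+\frac{v_i\cdot\Lambda_\varepsilon(u^\varepsilon)}{c_s^2}+\frac{\varepsilon}{2c_s^4}\sum_{\alpha,\beta=1}^d(v_{i,\alpha}v_{i,\beta}-c_s^2\delta_{\alpha\beta})\Lambda_\varepsilon\big(\Lambda_\varepsilon(u^\varepsilon)_\alpha\Lambda_\varepsilon(u^\varepsilon)_\beta\big),$$ with $\Lambda_\varepsilon(\rho^\varepsilon)=\sum_iw_i\Lambda_\varepsilon(g_i^\varepsilon)$, $\Lambda_\varepsilon(u^\varepsilon)=\sum_iw_iv_i\Lambda_\varepsilon(g_i^\varepsilon)$, and $\mathcal G^\varepsilon_{eq}=(\mathcal G^\varepsilon_{0,eq},\dots,\mathcal G^\varepsilon_{n,eq})$. Solutions are understood as normalized by $g^\varepsilon=\Lambda_\varepsilon(g^\varepsilon)$ and satisfying the time-integrated equation. The relaxation time $\nu>0$ is a fixed parameter of the equation throughout. *)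

(* Defs.v *)
From HB Require Import structures.
From mathcomp Require Import all_boot all_order all_algebra.
From mathcomp Require Import complex.
From mathcomp Require Import all_classical all_reals all_analysis.

Set Implicit Arguments.
Unset Strict Implicit.
Unset Printing Implicit Defensive.

Import Order.TTheory GRing.Theory Num.Theory.
Import numFieldNormedType.Exports.

Local Open Scope classical_set_scope.
Local Open Scope ring_scope.

(* Borel sigma-algebra of R^d, generated by the coordinates. *)
Section measurable_rV.
Context {d0 : measure_display} {T : measurableType d0}.
Variable d : nat.

Let coord (i : 'I_d) (x : 'rV[T]_d) : T := x ord0 i.

Let rV_set0 : g_sigma_preimage coord set0.
Proof. exact: sigma_algebra0. Qed.

Let rV_setC A : g_sigma_preimage coord A -> g_sigma_preimage coord (~` A).
Proof. exact: sigma_algebraC. Qed.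

Let rV_bigcup (F : _^nat) : (forall i, g_sigma_preimage coord (F i)) ->
  g_sigma_preimage coord (\bigcup_i F i).
Proof. exact: sigma_algebra_bigcup. Qed.

HB.instance Definition _ := @isMeasurable.Build (measure_tuple_display d0)
  'rV[T]_d (g_sigma_preimage coord) rV_set0 rV_setC rV_bigcup.

End measurable_rV.

Section measurable_rV_lemmas.
Context d0 d1 (T : measurableType d0) (U : measurableType d1).

Lemma measurable_rV_coord d (i : 'I_d) :
  measurable_fun [set: 'rV[T]_d] (fun x : 'rV[T]_d => x ord0 i).
Proof.
move=> _ Y mY; rewrite setTI; apply: sub_sigma_algebra => /=.
rewrite -bigcup_seq/=; exists i => /=; first by rewrite mem_index_enum.
by exists Y => //; rewrite setTI.
Qed.

Lemma measurable_fun_rV d (f : U -> 'rV[T]_d) :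
  (forall i, measurable_fun [set: U] (fun x => f x ord0 i)) ->
  measurable_fun [set: U] f.
Proof.
move=> mf.
suff pS : g_sigma_preimage (fun i x => f x ord0 i) `<=` measurable.
  move=> _ A mA; apply: pS.
  rewrite (_ : (fun i x => _) = (fun i => (fun y : 'rV[T]_d => y ord0 i) \o f))//.
  by rewrite g_sigma_preimage_comp; exists A.
apply: smallest_sub; first exact: sigma_algebra_measurable.
case: d => [|d] in f mf *; first by rewrite big_ord0.
rewrite -bigcup_mkord_ord; apply: bigcup_sub => i Ii.
by move=> A [B mB <-]; exact: mf.
Qed.

End measurable_rV_lemmas.

Section lebesgue_rV.
Context {R : realType}.
Local Open Scope ereal_scope.

Definition rV_cons d (p : R * 'rV[R]_d) : 'rV[R]_d.+1 :=
  row_mx (const_mx p.1 : 'rV[R]_1) p.2.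

Fixpoint lebesgue_rV (d : nat) : set 'rV[R]_d -> \bar R :=
  match d with
  | 0 => dirac (0%R : 'rV[R]_0)
  | d'.+1 => pushforward (lebesgue_measure \x @lebesgue_rV d') (@rV_cons d')
  end.

Let measurable_rV_cons d :
  measurable_fun [set: measurableTypeR R * 'rV[R]_d] (@rV_cons d).
Proof.
apply: measurable_fun_rV => i.
rewrite /rV_cons; under eq_fun do rewrite mxE.
case: fintype.split => j.
  under eq_fun do rewrite mxE.
  exact: (@measurable_fst _ _ (measurableTypeR R)).
exact: (measurableT_comp (measurable_rV_coord j) measurable_snd).
Qed.

Let rV_uncons d (x : 'rV[R]_d.+1) : measurableTypeR R * 'rV[R]_d :=
  (x ord0 ord0, \row_j x ord0 (lift ord0 j)).

Let rV_consK d : cancel (@rV_cons d) (@rV_uncons d).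
Proof.
move=> [a x]; rewrite /rV_uncons/=; congr pair.
  have -> : (ord0 : 'I_d.+1) = lshift d (ord0 : 'I_1) by exact/val_inj.
  by rewrite [LHS](row_mxEl (const_mx a) x) mxE.
apply/rowP => j; rewrite mxE.
have -> : lift ord0 j = rshift 1 j by exact/val_inj.
exact: (row_mxEr (const_mx a : 'rV[R]_1) x).
Qed.

Let measurable_rV_uncons d : measurable_fun setT (@rV_uncons d).
Proof.
apply: measurable_fun_pair; first exact: (measurable_rV_coord (ord0 : 'I_d.+1)).
apply: measurable_fun_rV => i; under eq_fun do rewrite mxE.
exact: measurable_rV_coord.
Qed.

Let sigma_finite_pack d0 (T : measurableType d0)
    (mu : {measure set T -> \bar R}) (muT : sigma_finite setT mu) :
  {nu : {sigma_finite_measure set T -> \bar R} |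
    nu = mu :> (set T -> \bar R)}.
Proof.
pose h1 := isSFinite.Build _ _ _ (Measure.sort mu)
  (sfinite_measure_sigma_finite muT).
pose h2 := isSigmaFinite.Build _ _ _ (Measure.sort mu) muT.
pose nu : {sigma_finite_measure set T -> \bar R} :=
  HB.pack (Measure.sort mu) h1 h2.
by exists nu.
Qed.

Let lebesgue_rV_spec d :
  {mu : {sigma_finite_measure set 'rV[R]_d -> \bar R} |
    mu = @lebesgue_rV d :> (set 'rV[R]_d -> \bar R)}.
Proof.
elim: d => [|d [mu muE]].
  by exists (dirac (0%R : 'rV[R]_0)).
pose nu : {measure set 'rV[R]_d.+1 -> \bar R} :=
  measure_function_pushforward__canonical__measure_function_Measure
    (lebesgue_measure \x mu) (@measurable_rV_cons d).
have nu_sf : sigma_finite setT nu.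
  have /sigma_finiteP[F [TF ndF Foo]] := sigma_finiteT (@lebesgue_measure R).
  have /sigma_finiteP[G [TG ndG Goo]] := sigma_finiteT mu.
  exists (fun k => @rV_uncons d @^-1` (F k `*` G k)).
    rewrite -preimage_bigcup (_ : \bigcup_k _ = setT) ?preimage_setT//.
    rewrite -setXTT TF TG predeqE => -[x y]; split=> [[n _ []/= ? ?]|].
      by split; exists n.
    move=> [/= [n _ Fnx] [k _ Gky]]; exists (maxn n k) => //; split.
    - by move: x Fnx; exact/subsetPset/ndF/leq_maxl.
    - by move: y Gky; exact/subsetPset/ndG/leq_maxr.
  move=> k; have [mF Fk] := Foo k; have [mG Gk] := Goo k.
  have mFG : measurable (F k `*` G k) by exact: measurableX.
  split; first by rewrite -[X in measurable X]setTI; exact: measurable_rV_uncons.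
  rewrite /nu/= /pushforward -comp_preimage.
  rewrite (_ : _ \o _ = idfun); last by apply/funext => x /=; rewrite rV_consK.
  by rewrite preimage_id product_measure1E// lte_mul_pinfty// ge0_fin_numE.
have [nu' nu'E] := sigma_finite_pack nu_sf.
by exists nu'; rewrite nu'E /= -muE.
Qed.

Let lebesgue_rV0 d : @lebesgue_rV d set0 = 0.
Proof. by have [mu <-] := lebesgue_rV_spec d; exact: measure0. Qed.

Let lebesgue_rV_ge0 d A : 0 <= @lebesgue_rV d A.
Proof. by have [mu <-] := lebesgue_rV_spec d; exact: measure_ge0. Qed.

Let lebesgue_rV_sigma_additive d : semi_sigma_additive (@lebesgue_rV d).
Proof.
by have [mu <-] := lebesgue_rV_spec d; exact: measure_semi_sigma_additive.
Qed.

HB.instance Definition _ d := isMeasure.Build _ _ _ (@lebesgue_rV d)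
  (@lebesgue_rV0 d) (@lebesgue_rV_ge0 d) (@lebesgue_rV_sigma_additive d).

Let lebesgue_rV_sigma_finite d : sigma_finite setT (@lebesgue_rV d).
Proof. by have [mu <-] := lebesgue_rV_spec d; exact: sigma_finiteT. Qed.

HB.instance Definition _ d := Measure_isSigmaFinite.Build _ _ _
  (@lebesgue_rV d) (@lebesgue_rV_sigma_finite d).

End lebesgue_rV.
Arguments lebesgue_rV {R} d.

Section fourier.
Context {R : realType} {d : nat}.
Implicit Types (x xi : 'rV[R]_d) (h k : 'rV[R]_d -> R) (H : 'rV[R]_d -> R[i]).

Definition dotv x xi : R := \sum_(i < d) x ord0 i * xi ord0 i.

(* Euclidean norm: the library norm `|x| on 'rV[R]_d is the sup norm. *)
Definition enorm x : R := Num.sqrt (dotv x x).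

Definition sqnormc (z : R[i]) : R := complex.Re z ^+ 2 + complex.Im z ^+ 2.

Definition inL2 h : Prop := h \in Lfun (lebesgue_rV d) 2%:E.

Definition inL2c H : Prop :=
  inL2 (fun xi => complex.Re (H xi)) /\ inL2 (fun xi => complex.Im (H xi)).

(* int_{|x| < N} h(x) e^{- 2 pi i x . xi} dx *)
Definition fourier_trunc (N : nat) h xi : R[i] :=
  Complex
    (\int[lebesgue_rV d]_(x in [set x | enorm x < N%:R])
      (h x * cos (2 * pi * dotv x xi)))
    (- \int[lebesgue_rV d]_(x in [set x | enorm x < N%:R])
      (h x * sin (2 * pi * dotv x xi))).

(* H is (a representative of) the Fourier transform of h in L^2: the L^2 limit
   of the truncated Fourier integrals. *)
Definition is_fourier h H : Prop :=
  [/\ inL2 h, inL2c H &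
    (\int[lebesgue_rV d]_xi (sqnormc (fourier_trunc N h xi - H xi))%:E)%E
      @[N --> \oo] --> 0%E].

(* Meaningful for h in L^2, where it is determined almost everywhere. *)
Definition fourier h : 'rV[R]_d -> R[i] := xget (fun=> 0) (is_fourier h).

(* H^m through the weight (1 + |xi|^2)^m. *)
Definition sobolev_sqnorm (m : nat) h : \bar R :=
  (\int[lebesgue_rV d]_xi
     ((1 + enorm xi ^+ 2) ^+ m * sqnormc (fourier h xi))%:E)%E.

Definition sobolev (m : nat) h : Prop :=
  inL2 h /\ (sobolev_sqnorm m h < +oo)%E.

(* A band-limited L^2 class has exactly one continuous representative; this is
   the one chosen, so that [cutoff eps h] is a genuine (smooth) function and
   h = cutoff eps h says that h is band-limited and is that representative. *)
Definition cutoff (eps : R) h : 'rV[R]_d -> R :=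
  xget (fun=> 0) [set k | continuous k /\
    is_fourier k (fun xi => if enorm xi < eps^-1 then fourier h xi else 0)].

End fourier.

Section LBGK.
Context {R : realType} {d n : nat}.
Variables (v : 'I_n.+1 -> 'rV[R]_d) (w : 'I_n.+1 -> R) (cs : R).
Implicit Types (f : 'I_n.+1 -> 'rV[R]_d -> R) (m : nat).
Implicit Types (g : R -> 'I_n.+1 -> 'rV[R]_d -> R).
Implicit Types (a b c z : 'I_d) (i : 'I_n.+1).

Local Notation vc i a := (v i ord0 a).
Local Notation delta a b := ((a == b)%:R : R).

Record isotropic_lattice : Prop := IsotropicLattice {
  lattice_v0 : v ord0 = 0;
  lattice_inj : injective v;
  lattice_w_gt0 : forall i, 0 < w i;
  lattice_cs_gt0 : 0 < cs;
  lattice_mom0 : \sum_i w i = 1;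
  lattice_mom1 : forall a, \sum_i w i * vc i a = 0;
  lattice_mom2 : forall a b,
    \sum_i w i * vc i a * vc i b = cs ^+ 2 * delta a b;
  lattice_mom3 : forall a b c,
    \sum_i w i * vc i a * vc i b * vc i c = 0;
  lattice_mom4 : forall a b c z,
    \sum_i w i * vc i a * vc i b * vc i c * vc i z =
      cs ^+ 4 * (delta a b * delta c z + delta a c * delta b z
                 + delta a z * delta b c) }.

Definition kinetic_sobolev m f : Prop := forall i, sobolev m (f i).

Definition kinetic_sqnorm m f : \bar R :=
  (\sum_(i < n.+1) (w i)%:E * sobolev_sqnorm m (f i))%E.

Definition cutoffs (eps : R) f : 'I_n.+1 -> 'rV[R]_d -> R :=
  fun i => cutoff eps (f i).

Definition density (eps : R) f (x : 'rV[R]_d) : R :=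
  \sum_i w i * cutoff eps (f i) x.

Definition bulk_velocity (eps : R) f a (x : 'rV[R]_d) : R :=
  \sum_i w i * vc i a * cutoff eps (f i) x.

Definition equilibrium (eps : R) f i (x : 'rV[R]_d) : R :=
  density eps f x
  + (\sum_a vc i a * bulk_velocity eps f a x) / cs ^+ 2
  + eps / (2 * cs ^+ 4) * \sum_a \sum_b
      (vc i a * vc i b - cs ^+ 2 * delta a b)
      * cutoff eps (fun y => bulk_velocity eps f a y * bulk_velocity eps f b y) x.

(* v_i . grad h *)
Definition transport i (h : 'rV[R]_d -> R) (x : 'rV[R]_d) : R :=
  \sum_a vc i a * 'D_(delta_mx ord0 a) h x.

Definition lbgk_rhs (nu eps : R) f i (x : 'rV[R]_d) : R :=
  (eps * nu)^-1 * (equilibrium eps f i x - cutoff eps (f i) x)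
  - transport i (cutoff eps (f i)) x.

(* Solutions are identified with their time-continuous, spatially smooth
   representatives, so that the first three fields express
   g in L^oo([0, T]; H^m_x L^2_{v,w}) and the time-integrated equation can be
   required at every t and x. *)
Record lbgk_solution (nu eps : R) m (T : R) f0 g : Prop := LBGKSolution {
  sol_measurable : forall i, measurable_fun (`[0, T] `*` [set: 'rV[R]_d])
    (fun p : R * 'rV[R]_d => g p.1 i p.2);
  sol_sobolev : forall t : R, 0 <= t <= T -> kinetic_sobolev m (g t);
  sol_bounded : exists M : R, forall t : R, 0 <= t <= T ->
    (kinetic_sqnorm m (g t) <= M%:E)%E;
  sol_cutoff : forall t : R, 0 <= t <= T -> g t = cutoffs eps (g t);
  sol_init : cutoffs eps (g 0) = cutoffs eps f0;
  sol_integrable : forall i x, (@lebesgue_measure R).-integrable `[0, T]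
    (fun s => (lbgk_rhs nu eps (g s) i x)%:E);
  sol_equation : forall t : R, 0 <= t <= T -> forall i x,
    eps * (cutoff eps (g t i) x - cutoff eps (f0 i) x) =
    \int[lebesgue_measure]_(s in `[0, t]) lbgk_rhs nu eps (g s) i x }.

Definition lbgk_well_posed (nu eps : R) m (T : R) f0 : Prop :=
  [/\ exists g, lbgk_solution nu eps m T f0 g,
      forall g g', lbgk_solution nu eps m T f0 g ->
        lbgk_solution nu eps m T f0 g' ->
        forall t : R, 0 <= t <= T -> g t = g' t &
      forall g, lbgk_solution nu eps m T f0 g ->
        forall e : R, 0 < e -> exists2 eta : R, 0 < eta &
          forall f0', kinetic_sobolev m f0' ->
            (kinetic_sqnorm m
               (fun i x => cutoff eps (f0' i) x - cutoff eps (f0 i) x)%R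
             < eta%:E)%E ->
            (exists g', lbgk_solution nu eps m T f0' g') /\
            forall g', lbgk_solution nu eps m T f0' g' ->
              forall t : R, 0 <= t <= T ->
              (kinetic_sqnorm m (fun i x => g' t i x - g t i x)%R <= e%:E)%E].

End LBGK.

(* Submission.v *)
(* Everything is carried out on the frequency side. Since all functions are
   real, the Fourier transform is replaced by the Hartley transform, i.e. by
   integration against cas = cos + sin: it is real, linear, an L^2 isometry and
   its own inverse. A band-limited state is the transform of an L^2 family
   supported in the ball of radius 1/eps, on which transport is the product
   with a bounded function composed with a reflection and the quadratic term is
   a convolution, so that the equation becomes an ordinary differential
   equation. The energy E(t), i.e. the square of the H^m norm, satisfies
   E' + (eps^2 nu)^-1 |G_eq - g|^2 <= (c / nu) E^2: transport does not
   contribute, the linear part of the collision operator dissipates by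
   isotropy, and the quadratic part of G_eq is orthogonal to the moments and
   controlled by H^m norms because (1 + |xi|^2)^-m is integrable. Truncating
   the nonlinearity radially gives a global solution of the truncated equation,
   and the energy estimate shows that the truncation is never active on [0, T]
   when 4 (c / nu) T E(0) < 1. Uniqueness and continuous dependence follow from
   a Gronwall argument in L^2, whose norm is equivalent to that of H^m under
   the band limitation. *)
Require Import Defs.
From mathcomp Require Import all_boot all_order all_algebra.
From mathcomp Require Import complex ring lra.
From mathcomp Require Import all_classical all_reals all_analysis.
From mathcomp Require Import measurable_realfun.

Set Implicit Arguments.
Unset Strict Implicit.
Unset Printing Implicit Defensive.

Import Order.TTheory GRing.Theory Num.Theory.
Import numFieldNormedType.Exports.

Local Open Scope classical_set_scope.
Local Open Scope ring_scope.

(** * Integration *)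

(** The constant [c0] of the energy inequality may not see [eps], whereas everything that serves
    only existence and uniqueness may: Lipschitz constants of the field use the band limit freely,
    but the growth constant comes from the weighted convolution estimate, on which the sharp cutoff
    acts as a contraction. No Riccati equation is solved: truncating at [M ^+ 2 = 2 * E] bounds the
    quadratic source by a constant, the energy then grows at most linearly, and on the chosen time
    it stays below [2 * E]; the closed form in the statement is compared with this cruder bound only
    at the end. A solution is given merely as a bounded family satisfying the integrated equation at
    each point, so the energy estimate is proved for the constructed solution and carried over by
    uniqueness; the uniform bounds needed for continuous dependence are obtained in the same way. *)

Section toolkit.
Context {d} {T : measurableType d} {R : realType}.
Variable mu : {measure set T -> \bar R}.
Implicit Types f g : T -> R.

Definition intble f : Prop := mu.-integrable setT (EFin \o f).

Lemma intble_measurable f : intble f -> measurable_fun setT f.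
Proof. by move=> /integrableP[/measurable_EFinP]. Qed.

Lemma intble_le f g : measurable_fun setT f -> intble g ->
  (forall x, `|f x| <= g x) -> intble f.
Proof.
move=> mf ig fg; apply: (le_integrable _ _ _ ig) => //; first exact/measurable_EFinP.
by move=> x _; rewrite /= lee_fin (le_trans (fg x))// ler_norm.
Qed.

Lemma intbleP f : measurable_fun setT f ->
  (\int[mu]_x (`|f x|)%:E < +oo)%E -> intble f.
Proof. by move=> mf foo; apply/integrableP; split => //; exact/measurable_EFinP. Qed.

Lemma ge0_intbleP f : measurable_fun setT f -> (forall x, 0 <= f x) ->
  (\int[mu]_x (f x)%:E < +oo)%E -> intble f.
Proof.
by move=> mf f0 foo; apply: intbleP => //; under eq_integral do rewrite ger0_norm//.
Qed.

Lemma RintE f : intble f -> (\int[mu]_x f x)%:E = (\int[mu]_x (f x)%:E)%E.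
Proof. by move=> fi; rewrite /Rintegral fineK//; exact: integrable_fin_num. Qed.

Lemma intbleD f g : intble f -> intble g -> intble (fun x => f x + g x).
Proof. by move=> fi gi; have := integrableD measurableT fi gi. Qed.

Lemma intbleB f g : intble f -> intble g -> intble (fun x => f x - g x).
Proof. by move=> fi gi; have := integrableB measurableT fi gi. Qed.

Lemma intbleZ r f : intble f -> intble (fun x => r * f x).
Proof. by move=> fi; have := integrableZl measurableT r fi. Qed.

Lemma intbleN f : intble f -> intble (fun x => - f x).
Proof. by move=> /(intbleZ (-1)); under eq_fun do rewrite mulN1r. Qed.

Lemma intble0 : intble (fun=> 0).
Proof. exact: integrable0. Qed.

Lemma intble_norm f : intble f -> intble (fun x => `|f x|).
Proof. by move=> fi; have := integrable_abse fi. Qed.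

Lemma intble_sum (I : Type) (s : seq I) (P : pred I) (F : I -> T -> R) :
  (forall i, P i -> intble (F i)) -> intble (fun x => \sum_(i <- s | P i) F i x).
Proof.
move=> Fi; elim: s => [|i s IH]; first by under eq_fun do rewrite big_nil; exact: intble0.
under eq_fun do rewrite big_cons; case: (boolP (P i)) => // Pi.
by apply: intbleD => //; exact: Fi.
Qed.

Lemma RintD f g : intble f -> intble g ->
  \int[mu]_x (f x + g x) = \int[mu]_x f x + \int[mu]_x g x.
Proof. by move=> fi gi; rewrite RintegralD. Qed.

Lemma RintB f g : intble f -> intble g ->
  \int[mu]_x (f x - g x) = \int[mu]_x f x - \int[mu]_x g x.
Proof. by move=> fi gi; rewrite RintegralB. Qed.

Lemma RintZ r f : intble f -> \int[mu]_x (r * f x) = r * \int[mu]_x f x.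
Proof. by move=> fi; rewrite RintegralZl. Qed.

Lemma RintN f : intble f -> \int[mu]_x (- f x) = - \int[mu]_x f x.
Proof.
move=> fi; rewrite -mulN1r -RintZ//.
by apply: eq_Rintegral => x _; rewrite mulN1r.
Qed.

Lemma Rint_sum (I : Type) (s : seq I) (P : pred I) (F : I -> T -> R) :
  (forall i, P i -> intble (F i)) ->
  \int[mu]_x (\sum_(i <- s | P i) F i x) = \sum_(i <- s | P i) \int[mu]_x F i x.
Proof.
move=> Fi; elim: s => [|i s IH].
  rewrite big_nil; under eq_Rintegral do rewrite big_nil.
  by rewrite Rintegral_cst// mul0r.
rewrite big_cons; under eq_Rintegral do rewrite big_cons.
case: ifP => Pi //; rewrite RintD ?IH//; first exact: Fi.
exact: intble_sum.
Qed.

Lemma Rint_ge0 f : (forall x, 0 <= f x) -> 0 <= \int[mu]_x f x.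
Proof. by move=> f0; apply: Rintegral_ge0. Qed.

Lemma le_Rint f g : intble f -> intble g -> (forall x, f x <= g x) ->
  \int[mu]_x f x <= \int[mu]_x g x.
Proof. by move=> fi gi fg; apply: le_Rintegral. Qed.

Lemma normr_Rint f : intble f -> `|\int[mu]_x f x| <= \int[mu]_x `|f x|.
Proof. by move=> fi; apply: le_normr_Rintegral. Qed.

Lemma normr_Rint_le f g : measurable_fun setT f -> intble g ->
  (forall x, `|f x| <= g x) -> `|\int[mu]_x f x| <= \int[mu]_x g x.
Proof.
move=> mf gi fg; have fi := intble_le mf gi fg.
by rewrite (le_trans (normr_Rint fi))// le_Rint//; exact: intble_norm.
Qed.

Definition sqint f : Prop :=
  measurable_fun setT f /\ intble (fun x => f x ^+ 2).

(** By the bound |f g| <= f^2 + g^2. *)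
Lemma sqint_mul f g : sqint f -> sqint g -> intble (fun x => f x * g x).
Proof.
move=> [mf fi] [mg gi]; apply: (intble_le _ (intbleD fi gi)).
  exact: measurable_funM.
move=> x; rewrite normrM -(real_normK (num_real (f x))) -(real_normK (num_real (g x))).
rewrite -subr_ge0; set a := `|f x|; set b := `|g x|.
have a0 : 0 <= a by rewrite /a.
have b0 : 0 <= b by rewrite /b.
have := sqr_ge0 (a - b); nra.
Qed.

Lemma sqintZ r f : sqint f -> sqint (fun x => r * f x).
Proof.
move=> [mf fi]; split; first exact: measurable_funM.
by under eq_fun do rewrite exprMn; exact: intbleZ.
Qed.

Lemma sqintD f g : sqint f -> sqint g -> sqint (fun x => f x + g x).
Proof.
move=> hf hg; have fgi := sqint_mul hf hg; move: hf hg => [mf fi] [mg gi].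
split; first exact: measurable_funD.
apply: (@eq_integrable _ _ _ _ _ measurableT
  (EFin \o (fun x => f x ^+ 2 + (2 * (f x * g x) + g x ^+ 2)))).
  by move=> x _ /=; congr EFin; ring.
apply: intbleD => //; apply: intbleD => //; exact: intbleZ.
Qed.

Lemma sqintN f : sqint f -> sqint (fun x => - f x).
Proof. by move=> /(sqintZ (-1)); under eq_fun do rewrite mulN1r. Qed.

Lemma sqintB f g : sqint f -> sqint g -> sqint (fun x => f x - g x).
Proof. by move=> hf hg; apply: sqintD => //; exact: sqintN. Qed.

Lemma sqint0 : sqint (fun=> 0).
Proof. by split => //; under eq_fun do rewrite expr0n; exact: intble0. Qed.

Lemma sqint_sum (I : Type) (s : seq I) (P : pred I) (F : I -> T -> R) :
  (forall i, P i -> sqint (F i)) -> sqint (fun x => \sum_(i <- s | P i) F i x).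
Proof.
move=> Fi; elim: s => [|i s IH]; first by under eq_fun do rewrite big_nil; exact: sqint0.
under eq_fun do rewrite big_cons; case: (boolP (P i)) => // Pi.
by apply: sqintD => //; exact: Fi.
Qed.

Lemma sqint_le f g : measurable_fun setT f -> sqint g ->
  (forall x, `|f x| <= `|g x|) -> sqint f.
Proof.
move=> mf [mg gi] fg; split => //; apply: (intble_le _ gi).
  exact: measurable_funX.
by move=> x; rewrite normrX -(real_normK (num_real (g x))) lerXn2r ?nnegrE.
Qed.

(** The quadratic polynomial t -> int (t f + g)^2 is nonnegative on the whole line, hence its
    discriminant condition; no square roots enter. *)
Lemma cauchy_schwarz f g : sqint f -> sqint g ->
  (\int[mu]_x (f x * g x)) ^+ 2 <=
  (\int[mu]_x (f x ^+ 2)) * (\int[mu]_x (g x ^+ 2)).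
Proof.
move=> hf hg; have fgi := sqint_mul hf hg; move: (hf) (hg) => [mf fi] [mg gi].
set A := \int[mu]_x (f x ^+ 2); set B := \int[mu]_x (f x * g x).
set C := \int[mu]_x (g x ^+ 2).
have key t : 0 <= t ^+ 2 * A + 2 * t * B + C.
  have := @Rint_ge0 (fun x => t ^+ 2 * f x ^+ 2 + (2 * t * (f x * g x) + g x ^+ 2)).
  rewrite RintD ?RintD ?RintZ ?addrA//; last first.
  - by apply: intbleD => //; exact: intbleZ.
  - exact: intbleZ.
  - exact: intbleZ.
  apply => x; rewrite (_ : _ + _ = (t * f x + g x) ^+ 2) ?sqr_ge0//; ring.
have A0 : 0 <= A by apply: Rint_ge0 => x; exact: sqr_ge0.
have [A0'|A0'] := eqVneq A 0.
  rewrite A0' mul0r; have [->|B0] := eqVneq B 0; first by rewrite expr0n.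
  (* The leading coefficient vanishes and [B] does not: this value of t makes the remaining affine
     expression equal to -1. *)
  have := key (- (C + 1) / (2 * B)); rewrite A0' mulr0 add0r.
  rewrite (_ : 2 * (- (C + 1) / (2 * B)) * B = - (C + 1)); last by field.
  lra.
have Agt0 : 0 < A by rewrite lt_neqAle eq_sym A0'.
have := key (- B / A).
rewrite (_ : _ + C = (A * C - B ^+ 2) / A); last by field.
by rewrite pmulr_lge0 ?invr_gt0// subr_ge0.
Qed.

End toolkit.

Lemma measurable_sect2 {d1 d2 d3} {T1 : measurableType d1} {T2 : measurableType d2}
    {T3 : measurableType d3} (F : T1 * T2 -> T3) x :
  measurable_fun setT F -> measurable_fun setT (fun y => F (x, y)).
Proof. by move=> mF; apply: (measurableT_comp mF); exact: measurable_fun_pair. Qed.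

Lemma measurable_sect1 {d1 d2 d3} {T1 : measurableType d1} {T2 : measurableType d2}
    {T3 : measurableType d3} (F : T1 * T2 -> T3) y :
  measurable_fun setT F -> measurable_fun setT (fun x => F (x, y)).
Proof. by move=> mF; apply: (measurableT_comp mF); exact: measurable_fun_pair. Qed.

Section product_toolkit.
Context {d1 d2} {T1 : measurableType d1} {T2 : measurableType d2} {R : realType}.
Variable m1 : {sigma_finite_measure set T1 -> \bar R}.
Variable m2 : {sigma_finite_measure set T2 -> \bar R}.
Implicit Types f : T1 * T2 -> R.

(** Tonelli gives measurability of partial integrals for nonnegative functions, hence the splitting
    into positive and negative parts. *)
Lemma measurable_integral_param (f : T1 * T2 -> \bar R) : measurable_fun setT f ->
  measurable_fun setT (fun x => \int[m2]_y f (x, y))%E.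
Proof.
move=> mf.
have -> : (fun x => \int[m2]_y f (x, y))%E =
  ((fun x => \int[m2]_y (f^\+)%E (x, y))%E \- (fun x => \int[m2]_y (f^\-)%E (x, y)))%E.
  apply/funext=> x; rewrite integralE.
  under eq_integral do rewrite funepos_comp/=.
  by under [X in (_ - X)%E = _]eq_integral do rewrite funeneg_comp/=.
apply: emeasurable_funB.
  by apply: measurable_fun_fubini_tonelli_F => //; exact: measurable_funepos.
by apply: measurable_fun_fubini_tonelli_F => //; exact: measurable_funeneg.
Qed.

Lemma measurable_Rint_param f : measurable_fun setT f ->
  measurable_fun setT (fun x => \int[m2]_y f (x, y)).
Proof.
move=> /measurable_EFinP/measurable_integral_param mf.
exact: (@measurableT_comp _ _ _ _ _ _ fine).
Qed.

Lemma Fubini_Rint f : intble (m1 \x m2)%E f ->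
  (forall x, intble m2 (fun y => f (x, y))) ->
  (forall y, intble m1 (fun x => f (x, y))) ->
  \int[m1]_x \int[m2]_y f (x, y) = \int[m2]_y \int[m1]_x f (x, y).
Proof.
move=> fi f1 f2; rewrite {1 3}/Rintegral.
under eq_integral do rewrite RintE//.
under [in RHS]eq_integral do rewrite RintE//.
by have := Fubini fi => /= ->.
Qed.

Lemma intble_prod_dom f (g1 : T1 -> R) (g2 : T2 -> R) :
  measurable_fun setT f -> intble m1 g1 -> intble m2 g2 ->
  (forall x y, `|f (x, y)| <= g1 x * g2 y) -> intble (m1 \x m2)%E f.
Proof.
move=> mf i1 i2 fg.
have m1' := intble_measurable i1; have m2' := intble_measurable i2.
apply/integrable12ltyP; first exact/measurable_EFinP.
apply: (@le_lt_trans _ _ (\int[m1]_x ((`|g1 x| * \int[m2]_y `|g2 y|)%:E))%E).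
  apply: ge0_le_integral => //.
  - by move=> x _; apply: integral_ge0.
  - apply: (measurable_fun_fubini_tonelli_F (fun p => `|(f p)%:E|%E)) => //.
    by apply/measurable_EFinP; apply: measurableT_comp.
  - by apply/measurable_EFinP; apply: measurable_funM => //; apply: measurableT_comp.
  move=> x _; rewrite -[`|g1 x| * _]RintZ; last exact: intble_norm.
  rewrite RintE; last by apply: intbleZ; exact: intble_norm.
  apply: ge0_le_integral => //.
  - by apply/measurable_EFinP; apply: measurableT_comp => //; exact: measurableT_comp.
  - by apply/measurable_EFinP; apply: measurable_funM => //; apply: measurableT_comp.
  by move=> y _; rewrite /= lee_fin -normrM (le_trans (fg x y))// ler_norm.
have := intbleZ (\int[m2]_y `|g2 y|) (intble_norm i1).
move=> /integrableP[_]; apply: le_lt_trans.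
apply: ge0_le_integral => //.
- by move=> x _; rewrite lee_fin mulr_ge0// Rint_ge0.
- by apply/measurable_EFinP; apply: measurable_funM => //; apply: measurableT_comp.
- apply: measurableT_comp => //; apply/measurable_EFinP.
  by apply: measurable_funM => //; apply: measurableT_comp.
by move=> x _ /=; rewrite lee_fin mulrC ler_norm.
Qed.

(** A tensor product majorant supplies at once joint integrability and integrability of every
    section. *)
Lemma Fubini_dom f (g1 : T1 -> R) (g2 : T2 -> R) :
  measurable_fun setT f -> intble m1 g1 -> intble m2 g2 ->
  (forall x y, `|f (x, y)| <= g1 x * g2 y) ->
  \int[m1]_x \int[m2]_y f (x, y) = \int[m2]_y \int[m1]_x f (x, y).
Proof.
move=> mf i1 i2 fg; apply: Fubini_Rint.
- exact: intble_prod_dom fg.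
- move=> x; apply: (intble_le _ (intbleZ (g1 x) i2)) => //.
  exact: measurableT_comp.
- move=> y; apply: (intble_le _ (intbleZ (g2 y) i1)) => //.
    exact: measurableT_comp.
  by move=> x; rewrite mulrC.
Qed.

End product_toolkit.

(** * Affine substitutions, translations and reflections *)

Section affine.
Context {R : realType}.
Local Notation mu := (@lebesgue_measure R).

Lemma measurable_affine (r c : R) :
  measurable_fun [set: measurableTypeR R]
    (fun x : measurableTypeR R => (r * x + c) : measurableTypeR R).
Proof. by apply: measurable_funD => //; exact: measurable_funM. Qed.

(** For negative [r] the preimage of a left-open interval is right-open, hence the two cases. *)
Let affine_itv (r c a b : R) : r != 0 -> a <= b ->
  mu ((fun x => r * x + c) @^-1` `]a, b]) = (`|r|^-1 * (b - a))%:E.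
Proof.
move=> r0 ab.
have [rgt|rlt|/eqP] := ltgtP 0 r; last by rewrite eq_sym (negbTE r0).
- rewrite (_ : _ @^-1` _ = `](a - c) / r, (b - c) / r]%classic); last first.
    apply/seteqP; split => x /=; rewrite !in_itv/=.
      by rewrite ltr_pdivrMr// ler_pdivlMr// ltrBlDr lerBrDr mulrC.
    by rewrite ltr_pdivrMr// ler_pdivlMr// ltrBlDr lerBrDr mulrC.
  rewrite lebesgue_measure_itv/= lte_fin ltr_pM2r ?invr_gt0// ltrD2r gtr0_norm//.
  case: ltP => [_|ba]; first by rewrite -EFinD; congr EFin; field.
  by have -> : a = b by [apply/eqP; rewrite eq_le ab]; rewrite subrr mulr0.
- rewrite (_ : _ @^-1` _ = `[(b - c) / r, (a - c) / r[%classic); last first.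
    apply/seteqP; split => x /=; rewrite !in_itv/=.
      by rewrite ltr_ndivlMr// ler_ndivrMr// ltrBlDr lerBrDr mulrC andbC.
    by rewrite ltr_ndivlMr// ler_ndivrMr// ltrBlDr lerBrDr mulrC andbC.
  rewrite lebesgue_measure_itv/= lte_fin ltr_nM2r ?invr_lt0// ltrD2r ltr0_norm//.
  case: ltP => [_|ba]; first by rewrite -EFinD; congr EFin; field.
  by have -> : a = b by [apply/eqP; rewrite eq_le ab]; rewrite subrr mulr0.
Qed.

(** The pushforward of Lebesgue measure under the affine map, scaled by |r|, has the right value on
    half-open intervals, so it is Lebesgue measure by uniqueness. *)
Lemma ge0_integral_affine (r c : R) (F : R -> \bar R) : r != 0 ->
  measurable_fun [set: measurableTypeR R] F -> (forall x, 0 <= F x)%E ->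
  (\int[mu]_x F (r * x + c)%R = (`|r|^-1)%:E * \int[mu]_x F x)%E.
Proof.
move=> r0 mF F0.
have nr0 : 0 < `|r| by rewrite normr_gt0.
pose nr : {nonneg R} := NngNum (normr_ge0 r).
pose nu : {measure set (measurableTypeR R) -> \bar R} :=
  measure_function_pushforward__canonical__measure_function_Measure mu
   (measurable_affine r c).
pose nu' : {measure set (measurableTypeR R) -> \bar R} := mscale nr nu.
have E A : measurable A -> mu A = nu' A.
  apply: lebesgue_measure_unique => X [[a b]/= _ <-].
  rewrite /nu'/= /mscale/= /pushforward.
  have [ab|ba] := leP a b.
    rewrite affine_itv// lebesgue_measure_itv/= -EFinM mulrA divff ?gt_eqF// mul1r.
    by rewrite lte_fin; case: ltP => // ba; have -> : a = b;
      [apply/eqP; rewrite eq_le ab | rewrite subrr].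
  rewrite (_ : [set` `]a, b]] = set0).
    by rewrite preimage_set0 !measure0 mule0.
  by rewrite set_itv_ge// bnd_simp -leNgt ltW.
rewrite (_ : (\int[mu]_x F x)%E = (\int[nu']_x F x)%E); last first.
  by apply: eq_measure_integral => A mA _; exact: E.
rewrite /nu' ge0_integral_mscale//= /nu.
rewrite (ge0_integral_pushforward (measurable_affine r c))//=.
by rewrite muleA -EFinM mulVf ?gt_eqF// mul1e.
Qed.

End affine.

Section rV_integral.
Context {R : realType}.
Local Notation mu := (@lebesgue_measure R).

Lemma measurable_rVcons d :
  measurable_fun [set: measurableTypeR R * 'rV[R]_d] (@rV_cons R d).
Proof.
apply: measurable_fun_rV => i.
rewrite /rV_cons; under eq_fun do rewrite mxE.
case: fintype.split => j.
  under eq_fun do rewrite mxE.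
  exact: (@measurable_fst _ _ (measurableTypeR R)).
exact: (measurableT_comp (measurable_rV_coord j) measurable_snd).
Qed.

Lemma ge0_integral_rV_cons d (F : 'rV[R]_d.+1 -> \bar R) :
  measurable_fun setT F -> (forall x, 0 <= F x)%E ->
  (\int[lebesgue_rV d.+1]_x F x =
   \int[mu]_x \int[lebesgue_rV d]_y F (rV_cons (x, y)))%E.
Proof.
move=> mF F0.
transitivity (\int[pushforward (mu \x lebesgue_rV d) (@rV_cons R d)]_x F x)%E.
  by [].
rewrite (ge0_integral_pushforward (@measurable_rVcons d))//=.
rewrite (fubini_tonelli1 (fun p : measurableTypeR R * 'rV[R]_d => F (rV_cons p)))//.
exact: (measurableT_comp mF (@measurable_rVcons d)).
Qed.

Lemma rV_consD d (a b : R) (x y : 'rV[R]_d) :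
  rV_cons (a, x) + rV_cons (b, y) = rV_cons (a + b, x + y).
Proof.
rewrite /rV_cons/=; apply/rowP => i; rewrite !mxE.
by case: fintype.split => j; rewrite !mxE.
Qed.

Lemma rV_consN d (a : R) (x : 'rV[R]_d) : - rV_cons (a, x) = rV_cons (- a, - x).
Proof.
rewrite /rV_cons/=; apply/rowP => i; rewrite !mxE.
by case: fintype.split => j; rewrite !mxE.
Qed.

Lemma rV_cons_surj d (x : 'rV[R]_d.+1) : exists a y, x = rV_cons (a, y).
Proof.
exists (x ord0 ord0), (\row_j x ord0 (lift ord0 j)); apply/rowP => i.
rewrite /rV_cons/= mxE.
have [j|j] := splitP; rewrite !mxE => ij; congr (x _ _); apply/val_inj => //=.
by rewrite ij; case: j {ij} => -[].
Qed.

Lemma rV_cons0 d (a : R) (y : 'rV[R]_d) : rV_cons (a, y) ord0 ord0 = a.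
Proof.
have -> : (ord0 : 'I_d.+1) = lshift d (ord0 : 'I_1) by exact/val_inj.
by rewrite [LHS](row_mxEl (const_mx a) y) mxE.
Qed.

Lemma rV_consS d (a : R) (y : 'rV[R]_d) j : rV_cons (a, y) ord0 (lift ord0 j) = y ord0 j.
Proof.
have -> : lift ord0 j = rshift 1 j by exact/val_inj.
exact: (row_mxEr (const_mx a : 'rV[R]_1) y).
Qed.

Lemma measurable_rV_add d : measurable_fun [set: 'rV[R]_d * 'rV[R]_d]
  (fun p : 'rV[R]_d * 'rV[R]_d => p.1 + p.2).
Proof.
apply: measurable_fun_rV => i; under eq_fun do rewrite mxE.
apply: measurable_funD.
  exact: (measurableT_comp (measurable_rV_coord i) measurable_fst).
exact: (measurableT_comp (measurable_rV_coord i) measurable_snd).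
Qed.

Lemma measurable_rV_opp d : measurable_fun [set: 'rV[R]_d] (fun x : 'rV[R]_d => - x).
Proof.
apply: measurable_fun_rV => i; under eq_fun do rewrite mxE.
by apply: measurableT_comp => //; exact: measurable_rV_coord.
Qed.

Lemma measurable_rV_addr d c : measurable_fun [set: 'rV[R]_d] (fun x : 'rV[R]_d => x + c).
Proof.
apply: measurable_fun_rV => i; under eq_fun do rewrite mxE.
by apply: measurable_funD => //; exact: measurable_rV_coord.
Qed.

(** Induction on the dimension: the inner integral is shifted by the induction hypothesis, the outer
    one by the one-dimensional substitution. *)
Lemma ge0_integral_rV_shift d (c : 'rV[R]_d) (F : 'rV[R]_d -> \bar R) :
  measurable_fun setT F -> (forall x, 0 <= F x)%E ->
  (\int[lebesgue_rV d]_x F (x + c)%R = \int[lebesgue_rV d]_x F x)%E.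
Proof.
elim: d c F => [|d IH] c F mF F0.
  by apply: eq_integral => x _; congr F; apply/rowP => -[].
have [a [c' ->]] := rV_cons_surj c.
have mFc : measurable_fun setT (fun x : 'rV[R]_d.+1 => F (x + rV_cons (a, c'))%R).
  exact: (measurableT_comp mF (measurable_rV_addr _)).
have mFr : measurable_fun setT (fun x : measurableTypeR R * 'rV[R]_d => F (rV_cons x)).
  exact: (measurableT_comp mF (@measurable_rVcons d)).
rewrite (ge0_integral_rV_cons mF F0) (ge0_integral_rV_cons mFc (fun=> F0 _)).
under eq_integral => x _.
  under eq_integral do rewrite rV_consD.
  rewrite (IH c' (fun y => F (rV_cons (x + a, y)%R)))//; last first.
    by apply: (measurableT_comp mFr); exact: measurable_fun_pair.
  over.
have := @ge0_integral_affine R 1 a (fun x => \int[lebesgue_rV d]_y F (rV_cons (x, y)%R))%E.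
rewrite normr1 invr1 mul1e => <-.
- by apply: eq_integral => x _; apply: eq_integral => y _; rewrite mul1r.
- exact: oner_neq0.
- exact: (measurable_fun_fubini_tonelli_F
    (fun p : measurableTypeR R * 'rV[R]_d => F (rV_cons p))).
- by move=> x; exact: integral_ge0.
Qed.

Lemma ge0_integral_rV_opp d (F : 'rV[R]_d -> \bar R) :
  measurable_fun setT F -> (forall x, 0 <= F x)%E ->
  (\int[lebesgue_rV d]_x F (- x)%R = \int[lebesgue_rV d]_x F x)%E.
Proof.
elim: d F => [|d IH] F mF F0.
  by apply: eq_integral => x _; congr F; apply/rowP => -[].
have mFc : measurable_fun setT (fun x : 'rV[R]_d.+1 => F (- x)%R).
  exact: (measurableT_comp mF (@measurable_rV_opp _)).
have mFr : measurable_fun setT (fun x : measurableTypeR R * 'rV[R]_d => F (rV_cons x)).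
  exact: (measurableT_comp mF (@measurable_rVcons d)).
rewrite (ge0_integral_rV_cons mF F0) (ge0_integral_rV_cons mFc (fun=> F0 _)).
under eq_integral => x _.
  under eq_integral do rewrite rV_consN.
  rewrite (IH (fun y => F (rV_cons (- x, y)%R)))//; last first.
    by apply: (measurableT_comp mFr); exact: measurable_fun_pair.
  over.
have := @ge0_integral_affine R (-1) 0 (fun x => \int[lebesgue_rV d]_y F (rV_cons (x, y)%R))%E.
rewrite normrN normr1 invr1 mul1e => <-.
- by apply: eq_integral => x _; apply: eq_integral => y _; rewrite mulN1r addr0.
- by rewrite oppr_eq0 oner_neq0.
- exact: (measurable_fun_fubini_tonelli_F
    (fun p : measurableTypeR R * 'rV[R]_d => F (rV_cons p))).
- by move=> x; exact: integral_ge0.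
Qed.

Lemma intble_rV_shift d (c : 'rV[R]_d) (f : 'rV[R]_d -> R) :
  intble (lebesgue_rV d) f -> intble (lebesgue_rV d) (fun x => f (x + c)).
Proof.
move=> fi; have mf := intble_measurable fi; apply: intbleP.
  exact: (measurableT_comp mf (measurable_rV_addr c)).
rewrite (ge0_integral_rV_shift c (F := fun x => (`|f x|)%:E))//.
  by case/integrableP: fi.
by apply/measurable_EFinP; exact: measurableT_comp.
Qed.

Lemma intble_rV_opp d (f : 'rV[R]_d -> R) :
  intble (lebesgue_rV d) f -> intble (lebesgue_rV d) (fun x => f (- x)).
Proof.
move=> fi; have mf := intble_measurable fi; apply: intbleP.
  exact: (measurableT_comp mf (@measurable_rV_opp d)).
rewrite (ge0_integral_rV_opp (F := fun x => (`|f x|)%:E))//.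
  by case/integrableP: fi.
by apply/measurable_EFinP; exact: measurableT_comp.
Qed.

(** Passes from nonnegative to signed integrands, integrable or not, by treating the positive and
    negative parts separately. *)
Let pos_part_trick d (phi : 'rV[R]_d -> 'rV[R]_d) (f : 'rV[R]_d -> R) :
  (forall F : 'rV[R]_d -> \bar R, measurable_fun setT F -> (forall x, 0 <= F x)%E ->
   (\int[lebesgue_rV d]_x F (phi x) = \int[lebesgue_rV d]_x F x)%E) ->
  measurable_fun setT f ->
  \int[lebesgue_rV d]_x f (phi x) = \int[lebesgue_rV d]_x f x.
Proof.
move=> H mf; rewrite /Rintegral; congr fine.
rewrite integralE [RHS]integralE.
have mfE : measurable_fun setT (EFin \o f) by exact/measurable_EFinP.
rewrite -(H (EFin \o f)^\+%E)//; last exact: measurable_funepos.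
rewrite -(H (EFin \o f)^\-%E)//; last exact: measurable_funeneg.
by congr (_ - _)%E; apply: eq_integral => x _; rewrite ?funeposE ?funenegE.
Qed.

Lemma Rint_rV_shift d (c : 'rV[R]_d) (f : 'rV[R]_d -> R) : measurable_fun setT f ->
  \int[lebesgue_rV d]_x f (x + c) = \int[lebesgue_rV d]_x f x.
Proof.
by apply: (pos_part_trick (phi := fun x => x + c)) => F mF F0; exact: ge0_integral_rV_shift.
Qed.

Lemma Rint_rV_opp d (f : 'rV[R]_d -> R) : measurable_fun setT f ->
  \int[lebesgue_rV d]_x f (- x) = \int[lebesgue_rV d]_x f x.
Proof.
by apply: (pos_part_trick (phi := fun x => - x)) => F mF F0; exact: ge0_integral_rV_opp.
Qed.

End rV_integral.

(** * The Plancherel identity *)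

(** Young's inequality, the difference being (t a - b)^2 / t. With [t] tending to 0 it replaces the
    triangle inequality in L^2 without taking square roots. *)
Lemma sqrD_split {R : realType} (t a b : R) : 0 < t ->
  (a + b) ^+ 2 <= (1 + t) * a ^+ 2 + (1 + t^-1) * b ^+ 2.
Proof.
move=> t0; rewrite -subr_ge0.
rewrite (_ : _ - _ = (t * a - b) ^+ 2 / t); last by field; rewrite gt_eqF.
by rewrite divr_ge0 ?sqr_ge0// ltW.
Qed.

Lemma cvg_dist_squeeze {R : realType} (u e : nat -> R) (l : R) :
  (forall n, `|u n - l| <= e n) -> e n @[n --> \oo] --> 0 -> u n @[n --> \oo] --> l.
Proof.
move=> ue e0; apply/cvgrPdist_le => /= r r0.
have /cvgrPdist_le /(_ r r0) := e0; apply: filterS => n /=.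
rewrite sub0r normrN distrC => /(le_trans (ler_norm _)) enr.
exact: le_trans (ue n) enr.
Qed.

(** * Extension of the Plancherel identity by density *)

Section plancherel_extension.
Context {dT} {T : measurableType dT} {R : realType}.
Variable m : {sigma_finite_measure set T -> \bar R}.
Implicit Types (f g : T -> R) (k : T * T -> R).

Definition itrans k f (xi : T) : R := \int[m]_x (f x * k (x, xi)).

Definition itrans_sq (k1 k2 : T * T -> R) f : \bar R :=
  (\int[m]_xi (itrans k1 f xi ^+ 2 + itrans k2 f xi ^+ 2)%:E)%E.

Lemma measurable_itrans k f : measurable_fun setT k -> measurable_fun setT f ->
  measurable_fun setT (itrans k f).
Proof.
move=> mk mf.
apply: (@measurable_Rint_param _ _ _ _ _ m (fun p : T * T => f p.2 * k (p.2, p.1))).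
apply: measurable_funM; first exact: (measurableT_comp mf).
apply: (measurableT_comp mk).
by apply: measurable_fun_pair; [exact: measurable_snd|exact: measurable_fst].
Qed.

Variables k1 k2 : T * T -> R.
Hypotheses (mk1 : measurable_fun setT k1) (mk2 : measurable_fun setT k2).
Hypotheses (b1 : forall p, `|k1 p| <= 1) (b2 : forall p, `|k2 p| <= 1).

Lemma intble_kernel k f xi : measurable_fun setT k -> (forall p, `|k p| <= 1) ->
  intble m f -> intble m (fun x => f x * k (x, xi)).
Proof.
move=> mk bk fi; have mf := intble_measurable fi.
apply: (intble_le _ (intble_norm fi)).
  apply: measurable_funM => //.
  by apply: (measurableT_comp mk); exact: measurable_fun_pair.
by move=> x; rewrite normrM ler_piMr.
Qed.

Lemma itransB k f g xi : measurable_fun setT k -> (forall p, `|k p| <= 1) ->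
  intble m f -> intble m g ->
  itrans k (fun x => f x - g x) xi = itrans k f xi - itrans k g xi.
Proof.
move=> mk bk fi gi; rewrite /itrans -RintB; try exact: intble_kernel.
by apply: eq_Rintegral => x _; rewrite mulrBl.
Qed.

Lemma normr_itrans k f xi : measurable_fun setT k -> (forall p, `|k p| <= 1) ->
  intble m f -> `|itrans k f xi| <= \int[m]_x `|f x|.
Proof.
move=> mk bk fi; apply: normr_Rint_le; last first.
- by move=> x; rewrite normrM ler_piMr.
- exact: intble_norm.
- apply: intble_measurable; exact: intble_kernel fi.
Qed.

Lemma itrans_cvg k (f_ : nat -> T -> R) f xi : measurable_fun setT k ->
  (forall p, `|k p| <= 1) -> (forall n, intble m (f_ n)) -> intble m f ->
  (\int[m]_x `|f_ n x - f x|) @[n --> \oo] --> 0 ->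
  itrans k (f_ n) xi @[n --> \oo] --> itrans k f xi.
Proof.
move=> mk bk fni fi; apply: cvg_dist_squeeze => n; rewrite -itransB//.
by rewrite normr_itrans//; exact: intbleB.
Qed.

Let mtr f : measurable_fun setT f ->
  measurable_fun setT (fun xi => (itrans k1 f xi ^+ 2 + itrans k2 f xi ^+ 2)%:E).
Proof.
move=> mf; apply/measurable_EFinP; apply: measurable_funD;
  by apply: measurable_funX; exact: measurable_itrans.
Qed.

(** Fatou's lemma: convergence in L^1 gives pointwise convergence of both transforms, because the
    kernels are bounded by 1. *)
Lemma itrans_sq_limit (f_ : nat -> T -> R) f (a : nat -> R) (l : R) :
  (forall n, intble m (f_ n)) -> intble m f ->
  (\int[m]_x `|f_ n x - f x|) @[n --> \oo] --> 0 ->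
  (forall n, itrans_sq k1 k2 (f_ n) <= (a n)%:E)%E -> a @ \oo --> l ->
  (itrans_sq k1 k2 f <= l%:E)%E.
Proof.
move=> fni fi f0 fa al.
have mfn n := intble_measurable (fni n).
pose F n xi := (itrans k1 (f_ n) xi ^+ 2 + itrans k2 (f_ n) xi ^+ 2)%:E.
have -> : itrans_sq k1 k2 f = (\int[m]_xi (limn_einf (F^~ xi)))%E.
  apply: eq_integral => xi _.
  have c : F n xi @[n --> \oo] -->
      (itrans k1 f xi ^+ 2 + itrans k2 f xi ^+ 2)%:E.
    apply: cvg_EFin; first exact: nearW.
    by apply: cvgD; apply: cvgM; exact: itrans_cvg.
  by rewrite is_cvg_limn_einfE ?(cvg_lim _ c)//; apply/cvg_ex; eexists; exact: c.
apply: (le_trans (fatou _ _ _ _)) => //.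
- by move=> n; exact: mtr.
- by move=> n x _; rewrite lee_fin addr_ge0// sqr_ge0.
have ca : (a n)%:E @[n --> \oo] --> l%:E by apply: cvg_EFin => //; exact: nearW.
rewrite -(cvg_lim _ ca)// -is_cvg_limn_einfE; last by apply/cvg_ex; eexists; exact: ca.
rewrite !limn_einf_lim; apply: lee_lim; try exact: is_cvg_einfs.
apply: nearW => n; apply: le_ereal_inf_tmp => _ [p /= np <-].
by apply: le_trans (fa p); apply: ereal_inf_lbound; exists p.
Qed.

Lemma itrans_sqB_le (t : R) f g : 0 < t -> intble m f -> intble m g ->
  (itrans_sq k1 k2 f <= (1 + t)%:E * itrans_sq k1 k2 g +
   (1 + t^-1)%:E * itrans_sq k1 k2 (fun x => f x - g x)%R)%E.
Proof.
move=> t0 fi gi.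
have mf := intble_measurable fi; have mg := intble_measurable gi.
have t1 : 0 <= 1 + t by rewrite addr_ge0// ltW.
have t2 : 0 <= 1 + t^-1 by rewrite addr_ge0// invr_ge0 ltW.
rewrite /itrans_sq -!ge0_integralZl_EFin//; last first.
- by apply: mtr.
- by move=> x _; rewrite lee_fin addr_ge0// sqr_ge0.
- by apply: mtr; exact: measurable_funB.
- by move=> x _; rewrite lee_fin addr_ge0// sqr_ge0.
have ge0 (c : R) (h : T -> R) xi : 0 <= c ->
    (0 <= c%:E * (itrans k1 h xi ^+ 2 + itrans k2 h xi ^+ 2)%:E)%E.
  by move=> c0; rewrite -EFinM lee_fin mulr_ge0// addr_ge0// sqr_ge0.
rewrite -ge0_integralD//; last first.
- by apply: measurable_funeM; apply: mtr; exact: measurable_funB.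
- by move=> x _; exact: ge0.
- by apply: measurable_funeM; apply: mtr.
- by move=> x _; exact: ge0.
apply: ge0_le_integral => //.
- by move=> x _; rewrite lee_fin addr_ge0// sqr_ge0.
- exact: mtr.
- apply: emeasurable_funD; apply: measurable_funeM; apply: mtr => //.
  exact: measurable_funB.
move=> xi _; rewrite -!EFinM -EFinD lee_fin !itransB//.
set a := itrans k1 f xi; set b := itrans k1 g xi.
set c := itrans k2 f xi; set e := itrans k2 g xi.
have := sqrD_split b (a - b) t0; have := sqrD_split e (c - e) t0.
rewrite !(addrC b) !(addrC e) !subrK; lra.
Qed.

Lemma itrans_sqBC f g : intble m f -> intble m g ->
  itrans_sq k1 k2 (fun x => f x - g x) = itrans_sq k1 k2 (fun x => g x - f x).
Proof.
move=> fi gi; apply: eq_integral => xi _; rewrite !itransB//.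
by rewrite -[X in (X ^+ 2 + _)%R]opprB -[X in (_ + X ^+ 2)%R]opprB !sqrrN.
Qed.

Lemma int_sqrD_split (t : R) f g : 0 < t -> sqint m f -> sqint m g ->
  \int[m]_x (f x ^+ 2) <=
  (1 + t) * \int[m]_x (g x ^+ 2) + (1 + t^-1) * \int[m]_x ((f x - g x) ^+ 2).
Proof.
move=> t0 hf hg; have [mfg fgi] := sqintB hf hg.
case: hf => mf fi; case: hg => mg gi.
rewrite -!RintZ// -RintD; [|exact: intbleZ..].
apply: le_Rint => //; first by apply: intbleD; exact: intbleZ.
by move=> x; have := sqrD_split (g x) (f x - g x) t0; rewrite addrC subrK.
Qed.

(** The upper bound is Fatou. For the lower bound, Fatou applied to [f_ p - f_ n] as [p] grows shows
    that the transforms of [f_ n] converge in L^2 to that of [f]; Young's inequality then compares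
    the two energies up to a factor tending to 1. *)
Lemma plancherel_limit (f_ : nat -> T -> R) f :
  (forall n, intble m (f_ n)) -> intble m f ->
  (forall n, sqint m (f_ n)) -> sqint m f ->
  (\int[m]_x `|f_ n x - f x|) @[n --> \oo] --> 0 ->
  (\int[m]_x (f_ n x - f x) ^+ 2) @[n --> \oo] --> 0 ->
  (forall n, itrans_sq k1 k2 (f_ n) = (\int[m]_x (f_ n x ^+ 2))%:E) ->
  (forall n p, itrans_sq k1 k2 (fun x => f_ n x - f_ p x) =
     (\int[m]_x ((f_ n x - f_ p x) ^+ 2))%:E) ->
  itrans_sq k1 k2 f = (\int[m]_x (f x ^+ 2))%:E.
Proof.
move=> fni fi fns fs e1 e2 pf pff.
set S := \int[m]_x (f x ^+ 2).
pose e n := \int[m]_x (f_ n x - f x) ^+ 2.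
have S0 : 0 <= S by apply: Rint_ge0 => x; exact: sqr_ge0.
have en0 n : 0 <= e n by apply: Rint_ge0 => x; exact: sqr_ge0.
have le_t (a b : R) : 0 <= b -> (forall t : R, 0 < t -> a <= (1 + t) * b) -> a <= b.
  move=> b0 h; apply/ler_addgt0Pr => r r0.
  apply: (le_trans (h (r / (b + 1)) _)); first by rewrite divr_gt0// ltr_wpDl.
  rewrite mulrDl mul1r lerD2l mulrAC ler_pdivrMr ?ltr_wpDl//.
  by apply: ler_wpM2l; [exact: ltW|lra].
have lim_t (c r : R) : (c + r * e n) @[n --> \oo] --> c.
  rewrite -[X in _ --> X]addr0 -[X in _ + X](mulr0 r).
  by apply: cvgD; [exact: cvg_cst | apply: cvgM => //; exact: cvg_cst].
have up (t : R) : 0 < t -> (itrans_sq k1 k2 f <= ((1 + t) * S)%:E)%E.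
  move=> t0; apply: (itrans_sq_limit fni fi e1 _ (lim_t ((1 + t) * S) (1 + t^-1))) => n.
  by rewrite pf lee_fin int_sqrD_split.
have fin : itrans_sq k1 k2 f \is a fin_num.
  rewrite ge0_fin_numE; first by rewrite (le_lt_trans (up 1 _))// ltry.
  by apply: integral_ge0 => x _; rewrite lee_fin addr_ge0// sqr_ge0.
rewrite -(fineK fin); congr EFin; apply/eqP; rewrite eq_le; apply/andP; split.
  by apply: le_t => // t t0; rewrite -lee_fin fineK//; exact: up.
set N := fine _.
have N0 : 0 <= N.
  by apply: fine_ge0; apply: integral_ge0 => x _; rewrite lee_fin addr_ge0// sqr_ge0.
(* Let [p] tend to infinity in the energy of [f_ p - f_ n]. The factor 2 comes from Young's
   inequality with parameter 1, which bounds the distance from [f_ p] to [f_ n] through [f]. *)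
have dif n : (itrans_sq k1 k2 (fun x => f_ n x - f x)%R <= (2 * e n)%:E)%E.
  rewrite itrans_sqBC//.
  apply: (@itrans_sq_limit (fun p x => f_ p x - f_ n x) _
    (fun p => (1 + 1) * e n + (1 + 1^-1) * e p) (2 * e n)) => //.
  - by move=> p; exact: intbleB.
  - exact: intbleB.
  - rewrite (_ : (fun p => _) = (fun p => \int[m]_x `|f_ p x - f x|))//.
    by apply/funext => p; apply: eq_Rintegral => x _; congr (`|_|); ring.
  - move=> p; rewrite pff lee_fin.
    have := int_sqrD_split (ltr01) (sqintB (fns p) (fns n)) (sqintB fs (fns n)).
    rewrite (_ : \int[m]_x ((f x - f_ n x) ^+ 2) = e n); last first.
      by apply: eq_Rintegral => x _; ring.
    rewrite (_ : \int[m]_x ((f_ p x - f_ n x - (f x - f_ n x)) ^+ 2) = e p)//.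
    by apply: eq_Rintegral => x _; ring.
apply: le_t => // s s0.
(* Young's inequality is used twice below, so (1 + t)^2 has to fit under 1 + s; for t <= 1 one has
   (1 + t)^2 <= 1 + 3 t. *)
have [t [t0 ts]] : exists t : R, 0 < t /\ (1 + t) ^+ 2 <= 1 + s.
  exists (Num.min 1 (s / 3)); split; first by rewrite lt_min ltr01/= divr_gt0.
  set t := Num.min _ _.
  have t0 : 0 < t by rewrite lt_min ltr01/= divr_gt0.
  have t1 : t <= 1 by rewrite ge_min lexx.
  have t2 : t <= s / 3 by rewrite ge_min lexx orbT.
  have : 3 * t <= s by rewrite mulrC -ler_pdivlMr.
  nra.
apply: (@le_trans _ _ ((1 + t) ^+ 2 * N)); last by rewrite ler_wpM2r.
pose K := (1 + t) * (1 + t^-1) * 2 + (1 + t^-1).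
have bd n : S <= (1 + t) ^+ 2 * N + K * e n.
  have t1 : 0 <= 1 + t by rewrite addr_ge0// ltW.
  have t2 : 0 <= 1 + t^-1 by rewrite addr_ge0// invr_ge0 ltW.
  have h1 := int_sqrD_split t0 fs (fns n).
  rewrite (_ : \int[m]_x ((f x - f_ n x) ^+ 2) = e n) in h1; last first.
    by apply: eq_Rintegral => x _; ring.
  have h2 := itrans_sqB_le t0 (fni n) fi.
  have : (itrans_sq k1 k2 (f_ n) <= ((1 + t) * N + (1 + t^-1) * (2 * e n))%:E)%E.
    apply: (le_trans h2); rewrite [leRHS]EFinD; apply: leeD.
      by rewrite [leRHS]EFinM fineK.
    by rewrite [leRHS]EFinM; apply: lee_wpmul2l => //; rewrite lee_fin.
  rewrite pf lee_fin => h3.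
  apply: (le_trans h1); have := ler_wpM2l t1 h3; rewrite /K; nra.
have cb := lim_t ((1 + t) ^+ 2 * N) K.
rewrite -(cvg_lim _ cb)//; apply: limr_ge; first by apply/cvg_ex; eexists; exact: cb.
exact: nearW.
Qed.

End plancherel_extension.

Lemma cvg_Rint_dominated {d} {T : measurableType d} {R : realType}
    (mu : {measure set T -> \bar R}) (f_ : nat -> T -> R) (f g : T -> R) :
  (forall n, measurable_fun setT (f_ n)) -> measurable_fun setT f ->
  intble mu g -> (forall n x, `|f_ n x| <= g x) ->
  (forall x, f_ n x @[n --> \oo] --> f x) ->
  \int[mu]_x f_ n x @[n --> \oo] --> \int[mu]_x f x.
Proof.
move=> mfn mf gi fg cf.
have fn_i n : intble mu (f_ n) by exact: intble_le gi _.
have [fi _ c] : [/\ mu.-integrable setT (EFin \o f),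
  [sequence \int[mu]_x `|(EFin \o f_ n) x - (EFin \o f) x|]_n @ \oo --> 0 &
  [sequence \int[mu]_x ((EFin \o f_ n) x)]_n @ \oo --> \int[mu]_x (EFin \o f) x]%E.
  apply: (@dominated_convergence _ _ _ mu setT measurableT _ _ (EFin \o g)) => //.
  - by move=> n; exact/measurable_EFinP.
  - exact/measurable_EFinP.
  - apply: aeW => x _ /=; apply: cvg_EFin; first exact: nearW.
    exact: cf.
  - by apply: aeW => x n _ /=; rewrite lee_fin.
apply: fine_cvg; rewrite -/(Rintegral _ _ _) fineK; last exact: integrable_fin_num.
exact: c.
Qed.

Section Rint_affine.
Context {R : realType}.
Local Notation mu := (@lebesgue_measure R).

Lemma Rint_affine (r c : R) (f : R -> R) : r != 0 ->
  measurable_fun [set: measurableTypeR R] f ->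
  intble mu f ->
  \int[mu]_x f (r * x + c) = `|r|^-1 * \int[mu]_x f x.
Proof.
move=> r0 mf fi.
have mfE : measurable_fun [set: measurableTypeR R] (EFin \o f) by exact/measurable_EFinP.
have hp := ge0_integral_affine c r0 (measurable_funepos mfE) (funepos_ge0 _).
have hn := ge0_integral_affine c r0 (measurable_funeneg mfE) (funeneg_ge0 _).
have fp := integrable_funepos measurableT fi.
have fn := integrable_funeneg measurableT fi.
rewrite /Rintegral integralE [in RHS]integralE.
rewrite (_ : (\int[mu]_x (fun x0 : R => (f (r * x0 + c))%:E)^\+ x =
  (`|r|^-1)%:E * \int[mu]_x (EFin \o f)^\+ x)%E); last first.
  by rewrite -hp; apply: eq_integral => x _; rewrite !funeposE.
rewrite (_ : (\int[mu]_x (fun x0 : R => (f (r * x0 + c))%:E)^\- x =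
  (`|r|^-1)%:E * \int[mu]_x (EFin \o f)^\- x)%E); last first.
  by rewrite -hn; apply: eq_integral => x _; rewrite !funenegE.
have := integrable_fin_num measurableT fp; have := integrable_fin_num measurableT fn.
move: (\int[mu]_x (EFin \o f)^\- x)%E => [a| |]// _.
by move: (\int[mu]_x (EFin \o f)^\+ x)%E => [b| |]// _; rewrite /= mulrBr.
Qed.

Lemma intble_affine (r c : R) (f : R -> R) : r != 0 -> intble mu f ->
  intble mu (fun x => f (r * x + c)).
Proof.
move=> r0 fi; have mf := intble_measurable fi; apply: intbleP.
  exact: (measurableT_comp mf (measurable_affine r c)).
rewrite (ge0_integral_affine c (F := fun x => (`|f x|)%:E) r0)//; last first.
  by apply/measurable_EFinP; exact: measurableT_comp.
by rewrite lte_mul_pinfty// ?lee_fin ?invr_ge0//; case/integrableP: fi.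
Qed.

End Rint_affine.

(** * The Abel weight and the Poisson kernel *)

Section abel_kernel.
Context {R : realType}.
Local Notation mu := (@lebesgue_measure R).

(** An antiderivative of exp(- de x) (1 + cos (a x)). The summand 1 keeps the integrand nonnegative
    for the fundamental theorem on a half-line; [abel_kernelE] removes it again by comparison with
    [a] = 0. *)
Let F (de a x : R) : R := expR (- (de * x)) *
  ((a * sin (a * x) - de * cos (a * x)) / (de ^+ 2 + a ^+ 2) - de^-1).

Let dF (de a x : R) : 0 < de ->
  is_derive x 1 (F de a) (expR (- (de * x)) * (1 + cos (a * x))).
Proof.
move=> de0.
have pos : 0 < de ^+ 2 + a ^+ 2 by rewrite ltr_wpDr ?sqr_ge0// exprn_gt0.
rewrite /F; apply: is_derive_eq.
rewrite !scaler0 /GRing.scale/=.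
by field; rewrite !gt_eqF.
Qed.

Lemma derivable1_continuous (f : R -> R) x : derivable f x 1 -> {for x, continuous f}.
Proof. by move=> h; apply: differentiable_continuous; exact/derivable1_diffP. Qed.

Let cts_cos (a : R) : continuous (fun x : R => cos (a * x)).
Proof. by move=> x; apply: derivable1_continuous; apply: ex_derive. Qed.

Let abel_half (de a : R) : 0 < de ->
  (\int[mu]_(x in `[0%R, +oo[) (expR (- (de * x)) * (1 + cos (a * x)))%:E =
   (de / (de ^+ 2 + a ^+ 2) + de^-1)%:E)%E.
Proof.
move=> de0.
have pos : 0 < de ^+ 2 + a ^+ 2 by rewrite ltr_wpDr ?sqr_ge0// exprn_gt0.
rewrite (@ge0_continuous_FTC2y _ _ (F de a) _ 0).
- rewrite /F !mulr0 oppr0 expR0 sin0 cos0 -EFinB; congr EFin.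
  by field; rewrite !gt_eqF.
- by move=> x _; rewrite mulr_ge0 ?expR_ge0//; have := cos_geN1 (a * x); lra.
- apply: continuous_subspaceT => x.
  by apply: derivable1_continuous; apply: ex_derive.
- pose K := (`|a| + de) / (de ^+ 2 + a ^+ 2) + de^-1.
  have e0 : (expR (- (de * x)) * K) @[x --> +oo] --> 0.
    rewrite -(mul0r K); apply: cvgMl.
    apply: (@cvg_comp _ _ _ (fun x => de * x) (fun x => expR (- x))); last exact: cvgr_expR.
    exact: gt0_cvgMry.
  apply/norm_cvg0P; apply: (squeeze_cvgr _ (cvg_cst 0) e0).
  apply: nearW => x; rewrite normr_ge0/= /F normrM ger0_norm ?expR_ge0// ler_wpM2l ?expR_ge0//.
  apply: (le_trans (ler_normB _ _)); apply: lerD; last first.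
    by rewrite ger0_norm// invr_ge0 ltW.
  rewrite normrM (@ger0_norm _ (_^-1)) ?invr_ge0 ?(ltW pos)//.
  rewrite ler_wpM2r ?invr_ge0 ?(ltW pos)//.
  apply: (le_trans (ler_normB _ _)); rewrite !normrM lerD//.
    by rewrite ler_piMr// sin_max.
  by rewrite (ger0_norm (ltW de0)) ler_piMr ?cos_max// ltW.
- by move=> x _; have [] := dF a x de0.
- by apply: cvg_at_right_filter; apply: derivable1_continuous; have [] := dF a 0 de0.
- by move=> x _; rewrite derive1E; have [_ ->] := dF a x de0.
Qed.

Let abel_full (de a : R) : 0 < de ->
  (\int[mu]_x (expR (- (de * `|x|)) * (1 + cos (a * x)))%:E =
   (2 * (de / (de ^+ 2 + a ^+ 2)) + 2 / de)%:E)%E.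
Proof.
move=> de0; rewrite ge0_symfun_integralT//=.
- rewrite -set_itvcy (_ : (\int[mu]_(x in _) _)%E =
    (\int[mu]_(x in `[0%R, +oo[) (expR (- (de * x)) * (1 + cos (a * x)))%:E)%E); last first.
    by apply: eq_integral => x; rewrite inE/= in_itv/= andbT => x0; rewrite ger0_norm.
  by rewrite abel_half// -EFinM mulrDr.
- move=> x; apply: cvgM; last by apply: cvgD; [exact: cvg_cst|exact: cts_cos].
  apply: (@continuous_comp _ _ _ (fun x : R => `|x|) (fun x => expR (- (de * x)))).
    exact: norm_continuous.
  by apply: derivable1_continuous; apply: ex_derive.
- by move=> x /=; rewrite normrN mulrN cosN.
Qed.

Lemma continuous_abel (de : R) : continuous (fun x : R => expR (- (de * `|x|))).
Proof.
move=> x; apply: (@continuous_comp _ _ _ (fun x : R => `|x|) (fun x => expR (- (de * x)))).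
  exact: norm_continuous.
by apply: derivable1_continuous; apply: ex_derive.
Qed.

Lemma intble_abel (de : R) : 0 < de -> intble mu (fun x : R => expR (- (de * `|x|))).
Proof.
move=> de0.
have m1 : measurable_fun [set: measurableTypeR R] (fun x : R => expR (- (de * `|x|))).
  by apply: continuous_measurable_fun; exact: continuous_abel.
have m2 : measurable_fun [set: measurableTypeR R] (fun x : R => cos (0 * x)).
  by apply: continuous_measurable_fun; exact: cts_cos.
apply: ge0_intbleP => //.
apply: (@le_lt_trans _ _ (\int[mu]_x (expR (- (de * `|x|)) * (1 + cos (0 * x)))%:E)%E).
  apply: ge0_le_integral => //.
  - exact/measurable_EFinP.
  - by apply/measurable_EFinP; apply: measurable_funM => //; exact: measurable_funD.
  - move=> x _; rewrite lee_fin mul0r cos0.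
    by have := expR_ge0 (- (de * `|x|)); lra.
by rewrite abel_full// ltry.
Qed.

Lemma intble_abel_cos (de a : R) : 0 < de ->
  intble mu (fun x : R => expR (- (de * `|x|)) * cos (a * x)).
Proof.
move=> de0; apply: (intble_le _ (intble_abel de0)).
  apply: continuous_measurable_fun => x.
  by apply: cvgM; [exact: continuous_abel|exact: cts_cos].
by move=> x; rewrite normrM (ger0_norm (expR_ge0 _)) ler_piMr ?expR_ge0// cos_max.
Qed.

Lemma abel_kernelE (de a : R) : 0 < de ->
  \int[mu]_x (expR (- (de * `|x|)) * cos (a * x)) = 2 * (de / (de ^+ 2 + a ^+ 2)).
Proof.
move=> de0.
have H b : \int[mu]_x expR (- (de * `|x|)) +
    \int[mu]_x (expR (- (de * `|x|)) * cos (b * x)) =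
    2 * (de / (de ^+ 2 + b ^+ 2)) + 2 / de.
  rewrite -RintD; [|exact: intble_abel|exact: intble_abel_cos].
  rewrite -[RHS]/(fine (_)%:E) -abel_full//; congr fine.
  by apply: eq_integral => x _; rewrite mulrDr mulr1.
have H0 := H 0; move: H0.
under [X in _ + X = _ -> _]eq_Rintegral do rewrite mul0r cos0 mulr1.
have := H a; set I := \int[mu]_x expR (- (de * `|x|)); set J := \int[mu]_x _.
move=> Ha; rewrite expr0n addr0 => H0.
have de1 : de != 0 by rewrite gt_eqF.
have : I = 2 / de.
  apply: (@mulfI _ 2) => //; rewrite (_ : 2 * I = I + I); last by ring.
  by rewrite H0; field.
by move=> IE; apply: (@addrI _ (2 / de)); rewrite -{1}IE Ha addrC.
Qed.

Let poisson_half :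
  (\int[mu]_(x in `[0%R, +oo[) (2 / (1 + (2 * pi * x) ^+ 2))%:E = (2^-1)%:E)%E.
Proof.
have pi0 : (0 : R) < pi by exact: pi_gt0.
have pos (x : R) : 0 < 1 + (2 * pi * x) ^+ 2 by rewrite ltr_wpDr// sqr_ge0.
have dG (x : R) : is_derive x 1 (fun x : R => pi^-1 * atan (2 * pi * x))
    (2 / (1 + (2 * pi * x) ^+ 2)).
  apply: is_derive_eq; rewrite /GRing.scale/= mulr1.
  by rewrite mulrCA [pi^-1 * _]mulrCA mulVf ?gt_eqF// mulr1 mulrC.
rewrite (@ge0_continuous_FTC2y _ _ (fun x : R => pi^-1 * atan (2 * pi * x)) _ (2^-1)).
- by rewrite mulr0 atan0 mulr0 sube0.
- by move=> x _; rewrite divr_ge0// ltW.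
- apply: continuous_subspaceT => x; apply: cvgM; first exact: cvg_cst.
  apply: cvgV; first by rewrite gt_eqF.
  by apply: (@derivable1_continuous (fun x : R => 1 + (2 * pi * x) ^+ 2)); apply: ex_derive.
- rewrite (_ : 2^-1 = pi^-1 * (pi / 2)); last by rewrite mulrA mulVf ?mul1r// gt_eqF.
  apply: cvgMr; apply: (@cvg_comp _ _ _ (fun x => 2 * pi * x) atan); last exact: cvgy_atan.
  by apply: gt0_cvgMry => //; rewrite mulr_gt0.
- by move=> x _; have [] := dG x.
- apply: cvg_at_right_filter.
  by apply: (@derivable1_continuous (fun x : R => pi^-1 * atan (2 * pi * x)) 0); have [] := dG 0.
- by move=> x _; rewrite derive1E; have [_ ->] := dG x.
Qed.

Lemma continuous_poisson : continuous (fun x : R => 2 / (1 + (2 * pi * x) ^+ 2)).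
Proof.
move=> x; apply: cvgM; first exact: cvg_cst.
apply: cvgV; first by rewrite gt_eqF// ltr_wpDr// sqr_ge0.
by apply: (@derivable1_continuous (fun x : R => 1 + (2 * pi * x) ^+ 2)); apply: ex_derive.
Qed.

Let poisson_full :
  (\int[mu]_x (2 / (1 + (2 * pi * x) ^+ 2))%:E = 1%:E)%E.
Proof.
rewrite ge0_symfun_integralT//=.
- by rewrite -set_itvcy poisson_half -EFinM mulfV.
- by move=> x; rewrite divr_ge0// addr_ge0// sqr_ge0.
- exact: continuous_poisson.
- by move=> x /=; rewrite mulrN sqrrN.
Qed.

Lemma intble_poisson : intble mu (fun x : R => 2 / (1 + (2 * pi * x) ^+ 2)).
Proof.
apply: ge0_intbleP.
- by apply: continuous_measurable_fun; exact: continuous_poisson.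
- by move=> x; rewrite divr_ge0// addr_ge0// sqr_ge0.
- by rewrite poisson_full ltry.
Qed.

(** Total mass 1: the dilates of this profile form the approximate identity behind Plancherel. *)
Lemma Rint_poisson : \int[mu]_x (2 / (1 + (2 * pi * x) ^+ 2)) = 1.
Proof. by rewrite /Rintegral poisson_full. Qed.

End abel_kernel.

Section bounded_support.
Context {R : realType}.
Local Notation mu := (@lebesgue_measure R).

Lemma intble_indic_itv (r : R) : intble mu (\1_(`[- r, r]%classic) : R -> R).
Proof.
exact: integrable_indic_itv.
Qed.

Lemma intble_bounded (f : R -> R) (M r : R) :
  measurable_fun [set: measurableTypeR R] f ->
  (forall x, `|f x| <= M) -> (forall x, r < `|x| -> f x = 0) -> intble mu f.
Proof.
move=> mf fM fr; apply: (intble_le mf (intbleZ M (intble_indic_itv r))) => x.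
rewrite indicE; case: (boolP (x \in _)) => [_|]; first by rewrite mulr1.
rewrite notin_setE/= in_itv/= => /negP; rewrite negb_and -!ltNge => xr.
rewrite fr ?normr0 ?mulr0//; move: xr.
by have [x0|x0] := ger0P x; case/orP => ?; lra.
Qed.

End bounded_support.

(** * Plancherel in dimension one *)

Section plancherel1.
Context {R : realType}.
Local Notation mu := (@lebesgue_measure R).
Local Notation rT := (measurableTypeR R).

Definition kcos (p : rT * rT) : R := cos (2 * pi * (p.1 * p.2)).
Definition ksin (p : rT * rT) : R := sin (2 * pi * (p.1 * p.2)).

Lemma measurable_cos_comp {d} {T : measurableType d} (f : T -> R) :
  measurable_fun setT f -> measurable_fun setT (fun x => cos (f x)).
Proof.
by apply: (measurableT_comp (continuous_measurable_fun (@continuous_cos R))).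
Qed.

Lemma measurable_sin_comp {d} {T : measurableType d} (f : T -> R) :
  measurable_fun setT f -> measurable_fun setT (fun x => sin (f x)).
Proof.
by apply: (measurableT_comp (continuous_measurable_fun (@continuous_sin R))).
Qed.

Lemma measurable_kcos : measurable_fun setT kcos.
Proof. by apply: measurable_cos_comp; apply: measurable_funM => //; exact: measurable_funM. Qed.

Lemma measurable_ksin : measurable_fun setT ksin.
Proof. by apply: measurable_sin_comp; apply: measurable_funM => //; exact: measurable_funM. Qed.

Lemma kcos_le1 p : `|kcos p| <= 1. Proof. exact: cos_max. Qed.
Lemma ksin_le1 p : `|ksin p| <= 1. Proof. exact: sin_max. Qed.

Section abel_means.
Variables (f : R -> R).
Hypothesis mf : measurable_fun [set: rT] f.
Hypothesis fi : intble mu f.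

Let C xi := itrans mu kcos f xi.
Let S xi := itrans mu ksin f xi.
Let w (de xi : R) := expR (- (de * `|xi|)).
Let nf := \int[mu]_x `|f x|.

Let mC : measurable_fun [set: rT] C.
Proof. exact: measurable_itrans measurable_kcos mf. Qed.
Let mS : measurable_fun [set: rT] S.
Proof. exact: measurable_itrans measurable_ksin mf. Qed.
Let C_le xi : `|C xi| <= nf.
Proof. exact: (normr_itrans _ measurable_kcos kcos_le1 fi). Qed.
Let S_le xi : `|S xi| <= nf.
Proof. exact: (normr_itrans _ measurable_ksin ksin_le1 fi). Qed.
Let mw (de : R) : measurable_fun [set: rT] (w de).
Proof. by apply: continuous_measurable_fun; exact: continuous_abel. Qed.

Let D (x xi : R) := cos (2 * pi * (x * xi)) * C xi + sin (2 * pi * (x * xi)) * S xi.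

(** The addition formula for cos merges the two transforms into a single kernel in [x - y]. *)
Let DE x xi : D x xi = \int[mu]_y (f y * cos (2 * pi * ((x - y) * xi))).
Proof.
rewrite /D /C /S /itrans -!RintZ; [|exact: intble_kernel measurable_ksin ksin_le1 fi|
  exact: intble_kernel measurable_kcos kcos_le1 fi].
rewrite -RintD; last 2 first.
- by apply: intbleZ; exact: intble_kernel measurable_kcos kcos_le1 fi.
- by apply: intbleZ; exact: intble_kernel measurable_ksin ksin_le1 fi.
apply: eq_Rintegral => y _; rewrite /kcos /ksin/=.
rewrite (_ : 2 * pi * ((x - y) * xi) = 2 * pi * (x * xi) - 2 * pi * (y * xi)); last by ring.
rewrite cosB; ring.
Qed.

Let D_le x xi : `|D x xi| <= 2 * nf.
Proof.
rewrite /D (le_trans (ler_normD _ _))// !normrM.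
have c := cos_max (2 * pi * (x * xi)); have s := sin_max (2 * pi * (x * xi)).
have h1 := ler_pM (normr_ge0 _) (normr_ge0 _) c (C_le xi).
have h2 := ler_pM (normr_ge0 _) (normr_ge0 _) s (S_le xi).
by lra.
Qed.

(* By Fubini, the Abel mean of the energy spectrum is a Poisson mean of the
   autocorrelation of [f]; Plancherel follows as [de] tends to 0. *)
Lemma abel_mean (de : R) : 0 < de ->
  \int[mu]_xi (w de xi * (C xi ^+ 2 + S xi ^+ 2)) =
  \int[mu]_x (f x * \int[mu]_u (f (- de * u + x) * (2 / (1 + (2 * pi * u) ^+ 2)))).
Proof.
move=> de0.
have nf0 : 0 <= nf by apply: Rint_ge0.
have wi := intble_abel de0.
transitivity (\int[mu]_xi \int[mu]_x (f x * (w de xi * D x xi))).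
  apply: eq_Rintegral => xi _.
  rewrite (_ : _ * _ = w de xi * C xi * C xi + w de xi * S xi * S xi); last by ring.
  have ci := intble_kernel xi measurable_kcos kcos_le1 fi.
  have si := intble_kernel xi measurable_ksin ksin_le1 fi.
  have -> : w de xi * C xi * C xi = \int[mu]_x (w de xi * C xi * (f x * kcos (x, xi))).
    by rewrite RintZ.
  have -> : w de xi * S xi * S xi = \int[mu]_x (w de xi * S xi * (f x * ksin (x, xi))).
    by rewrite RintZ.
  rewrite -RintD; [|exact: intbleZ..].
  apply: eq_Rintegral => x _; rewrite /D /kcos /ksin/=; ring.
have mD : measurable_fun setT (fun p : rT * rT => D p.2 p.1).
  apply: measurable_funD; apply: measurable_funM.
  - by apply: measurable_cos_comp; apply: measurable_funM => //; exact: measurable_funM.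
  - exact: (measurableT_comp mC).
  - by apply: measurable_sin_comp; apply: measurable_funM => //; exact: measurable_funM.
  - exact: (measurableT_comp mS).
rewrite (@Fubini_dom _ _ rT rT R mu mu (fun p => f p.2 * (w de p.1 * D p.2 p.1))
  (w de) (fun x => `|f x| * (2 * nf))) //=; last 3 first.
- apply: measurable_funM; first exact: (measurableT_comp mf).
  by apply: measurable_funM => //; exact: (measurableT_comp (mw de)).
- under eq_fun do rewrite mulrC; apply: intbleZ; exact: intble_norm.
- move=> xi x; rewrite !normrM (ger0_norm (expR_ge0 _)) mulrCA.
  by rewrite ler_wpM2l ?expR_ge0// ler_wpM2l.
apply: eq_Rintegral => x _.
have wDi : intble mu (fun xi => w de xi * D x xi).
  apply: (intble_le _ (intbleZ (2 * nf) wi)).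
    apply: measurable_funM => //.
    exact: (measurable_sect1 x mD).
  by move=> xi; rewrite normrM (ger0_norm (expR_ge0 _)) mulrC ler_wpM2r ?expR_ge0.
rewrite RintZ//; congr (_ * _).
transitivity (\int[mu]_xi \int[mu]_y (f y * (w de xi * cos (2 * pi * ((x - y) * xi))))).
  apply: eq_Rintegral => xi _; rewrite DE -RintZ.
    by apply: eq_Rintegral => y _; ring.
  apply: (intble_le _ (intble_norm fi)).
    apply: measurable_funM => //; apply: measurable_cos_comp.
    by apply: measurable_funM => //; apply: measurable_funM => //; exact: measurable_funB.
  by move=> y; rewrite normrM ler_piMr// cos_max.
rewrite (@Fubini_dom _ _ rT rT R mu mu
  (fun p => f p.2 * (w de p.1 * cos (2 * pi * ((x - p.2) * p.1))))
  (w de) (fun x => `|f x|)) //=; last 3 first.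
- apply: measurable_funM; first exact: (measurableT_comp mf).
  apply: measurable_funM; first exact: (measurableT_comp (mw de)).
  apply: measurable_cos_comp; apply: measurable_funM => //; apply: measurable_funM => //.
  exact: measurable_funB.
- exact: intble_norm.
- move=> xi y; rewrite !normrM (ger0_norm (expR_ge0 _)) mulrCA.
  by rewrite ler_wpM2l ?expR_ge0// ler_piMr// cos_max.
(* Integrating over [xi] first produces the Poisson kernel of width [de] at [x - y]. *)
pose F y := f y * (2 * (de / (de ^+ 2 + (2 * pi * (x - y)) ^+ 2))).
transitivity (\int[mu]_y F y).
  apply: eq_Rintegral => y _; rewrite RintZ; last first.
    under eq_fun do rewrite mulrA; exact: intble_abel_cos.
  rewrite /F -abel_kernelE//; congr (_ * _); apply: eq_Rintegral => xi _.
  by rewrite mulrA.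
have pos y : 0 < de ^+ 2 + (2 * pi * (x - y)) ^+ 2.
  by rewrite ltr_wpDr ?sqr_ge0// exprn_gt0.
have Fi : intble mu F.
  apply: (intble_le _ (intbleZ (2 / de) (intble_norm fi))).
    apply: measurable_funM => //; apply: continuous_measurable_fun => y.
    apply: cvgM; first exact: cvg_cst.
    apply: cvgM; first exact: cvg_cst.
    apply: cvgV; first by rewrite gt_eqF.
    by apply: (@derivable1_continuous _ (fun y => de ^+ 2 + (2 * pi * (x - y)) ^+ 2));
      apply: ex_derive.
  move=> y; rewrite /F normrM mulrC ler_wpM2r//.
  rewrite ger0_norm; last by rewrite mulr_ge0// divr_ge0// ltW.
  rewrite ler_wpM2l// ler_pdivrMr// ler_pdivlMl// -expr2 lerDl sqr_ge0//.
(* The substitution y = x - de u moves the dependence on [de] from the kernel into the argument of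
   [f]. *)
have := @Rint_affine R (- de) x F _ (intble_measurable Fi) Fi.
rewrite oppr_eq0 gt_eqF// normrN (gtr0_norm de0) => /(_ isT).
move/(congr1 (fun z => de * z)); rewrite mulrA divff ?gt_eqF// mul1r => <-.
rewrite -RintZ.
  apply: eq_Rintegral => u _; rewrite /F.
  have pu : 1 + (2 * pi * u) ^+ 2 != 0 by rewrite gt_eqF// ltr_wpDr// sqr_ge0.
  have e : de ^+ 2 + (2 * pi * (x - (- de * u + x))) ^+ 2 =
    de ^+ 2 * (1 + (2 * pi * u) ^+ 2) by ring.
  rewrite e mulrCA; congr (_ * _); move: pu; move: (1 + _) => A A0.
  by field; rewrite A0 gt_eqF.
by apply: intble_affine => //; rewrite oppr_eq0 gt_eqF.
Qed.

End abel_means.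

(** Both sides are limits of the Abel means [J]: on the physical side an approximate identity acts
    on a continuous function and dominated convergence applies, on the frequency side the Abel
    weights increase to 1 and monotone convergence applies. *)
Lemma plancherel1_continuous (f : R -> R) (M r : R) : continuous f ->
  (forall x, `|f x| <= M) -> (forall x, r < `|x| -> f x = 0) ->
  itrans_sq mu kcos ksin f = (\int[mu]_x (f x ^+ 2))%:E.
Proof.
move=> cf fM fr.
have mf : measurable_fun [set: rT] f := continuous_measurable_fun cf.
have fi := intble_bounded mf fM fr.
have M0 : 0 <= M := le_trans (normr_ge0 _) (fM 0).
pose de n : R := n.+1%:R^-1.
have de0 n : 0 < de n by rewrite invr_gt0.
have cde : de n @[n --> \oo] --> 0 by exact: cvg_harmonic.
pose C xi := itrans mu kcos f xi; pose S xi := itrans mu ksin f xi.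
have mC : measurable_fun [set: rT] C by exact: measurable_itrans measurable_kcos mf.
have mS : measurable_fun [set: rT] S by exact: measurable_itrans measurable_ksin mf.
have mCS : measurable_fun [set: rT] (fun xi => C xi ^+ 2 + S xi ^+ 2).
  by apply: measurable_funD; exact: measurable_funX.
have mw n : measurable_fun [set: rT] (fun xi : R => expR (- (de n * `|xi|))).
  by apply: continuous_measurable_fun; exact: continuous_abel.
pose J n := \int[mu]_xi (expR (- (de n * `|xi|)) * (C xi ^+ 2 + S xi ^+ 2)).
pose p (u : R) : R := 2 / (1 + (2 * pi * u) ^+ 2).
have p0 u : 0 <= p u by rewrite divr_ge0// addr_ge0// sqr_ge0.
have pI : intble mu p := intble_poisson.
have mp := intble_measurable pI.
have mshift n x : measurable_fun [set: rT] (fun u : R => f (- de n * u + x)).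
  exact: (measurableT_comp mf (measurable_affine (- de n) x)).
have cJ : J n @[n --> \oo] --> \int[mu]_x (f x ^+ 2).
  rewrite (_ : J = fun n => \int[mu]_x (f x * \int[mu]_u (f (- de n * u + x) * p u))); last first.
    by apply/funext => n; exact: abel_mean.
  apply: (@cvg_Rint_dominated _ rT _ mu
    (fun n x => f x * \int[mu]_u (f (- de n * u + x) * p u))
    (fun x => f x ^+ 2) (fun x => M * `|f x|)) => //.
  - move=> n; apply: measurable_funM => //.
    apply: (measurable_Rint_param _ (f := fun q : rT * rT => f (- de n * q.2 + q.1) * p q.2)).
    apply: measurable_funM; last exact: (measurableT_comp mp).
    apply: (measurableT_comp mf); apply: measurable_funD => //.
    exact: measurable_funM.
  - exact: measurable_funX.
  - by apply: intbleZ; exact: intble_norm.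
  - move=> n x; rewrite normrM mulrC ler_wpM2r//.
    rewrite -[leRHS]mulr1 -(@Rint_poisson R) -RintZ//.
    apply: normr_Rint_le; [exact: measurable_funM|exact: intbleZ|move=> u].
    by rewrite normrM [X in _ * X]ger0_norm ?p0// ler_wpM2r// p0.
  - move=> x; rewrite expr2; apply: cvgM; first exact: cvg_cst.
    rewrite -[X in _ --> X]mulr1 -(@Rint_poisson R) -RintZ//.
    apply: (@cvg_Rint_dominated _ rT _ mu (fun n u => f (- de n * u + x) * p u)
      (fun u => f x * p u) (fun u => M * p u)) => //.
    + by move=> n; exact: measurable_funM.
    + exact: measurable_funM.
    + exact: intbleZ.
    + by move=> n u; rewrite normrM [X in _ * X]ger0_norm ?p0// ler_wpM2r// p0.
    + move=> u; apply: cvgM; last exact: cvg_cst.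
      have cu : (- de n * (u : R) + (x : R)) @[n --> \oo] --> (x : R).
        rewrite -[X in _ --> X]add0r; apply: cvgD; last exact: cvg_cst.
        by rewrite -(mul0r (u : R)) -oppr0; apply: cvgMl; exact: cvgN.
      exact: (cvg_comp _ _ cu (cf x)).
have JE n : (J n)%:E =
    (\int[mu]_xi (expR (- (de n * `|xi|)) * (C xi ^+ 2 + S xi ^+ 2))%:E)%E.
  apply: RintE; set nf := \int[mu]_x `|f x|.
  apply: (intble_le _ (intbleZ (nf ^+ 2 + nf ^+ 2) (intble_abel (de0 n)))).
    exact: measurable_funM.
  move=> xi; rewrite normrM ger0_norm ?expR_ge0// mulrC ler_wpM2r ?expR_ge0//.
  rewrite ger0_norm ?addr_ge0 ?sqr_ge0//.
  rewrite -(real_normK (num_real (C xi))) -(real_normK (num_real (S xi))).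
  apply: lerD; rewrite ler_pXn2r ?nnegrE ?Rint_ge0//.
    exact: (normr_itrans _ measurable_kcos kcos_le1 fi).
  exact: (normr_itrans _ measurable_ksin ksin_le1 fi).
have c2 : (J n)%:E @[n --> \oo] --> itrans_sq mu kcos ksin f.
  rewrite (_ : (fun n => (J n)%:E) = fun n =>
    (\int[mu]_xi (expR (- (de n * `|xi|)) * (C xi ^+ 2 + S xi ^+ 2))%:E)%E); last first.
    by apply/funext => n; exact: JE.
  have -> : itrans_sq mu kcos ksin f = (\int[mu]_xi
     limn (fun n => (expR (- (de n * `|xi|)) * (C xi ^+ 2 + S xi ^+ 2))%:E))%E.
    apply: eq_integral => xi _; apply/esym/cvg_lim => //.
    apply: cvg_EFin; first exact: nearW.
    rewrite -[X in _ --> X]mul1r; apply: cvgMl.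
    have cx : (- (de n * `|xi : R|)) @[n --> \oo] --> (0 : R).
      by rewrite -oppr0; apply: cvgN; rewrite -(mul0r `|xi : R|); exact: cvgMl.
    rewrite -(@expR0 R); exact: (cvg_comp _ _ cx (@continuous_expR R 0)).
  apply: cvg_monotone_convergence => //.
  - by move=> n; apply/measurable_EFinP; exact: measurable_funM.
  - by move=> n x _; rewrite lee_fin mulr_ge0 ?expR_ge0// addr_ge0// sqr_ge0.
  - move=> x _ a b ab; rewrite lee_fin ler_wpM2r//.
      by rewrite addr_ge0// sqr_ge0.
    rewrite ler_expR lerN2 ler_wpM2r// lef_pV2 ?posrE//.
    by rewrite ler_nat ltnS.
apply: (cvg_unique _ c2) => //; apply: cvg_EFin => //; exact: nearW.
Qed.

End plancherel1.

Section plancherel1_bounded.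
Context {R : realType}.
Local Notation mu := (@lebesgue_measure R).
Local Notation rT := (measurableTypeR R).

(** Continuous L^1 approximants are multiplied by a cutoff [chi] and clipped to [-M, M]. Neither
    operation increases the distance to [f], and the uniform bound upgrades L^1 convergence to
    L^2. *)
Lemma plancherel1 (f : R -> R) (M r : R) : measurable_fun [set: rT] f ->
  (forall x, `|f x| <= M) -> (forall x, r < `|x| -> f x = 0) ->
  itrans_sq mu (@kcos R) (@ksin R) f = (\int[mu]_x (f x ^+ 2))%:E.
Proof.
move=> mf fM fr.
have M0 : 0 <= M := le_trans (normr_ge0 _) (fM 0).
have fi := intble_bounded mf fM fr.
have sq_b (g : R -> R) (K s : R) : measurable_fun [set: rT] g ->
    (forall x, `|g x| <= K) -> (forall x, s < `|x| -> g x = 0) -> sqint mu g.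
  move=> mg gK gs; split => //.
  apply: (@intble_bounded _ _ (K ^+ 2) s).
  - exact: measurable_funX.
  - by move=> x; rewrite normrX lerXn2r ?nnegrE// (le_trans _ (gK x)).
  - by move=> x /gs ->; rewrite expr0n.
pose E : set R := `[- (r + 1), r + 1]%classic.
have Efin : (mu E < +oo)%E.
  by rewrite /E lebesgue_measure_itv/=; case: ifP => _; rewrite ?ltry.
have fE : mu.-integrable E (EFin \o f) by apply: (integrableS _ _ _ fi) => //; exact: measurable_itv.
have [g_ [cg ig g0]] := approximation_continuous_integrable (measurable_itv _) Efin fE.
pose chi (x : R) := Num.max 0 (Num.min 1 (r + 1 - `|x|)).
pose clip (t : R) := Num.max (- M) (Num.min M t).
pose f_ n x := chi x * clip (g_ n x).
have chi01 x : 0 <= chi x <= 1.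
  by rewrite /chi le_max lexx/= ge_max ler01/= ge_min lexx.
have chi1 x : `|x| <= r -> chi x = 1.
  move=> xr; rewrite /chi min_l; last by lra.
  by rewrite max_r// ler01.
have chi0 x : r + 1 < `|x| -> chi x = 0.
  move=> xr; rewrite /chi max_l// ge_min; apply/orP; right; lra.
have clipM t : `|clip t| <= M.
  rewrite ler_norml /clip le_max lexx/= ge_max ge_min lexx/=.
  by rewrite andbT; lra.
have clip_id t : `|t| <= M -> clip t = t.
  by rewrite ler_norml => /andP[t1 t2]; rewrite /clip min_r// max_r.
have clip_le (s t : R) : `|s| <= M -> `|clip t - s| <= `|t - s|.
  rewrite ler_norml => /andP[s1 s2]; rewrite /clip.
  have [tM|Mt] := leP t M.
    have [tM'|Mt'] := leP (- M) t => //.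
    rewrite (_ : - M - s = - (s + M)); last by ring.
    rewrite normrN ger0_norm; last by lra.
    by rewrite ler0_norm; lra.
  rewrite max_r; last by lra.
  by rewrite !ger0_norm; lra.
have cmm (a b : R) (h : R -> R) : continuous h ->
    continuous (fun x => Num.max a (Num.min b (h x))).
  move=> ch x; apply: (@continuous_max _ _ (cst a) (fun x => Num.min b (h x)) x).
    exact: cst_continuous.
  by apply: (@continuous_min _ _ (cst b) h x); [exact: cst_continuous|exact: ch].
have cf n : continuous (f_ n).
  move=> x; apply: cvgM; last exact: cmm.
  apply: (cmm 0 1 (fun x => r + 1 - `|x|)) => y.
  by apply: cvgB; [exact: cvg_cst|exact: norm_continuous].
have fM_ n x : `|f_ n x| <= M.
  have /andP[c0 c1] := chi01 x.
  rewrite normrM (ger0_norm c0) -[leRHS]mul1r; exact: ler_pM.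
have fr_ n x : r + 1 < `|x| -> f_ n x = 0 by move=> /chi0 cx; rewrite /f_ cx mul0r.
have mf_ n : measurable_fun [set: rT] (f_ n) := continuous_measurable_fun (cf n).
have fi_ n : intble mu (f_ n) := intble_bounded (mf_ n) (fM_ n) (fr_ n).
have dle n x : E x -> `|f_ n x - f x| <= `|f x - g_ n x|.
  move=> _; rewrite [leRHS]distrC; have [xr|rx] := leP `|x| r.
    by rewrite /f_ chi1// mul1r clip_le.
  rewrite fr// !subr0 /f_ normrM.
  have /andP[c0 c1] := chi01 x; rewrite (ger0_norm c0).
  apply: (@le_trans _ _ `|clip (g_ n x)|); first by rewrite ler_piMl.
  by have := clip_le 0 (g_ n x); rewrite !subr0 normr0; apply.
have d0 n x : ~ E x -> f_ n x - f x = 0.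
  move=> Ex; have rx : r + 1 < `|x|.
    rewrite ltNge; apply/negP => xr; apply: Ex; rewrite /E/= in_itv/=.
    by rewrite -ler_norml.
  by rewrite fr_// fr ?subrr//; lra.
have dI n : intble mu (fun x => `|f_ n x - f x|).
  by apply: intble_norm; exact: intbleB.
have e1 : (\int[mu]_x `|f_ n x - f x|) @[n --> \oo] --> 0.
  suff : (\int[mu]_x `|f_ n x - f x|)%:E @[n --> \oo] --> 0%:E by move/fine_cvg.
  apply: (squeeze_cvge _ (cvg_cst 0%E) g0); apply: nearW => n.
  rewrite lee_fin Rint_ge0//= RintE//.
  rewrite (_ : (\int[mu]_x `|f_ n x - f x|%:E)%E =
    (\int[mu]_(x in E) `|f_ n x - f x|%:E)%E); last first.
    rewrite [RHS]integral_mkcond; apply: eq_integral => x _.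
    rewrite patchE; case: ifPn => // /negP; rewrite inE => /d0 ->.
    by rewrite normr0.
  have mfg : measurable_fun E (fun x => f x - g_ n x).
    apply: measurable_funB; first exact: measurable_funTS.
    by apply: measurable_funTS; exact: continuous_measurable_fun.
  apply: ge0_le_integral => //.
  - exact: measurable_itv.
  - apply/measurable_EFinP; apply: measurable_funTS; exact: intble_measurable (dI n).
  - by apply/measurable_EFinP; exact: measurableT_comp.
  - by move=> x Ex; rewrite lee_fin dle.
have e2 : (\int[mu]_x (f_ n x - f x) ^+ 2) @[n --> \oo] --> 0.
  have c : (2 * M) * (\int[mu]_x `|f_ n x - f x|) @[n --> \oo] --> 0.
    by rewrite -(mulr0 (2 * M)); exact: cvgMr.
  apply: (squeeze_cvgr _ (cvg_cst 0) c); apply: nearW => n.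
  rewrite Rint_ge0/=; last by move=> x; exact: sqr_ge0.
  rewrite -RintZ//; apply: le_Rint; last first.
  - move=> x; rewrite -(real_normK (num_real _)) expr2 ler_wpM2r//.
    by rewrite (le_trans (ler_normB _ _))// mulr_natl mulr2n lerD.
  - exact: intbleZ.
  - have [] := @sqintB _ _ _ mu (f_ n) f => //.
      exact: sq_b (mf_ n) (fM_ n) (fr_ n).
    exact: sq_b mf fM fr.
apply: (@plancherel_limit _ _ _ mu _ _ (@measurable_kcos R) (@measurable_ksin R)
  (@kcos_le1 R) (@ksin_le1 R) f_) => //.
- by move=> n; exact: sq_b (mf_ n) (fM_ n) (fr_ n).
- exact: sq_b mf fM fr.
- by move=> n; exact: (plancherel1_continuous (cf n) (fM_ n) (fr_ n)).
- move=> n p; apply: (@plancherel1_continuous _ _ (M + M) (r + 1)).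
  + by move=> x; apply: cvgB; exact: cf.
  + by move=> x; rewrite (le_trans (ler_normB _ _))// lerD.
  + by move=> x rx; rewrite !fr_// subrr.
Qed.

End plancherel1_bounded.

(** An integral against a reflection-invariant measure only sees the even part of the integrand.
    This is how all cross terms between even and odd transforms disappear. *)
Lemma integral_symmetrize {d} {T : measurableType d} {R : realType}
    (mu : {measure set T -> \bar R}) (opp : T -> T) (G K : T -> R) :
  (forall F : T -> \bar R, measurable_fun setT F -> (forall x, 0 <= F x)%E ->
    (\int[mu]_x F (opp x) = \int[mu]_x F x)%E) ->
  measurable_fun setT opp -> measurable_fun setT G -> measurable_fun setT K ->
  (forall x, 0 <= G x) -> (forall x, 0 <= K x) ->
  (forall x, G x + G (opp x) = 2 * K x) ->
  (\int[mu]_x (G x)%:E = \int[mu]_x (K x)%:E)%E.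
Proof.
move=> H mo mG mK G0 K0 GK.
have e : (2%:E * \int[mu]_x (G x)%:E = 2%:E * \int[mu]_x (K x)%:E)%E.
  rewrite -[in RHS]ge0_integralZl_EFin//; last 2 first.
  - by move=> x _; rewrite lee_fin.
  - exact/measurable_EFinP.
  under [in RHS]eq_integral do rewrite -EFinM -GK EFinD.
  rewrite [in RHS]ge0_integralD//; last 4 first.
  - by move=> x _; rewrite lee_fin.
  - exact/measurable_EFinP.
  - by move=> x _; rewrite lee_fin.
  - by apply/measurable_EFinP; exact: (measurableT_comp mG).
  rewrite (H (fun x => (G x)%:E))//; last exact/measurable_EFinP.
  by rewrite mule_natl mule2n.
have := congr1 (fun z => ((2^-1)%:E * z)%E) e.
by rewrite !muleA -!EFinM mulVf// !mul1e.
Qed.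

Section kernels.
Context {R : realType} {d : nat}.
Implicit Types x y : 'rV[R]_d.

Lemma measurable_dotv :
  measurable_fun setT (fun p : 'rV[R]_d * 'rV[R]_d => dotv p.1 p.2).
Proof.
apply: measurable_sum => i; apply: measurable_funM.
  exact: (measurableT_comp (measurable_rV_coord i) measurable_fst).
exact: (measurableT_comp (measurable_rV_coord i) measurable_snd).
Qed.

Definition kcosd (p : 'rV[R]_d * 'rV[R]_d) : R := cos (2 * pi * dotv p.1 p.2).
Definition ksind (p : 'rV[R]_d * 'rV[R]_d) : R := sin (2 * pi * dotv p.1 p.2).

Lemma measurable_kcosd : measurable_fun setT kcosd.
Proof. by apply: measurable_cos_comp; apply: measurable_funM => //; exact: measurable_dotv. Qed.

Lemma measurable_ksind : measurable_fun setT ksind.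
Proof. by apply: measurable_sin_comp; apply: measurable_funM => //; exact: measurable_dotv. Qed.

Lemma kcosd_le1 p : `|kcosd p| <= 1. Proof. exact: cos_max. Qed.
Lemma ksind_le1 p : `|ksind p| <= 1. Proof. exact: sin_max. Qed.

Lemma dotvC x y : dotv x y = dotv y x.
Proof. by apply: eq_bigr => i _; rewrite mulrC. Qed.

Lemma dotvDr x y z : dotv x (y + z) = dotv x y + dotv x z.
Proof. by rewrite -big_split; apply: eq_bigr => i _; rewrite mxE mulrDr. Qed.

Lemma dotvNr x y : dotv x (- y) = - dotv x y.
Proof. by rewrite /dotv -sumrN; apply: eq_bigr => i _; rewrite mxE mulrN. Qed.

Lemma dotvZr r x y : dotv x (r *: y) = r * dotv x y.
Proof. by rewrite /dotv mulr_sumr; apply: eq_bigr => i _; rewrite mxE mulrCA. Qed.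

Lemma dotvDl x y z : dotv (x + y) z = dotv x z + dotv y z.
Proof. by rewrite dotvC dotvDr !(dotvC z). Qed.

Lemma dotvNl x y : dotv (- x) y = - dotv x y.
Proof. by rewrite dotvC dotvNr dotvC. Qed.

Lemma dotvZl r x y : dotv (r *: x) y = r * dotv x y.
Proof. by rewrite dotvC dotvZr dotvC. Qed.

End kernels.

(** * Plancherel in dimension d *)

Section plancherel_d.
Context {R : realType}.
Local Notation mu := (@lebesgue_measure R).
Local Notation rT := (measurableTypeR R).

Lemma dotv_cons d (a b : R) (x y : 'rV[R]_d) :
  dotv (rV_cons (a, x)) (rV_cons (b, y)) = a * b + dotv x y.
Proof.
rewrite /dotv big_ord_recl !rV_cons0; congr (_ + _).
by apply: eq_bigr => i _; rewrite !rV_consS.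
Qed.

Lemma Rint_rV_cons d (f : 'rV[R]_d.+1 -> R) : intble (lebesgue_rV d.+1) f ->
  (forall x : R, intble (lebesgue_rV d) (fun y => f (rV_cons (x, y)))) ->
  \int[lebesgue_rV d.+1]_z f z = \int[mu]_x \int[lebesgue_rV d]_y f (rV_cons (x, y)).
Proof.
move=> fi fs; have mf := intble_measurable fi.
have mfr : measurable_fun setT (fun p : rT * 'rV[R]_d => f (rV_cons p)).
  exact: (measurableT_comp mf (@measurable_rVcons R d)).
have fp : (mu \x lebesgue_rV d)%E.-integrable setT (fun p : rT * 'rV[R]_d => (f (rV_cons p))%:E).
  apply/integrable12ltyP; first exact/measurable_EFinP.
  case/integrableP: fi => _; rewrite ge0_integral_rV_cons//.
  by apply/measurable_EFinP; exact: measurableT_comp.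
rewrite {1 2}/Rintegral; congr fine.
transitivity (\int[pushforward (mu \x lebesgue_rV d)%E (@rV_cons R d)]_z (f z)%:E)%E.
  by [].
rewrite (integral_pushforward (@measurable_rVcons R d))//; last exact/measurable_EFinP.
rewrite -(integral12_prod_meas1 fp); apply: eq_integral => x _.
by rewrite /fubini_F RintE.
Qed.

(** The support is confined to a cube rather than a ball, so that sections along the first
    coordinate satisfy the same condition with the same [r]. *)
Definition bddsupp d (M r : R) (f : 'rV[R]_d -> R) : Prop :=
  [/\ measurable_fun setT f, forall x, `|f x| <= M &
      forall (x : 'rV[R]_d) i, r < `|x ord0 i| -> f x = 0].

Lemma bddsupp_sect d M r (f : 'rV[R]_d.+1 -> R) (x : R) :
  bddsupp M r f -> bddsupp M r (fun y => f (rV_cons (x, y))).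
Proof.
move=> [mf fM fr]; split => //.
  exact: (measurable_sect2 (x : rT) (measurableT_comp mf (@measurable_rVcons R d))).
by move=> y i yi; apply: (fr _ (lift ord0 i)); rewrite rV_consS.
Qed.

Lemma bddsupp_norm1 d M r (f : 'rV[R]_d -> R) : bddsupp M r f ->
  (\int[lebesgue_rV d]_x (`|f x|)%:E <= (M * (2 * `|r|) ^+ d)%:E)%E.
Proof.
elim: d f => [|d IH] f fb; have [mf fM fr] := fb.
  rewrite integral_dirac//; last by apply/measurable_EFinP; exact: measurableT_comp.
  by rewrite diracT mul1e lee_fin expr0 mulr1.
have M0 : 0 <= M := le_trans (normr_ge0 _) (fM 0).
have mf' : measurable_fun setT (fun z : 'rV[R]_d.+1 => (`|f z|)%:E).
  by apply/measurable_EFinP; exact: measurableT_comp.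
rewrite ge0_integral_rV_cons//.
set K := M * (2 * `|r|) ^+ d.
have K0 : 0 <= K by rewrite mulr_ge0// exprn_ge0// mulr_ge0.
apply: (@le_trans _ _ (\int[mu]_x (K * \1_(`[- `|r|, `|r|]%classic) x)%:E)%E).
  apply: ge0_le_integral => //.
  - by move=> x _; exact: integral_ge0.
  - apply: (measurable_fun_fubini_tonelli_F (fun p : rT * 'rV[R]_d => (`|f (rV_cons p)|)%:E)) => //.
    exact: (measurableT_comp mf' (@measurable_rVcons R d)).
  - by apply/measurable_EFinP; exact: measurable_funM.
  move=> x _; rewrite indicE; case: (boolP (x \in _)) => [_|].
    by rewrite mulr1; apply: IH; exact: bddsupp_sect.
  rewrite notin_setE/= in_itv/= -ler_norml => /negP; rewrite -ltNge => xr.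
  rewrite mulr0 integral0_eq// => y _; rewrite (fr _ ord0) ?normr0//.
  by rewrite rV_cons0 (le_lt_trans (ler_norm _) xr).
have Ki := intbleZ K (intble_indic_itv `|r|).
rewrite -RintE// RintZ; last exact: intble_indic_itv.
rewrite lee_fin (_ : M * (2 * `|r|) ^+ d.+1 = K * (2 * `|r|)); last first.
  by rewrite /K exprSr; ring.
apply: ler_wpM2l => //.
rewrite /Rintegral integral_indic//= setIT lebesgue_measure_itv/=.
case: ifP => _ /=; last by rewrite mulr_ge0.
by rewrite opprK mulr_natl mulr2n.
Qed.

Lemma bddsupp_intble d M r (f : 'rV[R]_d -> R) : bddsupp M r f -> intble (lebesgue_rV d) f.
Proof.
move=> fb; have [mf _ _] := fb; apply: intbleP => //.
by rewrite (le_lt_trans (bddsupp_norm1 fb))// ltry.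
Qed.

Lemma bddsuppM d M r (f k : 'rV[R]_d -> R) : measurable_fun setT k ->
  (forall x, `|k x| <= 1) -> bddsupp M r f -> bddsupp M r (fun x => f x * k x).
Proof.
move=> mk k1 [mf fM fr]; split; first exact: measurable_funM.
  by move=> x; rewrite normrM (le_trans _ (fM x))// ler_piMr.
by move=> x i /fr ->; rewrite mul0r.
Qed.

Lemma bddsupp_itrans d M r (f : 'rV[R]_d.+1 -> R) (k : 'rV[R]_d * 'rV[R]_d -> R)
    (eta : 'rV[R]_d) (x : R) :
  measurable_fun setT k -> (forall p, `|k p| <= 1) -> bddsupp M r f ->
  `|itrans (lebesgue_rV d) k (fun y => f (rV_cons (x, y))) eta| <= M * (2 * `|r|) ^+ d.
Proof.
move=> mk k1 fb; have fx := bddsupp_sect x fb.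
apply: (le_trans (normr_itrans eta mk k1 (bddsupp_intble fx))).
by rewrite -lee_fin RintE; [exact: bddsupp_norm1|exact/intble_norm/bddsupp_intble/fx].
Qed.

Let Rint_rV0 (f : 'rV[R]_0 -> R) : measurable_fun setT f ->
  \int[lebesgue_rV 0]_x f x = f 0.
Proof.
move=> mf; rewrite /Rintegral integral_dirac//; last exact/measurable_EFinP.
by rewrite diracT mul1e.
Qed.

(** Induction on the dimension: transform the last [d] coordinates, then the first. The addition
    formulas mix the four iterated transforms, and reflecting the first frequency separates them
    again, since [Cc] and [Sc] are even in it, [Cs] and [Ss] odd. *)
Lemma plancherel_bddsupp d M r (f : 'rV[R]_d -> R) : bddsupp M r f ->
  itrans_sq (lebesgue_rV d) kcosd ksind f = (\int[lebesgue_rV d]_x (f x ^+ 2)%:E)%E.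
Proof.
elim: d f => [|d IH] f fb; have [mf fM fr] := fb.
  have E k (xi : 'rV[R]_0) : measurable_fun setT k ->
      itrans (lebesgue_rV 0) k f xi = f 0 * k (0, xi).
    move=> mk; rewrite /itrans Rint_rV0//; apply: measurable_funM => //.
    exact: measurable_sect1.
  apply: eq_integral => xi _; rewrite !E; [|exact: measurable_ksind|exact: measurable_kcosd].
  rewrite /kcosd /ksind /dotv !big_ord0 mulr0 cos0 sin0 mulr1 mulr0 expr0n addr0.
  by congr ((f _ ^+ 2)%:E); apply/rowP => -[].
pose mud := @lebesgue_rV R d.
pose F x y := f (rV_cons (x, y)).
have Fb x : bddsupp M r (F x) := bddsupp_sect x fb.
have Fi x := bddsupp_intble (Fb x).
pose c x eta := itrans mud kcosd (F x) eta.
pose s x eta := itrans mud ksind (F x) eta.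
pose K := M * (2 * `|r|) ^+ d.
have mFr : measurable_fun setT (fun p : rT * 'rV[R]_d => f (rV_cons p)).
  exact: (measurableT_comp mf (@measurable_rVcons R d)).
have mT (k : 'rV[R]_d * 'rV[R]_d -> R) : measurable_fun setT k ->
    measurable_fun setT (fun p : rT * 'rV[R]_d => itrans mud k (F p.1) p.2).
  move=> mk; apply: (@measurable_Rint_param _ _ _ _ _ mud
    (fun q : (rT * 'rV[R]_d) * 'rV[R]_d => f (rV_cons (q.1.1, q.2)) * k (q.2, q.1.2))).
  apply: measurable_funM.
    apply: (measurableT_comp mFr); apply: measurable_fun_pair => //.
    exact: (measurableT_comp measurable_fst measurable_fst).
  apply: (measurableT_comp mk); apply: measurable_fun_pair => //.
  exact: (measurableT_comp measurable_snd measurable_fst).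
have mc := mT _ measurable_kcosd; have ms := mT _ measurable_ksind.
have Tbd (k : 'rV[R]_d * 'rV[R]_d -> R) eta : measurable_fun setT k -> (forall p, `|k p| <= 1) ->
    [/\ measurable_fun [set: rT] (fun x => itrans mud k (F x) eta),
        forall x, `|itrans mud k (F x) eta| <= K &
        forall x, r < `|x| -> itrans mud k (F x) eta = 0].
  move=> mk k1; split.
  - exact: (measurable_sect1 eta (mT _ mk)).
  - by move=> x; exact: bddsupp_itrans.
  - move=> x rx; rewrite /itrans; under eq_Rintegral => y _.
      rewrite /F (fr _ ord0) ?rV_cons0// mul0r; over.
    by rewrite Rintegral_cst// mul0r.
have pc eta : itrans_sq mu (@kcos R) (@ksin R) (c ^~ eta) = (\int[mu]_x (c x eta ^+ 2)%:E)%E.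
  have [h1 h2 h3] := Tbd _ eta measurable_kcosd kcosd_le1.
  rewrite (plancherel1 h1 h2 h3) RintE//; apply: (@intble_bounded _ _ (K ^+ 2) r).
  - exact: measurable_funX.
  - move=> x; rewrite normrX lerXn2r ?nnegrE//; exact: le_trans (h2 x).
  - by move=> x /h3; rewrite /c => ->; rewrite expr0n.
have ps eta : itrans_sq mu (@kcos R) (@ksin R) (s ^~ eta) = (\int[mu]_x (s x eta ^+ 2)%:E)%E.
  have [h1 h2 h3] := Tbd _ eta measurable_ksind ksind_le1.
  rewrite (plancherel1 h1 h2 h3) RintE//; apply: (@intble_bounded _ _ (K ^+ 2) r).
  - exact: measurable_funX.
  - move=> x; rewrite normrX lerXn2r ?nnegrE//; exact: le_trans (h2 x).
  - by move=> x /h3; rewrite /s => ->; rewrite expr0n.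
pose G (p : rT * 'rV[R]_d) := itrans (lebesgue_rV d.+1) kcosd f (rV_cons p) ^+ 2 +
  itrans (lebesgue_rV d.+1) ksind f (rV_cons p) ^+ 2.
pose Cc xi eta := itrans mu (@kcos R) (c ^~ eta) xi.
pose Cs xi eta := itrans mu (@ksin R) (c ^~ eta) xi.
pose Sc xi eta := itrans mu (@kcos R) (s ^~ eta) xi.
pose Ss xi eta := itrans mu (@ksin R) (s ^~ eta) xi.
have fk_b (k : 'rV[R]_d.+1 * 'rV[R]_d.+1 -> R) : measurable_fun setT k -> (forall p, `|k p| <= 1) -> forall z,
    bddsupp M r (fun x => f x * k (x, z)).
  by move=> mk k1 z; apply: bddsuppM => //; exact: (measurable_sect1 z mk).
have Fk_i (k : 'rV[R]_d * 'rV[R]_d -> R) eta x : measurable_fun setT k -> (forall p, `|k p| <= 1) ->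
    intble mud (fun y => F x y * k (y, eta)).
  by move=> mk k1; exact: intble_kernel.
have Fki1 x eta := Fk_i _ eta x measurable_kcosd kcosd_le1.
have Fki2 x eta := Fk_i _ eta x measurable_ksind ksind_le1.
have ck_i (k : rT * rT -> R) xi eta : measurable_fun setT k -> (forall p, `|k p| <= 1) ->
    intble mu (fun x => c x eta * k (x, xi)) /\ intble mu (fun x => s x eta * k (x, xi)).
  move=> mk k1; split; apply: intble_kernel => //.
    have [h1 h2 h3] := Tbd _ eta measurable_kcosd kcosd_le1.
    exact: intble_bounded h1 h2 h3.
  have [h1 h2 h3] := Tbd _ eta measurable_ksind ksind_le1.
  exact: intble_bounded h1 h2 h3.
have EC xi eta : itrans (lebesgue_rV d.+1) kcosd f (rV_cons (xi, eta)) = Cc xi eta - Ss xi eta.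
  have b := fk_b _ measurable_kcosd kcosd_le1 (rV_cons (xi, eta)).
  rewrite /itrans Rint_rV_cons; first last.
  - by move=> x; exact: bddsupp_intble (bddsupp_sect x b).
  - exact: bddsupp_intble b.
  have [i1 _] := ck_i _ xi eta (@measurable_kcos R) (@kcos_le1 R).
  have [_ i2] := ck_i _ xi eta (@measurable_ksin R) (@ksin_le1 R).
  rewrite /Cc /Ss /itrans -RintB//; apply: eq_Rintegral => x _.
  rewrite [c x eta * _]mulrC [s x eta * _]mulrC /c /s /itrans -!RintZ//.
  rewrite -RintB; [|exact: intbleZ|exact: intbleZ].
  apply: eq_Rintegral => y _; rewrite /kcosd /ksind /kcos /ksin/= dotv_cons mulrDr cosD /F.
  ring.
have ES xi eta : itrans (lebesgue_rV d.+1) ksind f (rV_cons (xi, eta)) = Cs xi eta + Sc xi eta.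
  have b := fk_b _ measurable_ksind ksind_le1 (rV_cons (xi, eta)).
  rewrite /itrans Rint_rV_cons; first last.
  - by move=> x; exact: bddsupp_intble (bddsupp_sect x b).
  - exact: bddsupp_intble b.
  have [i1 _] := ck_i _ xi eta (@measurable_ksin R) (@ksin_le1 R).
  have [_ i2] := ck_i _ xi eta (@measurable_kcos R) (@kcos_le1 R).
  rewrite /Cs /Sc /itrans -RintD//; apply: eq_Rintegral => x _.
  rewrite [c x eta * _]mulrC [s x eta * _]mulrC /c /s /itrans -!RintZ//.
  rewrite -RintD; [|exact: intbleZ|exact: intbleZ].
  apply: eq_Rintegral => y _; rewrite /kcosd /ksind /kcos /ksin/= dotv_cons mulrDr sinD /F.
  ring.
have even (g : R -> R) xi : itrans mu (@kcos R) g (- xi) = itrans mu (@kcos R) g xi.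
  by apply: eq_Rintegral => x _; rewrite /kcos/= !mulrN cosN.
have odd (g : R -> R) xi : intble mu g ->
    itrans mu (@ksin R) g (- xi) = - itrans mu (@ksin R) g xi.
  move=> gi; rewrite /itrans -RintN.
    by apply: eq_Rintegral => x _; rewrite /ksin/= !mulrN sinN mulrN.
  by apply: intble_kernel => //; [exact: measurable_ksin|exact: ksin_le1].
have cI eta : intble mu (c ^~ eta).
  by have [h1 h2 h3] := Tbd _ eta measurable_kcosd kcosd_le1; exact: intble_bounded h1 h2 h3.
have sI eta : intble mu (s ^~ eta).
  by have [h1 h2 h3] := Tbd _ eta measurable_ksind ksind_le1; exact: intble_bounded h1 h2 h3.
have mGsq : measurable_fun setT (fun xi : 'rV[R]_d.+1 => (itrans (lebesgue_rV d.+1) kcosd f xi ^+ 2 +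
    itrans (lebesgue_rV d.+1) ksind f xi ^+ 2)%:E).
  by apply/measurable_EFinP; apply: measurable_funD; apply: measurable_funX;
    apply: measurable_itrans => //; [exact: measurable_kcosd|exact: measurable_ksind].
have mGE : measurable_fun setT (fun p => (G p)%:E).
  exact: (measurableT_comp mGsq (@measurable_rVcons R d)).
have mG : measurable_fun setT G by exact/measurable_EFinP.
have G0 p : 0 <= G p by rewrite addr_ge0// sqr_ge0.
have mf2 : measurable_fun setT (fun x => (f x ^+ 2)%:E).
  by apply/measurable_EFinP; exact: measurable_funX.
rewrite /itrans_sq (ge0_integral_rV_cons mGsq); last first.
  by move=> xi; rewrite lee_fin addr_ge0// sqr_ge0.
rewrite (ge0_integral_rV_cons mf2); last by move=> x; rewrite lee_fin sqr_ge0.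
(* Tonelli, so that the reflection can act on the first frequency with [eta] fixed. *)
transitivity (\int[mud]_eta \int[mu]_xi (G (xi, eta))%:E)%E.
  by have := fubini_tonelli (m1 := mu) (m2 := mud) _ mGE (fun p => G0 p).
have mCS k g xi : measurable_fun setT k -> measurable_fun [set: rT] g ->
    measurable_fun setT (fun xi => itrans mu k g xi ^+ 2).
  by move=> mk mg; apply: measurable_funX; exact: measurable_itrans.
have sym eta : (\int[mu]_xi (G (xi, eta))%:E =
    \int[mu]_x (c x eta ^+ 2 + s x eta ^+ 2)%:E)%E.
  have mce := intble_measurable (cI eta); have mse := intble_measurable (sI eta).
  have mkc := @measurable_kcos R; have mks := @measurable_ksin R.
  rewrite (@integral_symmetrize _ rT R mu (fun x => - x) (fun xi => G (xi, eta))
    (fun xi => (Cc xi eta ^+ 2 + Cs xi eta ^+ 2) + (Sc xi eta ^+ 2 + Ss xi eta ^+ 2))) //.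
  - under eq_integral do rewrite EFinD.
    under [in RHS]eq_integral do rewrite EFinD.
    rewrite !ge0_integralD//.
    + by rewrite -pc -ps.
    + by move=> x _; rewrite lee_fin sqr_ge0.
    + by apply/measurable_EFinP; exact: measurable_funX.
    + by move=> x _; rewrite lee_fin sqr_ge0.
    + by apply/measurable_EFinP; exact: measurable_funX.
    + by move=> x _; rewrite lee_fin addr_ge0// sqr_ge0.
    + by apply/measurable_EFinP; apply: measurable_funD; exact: mCS.
    + by move=> x _; rewrite lee_fin addr_ge0// sqr_ge0.
    + by apply/measurable_EFinP; apply: measurable_funD; exact: mCS.
  - move=> H mH H0; have := ge0_integral_affine 0 (_ : (-1 : R) != 0) mH H0.
    rewrite oppr_eq0 oner_neq0 normrN normr1 invr1 mul1e => /(_ isT) <-.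
    by apply: eq_integral => x _; rewrite mulN1r addr0.
  - rewrite (_ : (fun x => - x) = (fun x : rT => (-1 * x + 0) : rT)).
      exact: measurable_affine.
    by apply/funext => x; rewrite mulN1r addr0.
  - exact: (measurable_sect1 eta mG).
  - by apply: measurable_funD; apply: measurable_funD; exact: mCS.
  - by move=> xi; rewrite !addr_ge0// sqr_ge0.
  - move=> xi.
    have eCc : Cc (- xi) eta = Cc xi eta by exact: even.
    have eSc : Sc (- xi) eta = Sc xi eta by exact: even.
    have eCs : Cs (- xi) eta = - Cs xi eta by apply: odd.
    have eSs : Ss (- xi) eta = - Ss xi eta by apply: odd.
    rewrite /G !EC !ES eCc eSc eCs eSs.
    by move: (Cc _ _) (Sc _ _) (Cs _ _) (Ss _ _) => a1 a2 a3 a4; ring.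
under eq_integral do rewrite sym.
have mcs : measurable_fun setT (fun p : rT * 'rV[R]_d => (c p.1 p.2 ^+ 2 + s p.1 p.2 ^+ 2)%:E).
  by apply/measurable_EFinP; apply: measurable_funD; exact: measurable_funX.
have -> := esym (fubini_tonelli (m1 := mu) (m2 := mud) _ mcs
  (fun p => addr_ge0 (sqr_ge0 (c p.1 p.2)) (sqr_ge0 (s p.1 p.2)))).
by apply: eq_integral => x _; exact: (IH _ (Fb x)).
Qed.

End plancherel_d.

(** * The Hartley transform *)

Section enorm.
Context {R : realType} {d : nat}.
Implicit Types x y : 'rV[R]_d.

Lemma dotv_ge0 x : 0 <= dotv x x.
Proof. by apply: sumr_ge0 => i _; rewrite -expr2 sqr_ge0. Qed.

Lemma enorm_ge0 x : 0 <= enorm x. Proof. exact: sqrtr_ge0. Qed.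

Lemma sqr_enorm x : enorm x ^+ 2 = dotv x x.
Proof. by rewrite sqr_sqrtr// dotv_ge0. Qed.

Lemma enormN x : enorm (- x) = enorm x.
Proof. by rewrite /enorm dotvNl dotvNr opprK. Qed.

Lemma coord_le_enorm x i : `|x ord0 i| <= enorm x.
Proof.
rewrite -(@ler_pXn2r _ 2)// ?nnegrE ?enorm_ge0// sqr_enorm real_normK ?num_real//.
rewrite /dotv (bigD1 i)//= expr2 lerDl.
by apply: sumr_ge0 => j _; rewrite -expr2 sqr_ge0.
Qed.

Lemma measurable_enorm : measurable_fun [set: 'rV[R]_d] (@enorm R d).
Proof.
apply: measurableT_comp; first exact: (continuous_measurable_fun (@sqrt_continuous R)).
apply: measurable_sum => i.
by apply: measurable_funM; exact: measurable_rV_coord.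
Qed.

End enorm.

Section hartley.
Context {R : realType} {d : nat}.
Local Notation V := 'rV[R]_d.
Local Notation mu := (@lebesgue_rV R d).
Implicit Types (f g a : V -> R) (x xi : V).

Lemma measurable_enorm_le (r : R) : measurable_fun [set: V] (fun x => enorm x <= r).
Proof. by apply: measurable_fun_ler => //; exact: measurable_enorm. Qed.

Lemma measurable_enorm_lt (r : R) : measurable_fun [set: V] (fun x => enorm x < r).
Proof. by apply: measurable_fun_ltr => //; exact: measurable_enorm. Qed.

(** Truncation in value and in radius reduces to bounded functions of bounded support; at each [x]
    the truncated value is eventually [f x], so dominated convergence gives both the L^1 and the L^2
    limit. *)
Lemma plancherel f : intble mu f -> sqint mu f ->
  itrans_sq mu kcosd ksind f = (\int[mu]_x (f x ^+ 2))%:E.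
Proof.
move=> fi [mf f2i].
pose f_ (n : nat) x := if (`|f x| <= n%:R) && (enorm x <= n%:R) then f x else 0.
have mf_ n : measurable_fun setT (f_ n).
  apply: measurable_fun_ifT => //; apply: measurable_and; last exact: measurable_enorm_le.
  by apply: measurable_fun_ler => //; exact: measurableT_comp.
have f_f n x : `|f_ n x| <= `|f x| by rewrite /f_; case: ifP => // _; rewrite normr0.
have fi_ n : intble mu (f_ n) := intble_le (mf_ n) (intble_norm fi) (f_f n).
have fs_ n : sqint mu (f_ n) by exact: sqint_le (mf_ n) (conj mf f2i) (f_f n).
have fb_ n : bddsupp n%:R n%:R (f_ n).
  split => //.
    by move=> x; rewrite /f_; case: ifP => [/andP[]//|_]; rewrite normr0.
  move=> x i; rewrite ltNge /f_; case: ifP => // /andP[_ xn] /negP[].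
  exact: le_trans (coord_le_enorm x i) xn.
have near_eq x : \forall n \near \oo, f_ n x = f x.
  near=> n; rewrite /f_ ifT//; apply/andP; split; near: n; exact: nbhs_infty_ger.
have d_cvg : (fun n => \int[mu]_x `|f_ n x - f x|) @ \oo --> 0.
  rewrite (_ : 0 = \int[mu]_x (fun=> 0) x); last by rewrite Rintegral_cst// mul0r.
  apply: (@cvg_Rint_dominated _ V _ mu (fun n x => `|f_ n x - f x|) (fun=> 0)
    (fun x => 2 * `|f x|)) => //.
  - by move=> n; apply: measurableT_comp => //; exact: measurable_funB.
  - by apply: intbleZ; exact: intble_norm.
  - move=> n x; rewrite normr_id (le_trans (ler_normB _ _))//.
    by have := f_f n x; lra.
  - move=> x; apply: cvg_near_cst; have := near_eq x; apply: filterS => n ->.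
    by rewrite subrr normr0.
have d_cvg2 : (fun n => \int[mu]_x (f_ n x - f x) ^+ 2) @ \oo --> 0.
  rewrite (_ : 0 = \int[mu]_x (fun=> 0) x); last by rewrite Rintegral_cst// mul0r.
  apply: (@cvg_Rint_dominated _ V _ mu (fun n x => (f_ n x - f x) ^+ 2) (fun=> 0)
    (fun x => 4 * f x ^+ 2)) => //.
  - by move=> n; apply: measurable_funX; exact: measurable_funB.
  - exact: intbleZ.
  - move=> n x; rewrite /f_; case: ifP => _; rewrite ger0_norm ?sqr_ge0//.
      by rewrite subrr expr0n mulr_ge0// sqr_ge0.
    by rewrite sub0r sqrrN; have := sqr_ge0 (f x); lra.
  - move=> x; apply: cvg_near_cst; have := near_eq x; apply: filterS => n ->.
    by rewrite subrr expr0n.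
apply: (@plancherel_limit _ _ _ mu _ _ measurable_kcosd measurable_ksind
  kcosd_le1 ksind_le1 f_) => //.
- move=> n; rewrite (plancherel_bddsupp (fb_ n)) RintE//.
  by case: (fs_ n).
- move=> n p; have [_ fnp] := sqintB (fs_ n) (fs_ p).
  rewrite RintE// (@plancherel_bddsupp _ _ (n%:R + p%:R) (n%:R + p%:R))//.
  have [m1 n1 s1] := fb_ n; have [m2 n2 s2] := fb_ p; split.
  + exact: measurable_funB.
  + by move=> x; rewrite (le_trans (ler_normB _ _))// lerD.
  + move=> x i xi; rewrite (s1 _ i) ?(s2 _ i) ?subrr//.
      by rewrite (le_lt_trans _ xi)// lerDr.
    by rewrite (le_lt_trans _ xi)// lerDl.
Unshelve. all: by end_near. Qed.

Definition cas (t : R) : R := cos t + sin t.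

Definition hartley a x : R := \int[mu]_xi (a xi * cas (2 * pi * dotv x xi)).

Lemma cas_le2 t : `|cas t| <= 2.
Proof.
rewrite (le_trans (ler_normD _ _))//.
by have := cos_max t; have := sin_max t; lra.
Qed.

Lemma measurable_cas_comp {d0} {T : measurableType d0} (h : T -> R) :
  measurable_fun setT h -> measurable_fun setT (fun t => cas (h t)).
Proof.
by move=> mh; apply: measurable_funD; [exact: measurable_cos_comp|exact: measurable_sin_comp].
Qed.

Lemma measurable_cas_dotv :
  measurable_fun setT (fun p : V * V => cas (2 * pi * dotv p.1 p.2)).
Proof. by apply: measurable_cas_comp; apply: measurable_funM => //; exact: measurable_dotv. Qed.

Lemma intble_hartley a x : intble mu a ->
  intble mu (fun xi => a xi * cas (2 * pi * dotv x xi)).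
Proof.
move=> ai; apply: (intble_le _ (intbleZ 2 (intble_norm ai))).
  apply: measurable_funM; first exact: (intble_measurable ai).
  exact: (measurable_sect2 x measurable_cas_dotv).
by move=> xi; rewrite normrM mulrC ler_wpM2r// cas_le2.
Qed.

Lemma hartleyE a x : intble mu a ->
  hartley a x = itrans mu kcosd a x + itrans mu ksind a x.
Proof.
move=> ai; rewrite /itrans -RintD.
- by apply: eq_Rintegral => xi _; rewrite /cas /kcosd /ksind/= (dotvC xi) mulrDr.
- exact: intble_kernel measurable_kcosd kcosd_le1 ai.
- exact: intble_kernel measurable_ksind ksind_le1 ai.
Qed.

Lemma itransN_cos a x : itrans mu kcosd a (- x) = itrans mu kcosd a x.
Proof. by apply: eq_Rintegral => xi _; rewrite /kcosd/= dotvNr mulrN cosN. Qed.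

Lemma itransN_sin a x : intble mu a -> itrans mu ksind a (- x) = - itrans mu ksind a x.
Proof.
move=> ai; rewrite /itrans -RintN.
  by apply: eq_Rintegral => xi _; rewrite /ksind/= dotvNr mulrN sinN mulrN.
exact: intble_kernel measurable_ksind ksind_le1 ai.
Qed.

Lemma measurable_hartley_param {d0} {T : measurableType d0} (a : T * V -> R) (y : T -> V) :
  measurable_fun setT a -> measurable_fun setT y ->
  measurable_fun setT (fun t => hartley (fun xi => a (t, xi)) (y t)).
Proof.
move=> ma my; apply: (@measurable_Rint_param _ _ _ _ _ mu
  (fun p : T * V => a p * cas (2 * pi * dotv (y p.1) p.2))).
apply: measurable_funM => //.
apply: measurable_cas_comp; apply: measurable_funM => //; apply: measurable_sum => i.
apply: measurable_funM.
  exact: (measurableT_comp (measurable_rV_coord i) (measurableT_comp my measurable_fst)).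
exact: (measurableT_comp (measurable_rV_coord i) measurable_snd).
Qed.

Lemma measurable_hartley a : measurable_fun setT a -> measurable_fun setT (hartley a).
Proof.
move=> ma; apply: (@measurable_hartley_param _ V (fun p => a p.2) (fun x => x)) => //.
exact: measurableT_comp.
Qed.

Lemma hartleyB f g x : intble mu f -> intble mu g ->
  hartley (fun xi => f xi - g xi) x = hartley f x - hartley g x.
Proof.
move=> fi gi; rewrite /hartley -RintB; [|exact: intble_hartley..].
by apply: eq_Rintegral => xi _; rewrite mulrBl.
Qed.

Lemma hartleyD f g x : intble mu f -> intble mu g ->
  hartley (fun xi => f xi + g xi) x = hartley f x + hartley g x.
Proof.
move=> fi gi; rewrite /hartley -RintD; [|exact: intble_hartley..].
by apply: eq_Rintegral => xi _; rewrite mulrDl.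
Qed.

Lemma hartleyZ r f x : intble mu f ->
  hartley (fun xi => r * f xi) x = r * hartley f x.
Proof.
move=> fi; rewrite /hartley -RintZ; last exact: intble_hartley.
by apply: eq_Rintegral => xi _; rewrite mulrA.
Qed.

Lemma hartley_sum (I : Type) (s : seq I) (F : I -> V -> R) x :
  (forall i, intble mu (F i)) ->
  hartley (fun xi => \sum_(i <- s) F i xi) x = \sum_(i <- s) hartley (F i) x.
Proof.
move=> Fi; rewrite /hartley -Rint_sum; last by move=> i _; exact: intble_hartley.
by apply: eq_Rintegral => xi _; rewrite mulr_suml.
Qed.

(** The Hartley transform is the sum of an even and an odd function, and the even part of the square
    of such a sum is the sum of the squares. *)
Lemma plancherel_hartley f : intble mu f -> sqint mu f ->
  (\int[mu]_x (hartley f x ^+ 2)%:E = (\int[mu]_x (f x ^+ 2))%:E)%E.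
Proof.
move=> fi fs; have mf := intble_measurable fi; rewrite -plancherel//.
apply: (@integral_symmetrize _ V R mu (fun x => - x)).
- by move=> F mF F0; exact: ge0_integral_rV_opp.
- exact: measurable_rV_opp.
- by apply: measurable_funX; exact: measurable_hartley.
- by apply: measurable_funD; apply: measurable_funX; apply: measurable_itrans => //;
    [exact: measurable_kcosd|exact: measurable_ksind].
- by move=> x; exact: sqr_ge0.
- by move=> x; rewrite addr_ge0// sqr_ge0.
- move=> x; rewrite !hartleyE// itransN_cos itransN_sin//; ring.
Qed.

Lemma sqint_hartley f : intble mu f -> sqint mu f -> sqint mu (hartley f).
Proof.
move=> fi fs; have mh := measurable_hartley (intble_measurable fi).
split => //; apply: ge0_intbleP => //.
- exact: measurable_funX.
- by move=> x; exact: sqr_ge0.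
- by rewrite plancherel_hartley// ltry.
Qed.

Lemma Rint_hartley_sqr f : intble mu f -> sqint mu f ->
  \int[mu]_x (hartley f x ^+ 2) = \int[mu]_x (f x ^+ 2).
Proof. by move=> fi fs; rewrite [LHS]/Rintegral plancherel_hartley. Qed.

(** Fubini, the kernel being symmetric in its two variables. *)
Lemma hartley_dual f g : intble mu f -> intble mu g ->
  \int[mu]_x (hartley f x * g x) = \int[mu]_x (f x * hartley g x).
Proof.
move=> fi gi; have mf := intble_measurable fi; have mg := intble_measurable gi.
transitivity (\int[mu]_x \int[mu]_y (f y * g x * cas (2 * pi * dotv x y))).
  apply: eq_Rintegral => x _; rewrite mulrC -RintZ; last exact: intble_hartley.
  by apply: eq_Rintegral => y _; ring.
rewrite (@Fubini_dom _ _ V V R mu mu (fun p => f p.2 * g p.1 * cas (2 * pi * dotv p.1 p.2))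
  (fun x => 2 * `|g x|) (fun x => `|f x|))//=.
- apply: eq_Rintegral => x _; rewrite -RintZ; last exact: intble_hartley.
  by apply: eq_Rintegral => y _; rewrite dotvC; ring.
- apply: measurable_funM; last exact: measurable_cas_dotv.
  by apply: measurable_funM; exact: measurableT_comp.
- by apply: intbleZ; exact: intble_norm.
- exact: intble_norm.
- move=> x y; rewrite !normrM; have := cas_le2 (2 * pi * dotv x y).
  have := mulr_ge0 (normr_ge0 (f y)) (normr_ge0 (g x)).
  by move: `|cas _| `|f y| `|g x| => c u v; nra.
Qed.

End hartley.

(** * Fourier transforms and cutoffs *)

Lemma measurable_indicR {d} {T : measurableType d} {R : realType} (b : T -> bool) :
  measurable_fun setT b -> measurable_fun setT (fun x => (b x)%:R : R).
Proof.
move=> mb; rewrite (_ : (fun x => _) = (fun x => if b x then 1 else 0)).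
  exact: measurable_fun_ifT.
by apply/funext => x; case: (b x).
Qed.

Section cube.
Context {R : realType}.
Local Notation mu1 := (@lebesgue_measure R).

Lemma measurable_cube n (e : R) :
  measurable_fun [set: 'rV[R]_n] (fun x => [forall i, `|x ord0 i| < e]%:R : R).
Proof.
have -> : (fun x : 'rV[R]_n => [forall i, `|x ord0 i| < e]%:R : R) =
    (fun x => \prod_(i < n) ((`|x ord0 i| < e)%R%:R)).
  apply/funext => x; case: (boolP [forall i, _]) => [/forallP h|].
    by rewrite big1// => i _; rewrite h.
  by rewrite negb_forall => /existsP[i /negbTE hi]; rewrite (bigD1 i)//= hi mul0r.
apply: measurable_prod => i _.
apply: measurable_indicR; apply: measurable_fun_ltr => //.
by apply: measurableT_comp => //; exact: measurable_rV_coord.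
Qed.

Lemma integral_cube d (e : R) : 0 < e ->
  (\int[lebesgue_rV d]_x ([forall i, `|x ord0 i| < e]%:R)%:E = ((2 * e) ^+ d)%:E)%E.
Proof.
move=> e0; have mq n := @measurable_cube n e.
elim: d => [|d IH].
  rewrite integral_dirac//; last by apply/measurable_EFinP; exact: mq.
  rewrite diracT mul1e expr0 (_ : [forall i, _] = true)//.
  by apply/forallP => -[].
rewrite ge0_integral_rV_cons//; last by apply/measurable_EFinP; exact: mq.
have E x y : ([forall i, `|rV_cons (x, y) ord0 i| < e] : bool) =
    (`|x| < e) && [forall i : 'I_d, `|y ord0 i| < e].
  apply/forallP/andP => [h|[h1 /forallP h2] i].
    split; first by have := h ord0; rewrite rV_cons0.
    by apply/forallP => i; have := h (lift ord0 i); rewrite rV_consS.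
  by have [j ->|->] := unliftP ord0 i; rewrite ?rV_consS ?rV_cons0.
under eq_integral => x _.
  under eq_integral => y _ do rewrite E -mulnb natrM EFinM.
  rewrite ge0_integralZl_EFin//; [rewrite IH; over|].
  by apply/measurable_EFinP; exact: mq.
rewrite ge0_integralZr//=.
- rewrite (_ : (\int[mu1]_x _)%E = (\int[mu1]_x (\1_(`]- e, e[%classic) x)%:E)%E); last first.
    apply: eq_integral => x _; rewrite indicE; congr (_%:R%:E).
    by rewrite mem_setE/= in_itv/= ltr_norml.
  rewrite integral_indic//= setIT lebesgue_measure_itv/= lte_fin.
  by rewrite ifT ?gtrN// -EFinD -EFinM opprK exprS mulr_natl mulr2n.
- apply/measurable_EFinP.
  by apply: measurable_indicR; exact: measurable_fun_ltr.
- by rewrite lee_fin exprn_ge0// mulr_ge0// ltW.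
Qed.

End cube.

Section fourier_facts.
Context {R : realType} {d : nat}.
Local Notation V := 'rV[R]_d.
Local Notation mu := (@lebesgue_rV R d).
Implicit Types (f g a h k : V -> R) (x xi : V) (F G H : V -> R[i]).

Lemma inL2P f : inL2 f <-> sqint mu f.
Proof.
split=> [hf|[mf fi]].
  split; last exact: Lfun2_integrable_sqr.
  by move: hf; rewrite /inL2 inE => /andP[]; rewrite inE.
rewrite /inL2 inE; apply/andP; split; rewrite inE//=.
rewrite /finite_norm unlock poweR_lty//.
case/integrableP: fi => _; under eq_integral do rewrite /= ger0_norm ?sqr_ge0//.
apply: le_lt_trans; rewrite le_eqVlt; apply/orP; left; apply/eqP.
by apply: eq_integral => x _; rewrite /= powR_mulrn// real_normK// num_real.
Qed.

(** On the ball, |f| <= f^2 + 1. *)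
Lemma sqint_bounded_support f (r : R) : sqint mu f ->
  (forall x, r < enorm x -> f x = 0) -> intble mu f.
Proof.
move=> [mf fi] fr.
have bi : intble mu (fun x => (enorm x <= r)%R%:R).
  apply: (@bddsupp_intble _ _ 1 r); split.
  - by apply: measurable_indicR; exact: measurable_enorm_le.
  - by move=> x; rewrite ger0_norm ?ler0n// lern1 leq_b1.
  - move=> x i xi; apply/eqP; rewrite pnatr_eq0 eqb0 -ltNge.
    exact: lt_le_trans xi (coord_le_enorm x i).
apply: (intble_le mf (intbleD fi bi)) => x.
have [_|/fr ->] := leP (enorm x) r; last by rewrite normr0 expr0n addr0.
rewrite -(real_normK (num_real (f x))) (_ : true%:R = 1)//.
by have := sqr_ge0 (`|f x| - 1); rewrite !expr2; have := normr_ge0 (f x); nra.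
Qed.

(** Vanishing is required at every point outside the open ball and not just almost everywhere, so
    that the cutoff leaves such a spectrum literally unchanged. *)
Definition bandl (rho : R) a : Prop :=
  sqint mu a /\ forall xi, rho <= enorm xi -> a xi = 0.

Lemma bandl_intble rho a : bandl rho a -> intble mu a.
Proof.
by move=> [as_ a0]; apply: (sqint_bounded_support (r := rho) as_) => x /ltW /a0.
Qed.

Definition ballcut (N : R) k x : R := if enorm x < N then k x else 0.

Lemma measurable_ballcut N k : measurable_fun setT k -> measurable_fun setT (ballcut N k).
Proof. by move=> mk; apply: measurable_fun_ifT => //; exact: measurable_enorm_lt. Qed.

Lemma ballcut_le N k x : `|ballcut N k x| <= `|k x|.
Proof. by rewrite /ballcut; case: ifP => // _; rewrite normr0. Qed.

Lemma sqint_ballcut N k : sqint mu k -> sqint mu (ballcut N k).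
Proof.
move=> ks; apply: (sqint_le _ ks); last exact: ballcut_le.
by apply: measurable_ballcut; case: ks.
Qed.

Lemma intble_ballcut N k : sqint mu k -> intble mu (ballcut N k).
Proof.
move=> ks; apply: (@sqint_bounded_support _ N); first exact: sqint_ballcut.
by move=> x Nx; rewrite /ballcut ltNge ltW.
Qed.

Lemma bandl_ballcut rho k : sqint mu k -> bandl rho (ballcut rho k).
Proof.
move=> ks; split; first exact: sqint_ballcut.
by move=> xi; rewrite /ballcut ltNge => ->.
Qed.

Lemma cvg_ballcut_sqr k : sqint mu k ->
  \int[mu]_x (ballcut N%:R k x ^+ 2) @[N --> \oo] --> \int[mu]_x (k x ^+ 2).
Proof.
move=> [mk ki].
apply: (@cvg_Rint_dominated _ V _ mu (fun N x => ballcut N%:R k x ^+ 2)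
  (fun x => k x ^+ 2) (fun x => k x ^+ 2)) => //.
- by move=> N; apply: measurable_funX; exact: measurable_ballcut.
- exact: measurable_funX.
- move=> N x; rewrite normrX -(real_normK (num_real (k x))).
  by rewrite lerXn2r ?nnegrE// ballcut_le.
- move=> x; apply: cvg_near_cst; near=> N; rewrite /ballcut ifT//.
  near: N; exact: nbhs_infty_gtr.
Unshelve. all: by end_near. Qed.

(** With [kN] the truncation of [hartley a], duality gives <hartley kN, a> = <kN, hartley a> =
    |kN|^2. The squared error is therefore |a|^2 - |kN|^2, which tends to 0 by Plancherel. *)
Lemma hartley_inversion a rho : bandl rho a ->
  \int[mu]_xi ((hartley (ballcut N%:R (hartley a)) xi - a xi) ^+ 2) @[N --> \oo] --> 0.
Proof.
move=> ab; have ai := bandl_intble ab; have [as_ _] := ab.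
have ks := sqint_hartley ai as_.
have E (N : nat) : \int[mu]_xi ((hartley (ballcut N%:R (hartley a)) xi - a xi) ^+ 2) =
    \int[mu]_xi (a xi ^+ 2) - \int[mu]_x (ballcut N%:R (hartley a) x ^+ 2).
  set kN := ballcut _ _.
  have kNi : intble mu kN := intble_ballcut _ ks.
  have kNs : sqint mu kN := sqint_ballcut _ ks.
  have hs := sqint_hartley kNi kNs.
  have hai := sqint_mul hs as_.
  transitivity (\int[mu]_xi ((hartley kN xi ^+ 2 - 2 * (hartley kN xi * a xi)) + a xi ^+ 2)).
    by apply: eq_Rintegral => xi _; ring.
  have [_ h2] := hs; have [_ a2] := as_.
  rewrite RintD//; last by apply: intbleB => //; exact: intbleZ.
  rewrite RintB//; last exact: intbleZ.
  rewrite RintZ// hartley_dual// Rint_hartley_sqr//.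
  rewrite (_ : \int[mu]_x (kN x * hartley a x) = \int[mu]_x (kN x ^+ 2)); first by ring.
  apply: eq_Rintegral => x _; rewrite /kN /ballcut; case: ifP => // _.
  by rewrite mul0r expr0n.
under eq_fun do rewrite E.
rewrite -(subrr (\int[mu]_xi (a xi ^+ 2))); apply: cvgB; first exact: cvg_cst.
by rewrite -(Rint_hartley_sqr ai as_); exact: cvg_ballcut_sqr.
Qed.

Lemma fourier_truncE (N : nat) h xi : fourier_trunc N h xi =
  Complex (itrans mu kcosd (ballcut N%:R h) xi) (- itrans mu ksind (ballcut N%:R h) xi).
Proof.
rewrite /fourier_trunc; congr Complex; [|congr (- _)];
  rewrite Rintegral_mkcond; apply: eq_Rintegral => x _;
  rewrite patchE /ballcut/=; case: ifPn; rewrite ?inE/= => h1;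
  rewrite ?h1// (_ : (enorm x < N%:R) = false) ?mul0r//; apply/negP.
  by move: h1 => /negP; rewrite inE.
by move: h1 => /negP; rewrite inE.
Qed.

(* [fhart a] is the Fourier transform of [hartley a]. *)
Definition evenp a xi : R := (a xi + a (- xi)) / 2.
Definition oddp a xi : R := (a xi - a (- xi)) / 2.
Definition fhart a xi : R[i] := Complex (evenp a xi) (- oddp a xi).

Lemma sqint_opp a : sqint mu a -> sqint mu (fun xi => a (- xi)).
Proof.
move=> [ma ai]; split; first exact: (measurableT_comp ma (@measurable_rV_opp R d)).
exact: (intble_rV_opp ai).
Qed.

Lemma sqint_evenp a : sqint mu a -> sqint mu (evenp a).
Proof.
move=> as_; have := sqintZ 2^-1 (sqintD as_ (sqint_opp as_)).
by under eq_fun do rewrite mulrC.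
Qed.

Lemma sqint_oddp a : sqint mu a -> sqint mu (oddp a).
Proof.
move=> as_; have := sqintZ 2^-1 (sqintB as_ (sqint_opp as_)).
by under eq_fun do rewrite mulrC.
Qed.

(** Splitting [a] into its even and odd parts, the cross term is odd and integrates to 0 against an
    even weight. Weight 1 serves the inversion formula, the Sobolev weight serves the norm. *)
Lemma integral_hartley_fourier (w : V -> R) f g a : measurable_fun setT w ->
  (forall xi, 0 <= w xi) -> (forall xi, w (- xi) = w xi) ->
  measurable_fun setT f -> measurable_fun setT g -> measurable_fun setT a ->
  (forall xi, f (- xi) = f xi) -> (forall xi, g (- xi) = - g xi) ->
  (\int[mu]_xi (w xi * sqnormc (Complex (f xi) (- g xi) - fhart a xi))%:E =
   \int[mu]_xi (w xi * (f xi + g xi - a xi) ^+ 2)%:E)%E.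
Proof.
move=> mw w0 wN mf mg ma fN gN; apply/esym.
have mo := @measurable_rV_opp R d.
have maN : measurable_fun setT (fun xi => a (- xi)) := measurableT_comp ma mo.
apply: (@integral_symmetrize _ V R mu (fun x => - x)) => //.
- by move=> F mF F0; exact: ge0_integral_rV_opp.
- apply: measurable_funM => //; apply: measurable_funX; apply: measurable_funB => //.
  exact: measurable_funD.
- apply: measurable_funM => //; rewrite /sqnormc/=; apply: measurable_funD;
    apply: measurable_funX; apply: measurable_funD => //=; apply: measurableT_comp => //.
  + by apply: measurable_funM => //; exact: measurable_funD.
  + apply: measurableT_comp => //; apply: measurable_funM => //; exact: measurable_funB.
- by move=> xi; rewrite mulr_ge0// sqr_ge0.
- by move=> xi; rewrite mulr_ge0// addr_ge0// sqr_ge0.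
- move=> xi; by rewrite wN fN gN /sqnormc/= /evenp /oddp; field.
Qed.

(** The truncated Fourier integrals of [hartley a] are made of the even and odd parts of its
    truncated Hartley transform, so Hartley inversion provides the L^2 limit. *)
Lemma is_fourier_hartley rho a : bandl rho a -> is_fourier (hartley a) (fhart a).
Proof.
move=> ab; have ai := bandl_intble ab; have [as_ _] := ab.
have ks := sqint_hartley ai as_; have ma := intble_measurable ai.
split; first exact/inL2P.
  split; apply/inL2P => /=; first exact: sqint_evenp.
  by apply: sqintN; exact: sqint_oddp.
rewrite (_ : (fun N => _) = (fun N =>
    (\int[mu]_xi ((hartley (ballcut N%:R (hartley a)) xi - a xi) ^+ 2))%:E)).
  by apply: cvg_EFin; [exact: nearW|exact: hartley_inversion ab].
apply/funext => N; set kN := ballcut _ _.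
have kNi : intble mu kN := intble_ballcut _ ks.
have kNs : sqint mu kN := sqint_ballcut _ ks.
have hs := sqint_hartley kNi kNs.
have [_ dsi] := sqintB hs as_.
have mk := intble_measurable kNi.
rewrite RintE//.
transitivity (\int[mu]_xi (1 * sqnormc (Complex (itrans mu kcosd kN xi)
    (- itrans mu ksind kN xi) - fhart a xi))%:E)%E.
  by apply: eq_integral => xi _; rewrite mul1r fourier_truncE.
rewrite (@integral_hartley_fourier (fun=> 1) (itrans mu kcosd kN) (itrans mu ksind kN) a) //.
- by apply: eq_integral => xi _; rewrite mul1r -hartleyE.
- exact: measurable_itrans measurable_kcosd mk.
- exact: measurable_itrans measurable_ksind mk.
- by move=> xi; exact: itransN_cos.
- by move=> xi; exact: itransN_sin.
Qed.

End fourier_facts.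

Section cas_lipschitz.
Context {R : realType}.
Implicit Types s t : R.

Lemma is_derive_cas (t : R) : is_derive t 1 (@cas R) (cas (- t)).
Proof. by rewrite /cas; apply: is_derive_eq; rewrite cosN sinN addrC. Qed.

Lemma lipschitz_MVT (f df : R -> R) M : (forall x : R, is_derive x 1 f (df x)) ->
  (forall x, `|df x| <= M) -> forall s t, `|f s - f t| <= M * `|s - t|.
Proof.
move=> fdf dfM.
have H s t : t <= s -> `|f s - f t| <= M * `|s - t|.
  move=> ts; have [c _ ->] : exists2 c, c \in `[t, s]%R & f s - f t = df c * (s - t).
    apply: MVT_segment => //; apply: continuous_subspaceT => x.
    by apply: derivable1_continuous; case: (fdf x).
  by rewrite normrM ler_wpM2r.
move=> s t; have [ts|/ltW st] := leP t s; first exact: H.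
by rewrite distrC (distrC s); exact: H.
Qed.

Lemma cas_lipschitz s t : `|cas s - cas t| <= 2 * `|s - t|.
Proof. by apply: (lipschitz_MVT is_derive_cas) => x; exact: cas_le2. Qed.

(** Subtracting the linear term leaves a function whose derivative is 2-Lipschitz and vanishes at 0,
    so the mean value theorem already yields a quadratic bound. *)
Lemma cas_taylor t h : `|cas (t + h) - cas t - h * cas (- t)| <= 2 * h ^+ 2.
Proof.
pose f u := cas (t + u) - u * cas (- t).
have df (u : R) : is_derive u 1 f (cas (- (t + u)) - cas (- t)).
  rewrite /f /cas; apply: is_derive_eq; rewrite /GRing.scale/= !cosN !sinN; ring.
have [h0|h0] := leP 0 h.
  have [c /andP[c0 ch] E] : exists2 c, 0 <= c <= h & f h - f 0 =
      (cas (- (t + c)) - cas (- t)) * (h - 0).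
    have [|c cin E] := @MVT_segment _ f (fun u => cas (- (t + u)) - cas (- t)) 0 h h0 (fun u _ => df u).
      by apply: continuous_subspaceT => x; apply: derivable1_continuous; case: (df x).
    by exists c => //; move: cin; rewrite in_itv.
  have -> : cas (t + h) - cas t - h * cas (- t) = f h - f 0.
    by rewrite /f addr0 mul0r subr0; ring.
  rewrite E subr0 normrM (ger0_norm h0).
  have := cas_lipschitz (- (t + c)) (- t).
  rewrite (_ : - (t + c) - - t = - c); last by ring.
  rewrite normrN (ger0_norm c0) => k.
  by rewrite expr2 mulrA ler_wpM2r// (le_trans k)// ler_wpM2l.
have [c /andP[c0 ch] E] : exists2 c, h <= c <= 0 & f 0 - f h =
    (cas (- (t + c)) - cas (- t)) * (0 - h).
  have [|c cin E] := @MVT_segment _ f (fun u => cas (- (t + u)) - cas (- t)) h 0 (ltW h0) (fun u _ => df u).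
    by apply: continuous_subspaceT => x; apply: derivable1_continuous; case: (df x).
  by exists c => //; move: cin; rewrite in_itv.
have -> : cas (t + h) - cas t - h * cas (- t) = - (f 0 - f h).
  by rewrite /f addr0 mul0r subr0; ring.
rewrite normrN E sub0r normrM normrN (ltr0_norm h0).
have := cas_lipschitz (- (t + c)) (- t).
rewrite (_ : - (t + c) - - t = - c); last by ring.
rewrite normrN (ler0_norm ch) => k.
by move: k; rewrite expr2; move: `|_| => u k; nra.
Qed.

End cas_lipschitz.

(** * Uniqueness of the transform, the cutoff operator and Sobolev norms *)

Section fourier_unique.
Context {R : realType} {d : nat}.
Local Notation V := 'rV[R]_d.
Local Notation mu := (@lebesgue_rV R d).
Implicit Types (f g a h k : V -> R) (x xi : V) (F G H : V -> R[i]).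

Definition cmeasurable F : Prop :=
  measurable_fun setT (fun xi => complex.Re (F xi)) /\
  measurable_fun setT (fun xi => complex.Im (F xi)).

Lemma inL2c_cmeasurable F : inL2c F -> cmeasurable F.
Proof. by move=> [/inL2P[m1 _] /inL2P[m2 _]]. Qed.

Lemma sqnormc_ge0 (z : R[i]) : 0 <= sqnormc z.
Proof. by rewrite addr_ge0// sqr_ge0. Qed.

Lemma ReB (z w : R[i]) : complex.Re (z - w) = complex.Re z - complex.Re w.
Proof. by case: z w => [? ?] [? ?]. Qed.

Lemma ImB (z w : R[i]) : complex.Im (z - w) = complex.Im z - complex.Im w.
Proof. by case: z w => [? ?] [? ?]. Qed.

Lemma sqnormcB_le (z w u : R[i]) :
  sqnormc (z - w) <= 2 * sqnormc (u - z) + 2 * sqnormc (u - w).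
Proof.
rewrite /sqnormc !ReB !ImB.
have H (p q r : R) : (p - q) ^+ 2 <= 2 * (r - p) ^+ 2 + 2 * (r - q) ^+ 2.
  by have := sqr_ge0 ((r - p) + (r - q)); rewrite !expr2; nra.
have := H (complex.Re z) (complex.Re w) (complex.Re u).
have := H (complex.Im z) (complex.Im w) (complex.Im u); lra.
Qed.

Lemma measurable_sqnormcB F G : cmeasurable F -> cmeasurable G ->
  measurable_fun setT (fun xi => sqnormc (F xi - G xi)).
Proof.
move=> [F1 F2] [G1 G2]; rewrite /sqnormc.
under eq_fun do rewrite ReB ImB.
by apply: measurable_funD; apply: measurable_funX; exact: measurable_funB.
Qed.

Definition fdist F G : \bar R := (\int[mu]_xi (sqnormc (F xi - G xi))%:E)%E.

Lemma fdist_ge0 F G : (0 <= fdist F G)%E.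
Proof. by apply: integral_ge0 => xi _; rewrite lee_fin sqnormc_ge0. Qed.

(** A triangle inequality with factors 2 is enough, since it is applied only to distances that tend
    to 0, and it stays with squared norms. *)
Lemma fdist_le F G H : cmeasurable F -> cmeasurable G -> cmeasurable H ->
  (fdist F G <= 2%:E * fdist H F + 2%:E * fdist H G)%E.
Proof.
move=> mF mG mH; rewrite /fdist -!ge0_integralZl_EFin//.
- rewrite -ge0_integralD//.
  + apply: ge0_le_integral => //.
    * by move=> xi _; rewrite lee_fin sqnormc_ge0.
    * by apply/measurable_EFinP; exact: measurable_sqnormcB.
    * by apply: emeasurable_funD; apply: measurable_funeM; apply/measurable_EFinP;
        exact: measurable_sqnormcB.
    * by move=> xi _; rewrite -!EFinM -EFinD lee_fin sqnormcB_le.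
  + by move=> xi _; rewrite -EFinM lee_fin mulr_ge0// sqnormc_ge0.
  + by apply: measurable_funeM; apply/measurable_EFinP; exact: measurable_sqnormcB.
  + by move=> xi _; rewrite -EFinM lee_fin mulr_ge0// sqnormc_ge0.
  + by apply: measurable_funeM; apply/measurable_EFinP; exact: measurable_sqnormcB.
- by move=> xi _; rewrite lee_fin sqnormc_ge0.
- by apply/measurable_EFinP; exact: measurable_sqnormcB.
- by move=> xi _; rewrite lee_fin sqnormc_ge0.
- by apply/measurable_EFinP; exact: measurable_sqnormcB.
Qed.

Lemma cmeasurable_trunc (N : nat) h : measurable_fun setT h ->
  cmeasurable (fourier_trunc N h).
Proof.
move=> mh; have mb : measurable_fun setT (ballcut N%:R h) by exact: measurable_ballcut.
split; under eq_fun do rewrite fourier_truncE/=.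
  exact: measurable_itrans measurable_kcosd mb.
by apply: measurableT_comp => //; exact: measurable_itrans measurable_ksind mb.
Qed.

Lemma cvge_two (u v : nat -> \bar R) : u @ \oo --> 0%E -> v @ \oo --> 0%E ->
  (2%:E * u n + 2%:E * v n)%E @[n --> \oo] --> 0%E.
Proof.
have h (w : nat -> \bar R) : w @ \oo --> 0%E -> (2%:E * w n)%E @[n --> \oo] --> 0%E.
  by move=> w0; rewrite -[X in _ --> X](mule0 2%:E); exact: cvgeZl.
move=> u0 v0; have := cvgeD _ (h _ u0) (h _ v0); rewrite adde0; exact.
Qed.

Lemma fourier_unique h F G : is_fourier h F -> is_fourier h G -> fdist F G = 0%E.
Proof.
move=> [/inL2P[mh _] /inL2c_cmeasurable mF cF] [_ /inL2c_cmeasurable mG cG].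
apply/eqP; rewrite eq_le fdist_ge0 andbT.
apply: cvge_ge (cvge_two cF cG).
by apply: nearW => N; apply: fdist_le => //; exact: cmeasurable_trunc.
Qed.

Lemma fdist0_ae F G : cmeasurable F -> cmeasurable G -> fdist F G = 0%E ->
  {ae mu, forall xi, F xi = G xi}.
Proof.
move=> mF mG FG0.
have mFG := measurable_sqnormcB mF mG.
have [] := ae_eq_integral_abs mu measurableT
  ((measurable_EFinP _ (fun xi => sqnormc (F xi - G xi))).2 mFG).
rewrite (_ : (\int[mu]_x _)%E = fdist F G); last first.
  by apply: eq_integral => xi _; rewrite /= ger0_norm// sqnormc_ge0.
move=> /(_ FG0) + _; apply: filterS => xi /(_ I)/= [].
rewrite /sqnormc => /eqP; rewrite paddr_eq0 ?sqr_ge0// !sqrf_eq0 ReB ImB !subr_eq0.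
by case: (F xi) (G xi) => [? ?] [? ?] /= /andP[/eqP -> /eqP ->].
Qed.

Lemma is_fourier_ae h F G : is_fourier h F -> inL2c G ->
  {ae mu, forall xi, F xi = G xi} -> is_fourier h G.
Proof.
move=> [hh hF cF] hG FG; split => //.
rewrite (_ : (fun N => _) = (fun N : nat => fdist (fourier_trunc N h) F))//.
apply/funext => N.
have [mh _] := (inL2P h).1 hh.
have mT := cmeasurable_trunc N mh.
apply: ge0_ae_eq_integral => //.
- by apply/measurable_EFinP; apply: measurable_sqnormcB => //; exact: inL2c_cmeasurable.
- by apply/measurable_EFinP; apply: measurable_sqnormcB => //; exact: inL2c_cmeasurable.
- by move=> xi _; rewrite lee_fin sqnormc_ge0.
- by move=> xi _; rewrite lee_fin sqnormc_ge0.
- by move: FG; apply: filterS => xi -> _.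
Qed.

Lemma fourier_truncB (N : nat) h k xi : sqint mu h -> sqint mu k ->
  fourier_trunc N (fun x => h x - k x) xi = fourier_trunc N h xi - fourier_trunc N k xi.
Proof.
move=> hs ks; rewrite !fourier_truncE.
have E : ballcut N%:R (fun x => h x - k x) =
    (fun x => ballcut N%:R h x - ballcut N%:R k x).
  by apply/funext => x; rewrite /ballcut; case: ifP => // _; rewrite subrr.
rewrite E (itransB _ measurable_kcosd kcosd_le1)//; [|exact: intble_ballcut..].
rewrite (itransB _ measurable_ksind ksind_le1)//; [|exact: intble_ballcut..].
by rewrite opprB [RHS]/GRing.add/=; congr Complex; rewrite opprK addrC.
Qed.

Lemma is_fourierB h k F G : is_fourier h F -> is_fourier k G ->
  is_fourier (fun x => h x - k x) (fun xi => F xi - G xi).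
Proof.
move=> [/inL2P hs hF cF] [/inL2P ks hG cG].
have [mF mG] := (inL2c_cmeasurable hF, inL2c_cmeasurable hG).
split.
- by apply/inL2P; exact: sqintB.
- move: hF hG => [/inL2P f1 /inL2P f2] [/inL2P g1 /inL2P g2]; split; apply/inL2P.
    by under eq_fun do rewrite ReB; exact: sqintB.
  by under eq_fun do rewrite ImB; exact: sqintB.
have [mh _] := hs; have [mk _] := ks.
have c2 := cvge_two cF cG.
apply: (squeeze_cvge _ (cvg_cst 0%E) c2); apply: nearW => N.
rewrite fdist_ge0/=.
have E xi : sqnormc (fourier_trunc N (fun x => h x - k x) xi - (F xi - G xi)) =
    sqnormc ((fourier_trunc N h xi - F xi) - (fourier_trunc N k xi - G xi)).
  by rewrite fourier_truncB//; congr sqnormc; rewrite !opprD !opprK addrACA.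
under eq_integral do rewrite E.
have := @fdist_le (fun xi => fourier_trunc N h xi - F xi)
  (fun xi => fourier_trunc N k xi - G xi) (fun=> 0).
have cB A B : cmeasurable A -> cmeasurable B -> cmeasurable (fun xi => A xi - B xi).
  move=> [a1 a2] [b1 b2]; split.
    by under eq_fun do rewrite ReB; exact: measurable_funB.
  by under eq_fun do rewrite ImB; exact: measurable_funB.
have mTh := cmeasurable_trunc N mh; have mTk := cmeasurable_trunc N mk.
have c0 : cmeasurable (fun=> 0) by split.
move=> /(_ (cB _ _ mTh mF) (cB _ _ mTk mG) c0).
rewrite /fdist.
have N0 (z : R[i]) : sqnormc (0 - z) = sqnormc z.
  by rewrite /sqnormc ReB ImB !sub0r !sqrrN.
by under [X in (_ <= 2%:E * X + _)%E]eq_integral do rewrite N0;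
  under [X in (_ <= _ + 2%:E * X)%E]eq_integral do rewrite N0.
Qed.

(** By Plancherel the norms of the truncations tend to 0, while they are nondecreasing in the
    radius. *)
Lemma is_fourier0_sqr k : sqint mu k -> is_fourier k (fun=> 0) ->
  forall N : nat, \int[mu]_x (ballcut N%:R k x ^+ 2) = 0.
Proof.
move=> ks [_ _ c0] N.
have E (n : nat) : fdist (fourier_trunc n k) (fun=> 0) =
    (\int[mu]_x (ballcut n%:R k x ^+ 2))%:E.
  rewrite -(plancherel (intble_ballcut _ ks) (sqint_ballcut _ ks)).
  by apply: eq_integral => xi _; rewrite subr0 fourier_truncE /sqnormc/= sqrrN.
apply/eqP; rewrite eq_le; apply/andP; split; last first.
  by apply: Rint_ge0 => x; exact: sqr_ge0.
rewrite -lee_fin; apply: (cvge_ge _ c0).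
near=> n; rewrite -/(fdist _ _) E lee_fin.
have [_ i1] := sqint_ballcut N%:R ks; have [_ i2] := sqint_ballcut n%:R ks.
apply: le_Rint => // x; rewrite /ballcut.
case: ifP => [xN|_]; last by rewrite expr0n sqr_ge0.
rewrite ifT// (lt_le_trans xN)// ler_nat; near: n; exact: nbhs_infty_ge.
Unshelve. all: by end_near. Qed.

Lemma sup_le_enorm x : forall r : R, (forall i, `|x ord0 i| < r) -> 
  enorm x <= Num.sqrt (d%:R * r ^+ 2).
Proof.
move=> r xr; rewrite /enorm ler_wsqrtr// /dotv.
apply: (@le_trans _ _ (\sum_(i < d) r ^+ 2)); last first.
  by rewrite sumr_const card_ord mulr_natl.
apply: ler_sum => i _; rewrite -expr2 -(real_normK (num_real (x _ _))).
by rewrite ler_pXn2r ?nnegrE//; [exact: ltW|exact: le_trans (ltW (xr i))].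
Qed.

(** If [k x0] were nonzero, [k ^+ 2] would exceed a positive constant on a cube of positive volume
    around [x0], and this cube lies in a ball of integer radius. *)
Lemma continuous_sqr_int0 k : continuous k -> sqint mu k ->
  (forall N : nat, \int[mu]_x (ballcut N%:R k x ^+ 2) = 0) -> k = fun=> 0.
Proof.
move=> ck ks k0; apply/funext => x0; apply/eqP; apply: contraT => kx0.
have c0 : 0 < `|k x0| / 2 by rewrite divr_gt0// normr_gt0.
have /cvgrPdist_lt /(_ _ c0) := ck x0.
move=> /nbhs_ballP[e /= e0 ke].
have kc x : (forall i, `|x ord0 i - x0 ord0 i| < e) -> (`|k x0| / 2) ^+ 2 <= k x ^+ 2.
  move=> xx0; have /ke : ball x0 e x.
    by split => // i j; rewrite (ord1 i) /ball/= distrC.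
  move=> h; rewrite -(real_normK (num_real (k x))) ler_pXn2r ?nnegrE//.
  have := ler_normB (k x0) (k x0 - k x); rewrite subKr => h2.
  have := lerB_dist (k x0) (k x).
  by lra.
pose q x : R := [forall i, `|x ord0 i| < e]%:R.
have [N xN] : exists N : nat, forall x, (forall i, `|x ord0 i - x0 ord0 i| < e) -> enorm x < N%:R.
  pose r := \sum_(i < d) `|x0 ord0 i| + e.
  exists (Num.truncn (Num.sqrt (d%:R * r ^+ 2))).+1 => x xx.
  apply: (@le_lt_trans _ _ (Num.sqrt (d%:R * r ^+ 2))); last exact: truncnS_gt.
  apply: sup_le_enorm => i.
  rewrite -[x ord0 i](subrK (x0 ord0 i)) (le_lt_trans (ler_normD _ _))//.
  rewrite /r addrC ler_ltD//.
  by rewrite (bigD1 i)//= lerDl sumr_ge0.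
have mk : measurable_fun setT k by case: ks.
have [_ iN] := sqint_ballcut N%:R ks.
have I0 := congr1 EFin (k0 N); rewrite RintE// in I0.
have mq := @measurable_cube R d e.
have mqE : measurable_fun setT (fun x : V => ([forall i, `|x ord0 i| < e]%:R : R)%:E).
  exact/measurable_EFinP.
have := integral_cube d e0.
rewrite -(ge0_integral_rV_shift (- x0) mqE); last by move=> x; rewrite lee_fin ler0n.
move=> Iq.
have mqs := measurableT_comp mqE (measurable_rV_addr (- x0)).
have : (((`|k x0| / 2) ^+ 2 * (2 * e) ^+ d)%:E <= 0%:E)%E.
  rewrite -I0 EFinM -Iq -ge0_integralZl_EFin ?sqr_ge0//.
  apply: ge0_le_integral => //.
  + by apply: measurable_funeM.
  + by apply/measurable_EFinP; apply: measurable_funX; exact: measurable_ballcut.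
  + move=> x _; rewrite -EFinM lee_fin.
    case: (boolP [forall i, _]) => [/forallP h|_]; last by rewrite mulr0 sqr_ge0.
    have h' i : `|x ord0 i - x0 ord0 i| < e by have := h i; rewrite !mxE.
    by rewrite mulr1 /ballcut ifT ?kc//; exact: xN.
rewrite lee_fin leNgt => /negP[].
by rewrite mulr_gt0// exprn_gt0// mulr_gt0.
Qed.

(** Hermitian symmetry: the truncated transforms of a real function have it at every stage, and
    reflection preserves L^2 distances. *)
Lemma is_fourier_conj h F : is_fourier h F ->
  is_fourier h (fun xi => Complex (complex.Re (F (- xi))) (- complex.Im (F (- xi)))).
Proof.
move=> [hh [/inL2P F1 /inL2P F2] cF]; have [mh _] := (inL2P h).1 hh.
split => //.
  split; apply/inL2P => /=; first exact: (sqint_opp F1).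
  exact: sqintN (sqint_opp F2).
rewrite (_ : (fun N => _) = (fun N : nat => fdist (fourier_trunc N h) F))//.
apply/funext => N; rewrite /fdist.
have mF : cmeasurable F by split; [case: F1|case: F2].
have mT := cmeasurable_trunc N mh.
rewrite -[RHS](ge0_integral_rV_opp (F := fun xi => (sqnormc (fourier_trunc N h xi - F xi))%:E)).
- apply: eq_integral => xi _; congr EFin; rewrite !fourier_truncE /sqnormc !ReB !ImB/=.
  rewrite itransN_cos itransN_sin; last first.
    by apply: intble_ballcut; exact/inL2P.
  by rewrite opprK -[X in _ + X]sqrrN; congr (_ + _ ^+ 2); ring.
- by apply/measurable_EFinP; exact: measurable_sqnormcB.
- by move=> xi; rewrite lee_fin sqnormc_ge0.
Qed.

(* The inverse of [fhart] on the Fourier transforms of real functions. *)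
Definition hartley_of F xi : R := complex.Re (F xi) - complex.Im (F xi).

(** The identity expresses Hermitian symmetry, which holds only almost everywhere, through
    uniqueness of the L^2 limit. *)
Lemma fhart_hartley_of h F : is_fourier h F ->
  {ae mu, forall xi, fhart (hartley_of F) xi = F xi}.
Proof.
move=> hF; have hF' := is_fourier_conj hF.
have mF : cmeasurable F by case: hF => _ /inL2c_cmeasurable.
have mF' := inL2c_cmeasurable (let: And3 _ x _ := hF' in x).
have := fdist0_ae mF mF' (fourier_unique hF hF').
apply: filterS => xi; rewrite /fhart /evenp /oddp /hartley_of.
case: (F xi) (F (- xi)) => [a b] [a' b'] /= [-> ->].
by congr Complex; field.
Qed.

Lemma sqint_hartley_of h F : is_fourier h F -> sqint mu (hartley_of F).
Proof. by move=> [_ [/inL2P F1 /inL2P F2] _]; exact: sqintB. Qed.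

Lemma normr_dotv_le x y (r : R) : (forall i, `|x ord0 i| <= r) ->
  `|dotv x y| <= d%:R * r * enorm y.
Proof.
move=> xr; rewrite (le_trans (ler_norm_sum _ _ _))//.
rewrite (_ : d%:R * r * enorm y = \sum_(i < d) r * enorm y).
  by apply: ler_sum => i _; rewrite normrM ler_pM// coord_le_enorm.
by rewrite sumr_const card_ord -mulrA mulr_natl.
Qed.

(** The band limit bounds the gradient: 2 is the Lipschitz constant of [cas], 2 pi comes from the
    phase, and [d] from measuring [x - y] coordinatewise. *)
Lemma hartley_lipschitz rho a (x y : V) (r : R) : bandl rho a -> 0 <= r ->
  (forall i, `|x ord0 i - y ord0 i| <= r) ->
  `|hartley a x - hartley a y| <= (4 * pi * d%:R * `|rho| * \int[mu]_xi `|a xi|) * r.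
Proof.
move=> ab r0 xyr; have ai := bandl_intble ab.
rewrite /hartley -RintB; [|exact: intble_hartley..].
rewrite mulrAC -RintZ; last exact: intble_norm.
apply: normr_Rint_le.
- by apply: intble_measurable; apply: intbleB; exact: intble_hartley.
- by apply: intbleZ; exact: intble_norm.
move=> xi; rewrite -mulrBr normrM mulrC.
have [xr|rx] := ltP (enorm xi) rho; last first.
  by case: ab => _ /(_ _ rx) ->; rewrite normr0 !mulr0.
rewrite ler_wpM2r//; apply: (le_trans (cas_lipschitz _ _)).
rewrite -mulrBr -dotvNl -dotvDl normrM.
have H : `|dotv (x - y) xi| <= d%:R * r * `|rho|.
  apply: (@le_trans _ _ (d%:R * r * enorm xi)).
    by apply: normr_dotv_le => i; rewrite !mxE.
  by rewrite ler_wpM2l ?mulr_ge0// (le_trans (ltW xr))// ler_norm.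
have pi0 : 0 <= 2 * pi :> R by rewrite mulr_ge0// pi_ge0.
rewrite (ger0_norm pi0).
have := ler_wpM2l pi0 H; lra.
Qed.

Lemma continuous_hartley rho a : bandl rho a -> continuous (hartley a).
Proof.
move=> ab x; set C := 4 * pi * d%:R * `|rho| * \int[mu]_xi `|a xi|.
have C0 : 0 <= C by rewrite !mulr_ge0// ?pi_ge0// Rint_ge0.
have Fx := nbhs_filter x.
apply/cvgrPdist_lt => e e0.
apply: (iffRL (nbhs_ballP (x : V) _)).
exists (e / (C + 1)) => /=; first by rewrite divr_gt0// ltr_wpDl.
move=> y [d0 xy].
have r0 := ltW d0.
apply: (@le_lt_trans _ _ (C * (e / (C + 1)))).
  by apply: (hartley_lipschitz ab r0) => i; have := xy ord0 i; rewrite /ball/= => /ltW.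
by rewrite mulrA ltr_pdivrMr ?ltr_wpDl// mulrC ltr_pM2l//; lra.
Qed.

(* The spectrum of the [i]-th partial derivative, as cas' t = cas (- t). *)
Definition dmult (i : 'I_d) a xi : R := - (2 * pi * xi ord0 i * a (- xi)).

Lemma bandl_opp rho a : bandl rho a -> bandl rho (fun xi => a (- xi)).
Proof.
move=> [as_ a0]; split; first exact: sqint_opp.
by move=> xi rx; rewrite a0// enormN.
Qed.

Lemma bandl_bounded_mul rho (w : V -> R) (M : R) a : measurable_fun setT w ->
  (forall xi, enorm xi < rho -> `|w xi| <= M) -> bandl rho a -> bandl rho (fun xi => w xi * a xi).
Proof.
move=> mw wM [as_ a0]; split; last by move=> xi /a0 ->; rewrite mulr0.
apply: (sqint_le _ (sqintZ M as_)).
  by apply: measurable_funM => //; case: as_.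
move=> xi; rewrite !normrM; have [xr|/a0 ->] := ltP (enorm xi) rho.
  by rewrite ler_wpM2r// (le_trans (wM _ xr))// ler_norm.
by rewrite normr0 !mulr0.
Qed.

Lemma bandl_dmult rho i a : bandl rho a -> bandl rho (dmult i a).
Proof.
move=> ab; rewrite /dmult; under eq_fun do rewrite -mulNr.
apply: (@bandl_bounded_mul rho (fun xi => - (2 * pi * xi ord0 i)) (2 * pi * rho)).
- by apply: measurableT_comp => //; apply: measurable_funM => //; exact: measurable_rV_coord.
- move=> xi xr; rewrite normrN normrM (ger0_norm (_ : 0 <= 2 * pi)) ?mulr_ge0 ?pi_ge0//.
  by rewrite ler_wpM2l ?mulr_ge0 ?pi_ge0// (le_trans (coord_le_enorm xi i))// ltW.
- exact: bandl_opp.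
Qed.

Lemma dotv_delta (i : 'I_d) (xi : V) : dotv (delta_mx ord0 i) xi = xi ord0 i.
Proof.
rewrite /dotv (bigD1 i)//= mxE !eqxx mul1r big1 ?addr0// => j ji.
by rewrite mxE eqxx/= (negbTE ji) mul0r.
Qed.

(** Frequencies being bounded, the Taylor remainder of [cas] is uniformly quadratic in the
    increment, so the difference quotient converges at a linear rate. *)
Lemma derive_hartley rho a (i : 'I_d) (x : V) : bandl rho a ->
  (h^-1 *: (hartley a (h *: delta_mx ord0 i + x) - hartley a x)) @[h --> 0^'] -->
    hartley (dmult i a) x.
Proof.
move=> ab; have ai := bandl_intble ab; have [[ma _] a0] := ab.
have db := bandl_dmult i ab; have di := bandl_intble db.
(* On the band, the remainder 2 (2 pi h xi_i)^2 of [cas_taylor] is at most 8 pi^2 rho^2 h^2. *)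
set K := \int[mu]_xi (8 * pi ^+ 2 * rho ^+ 2 * `|a xi|).
have E : hartley (dmult i a) x =
    \int[mu]_xi (a xi * (2 * pi * xi ord0 i * cas (- (2 * pi * dotv x xi)))).
  have h := intble_hartley x di.
  rewrite /hartley -(Rint_rV_opp (intble_measurable h)).
  apply: eq_Rintegral => xi _; rewrite /dmult opprK dotvNr mulrN mxE; ring.
have Ei : intble mu (fun xi => a xi * (2 * pi * xi ord0 i * cas (- (2 * pi * dotv x xi)))).
  have := intble_rV_opp (intble_hartley x di).
  rewrite (_ : (fun xi => _) = (fun xi => a xi * (2 * pi * xi ord0 i * cas (- (2 * pi * dotv x xi)))))//.
  by apply/funext => xi; rewrite /dmult opprK dotvNr mulrN mxE; ring.
have bd (h : R) : h != 0 -> `|h^-1 *: (hartley a (h *: delta_mx ord0 i + x) - hartley a x) -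
    hartley (dmult i a) x| <= K * `|h|.
  move=> h0.
  have -> : h^-1 *: (hartley a (h *: delta_mx ord0 i + x) - hartley a x) - hartley (dmult i a) x =
      \int[mu]_xi (h^-1 * (a xi * (cas (2 * pi * dotv x xi + 2 * pi * (h * xi ord0 i)) -
        cas (2 * pi * dotv x xi) - 2 * pi * (h * xi ord0 i) * cas (- (2 * pi * dotv x xi))))).
    rewrite E /hartley -RintB; [|exact: intble_hartley..].
    rewrite /GRing.scale/= -RintZ; last by apply: intbleB; exact: intble_hartley.
    rewrite -RintB//; last by apply: intbleZ; apply: intbleB; exact: intble_hartley.
    apply: eq_Rintegral => xi _; rewrite dotvDl dotvZl dotv_delta [in 2 * pi * (_ + _)]mulrDr.
    rewrite [2 * pi * dotv x xi + _]addrC.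
    by move: (cas _) (cas _) (cas _) => c1 c2 c3; field.
  rewrite /K [leRHS]mulrC -RintZ; last by apply: intbleZ; exact: intble_norm.
  apply: normr_Rint_le.
  - apply: measurable_funM => //; apply: measurable_funM => //.
    have md : measurable_fun setT (fun xi : V => 2 * pi * dotv x xi).
      apply: measurable_funM => //; exact: (measurable_sect2 x (@measurable_dotv R d)).
    have mc : measurable_fun setT (fun xi : V => 2 * pi * (h * xi ord0 i)).
      do 2 apply: measurable_funM => //; exact: measurable_rV_coord.
    apply: measurable_funB; first apply: measurable_funB.
    + by apply: measurable_cas_comp; exact: measurable_funD.
    + exact: measurable_cas_comp.
    + apply: measurable_funM => //; apply: measurable_cas_comp; exact: measurableT_comp.
  - by do 2 apply: intbleZ; exact: intble_norm.
  move=> xi; rewrite !normrM normfV.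
  have [xr|/a0 ->] := ltP (enorm xi) rho; last by rewrite normr0 !(mul0r, mulr0).
  have T := cas_taylor (2 * pi * dotv x xi) (2 * pi * (h * xi ord0 i)).
  have x2 : xi ord0 i ^+ 2 <= rho ^+ 2.
    rewrite -(real_normK (num_real (xi ord0 i))) ler_pXn2r ?nnegrE//.
      exact: le_trans (coord_le_enorm xi i) (ltW xr).
    exact: le_trans (enorm_ge0 xi) (ltW xr).
  have h2 : 0 < `|h| by rewrite normr_gt0.
  rewrite mulrC ler_pdivrMr//.
  have T2 : 2 * (2 * pi * (h * xi ord0 i)) ^+ 2 <= 8 * pi ^+ 2 * rho ^+ 2 * `|h| ^+ 2.
    rewrite real_normK ?num_real// (_ : 2 * _ ^+ 2 = 8 * pi ^+ 2 * h ^+ 2 * xi ord0 i ^+ 2); last by ring.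
    rewrite [leRHS]mulrAC; apply: ler_wpM2l x2.
    by apply: mulr_ge0; [apply: mulr_ge0 => //|]; exact: sqr_ge0.
  have := ler_wpM2l (normr_ge0 (a xi)) (le_trans T T2).
  by move/le_trans; apply; rewrite le_eqVlt; apply/orP; left; apply/eqP; move: `|h| `|a xi| => *; ring.
have K0 : 0 <= K.
  apply: Rint_ge0 => xi; do 2 (apply: mulr_ge0; last by rewrite ?normr_ge0 ?sqr_ge0).
  by apply: mulr_ge0 => //; exact: sqr_ge0.
apply/cvgrPdist_lt => e e0.
near=> h.
have h0 : h != 0 by near: h; exact: nbhs_dnbhs_neq.
rewrite distrC; apply: (le_lt_trans (bd h h0)).
have : `|h| < e / (K + 1).
  near: h; apply: dnbhs0_lt; rewrite divr_gt0// ltr_wpDl//.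
rewrite ltr_pdivlMr ?ltr_wpDl// mulrDr mulr1 => he.
by apply: (le_lt_trans _ he); rewrite mulrC lerDl.
Unshelve. all: by end_near. Qed.

Lemma deriveE_hartley rho a (i : 'I_d) (x : V) : bandl rho a ->
  'D_(delta_mx ord0 i) (hartley a) x = hartley (dmult i a) x.
Proof. by move=> ab; apply: cvg_lim => //; exact: derive_hartley ab. Qed.

Lemma is_fourier_inj h k F : continuous h -> continuous k ->
  is_fourier h F -> is_fourier k F -> h = k.
Proof.
move=> ch ck hF kF.
have := is_fourierB hF kF; rewrite (_ : (fun xi => F xi - F xi) = fun=> 0); last first.
  by apply/funext => xi; rewrite subrr.
move=> h0.
have hk : sqint mu (fun x => h x - k x) by case: h0 => /inL2P.
have chk : continuous (fun x => h x - k x).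
  by move=> x; exact: (cvgB (ch x) (ck x)).
have := continuous_sqr_int0 chk hk (is_fourier0_sqr hk h0).
by move=> /funeqP E; apply/funext => x; apply/eqP; rewrite -subr_eq0; apply/eqP; exact: E.
Qed.

(** [cutoff] selects a continuous function with a prescribed transform. The Hartley transform of the
    truncated spectrum is one, after a change of its transform on a null set, and continuous
    functions with the same transform coincide. *)
Lemma cutoff_hartley eps h F : is_fourier h F ->
  cutoff eps h = hartley (ballcut eps^-1 (hartley_of F)).
Proof.
move=> hF; set a := ballcut _ _.
have ab : bandl eps^-1 a by apply: bandl_ballcut; exact: sqint_hartley_of hF.
have hfh : is_fourier h (fourier h) by apply: xgetPex; exists F.
have ae1 := fhart_hartley_of hF.
have ae2 := fdist0_ae (inL2c_cmeasurable (let: And3 _ x _ := hF in x))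
  (inL2c_cmeasurable (let: And3 _ x _ := hfh in x)) (fourier_unique hF hfh).
set G := fun xi => if enorm xi < eps^-1 then fourier h xi else 0.
have aG : is_fourier (hartley a) G.
  apply: (is_fourier_ae (is_fourier_hartley ab)).
    have [_ [/inL2P g1 /inL2P g2] _] := hfh.
    split; apply/inL2P.
      rewrite (_ : (fun xi => _) = ballcut eps^-1 (fun xi => complex.Re (fourier h xi))).
        exact: sqint_ballcut.
      by apply/funext => xi; rewrite /G /ballcut; case: ifP.
    rewrite (_ : (fun xi => _) = ballcut eps^-1 (fun xi => complex.Im (fourier h xi))).
      exact: sqint_ballcut.
    by apply/funext => xi; rewrite /G /ballcut; case: ifP.
  apply: filterS2 ae1 ae2 => xi e1 e2; rewrite /G -e2 -e1.
  rewrite /fhart /evenp /oddp /a /ballcut enormN; case: ifP => // _.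
  by rewrite addr0 subr0 mul0r oppr0.
rewrite /cutoff; apply: xget_subset1.
  by split; [exact: continuous_hartley ab|].
move=> k1 k2 [c1 f1] [c2 f2]; exact: is_fourier_inj f1 f2.
Qed.

Lemma fourier_none h : (forall F, ~ is_fourier h F) -> fourier h = fun=> 0.
Proof. by move=> nh; rewrite /fourier; apply: xgetPN => F; exact: nh. Qed.

Lemma bandl0 rho : @bandl R d rho (fun=> 0). Proof. by split => //; exact: sqint0. Qed.

Lemma cutoff_bandl eps h : exists2 a, bandl eps^-1 a & cutoff eps h = hartley a.
Proof.
have [[F hF]|nF] := pselect (exists F, is_fourier h F).
  exists (ballcut eps^-1 (hartley_of F)); last exact: cutoff_hartley.
  by apply: bandl_ballcut; exact: sqint_hartley_of hF.
(* Without any transform, [fourier h] is its default value 0, and [cutoff] then selects the zero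
   function. *)
exists (fun=> 0); first exact: bandl0.
rewrite /cutoff fourier_none; last by move=> F hF; apply: nF; exists F.
rewrite (_ : (fun xi => _) = (fhart (fun=> 0))); last first.
  by apply/funext => xi; rewrite if_same /fhart /evenp /oddp addr0 subrr !mul0r oppr0.
have b0 := bandl0 0.
apply: xget_subset1; first by split; [exact: continuous_hartley b0|exact: is_fourier_hartley b0].
move=> k1 k2 [c1 f1] [c2 f2]; exact: is_fourier_inj f1 f2.
Qed.

Lemma hartley_of_fhart a xi : hartley_of (fhart a) xi = a xi.
Proof. by rewrite /hartley_of /= /evenp /oddp; field. Qed.

Lemma cutoff_hartleyE eps rho a : bandl rho a ->
  cutoff eps (hartley a) = hartley (ballcut eps^-1 a).
Proof.
move=> ab; rewrite (cutoff_hartley eps (is_fourier_hartley ab)).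
by congr (hartley (ballcut _ _)); apply/funext => xi; rewrite hartley_of_fhart.
Qed.

Lemma cutoff_hartley_id eps a : bandl eps^-1 a -> cutoff eps (hartley a) = hartley a.
Proof.
move=> ab; rewrite (cutoff_hartleyE eps ab); congr hartley; apply/funext => xi.
rewrite /ballcut; case: ltP => // h; case: ab => _ /(_ xi h) -> //.
Qed.

Definition weight (m : nat) xi : R := (1 + enorm xi ^+ 2) ^+ m.

Lemma weight_ge1 m xi : 1 <= weight m xi.
Proof. by rewrite exprn_ege1// lerDl sqr_ge0. Qed.

Lemma weight_ge0 m xi : 0 <= weight m xi.
Proof. exact: le_trans ler01 (weight_ge1 m xi). Qed.

Lemma measurable_weight m : measurable_fun setT (@weight m).
Proof.
apply: measurable_funX; apply: measurable_funD => //; apply: measurable_funX.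
exact: measurable_enorm.
Qed.

(** [fourier] is determined only almost everywhere, so it is first replaced by [fhart a];
    symmetrisation against the even weight then leaves the real spectrum. *)
Lemma sobolev_sqnorm_hartley m rho a : bandl rho a ->
  sobolev_sqnorm m (hartley a) = (\int[mu]_xi (weight m xi * a xi ^+ 2)%:E)%E.
Proof.
move=> ab; have hF := is_fourier_hartley ab.
have hfh : is_fourier (hartley a) (fourier (hartley a)) by apply: xgetPex; exists (fhart a).
have ma := intble_measurable (bandl_intble ab).
have c1 := inL2c_cmeasurable (let: And3 _ x _ := hF in x).
have c2 := inL2c_cmeasurable (let: And3 _ x _ := hfh in x).
have ae2 := fdist0_ae c1 c2 (fourier_unique hF hfh).
have mw := measurable_weight m.
have msq F : cmeasurable F -> measurable_fun setT (fun xi => sqnormc (F xi)).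
  by move=> [f1 f2]; apply: measurable_funD; exact: measurable_funX.
transitivity (\int[mu]_xi (weight m xi * sqnormc (fhart a xi))%:E)%E.
  apply: ge0_ae_eq_integral => //.
  - by apply/measurable_EFinP; apply: measurable_funM => //; exact: msq.
  - by apply/measurable_EFinP; apply: measurable_funM => //; exact: msq.
  - by move=> xi _; rewrite lee_fin mulr_ge0 ?weight_ge0// sqnormc_ge0.
  - by move=> xi _; rewrite lee_fin mulr_ge0 ?weight_ge0// sqnormc_ge0.
  - by move: ae2; apply: filterS => xi -> _.
transitivity (\int[mu]_xi (weight m xi * sqnormc (Complex 0 (- 0) - fhart a xi))%:E)%E.
  apply: eq_integral => xi _; congr (_ * _)%:E.
  by rewrite /sqnormc ReB ImB/= oppr0 !sub0r !sqrrN.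
rewrite (@integral_hartley_fourier _ _ (@weight m) (fun=> 0) (fun=> 0) a mw (@weight_ge0 m)) //.
- by apply: eq_integral => xi _; rewrite addr0 sub0r sqrrN.
- by move=> xi; rewrite /weight enormN.
- by move=> xi; rewrite oppr0.
Qed.

End fourier_unique.

(** * Products of band-limited functions *)

(** Covers integrands such as p(x) q(z - x), to which a tensor product majorant is not adapted. *)
Lemma intble_prod_iter {d1 d2} {T1 : measurableType d1} {T2 : measurableType d2}
    {R : realType} (m1 : {sigma_finite_measure set T1 -> \bar R})
    (m2 : {sigma_finite_measure set T2 -> \bar R}) (f : T1 * T2 -> R) (g : T1 -> R) :
  measurable_fun setT f -> (forall x, intble m2 (fun y => f (x, y))) ->
  intble m1 g -> (forall x, \int[m2]_y `|f (x, y)| <= g x) -> intble (m1 \x m2)%E f.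
Proof.
move=> mf fx gi fg.
apply/integrable12ltyP; first exact/measurable_EFinP.
have mfx : measurable_fun setT (fun x => \int[m2]_y `|f (x, y)|).
  by apply: (@measurable_Rint_param _ _ _ _ _ m2 (fun p => `|f p|)); exact: measurableT_comp.
apply: (@le_lt_trans _ _ (\int[m1]_x (`|g x|)%:E)%E); last by case/integrableP: gi.
apply: ge0_le_integral => //.
- by move=> x _; exact: integral_ge0.
- have := mfx => /measurable_EFinP; congr measurable_fun; apply/funext => x /=.
  by rewrite RintE //; exact: intble_norm.
- by apply/measurable_EFinP; apply: measurableT_comp => //; exact: intble_measurable gi.
- move=> x _; under eq_integral do rewrite abse_EFin.
  rewrite -RintE; last exact: intble_norm.
  by rewrite lee_fin (le_trans (fg x))// ler_norm.
Qed.

Section convolution.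
Context {R : realType} {d : nat}.
Local Notation V := 'rV[R]_d.
Local Notation mu := (@lebesgue_rV R d).
Implicit Types (p q : V -> R) (x z xi : V).

Definition cnv p q z : R := \int[mu]_x (p x * q (z - x)).

Definition l2sq p : R := \int[mu]_x (p x ^+ 2).

Lemma l2sq_ge0 p : 0 <= l2sq p.
Proof. by apply: Rint_ge0 => x; exact: sqr_ge0. Qed.

Lemma measurable_rV_sub : measurable_fun setT (fun t : V * V => t.1 - t.2).
Proof.
apply: (measurableT_comp (@measurable_rV_add R d) (g := fun t : V * V => (t.1, - t.2))).
apply: measurable_fun_pair => //=.
exact: (measurableT_comp (@measurable_rV_opp R d) measurable_snd).
Qed.

Lemma measurable_cnv_kernel p q : measurable_fun setT p -> measurable_fun setT q ->
  measurable_fun setT (fun t : V * V => p t.2 * q (t.1 - t.2)).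
Proof.
move=> mp mq; apply: measurable_funM; first exact: (measurableT_comp mp).
exact: (measurableT_comp mq measurable_rV_sub).
Qed.

Lemma measurable_cnv p q : measurable_fun setT p -> measurable_fun setT q ->
  measurable_fun setT (cnv p q).
Proof.
move=> mp mq; apply: (@measurable_Rint_param _ _ _ _ _ mu (fun t : V * V => p t.2 * q (t.1 - t.2))).
exact: measurable_cnv_kernel.
Qed.

Lemma reflect_shiftE q z : (fun x => q (z - x)) = (fun x => (fun y => q (y + z)) (- x)).
Proof. by apply/funext => x; rewrite addrC. Qed.

Lemma intble_reflect q z : intble mu q -> intble mu (fun x => q (z - x)).
Proof. by move=> qi; rewrite reflect_shiftE; exact: intble_rV_opp (intble_rV_shift z qi). Qed.

Lemma Rint_reflect q z : measurable_fun setT q ->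
  \int[mu]_x q (z - x) = \int[mu]_x q x.
Proof.
move=> mq; rewrite reflect_shiftE (@Rint_rV_opp _ d (fun y => q (y + z))) ?Rint_rV_shift//.
exact: (measurableT_comp mq (measurable_rV_addr z)).
Qed.

Lemma measurable_reflect q z : measurable_fun setT q -> measurable_fun setT (fun x => q (z - x)).
Proof. by move=> mq; exact: (measurableT_comp mq (measurable_sect2 z measurable_rV_sub)). Qed.

Lemma sqint_reflect q z : sqint mu q -> sqint mu (fun x => q (z - x)).
Proof.
by move=> [mq qi]; split; [exact: measurable_reflect|exact: (intble_reflect z qi)].
Qed.

Lemma intble_cnv p q z : sqint mu p -> sqint mu q -> intble mu (fun x => p x * q (z - x)).
Proof. by move=> ps qs; apply: sqint_mul => //; exact: sqint_reflect. Qed.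

Lemma cnv_sqr_le p q z : sqint mu p -> sqint mu q -> cnv p q z ^+ 2 <= l2sq p * l2sq q.
Proof.
move=> ps qs; apply: (le_trans (cauchy_schwarz ps (sqint_reflect z qs))).
rewrite /l2sq (@Rint_reflect (fun y => q y ^+ 2))//.
by apply: measurable_funX; case: qs.
Qed.

(** Rests on Cauchy-Schwarz for [dotv], by the same discriminant argument as for integrals. *)
Lemma enormD x y : enorm (x + y) <= enorm x + enorm y.
Proof.
rewrite -(@ler_pXn2r _ 2)// ?nnegrE ?addr_ge0 ?enorm_ge0// sqrrD !sqr_enorm.
rewrite dotvDl !dotvDr (dotvC y x).
suff : dotv x y <= enorm x * enorm y by lra.
apply: le_trans (ler_norm _) _.
rewrite -(@ler_pXn2r _ 2)// ?nnegrE ?mulr_ge0 ?enorm_ge0// exprMn !sqr_enorm.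
rewrite real_normK ?num_real//.
have key (t : R) : 0 <= t ^+ 2 * dotv x x + 2 * t * dotv x y + dotv y y.
  have := dotv_ge0 (t *: x + y).
  rewrite dotvDl !dotvDr !dotvZl !dotvZr (dotvC y x); lra.
have [x0|x0] := eqVneq (dotv x x) 0.
  have y0 := dotv_ge0 y; rewrite x0 mul0r.
  have [->|xy0] := eqVneq (dotv x y) 0; first by rewrite expr0n.
  have := key (- (dotv y y + 1) / (2 * dotv x y)).
  rewrite x0 mulr0 add0r (_ : 2 * _ * _ = - (dotv y y + 1)); last by field.
  lra.
have xp : 0 < dotv x x by rewrite lt_neqAle eq_sym x0 dotv_ge0.
have := key (- dotv x y / dotv x x).
rewrite (_ : _ + _ + _ = dotv y y - dotv x y ^+ 2 / dotv x x); last by field.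
by rewrite subr_ge0 ler_pdivrMr// mulrC.
Qed.

Lemma cnv_support rho p q z : bandl rho p -> bandl rho q -> 2 * rho <= enorm z ->
  cnv p q z = 0.
Proof.
move=> [_ p0] [_ q0] rz; rewrite /cnv (_ : (fun x => _) = fun=> 0).
  by rewrite Rintegral_cst// mul0r.
apply/funext => x; have [/p0 ->|xr] := leP rho (enorm x); first by rewrite mul0r.
rewrite q0 ?mulr0// leNgt; apply/negP => zx.
by have := enormD x (z - x); rewrite addrC subrK; lra.
Qed.

Lemma intble_ball (r : R) : intble mu (fun x => (enorm x <= r)%R%:R).
Proof.
apply: (@bddsupp_intble _ _ 1 r); split.
- by apply: measurable_indicR; exact: measurable_enorm_le.
- by move=> x; rewrite ger0_norm ?ler0n// lern1 leq_b1.
- move=> x i xi; apply/eqP; rewrite pnatr_eq0 eqb0 -ltNge.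
  exact: lt_le_trans xi (coord_le_enorm x i).
Qed.

(** A convolution of two square-integrable functions is bounded; here it also has bounded support,
    so it is again square integrable. *)
Lemma bandl_cnv rho p q : bandl rho p -> bandl rho q -> bandl (2 * rho) (cnv p q).
Proof.
move=> pb qb; have [ps _] := pb; have [qs _] := qb; have [mp _] := ps; have [mq _] := qs.
have mc := measurable_cnv mp mq.
split; last by move=> z; exact: cnv_support.
split => //; have bi := intble_ball (2 * rho).
apply: (intble_le _ (intbleZ (l2sq p * l2sq q) bi)).
  exact: measurable_funX.
move=> z; rewrite ger0_norm ?sqr_ge0//.
have [zr|/ltW rz] := leP (enorm z) (2 * rho); first by rewrite mulr1 cnv_sqr_le.
by rewrite (cnv_support pb qb rz) expr0n mulr0.
Qed.

Lemma itrans_cos_opp p x : measurable_fun setT p ->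
  itrans mu kcosd (fun xi => p (- xi)) x = itrans mu kcosd p x.
Proof.
move=> mp; rewrite /itrans.
rewrite -(@Rint_rV_opp _ d (fun xi => p xi * kcosd (xi, x))).
  by apply: eq_Rintegral => xi _; rewrite /kcosd/= dotvNl mulrN cosN.
by apply: measurable_funM => //; exact: (measurable_sect1 x measurable_kcosd).
Qed.

Lemma itrans_sin_opp p x : intble mu p ->
  itrans mu ksind (fun xi => p (- xi)) x = - itrans mu ksind p x.
Proof.
move=> ip; have mp := intble_measurable ip; rewrite /itrans -RintN; last first.
  exact: intble_kernel measurable_ksind ksind_le1 ip.
rewrite -(@Rint_rV_opp _ d (fun xi => - (p xi * ksind (xi, x)))).
  by apply: eq_Rintegral => xi _; rewrite /ksind/= dotvNl mulrN sinN mulrN opprK.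
apply: measurableT_comp => //.
by apply: measurable_funM => //; exact: (measurable_sect1 x measurable_ksind).
Qed.

(** Fubini and the shift z = eta + xi, followed by the addition formulas. The outcome is not the
    product of the two Hartley transforms, which is why [hconv] has four terms. *)
Lemma hartley_cnv rho p q x : bandl rho p -> bandl rho q ->
  let c f := itrans mu kcosd f x in let s f := itrans mu ksind f x in
  hartley (cnv p q) x = c p * c q - s p * s q + s p * c q + c p * s q.
Proof.
move=> pb qb c s; have [ps _] := pb; have [qs _] := qb; have [mp _] := ps; have [mq _] := qs.
have [ip iq] := (bandl_intble pb, bandl_intble qb).
pose F (t : V * V) := p t.1 * q (t.2 - t.1) * cas (2 * pi * dotv x t.2).
have mF : measurable_fun setT F.
  apply: measurable_funM; last first.
    apply: measurable_cas_comp; apply: measurable_funM => //.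
    exact: (measurableT_comp (measurable_sect2 x (@measurable_dotv R d)) measurable_snd).
  apply: (measurableT_comp (measurable_cnv_kernel mp mq) (g := fun t : V * V => (t.2, t.1))).
  by apply: measurable_fun_pair; [exact: measurable_snd|exact: measurable_fst].
have iqs xi : intble mu (fun z => q (z - xi)) by exact: intble_rV_shift.
have F1 xi : intble mu (fun z => F (xi, z)).
  by apply: (@intble_hartley _ _ (fun z => p xi * q (z - xi))); exact: intbleZ.
have F2 z : intble mu (fun xi => F (xi, z)).
  rewrite /F/=; under eq_fun do rewrite mulrC; apply: intbleZ; exact: intble_cnv.
have Fi : intble (mu \x mu)%E F.
  apply: (@intble_prod_iter _ _ _ _ _ mu mu F (fun xi => (2 * \int[mu]_z `|q z|) * `|p xi|) mF F1).
    by apply: intbleZ; exact: intble_norm.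
  move=> xi; rewrite mulrAC [leRHS]mulrC.
  rewrite -(@Rint_rV_shift _ d (- xi) (fun z => `|q z|)); last exact: measurableT_comp.
  rewrite mulrC -RintZ; last by apply: intble_norm.
  apply: le_Rint.
  - exact: intble_norm.
  - by apply: intbleZ; exact: intble_norm.
  move=> z; rewrite /F/= !normrM mulrC mulrA ler_wpM2r// mulrC [leRHS]mulrC.
  by rewrite ler_wpM2l// cas_le2.
transitivity (\int[mu]_z \int[mu]_xi F (xi, z)).
  apply: eq_Rintegral => z _; rewrite /cnv mulrC -RintZ; last exact: intble_cnv.
  by apply: eq_Rintegral => xi _; rewrite mulrC.
rewrite -(Fubini_Rint Fi F1 F2).
have kc f : intble mu f -> intble mu (fun xi => f xi * kcosd (xi, x)).
  exact: intble_kernel measurable_kcosd kcosd_le1.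
have ks f : intble mu f -> intble mu (fun xi => f xi * ksind (xi, x)).
  exact: intble_kernel measurable_ksind ksind_le1.
transitivity (\int[mu]_xi ((c q + s q) * (p xi * kcosd (xi, x)) +
    (c q - s q) * (p xi * ksind (xi, x)))); last first.
  rewrite RintD; [|apply: intbleZ; exact: kc|apply: intbleZ; exact: ks].
  rewrite (RintZ _ (kc _ ip)) (RintZ _ (ks _ ip)) /c /s /itrans; ring.
apply: eq_Rintegral => xi _.
have mG : measurable_fun setT (fun eta => p xi * q eta * cas (2 * pi * dotv x (eta + xi))).
  apply: measurable_funM; first exact: measurable_funM.
  apply: measurable_cas_comp; apply: measurable_funM => //.
  apply: (measurableT_comp (measurable_sect2 x (@measurable_dotv R d))).
  exact: measurable_rV_addr.
rewrite -[LHS](@Rint_rV_shift _ d xi (fun z => F (xi, z))); last exact: intble_measurable (F1 xi).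
transitivity (\int[mu]_eta ((p xi * (kcosd (xi, x) + ksind (xi, x))) * (q eta * kcosd (eta, x)) +
    (p xi * (kcosd (xi, x) - ksind (xi, x))) * (q eta * ksind (eta, x)))).
  apply: eq_Rintegral => eta _; rewrite /F/= addrK dotvDr (mulrDr (2 * pi)) /cas cosD sinD.
  by rewrite /kcosd /ksind/= !(dotvC x); ring.
rewrite RintD; [|apply: intbleZ; exact: kc|apply: intbleZ; exact: ks].
rewrite (RintZ _ (kc _ iq)) (RintZ _ (ks _ iq)) /c /s /itrans; ring.
Qed.

(* cas a * cas b = (cas (a + b) + cas (a - b) + cas (b - a) - cas (- a - b)) / 2 *)
Definition hconv p q z : R :=
  (cnv p q z + cnv p (fun xi => q (- xi)) z + cnv (fun xi => p (- xi)) q z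
   - cnv (fun xi => p (- xi)) (fun xi => q (- xi)) z) / 2.

(** Reflecting a spectrum changes only the sign of its sine transform, so the four convolutions
    recombine into the product of the two sums cosine plus sine. *)
Lemma hartley_hconv rho p q x : bandl rho p -> bandl rho q ->
  hartley p x * hartley q x = hartley (hconv p q) x.
Proof.
move=> pb qb; have [pb' qb'] := (bandl_opp pb, bandl_opp qb).
have [ip iq] := (bandl_intble pb, bandl_intble qb).
have [mp mq] := (intble_measurable ip, intble_measurable iq).
have i1 := bandl_intble (bandl_cnv pb qb).
have i2 := bandl_intble (bandl_cnv pb qb').
have i3 := bandl_intble (bandl_cnv pb' qb).
have i4 := bandl_intble (bandl_cnv pb' qb').
transitivity (2^-1 * (hartley (cnv p q) x + hartley (cnv p (fun xi => q (- xi))) x +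
   hartley (cnv (fun xi => p (- xi)) q) x -
   hartley (cnv (fun xi => p (- xi)) (fun xi => q (- xi))) x)).
  rewrite (hartley_cnv x pb qb) (hartley_cnv x pb qb') (hartley_cnv x pb' qb) (hartley_cnv x pb' qb').
  rewrite !itrans_cos_opp// !itrans_sin_opp// !hartleyE//; by field.
rewrite -!hartleyD//; last exact: intbleD.
rewrite -hartleyB//; last by do 2 apply: intbleD => //.
rewrite -hartleyZ; first by congr hartley; apply/funext => z; rewrite mulrC.
by apply: intbleB => //; do 2 apply: intbleD => //.
Qed.

Lemma bandlD rho p q : bandl rho p -> bandl rho q -> bandl rho (fun x => p x + q x).
Proof.
move=> [ps p0] [qs q0]; split; first exact: sqintD.
by move=> x rx; rewrite p0// q0// addr0.
Qed.

Lemma bandlZ rho r p : bandl rho p -> bandl rho (fun x => r * p x).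
Proof.
by move=> [ps p0]; split; [exact: sqintZ|move=> x rx; rewrite p0// mulr0].
Qed.

Lemma bandlB rho p q : bandl rho p -> bandl rho q -> bandl rho (fun x => p x - q x).
Proof.
move=> [ps p0] [qs q0]; split; first exact: sqintB.
by move=> x rx; rewrite p0// q0// subr0.
Qed.

Lemma bandl_sum rho (I : Type) (s : seq I) (P : pred I) (F : I -> V -> R) :
  (forall i, bandl rho (F i)) -> bandl rho (fun x => \sum_(i <- s | P i) F i x).
Proof.
move=> Fb; split; first by apply: sqint_sum => i _; case: (Fb i).
by move=> x rx; rewrite big1// => i _; case: (Fb i) => _; apply.
Qed.

Lemma bandl_hconv rho p q : bandl rho p -> bandl rho q -> bandl (2 * rho) (hconv p q).
Proof.
move=> pb qb; have [pb' qb'] := (bandl_opp pb, bandl_opp qb).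
rewrite /hconv; under eq_fun do rewrite mulrC.
by apply: bandlZ; apply: bandlB; [apply: bandlD; [apply: bandlD|]|]; exact: bandl_cnv.
Qed.

Lemma sqr4_le (a b c e : R) : ((a + b + c - e) / 2) ^+ 2 <= a ^+ 2 + b ^+ 2 + c ^+ 2 + e ^+ 2.
Proof.
rewrite -subr_ge0.
have -> : a ^+ 2 + b ^+ 2 + c ^+ 2 + e ^+ 2 - ((a + b + c - e) / 2) ^+ 2 =
  ((a - b) ^+ 2 + (a - c) ^+ 2 + (a + e) ^+ 2 + (b - c) ^+ 2 + (b + e) ^+ 2 + (c + e) ^+ 2) / 4.
  by field.
by rewrite divr_ge0// !addr_ge0// sqr_ge0.
Qed.

Lemma l2sq_opp p : measurable_fun setT p -> l2sq (fun x => p (- x)) = l2sq p.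
Proof. by move=> mp; apply: (Rint_rV_opp (f := fun x => p x ^+ 2)); exact: measurable_funX. Qed.

Lemma hconv_sqr_le p q z : sqint mu p -> sqint mu q ->
  hconv p q z ^+ 2 <= 4 * (l2sq p * l2sq q).
Proof.
move=> ps qs; have [ps' qs'] := (sqint_opp ps, sqint_opp qs).
have [mp _] := ps; have [mq _] := qs.
apply: (le_trans (sqr4_le _ _ _ _)).
have h1 := cnv_sqr_le z ps qs; have h2 := cnv_sqr_le z ps qs'.
have h3 := cnv_sqr_le z ps' qs; have h4 := cnv_sqr_le z ps' qs'.
rewrite !l2sq_opp// in h2 h3 h4; lra.
Qed.

Lemma cnvBl p p' q z : sqint mu p -> sqint mu p' -> sqint mu q ->
  cnv (fun x => p x - p' x) q z = cnv p q z - cnv p' q z.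
Proof.
move=> ps ps' qs; rewrite /cnv -RintB; [|exact: intble_cnv..].
by apply: eq_Rintegral => x _; rewrite mulrBl.
Qed.

Lemma cnvBr p q q' z : sqint mu p -> sqint mu q -> sqint mu q' ->
  cnv p (fun x => q x - q' x) z = cnv p q z - cnv p q' z.
Proof.
move=> ps ps' qs; rewrite /cnv -RintB; [|exact: intble_cnv..].
by apply: eq_Rintegral => x _; rewrite mulrBr.
Qed.

(** Bilinearity, in the form that makes a difference of quadratic terms linear in the difference of
    the states. *)
Lemma hconvB p p' q q' z : sqint mu p -> sqint mu p' -> sqint mu q -> sqint mu q' ->
  hconv p q z - hconv p' q' z =
  hconv (fun x => p x - p' x) q z + hconv p' (fun x => q x - q' x) z.
Proof.
move=> ps ps' qs qs'.
have [s1 s2] := (sqint_opp ps, sqint_opp ps'); have [s3 s4] := (sqint_opp qs, sqint_opp qs').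
rewrite /hconv (@cnvBl (fun x => p (- x)))// (@cnvBl (fun x => p (- x)))//.
rewrite (cnvBl _ ps)// (cnvBl _ ps)//.
rewrite (@cnvBr _ (fun x => q (- x)) (fun x => q' (- x)))//.
rewrite (@cnvBr _ (fun x => q (- x)) (fun x => q' (- x)))//.
rewrite (cnvBr _ _ qs qs')// (cnvBr _ _ qs qs')//; ring.
Qed.

Lemma hconvZ r p q z : sqint mu p -> sqint mu q ->
  hconv (fun x => r * p x) (fun x => r * q x) z = r ^+ 2 * hconv p q z.
Proof.
move=> ps qs; have [s1 s3] := (sqint_opp ps, sqint_opp qs).
have E p' q' : sqint mu p' -> sqint mu q' ->
    cnv (fun x => r * p' x) (fun x => r * q' x) z = r ^+ 2 * cnv p' q' z.
  move=> ps' qs'; rewrite /cnv -RintZ; last exact: intble_cnv.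
  by apply: eq_Rintegral => x _; ring.
rewrite /hconv (E p q)// (E p (fun x => q (- x)))// (E (fun x => p (- x)) q)//.
rewrite (E (fun x => p (- x)) (fun x => q (- x)))//; ring.
Qed.

End convolution.

(** * The algebra property of the weighted L^2 space *)

Section weighted_convolution.
Context {R : realType}.
Local Notation mu1 := (@lebesgue_measure R).

Lemma measurable_inv_ge1 {d} {T : measurableType d} (f : T -> R) :
  measurable_fun setT f -> (forall x, 1 <= f x) -> measurable_fun setT (fun x => (f x)^-1).
Proof.
move=> mf f1; pose phi (t : R) := (Num.max 1 t)^-1.
have -> : (fun x => (f x)^-1) = phi \o f.
  by apply/funext => x; rewrite /phi/=; congr (_^-1); rewrite max_r.
apply: measurableT_comp mf; apply: continuous_measurable_fun => t.
apply: cvgV; first by rewrite gt_eqF// lt_max ltr01.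
by apply: continuous_max; [exact: cvg_cst|exact: cvg_id].
Qed.

Lemma intble_oneDsqrV : intble mu1 (fun x : R => (oneDsqr x)^-1).
Proof.
have mV : measurable_fun setT (fun x : R => (oneDsqr x)^-1).
  exact: continuous_measurable_fun (@continuous_oneDsqrV R).
have V0 (x : R) : 0 <= (oneDsqr x)^-1 by rewrite invr_ge0 (le_trans ler01)// oneDsqr_ge1.
pose F (x : R) : \bar R := ((fun x : R => (oneDsqr x)^-1%:E) \_ `[0, +oo[) x.
have mF : measurable_fun setT F.
  apply/(measurable_restrictT _ _).1 => //; apply: measurable_funTS.
  exact/measurable_EFinP.
have F0 x : (0 <= F x)%E.
  by rewrite /F patchE; case: ifPn => // _; rewrite lee_fin.
have IF : (\int[mu1]_x F x = (pi / 2)%:E)%E.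
  by rewrite -integral_mkcond integral0y_oneDsqr.
have IFN : (\int[mu1]_x F (- x)%R = (pi / 2)%:E)%E.
  rewrite -IF -[RHS]mul1e (_ : 1%:E = (`|-1|^-1)%:E)%E; last by rewrite normrN1 invr1.
  have N1 : -1 != 0 :> R by rewrite oppr_eq0 oner_eq0.
  rewrite -(ge0_integral_affine 0 N1 mF F0).
  by apply: eq_integral => x _; rewrite addr0 mulN1r.
apply: ge0_intbleP => //.
apply: (@le_lt_trans _ _ (\int[mu1]_x (F x + F (- x)%R))%E).
  apply: ge0_le_integral => //.
  - exact/measurable_EFinP.
  - by apply: emeasurable_funD => //; exact: (measurableT_comp mF (@oppr_measurable R setT)).
  - move=> x _; rewrite /F !patchE.
    have [x0|x0] := leP 0 x.
      rewrite ifT ?inE/= ?in_itv/= ?andbT ?x0//.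
      by rewrite leeDl//; case: ifP => // _; rewrite lee_fin.
    rewrite [X in (_ <= _ + X)%E]ifT ?inE/= ?in_itv/= ?andbT ?oppr_ge0 ?(ltW x0)//.
    rewrite (_ : oneDsqr (- x) = oneDsqr x) ?leeDr//; last by rewrite /oneDsqr sqrrN.
    by case: ifP => // _; rewrite lee_fin.
rewrite ge0_integralD//; last first.
  exact: (measurableT_comp mF (@oppr_measurable R setT)).
by rewrite IF IFN -EFinD ltry.
Qed.

Lemma integral_prod_oneDsqrV d :
  (\int[lebesgue_rV d]_x (\prod_(i < d) (oneDsqr (x ord0 i : R))^-1)%:E < +oo)%E.
Proof.
have mp n : measurable_fun [set: 'rV[R]_n] (fun x => \prod_(i < n) (oneDsqr (x ord0 i))^-1).
  apply: measurable_prod => i _.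
  exact: (measurableT_comp (intble_measurable intble_oneDsqrV) (measurable_rV_coord i)).
have V0 (x : R) : 0 <= (oneDsqr x)^-1 by rewrite invr_ge0 (le_trans ler01)// oneDsqr_ge1.
elim: d => [|d IH].
  rewrite integral_dirac//; last by apply/measurable_EFinP; exact: mp.
  by rewrite diracT mul1e ltry.
rewrite ge0_integral_rV_cons//; first last.
- by move=> x; rewrite lee_fin prodr_ge0.
- by apply/measurable_EFinP; exact: mp.
under eq_integral => x _.
  under eq_integral => y _ do rewrite big_ord_recl rV_cons0 EFinM.
  under eq_integral => y _ do under eq_bigr do rewrite rV_consS.
  rewrite ge0_integralZl_EFin//; [over| |].
  - by move=> y _; rewrite lee_fin prodr_ge0.
  - by apply/measurable_EFinP; exact: mp.
have I0 : (0 <= \int[lebesgue_rV d]_x (\prod_(i < d) (oneDsqr (x ord0 i : R))^-1)%:E)%E.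
  by apply: integral_ge0 => x _; rewrite lee_fin prodr_ge0.
rewrite ge0_integralZr//=; last by apply/measurable_EFinP; exact: intble_measurable intble_oneDsqrV.
rewrite lte_mul_pinfty//; first by apply: integral_ge0 => x _; rewrite lee_fin.
by rewrite -(RintE intble_oneDsqrV).
Qed.

Context {d : nat}.
Local Notation V := 'rV[R]_d.
Local Notation mu := (@lebesgue_rV R d).
Implicit Types (p q : V -> R) (x z xi : V).

Lemma wsqr_ge0 m x (a : R) : 0 <= weight m x * a ^+ 2.
Proof. by apply: mulr_ge0; [exact: weight_ge0|exact: sqr_ge0]. Qed.

(** Each factor 1 + x_i^2 is at most 1 + |x|^2, so the inverse weight is bounded by a product of
    integrable functions of one variable. This is where [m] is compared with [d]. *)
Lemma intble_weightV m : (d <= m)%N -> intble mu (fun x => (weight m x)^-1).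
Proof.
move=> dm.
have w1 (x : V) : 1 <= 1 + enorm x ^+ 2 by rewrite lerDl sqr_ge0.
apply: ge0_intbleP.
- by apply: measurable_inv_ge1; [exact: measurable_weight|exact: weight_ge1].
- by move=> x; rewrite invr_ge0 weight_ge0.
apply: le_lt_trans (integral_prod_oneDsqrV d).
have V0 (x : R) : 0 <= (oneDsqr x)^-1 by rewrite invr_ge0 (le_trans ler01)// oneDsqr_ge1.
apply: ge0_le_integral => //.
- by move=> x _; rewrite lee_fin invr_ge0 weight_ge0.
- apply/measurable_EFinP.
  by apply: measurable_inv_ge1; [exact: measurable_weight|exact: weight_ge1].
- apply/measurable_EFinP; apply: measurable_prod => i _.
  exact: (measurableT_comp (intble_measurable intble_oneDsqrV) (measurable_rV_coord i)).
move=> x _; rewrite lee_fin prodfV lef_pV2 ?posrE.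
- apply: (@le_trans _ _ ((1 + enorm x ^+ 2) ^+ d)); last exact: ler_weXn2l.
  rewrite -[X in _ ^+ X]card_ord -prodr_const; apply: ler_prod => i _.
  rewrite (le_trans ler01) ?oneDsqr_ge1//= lerD2l -(real_normK (num_real (x _ _))).
  by rewrite ler_pXn2r ?nnegrE ?enorm_ge0// coord_le_enorm.
- exact: lt_le_trans ltr01 (weight_ge1 m x).
- by apply: prodr_gt0 => i _; rewrite (lt_le_trans ltr01)// oneDsqr_ge1.
Qed.

Lemma sqr_enormD_le x y : 1 + enorm (x + y) ^+ 2 <= 2 * ((1 + enorm x ^+ 2) + (1 + enorm y ^+ 2)).
Proof.
have := enormD x y; have := enorm_ge0 (x + y); have := sqr_ge0 (enorm x - enorm y).
by move: (enorm x) (enorm y) (enorm _) => a b c; nra.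
Qed.

(** 1 + |x + y|^2 is at most 4 times the larger of 1 + |x|^2 and 1 + |y|^2. *)
Lemma weightD m x y : weight m (x + y) <= 4 ^+ m * (weight m x + weight m y).
Proof.
rewrite /weight; set a := 1 + enorm x ^+ 2; set b := 1 + enorm y ^+ 2.
have a0 : 0 <= a by rewrite addr_ge0// sqr_ge0.
have b0 : 0 <= b by rewrite addr_ge0// sqr_ge0.
have c0 : 0 <= 1 + enorm (x + y) ^+ 2 by rewrite addr_ge0// sqr_ge0.
have h := sqr_enormD_le x y; rewrite -/a -/b in h.
have [ab|ba] := leP a b.
  apply: (@le_trans _ _ ((4 * b) ^+ m)).
    by rewrite lerXn2r ?nnegrE// ?mulr_ge0//; lra.
  by rewrite exprMn ler_wpM2l ?exprn_ge0// lerDr exprn_ge0.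
apply: (@le_trans _ _ ((4 * a) ^+ m)).
  by rewrite lerXn2r ?nnegrE// ?mulr_ge0//; lra.
by rewrite exprMn ler_wpM2l ?exprn_ge0// lerDl exprn_ge0.
Qed.

Definition wsq m p : R := \int[mu]_x (weight m x * p x ^+ 2).

Lemma weight_bounded m rho x : enorm x < rho -> weight m x <= (1 + rho ^+ 2) ^+ m.
Proof.
move=> xr; rewrite /weight lerXn2r ?nnegrE ?addr_ge0 ?sqr_ge0// lerD2l.
by rewrite ler_pXn2r ?nnegrE ?enorm_ge0 ?(le_trans (enorm_ge0 x))// ltW.
Qed.

Lemma intble_wsq m rho p : bandl rho p -> intble mu (fun x => weight m x * p x ^+ 2).
Proof.
move=> [[mp pi_] p0].
apply: (intble_le _ (intbleZ ((1 + rho ^+ 2) ^+ m) pi_)).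
  by apply: measurable_funM; [exact: measurable_weight|exact: measurable_funX].
move=> x; rewrite normrM !ger0_norm ?weight_ge0 ?sqr_ge0//.
have [xr|/p0 ->] := ltP (enorm x) rho; last by rewrite expr0n !mulr0.
by rewrite ler_wpM2r ?sqr_ge0// weight_bounded.
Qed.

Lemma wsq_ge0 m p : 0 <= wsq m p.
Proof. by apply: Rint_ge0 => x; rewrite mulr_ge0 ?weight_ge0 ?sqr_ge0. Qed.

(** The factor 2 accounts for the two terms of [weightD], which have the same integral; the final +
    1 makes positivity immediate. *)
Definition cnv_cst m : R := 4 ^+ m * (2 * \int[mu]_x (weight m x)^-1) + 1.

Lemma cnv_cst_gt0 m : 0 < cnv_cst m.
Proof.
rewrite ltr_pwDr// !mulr_ge0// ?exprn_ge0//.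
by apply: Rint_ge0 => x; rewrite invr_ge0 weight_ge0.
Qed.

(** Cauchy-Schwarz after multiplying and dividing by the square root of [w x], the product of the
    weights at x and z - x; by [weightD] the integral of 1 / w is at most a constant over
    [weight m z]. Extended values are used since the right-hand integral may be infinite for an
    individual [z]. *)
Lemma weighted_cnv_pointwise m p q z : (d <= m)%N -> measurable_fun setT p ->
  measurable_fun setT q ->
  ((weight m z * cnv p q z ^+ 2)%:E <= (cnv_cst m)%:E *
   \int[mu]_x ((weight m x * p x ^+ 2) * (weight m (z - x) * q (z - x) ^+ 2))%:E)%E.
Proof.
move=> dm mp mq.
pose w x := weight m x * weight m (z - x).
have mw : measurable_fun setT w.
  apply: measurable_funM; first exact: measurable_weight.
  exact: (measurable_reflect z (@measurable_weight R d m)).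
have w1 x : 0 < w x.
  by rewrite mulr_gt0// (lt_le_trans ltr01)// weight_ge1.
pose G x := (weight m x * p x ^+ 2) * (weight m (z - x) * q (z - x) ^+ 2).
have G0 x : 0 <= G x by rewrite mulr_ge0// wsqr_ge0.
have GE x : G x = (Num.sqrt (w x) * (p x * q (z - x))) ^+ 2.
  by rewrite exprMn sqr_sqrtr ?(ltW (w1 x))// /G /w; ring.
have mpq : measurable_fun setT (fun x => p x * q (z - x)).
  by apply: measurable_funM => //; exact: measurable_reflect.
have ms : measurable_fun setT (fun x => Num.sqrt (w x)).
  by apply: measurableT_comp mw; exact: (continuous_measurable_fun (@sqrt_continuous R)).
have mG : measurable_fun setT G.
  by rewrite (funext GE); apply: measurable_funX; exact: measurable_funM.
rewrite -/G; have [Goo|] := ltP (\int[mu]_x (G x)%:E)%E +oo%E; last first.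
  rewrite leye_eq => /eqP ->.
  by rewrite gt0_muley ?lte_fin ?cnv_cst_gt0// leey.
have iG := ge0_intbleP mG G0 Goo.
have sf2 : sqint mu (fun x => Num.sqrt (w x) * (p x * q (z - x))).
  split; first exact: measurable_funM.
  by under eq_fun do rewrite -GE.
have K := intble_weightV dm.
have wz := lt_le_trans ltr01 (weight_ge1 m z).
pose g x := (4 ^+ m * (weight m z)^-1) * ((weight m x)^-1 + (weight m (z - x))^-1).
have ig : intble mu g.
  by apply: intbleZ; apply: intbleD => //; exact: (intble_reflect z K).
have wV x : (w x)^-1 <= g x.
  have := weightD m x (z - x); rewrite addrC subrK /g /w => h.
  have a0 := lt_le_trans ltr01 (weight_ge1 m x).
  have b0 := lt_le_trans ltr01 (weight_ge1 m (z - x)).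
  rewrite -[leLHS]mul1r ler_pdivrMr ?mulr_gt0//.
  have -> : 4 ^+ m / weight m z * ((weight m x)^-1 + (weight m (z - x))^-1) * (weight m x * weight m (z - x))
     = (4 ^+ m * (weight m x + weight m (z - x))) / weight m z.
    by field; rewrite !gt_eqF.
  by rewrite ler_pdivlMr// mul1r.
have mwV : measurable_fun setT (fun x => (Num.sqrt (w x))^-1).
  apply: measurable_inv_ge1 ms _ => x; rewrite -sqrtr1 ler_wsqrtr// mulr_ege1 ?weight_ge1//.
have sf1 : sqint mu (fun x => (Num.sqrt (w x))^-1).
  split => //; apply: (intble_le _ ig); first exact: measurable_funX.
  move=> x; rewrite exprVn sqr_sqrtr ?(ltW (w1 x))// ger0_norm ?invr_ge0 ?(ltW (w1 x))//.
have cs := cauchy_schwarz sf1 sf2.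
rewrite -RintE// -EFinM lee_fin.
have -> : cnv p q z = \int[mu]_x ((Num.sqrt (w x))^-1 * (Num.sqrt (w x) * (p x * q (z - x)))).
  apply: eq_Rintegral => x _; rewrite mulKf// gt_eqF// sqrtr_gt0//.
apply: (le_trans (ler_wpM2l (ltW wz) cs)).
rewrite mulrA (_ : \int[mu]_x ((Num.sqrt (w x) * (p x * q (z - x))) ^+ 2) = \int[mu]_x G x); last first.
  by apply: eq_Rintegral => x _; rewrite GE.
rewrite ler_wpM2r ?Rint_ge0//.
have [_ i1] := sf1.
have := le_Rint i1 ig; move=> /(_ _)-/(_ _)/le_trans h.
apply: (@le_trans _ _ (weight m z * \int[mu]_x g x)).
  rewrite ler_wpM2l ?(ltW wz)//; apply: le_Rint => // x.
  by rewrite exprVn sqr_sqrtr ?(ltW (w1 x)).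
rewrite RintZ; last by apply: intbleD => //; exact: (intble_reflect z K).
rewrite RintD//; last exact: (intble_reflect z K).
rewrite (Rint_reflect z (intble_measurable K)) /cnv_cst.
set k := \int[mu]_x _.
rewrite (_ : weight m z * _ = 4 ^+ m * (2 * k)); first by rewrite lerDl.
by field; rewrite gt_eqF.
Qed.

(** Integrating the pointwise bound over [z], Tonelli and translation invariance factor the double
    integral. The constant does not involve the band limit, and this is what frees [c0] from
    [eps]. *)
Lemma weighted_cnv m rho p q : (d <= m)%N -> bandl rho p -> bandl rho q ->
  wsq m (cnv p q) <= cnv_cst m * (wsq m p * wsq m q).
Proof.
move=> dm pb qb; have [[mp _] _] := pb; have [[mq _] _] := qb.
have cb := bandl_cnv pb qb; have [[mc _] _] := cb.
have [ip iq] := (intble_wsq m pb, intble_wsq m qb).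
have [m1 m2] := (intble_measurable ip, intble_measurable iq).
rewrite -lee_fin RintE; last exact: intble_wsq cb.
pose G (t : V * V) := ((weight m t.2 * p t.2 ^+ 2) * (weight m (t.1 - t.2) * q (t.1 - t.2) ^+ 2))%:E.
have mG : measurable_fun setT G.
  apply/measurable_EFinP; exact: (measurable_cnv_kernel m1 m2).
have G0 t : (0 <= G t)%E by rewrite lee_fin mulr_ge0// wsqr_ge0.
apply: (@le_trans _ _ ((cnv_cst m)%:E * \int[mu]_z \int[mu]_x G (z, x))%E).
  rewrite -ge0_integralZl_EFin ?(ltW (cnv_cst_gt0 m))//; first last.
  - exact: measurable_integral_param.
  - by move=> z _; exact: integral_ge0.
  apply: ge0_le_integral => //.
  - by move=> z _; rewrite lee_fin mulr_ge0 ?weight_ge0 ?sqr_ge0.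
  - apply/measurable_EFinP; apply: measurable_funM; first exact: measurable_weight.
    exact: measurable_funX.
  - by apply: measurable_funeM; exact: measurable_integral_param.
  - by move=> z _; exact: weighted_cnv_pointwise.
rewrite EFinM lee_wpmul2l ?lee_fin ?(ltW (cnv_cst_gt0 m))//.
have -> := fubini_tonelli (m1 := mu) (m2 := mu) _ mG G0.
under eq_integral => x _.
  rewrite (_ : (\int[mu]_z _)%E = (weight m x * p x ^+ 2 * wsq m q)%:E); last first.
    have iqs := intble_rV_shift (- x) iq.
    rewrite /wsq -(Rint_rV_shift (- x) m2) -(RintZ _ iqs) RintE//.
    exact: (intbleZ _ iqs).
  over.
rewrite -RintE; last by under eq_fun do rewrite mulrC; exact: intbleZ.
rewrite lee_fin; under eq_Rintegral do rewrite mulrC.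
by rewrite RintZ// mulrC.
Qed.

Lemma wsq_opp m p : measurable_fun setT p -> wsq m (fun x => p (- x)) = wsq m p.
Proof.
move=> mp; rewrite /wsq -[RHS](@Rint_rV_opp _ d (fun x => weight m x * p x ^+ 2)).
  by apply: eq_Rintegral => x _; rewrite /weight enormN.
by apply: measurable_funM; [exact: measurable_weight|exact: measurable_funX].
Qed.

Lemma weighted_hconv m rho p q : (d <= m)%N -> bandl rho p -> bandl rho q ->
  wsq m (hconv p q) <= 4 * cnv_cst m * (wsq m p * wsq m q).
Proof.
move=> dm pb qb; have [pb' qb'] := (bandl_opp pb, bandl_opp qb).
have [[mp _] _] := pb; have [[mq _] _] := qb.
have c1 := bandl_cnv pb qb; have c2 := bandl_cnv pb qb'.
have c3 := bandl_cnv pb' qb; have c4 := bandl_cnv pb' qb'.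
have h1 := weighted_cnv dm pb qb; have h2 := weighted_cnv dm pb qb'.
have h3 := weighted_cnv dm pb' qb; have h4 := weighted_cnv dm pb' qb'.
rewrite !wsq_opp// in h2 h3 h4.
rewrite -mulrA; move: h1 h2 h3 h4; move: (cnv_cst m * _) => X h1 h2 h3 h4.
have i1 := intble_wsq m c1; have i2 := intble_wsq m c2.
have i3 := intble_wsq m c3; have i4 := intble_wsq m c4.
apply: (@le_trans _ _ (wsq m (cnv p q) + wsq m (cnv p (fun xi => q (- xi))) +
   wsq m (cnv (fun xi => p (- xi)) q) + wsq m (cnv (fun xi => p (- xi)) (fun xi => q (- xi))))).
  rewrite /wsq -!RintD//; [|by do ?apply: intbleD => //..].
  apply: le_Rint => [||z]; [exact: intble_wsq (bandl_hconv pb qb)|by do ?apply: intbleD => //|].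
  by rewrite -!mulrDr ler_wpM2l ?weight_ge0// sqr4_le.
move: h1 h2 h3 h4; move: (wsq m _) (wsq m _) (wsq m _) (wsq m _) => a1 a2 a3 a4; lra.
Qed.

Lemma wsq_le m rho p q : bandl rho q -> measurable_fun setT p ->
  (forall x, `|p x| <= `|q x|) -> wsq m p <= wsq m q.
Proof.
move=> qb mp pq; have iq := intble_wsq m qb.
have pqs x : weight m x * p x ^+ 2 <= weight m x * q x ^+ 2.
  rewrite ler_wpM2l ?weight_ge0// -(real_normK (num_real (p x))) -(real_normK (num_real (q x))).
  by rewrite lerXn2r ?nnegrE.
apply: le_Rint => //; apply: (intble_le _ iq).
  by apply: measurable_funM; [exact: measurable_weight|exact: measurable_funX].
by move=> x; rewrite ger0_norm// mulr_ge0 ?weight_ge0 ?sqr_ge0.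
Qed.

End weighted_convolution.

(** * Integration in time *)

Section caratheodory.
Context {R : realType} {d0} {T : measurableType d0}.

Lemma measurable_countable_slices {dX} {X : measurableType dX} (I : countType)
    (q : X -> I) (pt : I -> X) (F : T -> X -> R) :
  (forall i, measurable (q @^-1` [set i])) ->
  (forall i, measurable_fun setT (F^~ (pt i))) ->
  measurable_fun setT (fun p : T * X => F p.1 (pt (q p.2))).
Proof.
move=> mq mF _ Y mY; rewrite setTI.
rewrite (_ : _ @^-1` Y = \bigcup_i (((F^~ (pt i)) @^-1` Y) `*` (q @^-1` [set i]))).
  apply: countable_bigcupT_measurable => [|i]; first exact: countableP.
  by apply: measurableX => //; rewrite -[X in measurable X]setTI; exact: mF.
apply/seteqP; split => [[t x] /= tx|[t x] [i _] /= [Yt /= qx]]; first by exists (q x).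
by rewrite qx.
Qed.

(** Caratheodory functions are jointly measurable: [x] is replaced by the corner of its cell in a
    grid of mesh 1 / (k + 1), which takes countably many values, and continuity in [x] gives the
    limit. *)
Lemma measurable_continuous_rV {d : nat} (F : T -> 'rV[R]_d -> R) :
  (forall x, measurable_fun setT (F^~ x)) -> (forall t, continuous (F t)) ->
  measurable_fun setT (fun p : T * 'rV[R]_d => F p.1 p.2).
Proof.
move=> mF cF.
pose q (k : nat) (x : 'rV[R]_d) : {ffun 'I_d -> int} :=
  [ffun i => Num.floor (x ord0 i * k.+1%:R)].
pose pt (k : nat) (z : {ffun 'I_d -> int}) : 'rV[R]_d := \row_i ((z i)%:~R / k.+1%:R).
apply: (@measurable_fun_cvg _ _ _ _ (fun k p => F p.1 (pt k (q k p.2)))) => [k|[t x] _ /=].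
  apply: measurable_countable_slices => // z.
  rewrite (_ : _ @^-1` _ = \bigcap_(i in [set: 'I_d])
      ((fun x : 'rV[R]_d => x ord0 i) @^-1` `[((z i)%:~R / k.+1%:R)%R, (((z i + 1)%:~R) / k.+1%:R)%R[)).
    apply: fin_bigcap_measurable => // i _; rewrite -[X in measurable X]setTI.
    by apply: (measurable_rV_coord i) => //; exact: measurable_itv.
  have E (y : R) (n : int) : (Num.floor (y * k.+1%:R) == n) =
      (n%:~R / k.+1%:R <= y < (n + 1)%:~R / k.+1%:R).
    by rewrite floor_eq ler_pdivrMr// ltr_pdivlMr.
  apply/seteqP; split => [x <- i _|x zx] /=.
    by rewrite in_itv/= -E ffunE.
  apply/ffunP => i; rewrite ffunE; apply/eqP; rewrite E.
  by have := zx i I; rewrite /= in_itv.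
have Fx := nbhs_filter x.
apply/cvgrPdist_lt => e e0; have /cvgrPdist_lt /(_ _ e0) := cF t x.
move=> /nbhs_ballP[r /= r0 xr]; near=> k; apply: xr.
split => // i j; rewrite (ord1 i) /ball/= mxE ffunE.
have h := floor_le (x ord0 j * k.+1%:R); have h2 := floorD1_gt (x ord0 j * k.+1%:R).
set z := Num.floor _ in h h2 *.
have k0 : 0 < k.+1%:R :> R by [].
rewrite ger0_norm; last by rewrite subr_ge0 ler_pdivrMr.
rewrite (_ : x ord0 j - _ = (x ord0 j * k.+1%:R - z%:~R) / k.+1%:R); last first.
  by rewrite mulrBl mulfK// gt_eqF.
rewrite ltr_pdivrMr// (@lt_le_trans _ _ 1)//.
  by move: h2; rewrite intrD; lra.
rewrite -ler_pdivrMl// mulr1.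
near: k; exists (Num.truncn r^-1) => // k /= rk.
by rewrite (le_trans (ltW (truncnS_gt r^-1)))// ler_nat.
Unshelve. all: by end_near. Qed.

Lemma measurable_continuous_R (F : T -> R -> R) :
  (forall s, measurable_fun setT (F^~ s)) -> (forall t, continuous (F t)) ->
  measurable_fun setT (fun p : T * R => F p.1 p.2).
Proof.
move=> mF cF.
have h : measurable_fun setT (fun p : T * 'rV[R]_1 => F p.1 (p.2 ord0 ord0)).
  apply: (@measurable_continuous_rV 1 (fun t x => F t (x ord0 ord0))) => // t x.
  apply: (@cvg_comp _ _ _ (fun x : 'rV[R]_1 => x ord0 ord0) (F t) _ (nbhs (x ord0 ord0))); last exact: cF.
  exact: coord_continuous.
have hc : measurable_fun [set: T * R] (fun p : T * R => (p.1, \row_(i < 1) p.2)).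
  apply: measurable_fun_pair => //=; apply: measurable_fun_rV => i.
  by under eq_fun do rewrite mxE; exact: measurable_snd.
have := measurableT_comp h hc; congr measurable_fun.
by apply/funext => -[t s] /=; rewrite mxE.
Qed.

End caratheodory.

Section time_integral.
Context {R : realType}.
Local Notation leb := (@lebesgue_measure R).
Implicit Types (f g : R -> R) (s t : R).

(** For [t <= 0] the value is 0, so families built from it live on the whole line and are constant
    for negative times. *)
Definition tint f t : R := \int[leb]_(s in `[0, t]) f s.

Lemma continuous_integrable f a b : continuous f -> leb.-integrable `[a, b] (EFin \o f).
Proof.
move=> cf; apply: continuous_compact_integrable; first exact: segment_compact.
exact: continuous_subspaceT.
Qed.

Lemma tintB f g t : continuous f -> continuous g ->
  tint (fun s => f s - g s) t = tint f t - tint g t.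
Proof. by move=> cf cg; rewrite /tint RintegralB//; exact: continuous_integrable. Qed.

Lemma tint_lt0 f t : t <= 0 -> tint f t = 0.
Proof.
move=> t0; rewrite /tint; have [->|tn0] := eqVneq t 0.
  by rewrite set_itv1 Rintegral_set1.
by rewrite set_itv_ge ?Rintegral_set0// bnd_simp -ltNge lt_neqAle tn0.
Qed.

Lemma le_tint f g t : continuous f -> continuous g ->
  (forall s, 0 <= s <= t -> f s <= g s) -> tint f t <= tint g t.
Proof.
move=> cf cg fg; apply: le_Rintegral => //; exact: continuous_integrable.
Qed.

Lemma normr_tint f g t : continuous f -> continuous g ->
  (forall s, 0 <= s <= t -> `|f s| <= g s) -> `|tint f t| <= tint g t.
Proof.
move=> cf cg fg; rewrite (le_trans (le_normr_Rintegral _ _))//.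
  exact: continuous_integrable.
apply: le_tint => //; move=> s; apply: cvg_norm; exact: cf.
Qed.

Lemma continuous_cst_fun (c : R) : continuous (fun _ : R => c).
Proof. by move=> s; exact: cvg_cst. Qed.

Lemma tint_cst (c : R) t : 0 <= t -> tint (fun=> c) t = c * t.
Proof.
move=> t0; rewrite /tint Rintegral_cst//= lebesgue_measure_itv/= lte_fin.
by case: ltP => [_|t0'] /=; [rewrite subr0|have -> : t = 0 by lra].
Qed.

Lemma tint_sub_le f (K : R) s t : continuous f -> 0 <= s <= t ->
  (forall u, s <= u <= t -> `|f u| <= K) -> `|tint f t - tint f s| <= K * (t - s).
Proof.
move=> cf /andP[s0 st] fK.
rewrite /tint (@Rintegral_itvB _ f (BLeft 0) (BRight t) s)//; try exact: continuous_integrable.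
have mi : measurable (`]s, t] : set (measurableTypeR R)) by exact: measurable_itv.
have si : `]s, t] `<=` `[s, t] by apply: subset_itvr; rewrite bnd_simp.
have iS g : continuous g -> leb.-integrable `]s, t] (EFin \o g).
  by move=> cg; apply: (integrableS _ mi si); [exact: measurable_itv|exact: continuous_integrable].
rewrite (le_trans (le_normr_Rintegral _ _))//; first exact: iS.
apply: (@le_trans _ _ (\int[leb]_(x in `]s, t]) K)).
  apply: le_Rintegral => //.
  - by apply: iS => u; apply: cvg_norm; exact: cf.
  - by apply: (iS (fun=> K)); exact: continuous_cst_fun.
  - by move=> u /= /si; rewrite /= in_itv/=; exact: fK.
rewrite Rintegral_cst//= lebesgue_measure_itv/= lte_fin.
by case: ltP => [_|ts] //=; rewrite (_ : t = s) ?subrr//; apply/le_anti/andP.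
Qed.

Lemma tint_lip f (K T : R) s t : continuous f -> 0 <= K ->
  (forall u, 0 <= u <= T -> `|f u| <= K) -> s <= T -> t <= T ->
  `|tint f s - tint f t| <= K * `|s - t|.
Proof.
move=> cf K0 fK.
have H u v : u <= v -> v <= T -> `|tint f v - tint f u| <= K * (v - u).
  move=> uv vT; have [u0|/ltW u0] := leP 0 u.
    apply: tint_sub_le => //; first by rewrite u0.
    by move=> r /andP[ur rv]; apply: fK; rewrite (le_trans u0)//= (le_trans rv).
  rewrite (tint_lt0 _ u0); have [v0|/ltW v0] := leP 0 v; last first.
    by rewrite (tint_lt0 _ v0) subrr normr0 mulr_ge0// subr_ge0.
  rewrite -(@tint_lt0 f 0)//; apply: (@le_trans _ _ (K * (v - 0))).
    by apply: tint_sub_le => //; [rewrite lexx|move=> r /andP[r0 rv]; apply: fK; rewrite r0 (le_trans rv)].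
  by rewrite ler_wpM2l//; lra.
move=> sT tT; have [st|/ltW ts] := leP s t.
  by rewrite distrC [X in K * X]distrC [X in K * X]ger0_norm ?subr_ge0//; exact: H.
by rewrite [X in K * X]ger0_norm ?subr_ge0//; exact: H.
Qed.

Lemma tint_derive_eq (F f : R -> R) t : 0 <= t -> continuous f -> continuous F ->
  (forall s, 0 < s -> s < t -> is_derive s 1 F (f s)) -> tint f t = F t - F 0.
Proof.
rewrite le_eqVlt => /predU1P[<-|t0] cf cF dF; first by rewrite tint_lt0// subrr.
rewrite /tint /Rintegral (@continuous_FTC2 _ f F 0 t)//.
- exact: continuous_subspaceT.
- split; first by move=> s; rewrite in_itv/= => /andP[s0 st]; case: (dF s s0 st).
  + by apply: cvg_at_right_filter; exact: cF.
  + by apply: cvg_at_left_filter; exact: cF.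
- move=> s; rewrite in_itv/= => /andP[s0 st]; rewrite derive1E.
  by have [_ ->] := dF s s0 st.
Qed.

Lemma is_derive_tint f t : continuous f -> 0 < t -> is_derive t 1 (tint f) (f t).
Proof.
move=> cf t0; have tt1 : t < t + 1 by rewrite ltrDl.
have [dd de] := @continuous_FTC1_closed _ f 0 t (t + 1) tt1 (continuous_integrable _ _ cf) t0 (cf t).
split; first exact: dd.
by rewrite -derive1E.
Qed.

Lemma continuous_tint f : continuous f -> continuous (tint f).
Proof.
move=> cf t; have [M fM] : exists M : R, forall u : R, 0 <= u <= `|t| + 1 -> `|f u| <= M.
  have /compact_bounded[M [_ /(_ (M + 1))]] :=
    continuous_compact (continuous_subspaceT cf) (@segment_compact R 0 (`|t| + 1)).
  rewrite ltrDl ltr01 => /(_ isT) h; exists (M + 1) => u ut; apply: h; exists u => //.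
pose K : R := `|M|; have K0 : 0 <= K by exact: normr_ge0.
have fK (u : R) : 0 <= u <= `|t| + 1 -> `|f u| <= K.
  by move=> /fM /le_trans; apply; exact: ler_norm.
apply/cvgrPdist_lt => e e0; near=> s.
apply: (@le_lt_trans _ _ (K * `|t - s|)).
  apply: (tint_lip cf _ fK) => //.
    by have := ler_norm t; lra.
  have : `|t - s| < 1 by near: s; apply: cvgr_dist_lt.
  by have := ler_norm t; have := ler_norm (s - t); rewrite distrC; lra.
have : `|t - s| < e / (K + 1).
  by near: s; apply: cvgr_dist_lt => //; rewrite divr_gt0// ltr_wpDl.
rewrite ltr_pdivlMr ?ltr_wpDl// mulrDr mulr1 => he.
by apply: (le_lt_trans _ he); rewrite mulrC lerDl.
Unshelve. all: by end_near. Qed.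

Lemma continuousM_fun f g : continuous f -> continuous g -> continuous (fun s => f s * g s).
Proof. by move=> cf cg s; apply: cvgM; [exact: cf|exact: cg]. Qed.

(** The chain rule for the square of a primitive; applied at each frequency it yields the energy
    identity. *)
Lemma tint_sqr f (c : R) t : continuous f -> 0 <= t ->
  (c + tint f t) ^+ 2 = c ^+ 2 + tint (fun s => 2 * ((c + tint f s) * f s)) t.
Proof.
move=> cf t0; have ct := continuous_tint cf.
have ca : continuous (fun s => c + tint f s).
  by move=> s; apply: cvgD; [exact: cvg_cst|exact: ct].
have -> : tint (fun s => 2 * ((c + tint f s) * f s)) t =
    (c + tint f t) ^+ 2 - (c + tint f 0) ^+ 2; last first.
  by rewrite (tint_lt0 _ (lexx 0)) addr0 [RHS]addrC subrK.
apply: (@tint_derive_eq (fun s => (c + tint f s) ^+ 2)) => //.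
- by apply: continuousM_fun; [exact: continuous_cst_fun|exact: continuousM_fun].
- by move=> s; apply: (cvgM (ca s) (ca s)).
- move=> s s0 _; have ds := is_derive_tint cf s0.
  by apply: is_derive_eq; rewrite add0r /GRing.scale/=; ring.
Qed.

Lemma tint_expR (k : R) t : 0 <= t -> k != 0 ->
  tint (fun s => expR (k * s)) t = (expR (k * t) - 1) / k.
Proof.
move=> t0 k0.
have ck : continuous (fun s : R => expR (k * s)).
  move=> s; apply: (@cvg_comp _ _ _ (fun s => k * s) expR _ (nbhs (k * s))).
    by apply: cvgM; [exact: cvg_cst|exact: cvg_id].
  by have := @continuous_expR R (k * s).
rewrite mulrBl mul1r -[X in _ - X](_ : expR (k * 0) / k = _); last by rewrite mulr0 expR0 mul1r.
apply: (@tint_derive_eq (fun s => expR (k * s) / k)) => //.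
- by move=> s; apply: cvgM; [exact: ck|exact: cvg_cst].
- move=> s _ _; apply: is_derive_eq; rewrite /GRing.scale/=; by field.
Qed.

End time_integral.

(** * Picard iteration *)

Section picard.
Context {R : realType} {J : Type}.
Variables (P : (J -> R) -> Prop) (h a0 : J -> R) (Phi : (J -> R) -> J -> R) (L : R).
Implicit Types (a b : R -> J -> R) (s t : R).

(** [J] will consist of pairs of a population index and a frequency, [P] will be measurability in
    the frequency and [h] a fixed majorant: convergence is pointwise, and only real-valued functions
    of time are integrated. *)
Definition dominated (x : J -> R) : Prop := exists C : R, forall j, `|x j| <= C * h j.

Hypothesis h0 : forall j, 0 <= h j.
Hypothesis L0 : 0 < L.
Hypothesis Pa0 : P a0.
Hypothesis a0h : forall j, `|a0 j| <= h j.
Hypothesis PPhi : forall x, P x -> dominated x -> P (Phi x).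
Hypothesis Phi_le : forall x (C : R), P x -> 0 <= C -> (forall j, `|x j| <= C * h j) ->
  forall j, `|Phi x j| <= L * C * h j.
Hypothesis Phi_lip : forall x y (C : R), P x -> P y -> dominated x -> dominated y -> 0 <= C ->
  (forall j, `|x j - y j| <= C * h j) -> forall j, `|Phi x j - Phi y j| <= L * C * h j.
Hypothesis Ptint : forall b t, (forall s, P (b s)) -> (forall j, continuous (b^~ j)) ->
  P (fun j => a0 j + tint (b^~ j) t).
Hypothesis Plim : forall (x_ : nat -> J -> R) x, (forall k, P (x_ k)) ->
  (forall j, x_ k j @[k --> \oo] --> x j) -> P x.

(** Exponential weight in time: with exponent [2 * L], integrating an [L]-Lipschitz field contracts
    by 1/2 on the whole time line at once. *)
Let E t : R := expR (2 * L * `|t|).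

Let E_ge1 t : 1 <= E t.
Proof. by rewrite -expR0 ler_expR !mulr_ge0// ltW. Qed.

Let E_ge0 t : 0 <= E t. Proof. exact: le_trans ler01 (E_ge1 t). Qed.

Let E_le s t : `|s| <= t -> E s <= E t.
Proof.
move=> st; have L2 : 0 <= 2 * L by rewrite mulr_ge0// ltW.
by rewrite ler_expR ler_wpM2l// (ger0_norm (le_trans (normr_ge0 s) st)).
Qed.

Let E_sub s t : 0 <= s <= t -> E s <= E t.
Proof. by move=> /andP[s0 st]; apply: E_le; rewrite ger0_norm. Qed.

Let continuous_E : continuous E.
Proof.
move=> s; apply: (@cvg_comp _ _ _ (fun s => 2 * L * `|s|) expR _ (nbhs (2 * L * `|s|))).
  by apply: cvgM; [exact: cvg_cst|exact: cvg_norm].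
by have := @continuous_expR R (2 * L * `|s|).
Qed.

Let tint_E (c : R) t : 0 <= c -> tint (fun s => c * E s) t <= c * (E t - 1) / (2 * L).
Proof.
move=> c0; have L2 : 0 < 2 * L by rewrite mulr_gt0.
have [t0|/ltW t0] := leP 0 t; last first.
  by rewrite tint_lt0// !mulr_ge0 ?invr_ge0 ?(ltW L2)// subr_ge0.
rewrite -mulrA {2}/E (ger0_norm t0) -tint_expR ?gt_eqF//.
have ck : continuous (fun s : R => expR (2 * L * s)).
  move=> s; apply: (@cvg_comp _ _ _ (fun s => 2 * L * s) expR _ (nbhs (2 * L * s))).
    by apply: cvgM; [exact: cvg_cst|exact: cvg_id].
  by have := @continuous_expR R (2 * L * s).
rewrite /tint -RintegralZl//; last exact: continuous_integrable.
apply: le_tint.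
- by apply: continuousM_fun => //; exact: continuous_cst_fun.
- by apply: continuousM_fun => //; exact: continuous_cst_fun.
- by move=> s /andP[s0 _]; rewrite /E ger0_norm.
Qed.

(** Lipschitz control in time makes [Phi] continuous along an iterate, so that the next integral
    makes sense. *)
Let tlip a : Prop := forall T s t j, `|s| <= T -> `|t| <= T ->
  `|a s j - a t j| <= L * E T * `|s - t| * h j.

Let good a : Prop := [/\ forall t, P (a t), forall t j, `|a t j| <= E t * h j & tlip a].

Let good_dominated a t : good a -> dominated (a t).
Proof. by move=> [_ ah _]; exists (E t) => j. Qed.

Let continuous_Phi a j : good a -> continuous (fun s => Phi (a s) j).
Proof.
move=> ga t; have [Pa ah la] := ga.
pose K := L * (L * E (`|t| + 1)) * h j.
have K0 : 0 <= K by rewrite !mulr_ge0// ltW.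
apply/cvgrPdist_lt => e e0; near=> s.
have s1 : `|t - s| < 1 by near: s; apply: cvgr_dist_lt.
apply: (@le_lt_trans _ _ (K * `|t - s|)).
  have := @Phi_lip (a t) (a s) (L * E (`|t| + 1) * `|t - s|) (Pa t) (Pa s)
    (good_dominated t ga) (good_dominated s ga).
  rewrite !mulr_ge0 ?(ltW L0)// => /(_ isT) H.
  have -> : K * `|t - s| = L * (L * E (`|t| + 1) * `|t - s|) * h j by rewrite /K; ring.
  apply: H => i; apply: la; first by rewrite lerDl.
  have := ler_normB t (t - s); rewrite subKr => /le_trans; apply.
  by rewrite lerD2l ltW.
have : `|t - s| < e / (K + 1).
  by near: s; apply: cvgr_dist_lt => //; rewrite divr_gt0// ltr_wpDl.
rewrite ltr_pdivlMr ?ltr_wpDl// mulrDr mulr1 => he.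
by apply: (le_lt_trans _ he); rewrite mulrC lerDl.
Unshelve. all: by end_near. Qed.

Let Phi_E a t j : good a -> `|Phi (a t) j| <= L * E t * h j.
Proof. by move=> [Pa ah _]; apply: Phi_le. Qed.

Let step a t j : R := a0 j + tint (fun s => Phi (a s) j) t.

Let good_step a : good a -> good (step a).
Proof.
move=> ga; have [Pa ah la] := ga.
have L2 : 0 < 2 * L by rewrite mulr_gt0.
split.
- move=> t; apply: (@Ptint (fun s => Phi (a s))) => [s|j]; last exact: continuous_Phi.
  by apply: PPhi => //; exact: good_dominated.
- move=> t j; apply: (le_trans (ler_normD _ _)).
  have := normr_tint (t := t) (@continuous_Phi a j ga)
    (continuousM_fun (@continuous_cst_fun R (L * h j)) continuous_E).
  move=> /(_ _)/le_trans => H; have : `|tint (fun s => Phi (a s) j) t| <= L * h j * (E t - 1) / (2 * L).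
    apply: H (tint_E _ _); first by move=> s _; rewrite mulrAC; exact: Phi_E.
    by rewrite mulr_ge0// ltW.
  (* The new bound is h + h (E - 1) / 2, which stays below E h because E >= 1. *)
  rewrite (_ : L * h j * (E t - 1) / (2 * L) = h j * (E t - 1) / 2); last by field; rewrite gt_eqF.
  have := a0h j; have := E_ge1 t; have := h0 j; move: (h j) (E t) => x y; nra.
- move=> T s t j sT tT; rewrite /step opprD addrACA subrr add0r [leRHS]mulrAC.
  have T0 := le_trans (normr_ge0 s) sT.
  apply: (@tint_lip _ _ _ T).
  + exact: continuous_Phi.
  + by rewrite !mulr_ge0// ltW.
  + move=> u uT; apply: (le_trans (Phi_E u j ga)); rewrite -!mulrA ler_wpM2l ?(ltW L0)//.
    by rewrite ler_wpM2r// E_sub.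
  + exact: le_trans (ler_norm s) sT.
  + exact: le_trans (ler_norm t) tT.
Qed.

Fixpoint picard_iter (k : nat) : R -> J -> R :=
  if k is k'.+1 then step (picard_iter k') else fun=> a0.
Local Notation A := picard_iter.

Let good_iter k : good (A k).
Proof.
elim: k => [|k IH] /=; last exact: good_step.
split=> // [t j|T s t j sT tT].
  by rewrite (le_trans (a0h j))// ler_peMl.
by rewrite subrr normr0 !mulr_ge0// ltW.
Qed.

Let step_close a b (c : R) t j : good a -> good b -> 0 <= c ->
  (forall s i, `|a s i - b s i| <= c * E s * h i) ->
  `|step a t j - step b t j| <= c / 2 * E t * h j.
Proof.
move=> ga gb c0 ab; rewrite /step opprD addrACA subrr add0r -tintB; try exact: continuous_Phi.
have L2 : 0 < 2 * L by rewrite mulr_gt0.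
have [Pa _ _] := ga; have [Pb _ _] := gb.
apply: (le_trans (normr_tint (g := fun s => L * c * h j * E s) _ _ _)).
- by move=> s; apply: cvgB; exact: continuous_Phi.
- by apply: continuousM_fun => //; exact: continuous_cst_fun.
- move=> s _; have := @Phi_lip (a s) (b s) (c * E s) (Pa s) (Pb s)
    (good_dominated s ga) (good_dominated s gb).
  rewrite mulr_ge0// => /(_ isT) H.
  by rewrite (_ : L * c * h j * E s = L * (c * E s) * h j); [exact: H|ring].
apply: (le_trans (tint_E _ _)); first by rewrite !mulr_ge0// ltW.
rewrite (_ : L * c * h j * (E t - 1) / (2 * L) = c / 2 * h j * (E t - 1)); last by field; rewrite gt_eqF.
rewrite [leRHS]mulrAC ler_wpM2l//; last by rewrite gerBl.
by rewrite !mulr_ge0// invr_ge0.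
Qed.

Let iter_close k t j : `|A k.+1 t j - A k t j| <= (2 * 2^-1 ^+ k) * E t * h j.
Proof.
elim: k t j => [|k IH] t j.
  have [_ h1 _] := good_iter 1; have [_ h2 _] := good_iter 0.
  rewrite expr0 mulr1 (le_trans (ler_normB _ _))//.
  by have := h1 t j; have := h2 t j; lra.
rewrite -[A k.+2]/(step (A k.+1)) -[X in _ - X]/(step (A k) t j) exprSr mulrA.
by apply: step_close => //; rewrite mulr_ge0// exprn_ge0.
Qed.

(** The sequences u_k - 2 c 2^-k and u_k + 2 c 2^-k are monotone in opposite directions; the
    supremum of the first is the limit, with an explicit rate. *)
Let geometric_limit (u : nat -> R) (c : R) : 0 <= c ->
  (forall k, `|u k.+1 - u k| <= c * 2^-1 ^+ k) ->
  exists l, forall k, `|u k - l| <= 2 * c * 2^-1 ^+ k.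
Proof.
move=> c0 uc.
pose v k := u k - 2 * c * 2^-1 ^+ k; pose w k := u k + 2 * c * 2^-1 ^+ k.
have S k : v k <= v k.+1 /\ w k.+1 <= w k.
  have := uc k; rewrite /v /w exprSr ler_norml; move: (2^-1 ^+ k) => x; lra.
have vm k i : v k <= v (k + i)%N.
  by elim: i => [|i IH]; rewrite ?addn0// addnS (le_trans IH)//; case: (S (k + i)%N).
have wm k i : w (k + i)%N <= w k.
  by elim: i => [|i IH]; rewrite ?addn0// addnS (le_trans _ IH)//; case: (S (k + i)%N).
have vw k i : v k <= w i.
  rewrite (le_trans (vm k i))// addnC (le_trans _ (wm i k))// /v /w.
  have : 0 <= 2 * c * 2^-1 ^+ (i + k) by rewrite !mulr_ge0// exprn_ge0.
  by move: (2^-1 ^+ _) => x; lra.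
have hs : has_sup (range v).
  by split; [exists (v 0%N); exists 0%N|exists (w 0%N) => _ [k _ <-]].
exists (sup (range v)) => k; rewrite ler_norml.
have h1 : v k <= sup (range v) by apply: sup_upper_bound => //; exists k.
have h2 : sup (range v) <= w k by apply: sup_le_ub => [|_ [i _ <-]//]; exists (v 0%N); exists 0%N.
by move: h1 h2; rewrite /v /w; move: (sup _) (2 * c * _) => x y; lra.
Qed.

Lemma picard_global : exists a,
  [/\ forall t, P (a t),
      forall t j, `|a t j| <= E t * h j,
      forall T s t j, `|s| <= T -> `|t| <= T -> `|a s j - a t j| <= L * E T * `|s - t| * h j,
      forall j, continuous (fun s => Phi (a s) j) &
      forall t j, a t j = a0 j + tint (fun s => Phi (a s) j) t].
Proof.
have cE t j : 0 <= 2 * E t * h j by rewrite !mulr_ge0.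
have /choice[a ha] : forall tj : R * J, exists l, forall k,
    `|A k tj.1 tj.2 - l| <= 2 * (2 * E tj.1 * h tj.2) * 2^-1 ^+ k.
  by move=> [t j]; apply: geometric_limit => // k; rewrite /= (_ : _ * _ = 2 * 2^-1 ^+ k * E t * h j) ?iter_close//; ring.
have e2 : (2^-1 ^+ k : R) @[k --> \oo] --> 0.
  by apply: cvg_expr; rewrite ger0_norm ?invr_ge0// invf_lt1// ltr1n.
have lim t j : A k t j @[k --> \oo] --> a (t, j).
  apply: (cvg_dist_squeeze (fun k => ha (t, j) k)).
  rewrite -[X in _ --> X](mulr0 (2 * (2 * E t * h j))).
  by apply: cvgM => //; exact: cvg_cst.
have le_lim (u : nat -> R) (l c : R) : u k @[k --> \oo] --> l -> (forall k, `|u k| <= c) -> `|l| <= c.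
  move=> ul uc; apply: (ler_cvg_to (cvg_norm ul) (cvg_cst c)); exact: nearW.
pose b t j := a (t, j).
have gb : good b.
  split.
  - by move=> t; apply: (Plim (x_ := fun k => A k t)) => [k|j]; [case: (good_iter k)|exact: lim].
  - by move=> t j; apply: (le_lim (fun k => A k t j)) => [|k]; [exact: lim|case: (good_iter k)].
  - move=> T s t j sT tT; apply: (le_lim (fun k => A k s j - A k t j)).
      by apply: cvgB; exact: lim.
    by move=> k; have [_ _] := good_iter k; apply.
have [Pb bh lb] := gb.
exists b; split=> //; first by move=> j; exact: continuous_Phi.
(* The limit is a fixed point: [A k.+1] is [step (A k)], and both sides converge. *)
move=> t j; have : step (A k) t j @[k --> \oo] --> step b t j.
  apply: (@cvg_dist_squeeze _ _ (fun k => (4 * 2^-1 ^+ k) / 2 * E t * h j)).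
    move=> k; apply: (@step_close (A k) b (4 * 2^-1 ^+ k)) => //.
    by move=> s i; apply: (le_trans (ha (s, i) k)); rewrite /= le_eqVlt; apply/orP; left; apply/eqP; ring.
  rewrite (_ : (fun k => _) = (fun k => 2^-1 ^+ k * (2 * E t * h j))); last first.
    by apply/funext => k; field.
  rewrite -[X in _ --> X](mul0r (2 * E t * h j)).
  by apply: cvgM => //; exact: cvg_cst.
move=> c1; have c2 := lim t j.
rewrite -cvg_shiftS /= in c2.
exact: (cvg_unique (@Rhausdorff R) c2 c1).
Qed.

End picard.

(** * The equation on the frequency side *)

Section finite_sums.
Context {R : realType}.

(** The variance of [x] under the weights is nonnegative. *)
Lemma jensen_sqr n (w x : 'I_n -> R) : (forall i, 0 <= w i) -> \sum_i w i = 1 ->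
  (\sum_i w i * x i) ^+ 2 <= \sum_i w i * x i ^+ 2.
Proof.
move=> w0 w1; set m := \sum_i w i * x i.
have : 0 <= \sum_i w i * (x i - m) ^+ 2.
  by apply: sumr_ge0 => i _; rewrite mulr_ge0// sqr_ge0.
have -> : \sum_i w i * (x i - m) ^+ 2 = \sum_i w i * x i ^+ 2 - 2 * m * m + m ^+ 2 * 1.
  transitivity (\sum_i (w i * x i ^+ 2 - 2 * m * (w i * x i) + m ^+ 2 * w i)).
    by apply: eq_bigr => i _; ring.
  by rewrite big_split/= sumrB -!mulr_sumr w1.
by rewrite mulr1 !expr2; lra.
Qed.

Lemma sqr_sum_le n (x : 'I_n -> R) : (\sum_i x i) ^+ 2 <= n%:R * \sum_i x i ^+ 2.
Proof.
case: n x => [|n] x; first by rewrite !big_ord0 expr0n mul0r.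
have n0 : n.+1%:R != 0 :> R by rewrite pnatr_eq0.
have w1 : \sum_(i < n.+1) (n.+1%:R^-1 : R) = 1.
  by rewrite sumr_const card_ord -[LHS]mulr_natl mulfV.
have := @jensen_sqr n.+1 (fun=> n.+1%:R^-1) x (fun=> ltac:(by rewrite invr_ge0)) w1.
rewrite -!mulr_sumr exprMn exprVn expr2 invfM -mulrA ler_pM2l ?invr_gt0//.
by rewrite mulrC ler_pdivrMr ?ltr0n// mulrC.
Qed.

Lemma ler_norm_sum_bound n (x : 'I_n -> R) (M : R) : (forall i, `|x i| <= M) ->
  `|\sum_i x i| <= n%:R * M.
Proof.
move=> xM; rewrite (le_trans (ler_norm_sum _ _ _))//.
apply: (@le_trans _ _ (\sum_(i < n) M)); first exact: ler_sum.
by rewrite sumr_const card_ord mulr_natl.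
Qed.

(** The optimal parameter is b / a; passing to [a + r] and [b + r] keeps it meaningful when one of
    them is 0. This recovers Minkowski's inequality from Young's. *)
Lemma sqrD_opt (z a b : R) : 0 <= a -> 0 <= b ->
  (forall t, 0 < t -> z <= (1 + t) * a ^+ 2 + (1 + t^-1) * b ^+ 2) -> z <= (a + b) ^+ 2.
Proof.
move=> a0 b0 H; apply/ler_addgt0Pr => e e0.
pose c := 4 * (a + b) + 4; have c0 : 0 < c by rewrite /c; lra.
pose r := Num.min 1 (e / c).
have r0 : 0 < r by rewrite lt_min ltr01 divr_gt0.
have r1 : r <= 1 by rewrite ge_min lexx.
have rc : r * c <= e by rewrite -ler_pdivlMr// ge_min lexx orbT.
have ar : 0 < a + r by lra.
have br : 0 < b + r by lra.
have := H ((b + r) / (a + r)) (divr_gt0 br ar); move/le_trans; apply.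
apply: (@le_trans _ _ ((1 + (b + r) / (a + r)) * (a + r) ^+ 2 +
    (1 + ((b + r) / (a + r))^-1) * (b + r) ^+ 2)).
  by apply: lerD; apply: ler_wpM2l; rewrite ?lerXn2r ?nnegrE ?addr_ge0 ?invr_ge0 ?divr_ge0//; lra.
have -> : (1 + (b + r) / (a + r)) * (a + r) ^+ 2 + (1 + ((b + r) / (a + r))^-1) * (b + r) ^+ 2
   = (a + r + (b + r)) ^+ 2 by field; rewrite !gt_eqF.
rewrite (_ : (a + r + (b + r)) ^+ 2 = (a + b) ^+ 2 + r * (4 * (a + b) + 4 * r)); last by ring.
by rewrite lerD2l (le_trans _ rc)// ler_wpM2l ?(ltW r0)// /c; lra.
Qed.

End finite_sums.

Section vector_field.
Context {R : realType} {d n : nat}.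
Local Notation V := 'rV[R]_d.
Local Notation mu := (@lebesgue_rV R d).
Variables (v : 'I_n.+1 -> V) (w : 'I_n.+1 -> R) (cs nu eps : R).
Hypothesis iso : isotropic_lattice v w cs.
Hypothesis eps0 : 0 < eps.
Hypothesis nu0 : 0 < nu.
Local Notation vc i a := (v i ord0 a).
Local Notation delta a b := ((a == b)%:R : R).
Local Notation rho := (eps^-1).
Implicit Types (st : 'I_n.+1 -> V -> R) (xi x : V) (s r : R).

Definition bl st : Prop := forall i, bandl rho (st i).

Definition velH st a xi : R := \sum_j w j * vc j a * st j xi.

Definition momP st a b : V -> R := ballcut rho (hconv (velH st a) (velH st b)).

(* The factor [s] scales the quadratic term: 1 for the equation itself, the square of
   the truncation factor [theta] for the truncated one. *)
Definition quadH s st i xi : R :=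
  (2 * cs ^+ 4)^-1 * \sum_a \sum_b (vc i a * vc i b - cs ^+ 2 * delta a b) * (s * momP st a b xi).

Definition eqH s st i xi : R :=
  \sum_j w j * st j xi + (\sum_a vc i a * velH st a xi) / cs ^+ 2 + eps * quadH s st i xi.

Definition transH st i xi : R := \sum_a vc i a * dmult a (st i) xi.

Definition fieldH s st i xi : R :=
  (eps * nu)^-1 * (eqH s st i xi - st i xi) - transH st i xi.

Lemma bandl_velH st a : bl st -> bandl rho (velH st a).
Proof. by move=> bs; apply: bandl_sum => i; apply: bandlZ. Qed.

Lemma bandl_momP st a b : bl st -> bandl rho (momP st a b).
Proof.
move=> bs; apply: bandl_ballcut.
by case: (bandl_hconv (bandl_velH a bs) (bandl_velH b bs)).
Qed.

Lemma bandl_quadH s st i : bl st -> bandl rho (quadH s st i).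
Proof.
move=> bs; apply: bandlZ; apply: bandl_sum => a; apply: bandl_sum => b.
by apply: bandlZ; apply: bandlZ; exact: bandl_momP.
Qed.

Lemma bandl_eqH s st i : bl st -> bandl rho (eqH s st i).
Proof.
move=> bs; apply: bandlD; last by apply: bandlZ; exact: bandl_quadH.
apply: bandlD; first by apply: bandl_sum => j; apply: bandlZ.
under eq_fun do rewrite mulrC; apply: bandlZ; apply: bandl_sum => a.
by apply: bandlZ; exact: bandl_velH.
Qed.

Lemma bandl_transH st i : bl st -> bandl rho (transH st i).
Proof. by move=> bs; apply: bandl_sum => a; apply: bandlZ; exact: bandl_dmult. Qed.

Lemma bandl_fieldH s st i : bl st -> bandl rho (fieldH s st i).
Proof.
move=> bs; apply: bandlB; last exact: bandl_transH.
by apply: bandlZ; apply: bandlB => //; exact: bandl_eqH.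
Qed.

Definition hart st i : V -> R := hartley (st i).

Lemma cutoff_hart st i : bl st -> cutoff eps (hart st i) = hartley (st i).
Proof. by move=> bs; exact: cutoff_hartley_id. Qed.

Lemma bulk_velocity_hart st a : bl st -> bulk_velocity v w eps (hart st) a = hartley (velH st a).
Proof.
move=> bs; apply/funext => x; rewrite /bulk_velocity /velH hartley_sum; last first.
  by move=> i; apply: intbleZ; exact: bandl_intble.
by apply: eq_bigr => i _; rewrite cutoff_hart// hartleyZ//; exact: bandl_intble.
Qed.

Lemma equilibrium_hart st i x : bl st ->
  equilibrium v w cs eps (hart st) i x = hartley (eqH 1 st i) x.
Proof.
move=> bs.
have iv a := bandl_intble (bandl_velH a bs).
have im a b := bandl_intble (bandl_momP a b bs).
have is_ j := bandl_intble (bs j).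
have E1 : density w eps (hart st) x = hartley (fun xi => \sum_j w j * st j xi) x.
  rewrite hartley_sum; last by move=> j; exact: intbleZ.
  by apply: eq_bigr => j _; rewrite cutoff_hart// hartleyZ.
have E2 : \sum_a vc i a * bulk_velocity v w eps (hart st) a x =
    hartley (fun xi => \sum_a vc i a * velH st a xi) x.
  rewrite hartley_sum; last by move=> j; exact: intbleZ.
  by apply: eq_bigr => a _; rewrite bulk_velocity_hart// hartleyZ.
(* The product of two band-limited functions has its spectrum in the ball of radius 2 rho; the outer
   cutoff of the equation brings it back to rho. *)
have E3 a b : cutoff eps (fun y => bulk_velocity v w eps (hart st) a y *
    bulk_velocity v w eps (hart st) b y) x = hartley (momP st a b) x.
  have [bv1 bv2] := (bandl_velH a bs, bandl_velH b bs).
  rewrite -[RHS](congr1 (fun f => f x) (cutoff_hartleyE eps (bandl_hconv bv1 bv2))).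
  congr (cutoff eps _ x); apply/funext => y.
  by rewrite !bulk_velocity_hart// (hartley_hconv y bv1 bv2).
rewrite /equilibrium E1 E2.
under eq_bigr do under eq_bigr do rewrite E3.
have i1 : intble mu (fun xi => \sum_j w j * st j xi).
  by apply: intble_sum => j _; exact: intbleZ.
have i2 : intble mu (fun xi => \sum_a vc i a * velH st a xi).
  by apply: intble_sum => j _; exact: intbleZ.
have i3 a : intble mu (fun xi => \sum_b (vc i a * vc i b - cs ^+ 2 * delta a b) * (1 * momP st a b xi)).
  by apply: intble_sum => b _; apply: intbleZ; exact: intbleZ.
have i4 : intble mu (quadH 1 st i) by exact: bandl_intble (bandl_quadH _ _ bs).
have E4 : \sum_a \sum_b (vc i a * vc i b - cs ^+ 2 * delta a b) * hartley (momP st a b) x =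
  hartley (fun xi => \sum_a \sum_b (vc i a * vc i b - cs ^+ 2 * delta a b) * (1 * momP st a b xi)) x.
  rewrite hartley_sum; last exact: i3.
  apply: eq_bigr => a _; rewrite hartley_sum.
    by apply: eq_bigr => b _; rewrite hartleyZ ?hartleyZ ?mul1r//; exact: intbleZ.
  by move=> b; apply: intbleZ; exact: intbleZ.
rewrite E4 /eqH hartleyD; [|apply: intbleD => //|exact: intbleZ]; last first.
  by under eq_fun do rewrite mulrC; exact: intbleZ.
rewrite hartleyD//; last by under eq_fun do rewrite mulrC; exact: intbleZ.
have -> : hartley (fun xi => (\sum_a vc i a * velH st a xi) / cs ^+ 2) x =
   (cs ^+ 2)^-1 * hartley (fun xi => \sum_a vc i a * velH st a xi) x.
  by rewrite -hartleyZ//; congr hartley; apply/funext => xi; rewrite mulrC.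
rewrite hartleyZ// /quadH hartleyZ; last by apply: intble_sum => a _; exact: i3.
congr (_ + _ + _); first exact: mulrC.
by rewrite mulrA.
Qed.

Lemma lbgk_rhs_hart st i x : bl st ->
  lbgk_rhs v w cs nu eps (hart st) i x = hartley (fieldH 1 st i) x.
Proof.
move=> bs; have ie := bandl_intble (bandl_eqH 1 i bs); have ia := bandl_intble (bs i).
have it := bandl_intble (bandl_transH i bs).
rewrite /lbgk_rhs equilibrium_hart// cutoff_hart// /fieldH hartleyB//; last first.
  by apply: intbleZ; exact: intbleB.
rewrite hartleyZ ?hartleyB//; last exact: intbleB.
congr (_ - _); rewrite /transport /transH hartley_sum; last first.
  by move=> a; apply: intbleZ; apply: bandl_intble (bandl_dmult a (bs i)).
apply: eq_bigr => a _; rewrite (deriveE_hartley _ _ (bs i)) hartleyZ//.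
exact: bandl_intble (bandl_dmult a (bs i)).
Qed.

(* The moments of [eqH s st - st] vanish, so it is orthogonal to the affine part of [eqH]. *)
Lemma relaxation_le s st xi :
  \sum_i w i * (2 * (st i xi * (eqH s st i xi - st i xi))) <=
  - (\sum_i w i * (eqH s st i xi - st i xi) ^+ 2) + eps ^+ 2 * \sum_i w i * quadH s st i xi ^+ 2.
Proof.
have [_ _ w0 cs0 m0 m1 m2 m3 _] := iso.
have cs2 : cs ^+ 2 != 0 by rewrite gt_eqF// exprn_gt0.
set D := fun i => eqH s st i xi - st i xi.
set q := fun i => quadH s st i xi.
set u := fun a => velH st a xi.
set p := \sum_j w j * st j xi.
(* Isotropy up to order three annihilates the mass and, in [qm1], the momentum of the quadratic
   part. *)
have qm0 : \sum_i w i * q i = 0.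
  under eq_bigr do rewrite /q /quadH mulrCA mulr_sumr.
  rewrite -mulr_sumr exchange_big/= big1 ?mulr0// => a _.
  under eq_bigr do rewrite mulr_sumr.
  rewrite exchange_big/= big1// => b _.
  transitivity (\sum_i (w i * vc i a * vc i b - cs ^+ 2 * delta a b * w i) * (s * momP st a b xi)).
    by apply: eq_bigr => i _; ring.
  by rewrite -mulr_suml sumrB m2 -mulr_sumr m0 mulr1 subrr mul0r.
have qm1 c : \sum_i w i * vc i c * q i = 0.
  under eq_bigr do rewrite /q /quadH mulrCA mulr_sumr.
  rewrite -mulr_sumr exchange_big/= big1 ?mulr0// => a _.
  under eq_bigr do rewrite mulr_sumr.
  rewrite exchange_big/= big1// => b _.
  transitivity (\sum_i (w i * vc i c * vc i a * vc i b - cs ^+ 2 * delta a b * (w i * vc i c)) *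
      (s * momP st a b xi)).
    by apply: eq_bigr => i _; ring.
  by rewrite -mulr_suml sumrB m3 -mulr_sumr m1 mulr0 subrr mul0r.
have lin0 : \sum_i w i * ((\sum_a vc i a * u a) / cs ^+ 2) = 0.
  under eq_bigr do rewrite mulrA mulr_sumr.
  rewrite -mulr_suml exchange_big/= big1 ?mul0r// => a _.
  by under eq_bigr do rewrite mulrA; rewrite -mulr_suml m1 mul0r.
have lin1 c : \sum_i w i * vc i c * ((\sum_a vc i a * u a) / cs ^+ 2) = u c.
  under eq_bigr do rewrite mulrA mulr_sumr.
  rewrite -mulr_suml exchange_big/=.
  under eq_bigr do under eq_bigr do rewrite mulrA.
  under eq_bigr do rewrite -mulr_suml m2.
  rewrite (bigD1 c)//= eqxx mulr1 big1 ?addr0; last first.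
    by move=> a ac; rewrite eq_sym (negbTE ac) mulr0 mul0r.
  by rewrite mulrC mulKf.
have D0 : \sum_i w i * D i = 0.
  rewrite /D /eqH -/p.
  under eq_bigr do rewrite mulrBr !mulrDr [w _ * (eps * _)]mulrCA.
  by rewrite sumrB !big_split/= lin0 -mulr_sumr qm0 mulr0 !addr0 -mulr_suml m0 mul1r subrr.
have D1 c : \sum_i w i * vc i c * D i = 0.
  rewrite /D /eqH -/p.
  under eq_bigr do rewrite mulrBr !mulrDr [w _ * _ * (eps * _)]mulrCA.
  by rewrite sumrB !big_split/= lin1 -mulr_sumr qm1 mulr0 addr0 -mulr_suml m1 mul0r add0r subrr.
have GD : \sum_i w i * (eqH s st i xi * D i) = eps * \sum_i w i * (q i * D i).
  transitivity (\sum_i (p * (w i * D i) + ((\sum_a u a * (w i * vc i a * D i)) / cs ^+ 2 +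
      eps * (w i * (q i * D i))))).
    apply: eq_bigr => i _; rewrite /eqH -/p.
    have -> : \sum_a u a * (w i * vc i a * D i) = w i * D i * \sum_a vc i a * u a.
      by rewrite mulr_sumr; apply: eq_bigr => a _; ring.
    by rewrite -/(q i); ring.
  rewrite big_split/= -mulr_sumr D0 mulr0 add0r big_split/= -mulr_suml exchange_big/= big1 ?mul0r ?add0r ?mulr_sumr//.
  by move=> a _; rewrite -mulr_sumr D1 mulr0.
have -> : \sum_i w i * (2 * (st i xi * D i)) =
    2 * (eps * \sum_i w i * (q i * D i)) - 2 * \sum_i w i * D i ^+ 2.
  rewrite -GD !mulr_sumr -sumrB; apply: eq_bigr => i _; rewrite /D; ring.
rewrite -subr_ge0.
have -> : - (\sum_i w i * D i ^+ 2) + eps ^+ 2 * (\sum_i w i * q i ^+ 2)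
   - (2 * (eps * \sum_i w i * (q i * D i)) - 2 * \sum_i w i * D i ^+ 2) =
   \sum_i w i * (D i - eps * q i) ^+ 2.
  transitivity (\sum_i w i * D i ^+ 2 + eps ^+ 2 * (\sum_i w i * q i ^+ 2)
     - (2 * (eps * \sum_i w i * (q i * D i)))); first by ring.
  by rewrite !mulr_sumr -big_split -sumrB/=; apply: eq_bigr => i _; ring.
by apply: sumr_ge0 => i _; rewrite mulr_ge0 ?sqr_ge0// ltW.
Qed.

(** The spectrum of a derivative carries a factor [xi] and a reflection, so the integrand is odd:
    this is the skew-adjointness of transport in every H^m. *)
Lemma transport_integral0 m st i : bl st ->
  \int[mu]_xi (weight m xi * (st i xi * transH st i xi)) = 0.
Proof.
move=> bs; have ms := intble_measurable (bandl_intble (bs i)).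
have mt := intble_measurable (bandl_intble (bandl_transH i bs)).
set F := fun xi => _.
have mF : measurable_fun setT F.
  by apply: measurable_funM; [exact: measurable_weight|exact: measurable_funM].
have : \int[mu]_xi F xi = \int[mu]_xi (- F xi).
  rewrite -[LHS](@Rint_rV_opp _ d F)//; apply: eq_Rintegral => xi _.
  rewrite /F /weight enormN -mulrN; congr (_ * _); rewrite /transH -mulrN -sumrN !mulr_sumr.
  by apply: eq_bigr => a _; rewrite /dmult !mxE opprK; ring.
have iF : intble mu F.
  have b1 := bs i; have b2 := bandl_transH i bs.
  have := sqint_mul (proj1 (bandl_bounded_mul (@measurable_weight R d m)
    (M := (1 + rho ^+ 2) ^+ m) _ b1)) (proj1 b2).
  under eq_fun do rewrite -mulrA; apply.
  by move=> xi xr; rewrite ger0_norm ?weight_ge0// weight_bounded.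
rewrite RintN// => h; lra.
Qed.

End vector_field.

Ltac nonneg := repeat first
  [ done | exact: ltW | exact: sqr_ge0 | exact: normr_ge0 | exact: pi_ge0
  | rewrite invr_ge0 | apply: mulr_ge0 | apply: exprn_ge0 | apply: addr_ge0 ].

(** * Bounds on the vector field and its truncation *)

Section estimates.
Context {R : realType} {d n : nat}.
Local Notation V := 'rV[R]_d.
Local Notation mu := (@lebesgue_rV R d).
Variables (v : 'I_n.+1 -> V) (w : 'I_n.+1 -> R) (cs nu eps : R) (m : nat).
Hypothesis iso : isotropic_lattice v w cs.
Hypothesis eps0 : 0 < eps.
Hypothesis nu0 : 0 < nu.
Local Notation vc i a := (v i ord0 a).
Local Notation delta a b := ((a == b)%:R : R).
Local Notation rho := (eps^-1).
Implicit Types (st : 'I_n.+1 -> V -> R) (xi x : V) (s r : R).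
Local Notation bl := (bl eps).
Local Notation velH := (velH v w).
Local Notation momP := (momP v w eps).
Local Notation quadH := (quadH v w cs eps).
Local Notation eqH := (eqH v w cs eps).
Local Notation transH := (transH v).
Local Notation fieldH := (fieldH v w cs nu eps).

Let w0 i : 0 < w i. Proof. by case: iso. Qed.
Let cs0 : 0 < cs. Proof. by case: iso. Qed.
Let w1 : \sum_i w i = 1. Proof. by case: iso. Qed.

Lemma weight_le1 i : w i <= 1.
Proof. by rewrite -w1 (bigD1 i)//= lerDl sumr_ge0// => j _; exact: ltW. Qed.

(** The summand 1 keeps the bound positive whatever the velocities are. *)
Definition vbound : R := 1 + \sum_i \sum_a `|vc i a|.

Lemma vbound_ge1 : 1 <= vbound.
Proof. by rewrite lerDl; apply: sumr_ge0 => i _; exact: sumr_ge0. Qed.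

Lemma vbound_gt0 : 0 < vbound. Proof. exact: lt_le_trans ltr01 vbound_ge1. Qed.

Lemma normr_vc_le i a : `|vc i a| <= vbound.
Proof.
rewrite /vbound (bigD1 i)//= (bigD1 a)//= addrCA -!addrA lerDl !addr_ge0//.
- exact: sumr_ge0.
- by apply: sumr_ge0 => j _; exact: sumr_ge0.
Qed.

Definition tbound : R := vbound ^+ 2 + cs ^+ 2.

Lemma tbound_gt0 : 0 < tbound. Proof. by rewrite addr_gt0// exprn_gt0// vbound_gt0. Qed.

Lemma normr_tensor_le i a b : `|vc i a * vc i b - cs ^+ 2 * delta a b| <= tbound.
Proof.
rewrite (le_trans (ler_normB _ _))// lerD// normrM.
  by rewrite expr2 ler_pM// normr_vc_le.
rewrite (ger0_norm (sqr_ge0 _)) ler_piMr ?sqr_ge0// ger0_norm ?ler0n//.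
by case: (a == b).
Qed.

Definition ysq st : R := \sum_i w i * wsq m (st i).
Definition nrm st : R := Num.sqrt (ysq st).

Lemma ysq_ge0 st : 0 <= ysq st.
Proof. by apply: sumr_ge0 => i _; rewrite mulr_ge0 ?(ltW (w0 i))// wsq_ge0. Qed.

Lemma nrm_ge0 st : 0 <= nrm st. Proof. exact: sqrtr_ge0. Qed.

Lemma sqr_nrm st : nrm st ^+ 2 = ysq st. Proof. by rewrite sqr_sqrtr// ysq_ge0. Qed.

Lemma bl_measurable st i : bl st -> measurable_fun setT (st i).
Proof. by move=> bs; exact: intble_measurable (bandl_intble (bs i)). Qed.

Lemma wsqZ r (p : V -> R) : bandl rho p -> wsq m (fun xi => r * p xi) = r ^+ 2 * wsq m p.
Proof.
move=> bp; rewrite /wsq -RintZ; last exact: intble_wsq bp.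
by apply: eq_Rintegral => xi _; ring.
Qed.

Lemma velH_sqr_le st a xi : velH st a xi ^+ 2 <= vbound ^+ 2 * \sum_i w i * st i xi ^+ 2.
Proof.
have := @jensen_sqr R n.+1 w (fun j => vc j a * st j xi) (fun i => ltW (w0 i)) w1.
rewrite (_ : \sum_i w i * (vc i a * st i xi) = velH st a xi); last first.
  by apply: eq_bigr => i _; rewrite mulrA.
move/le_trans; apply; rewrite mulr_sumr; apply: ler_sum => i _.
have wi := w0 i; have vb := vbound_gt0; rewrite exprMn mulrCA; apply: ler_wpM2r; first by nonneg.
rewrite -(real_normK (num_real (vc i a))) ler_pXn2r ?nnegrE ?(ltW vb)//.
exact: normr_vc_le.
Qed.

Lemma wsq_velH st a : bl st -> wsq m (velH st a) <= vbound ^+ 2 * ysq st.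
Proof.
move=> bs; have bv := bandl_velH v w a bs.
have iw i := intble_wsq m (bs i).
have isum : intble mu (fun xi => \sum_i w i * (weight m xi * st i xi ^+ 2)).
  by apply: intble_sum => i _; exact: intbleZ.
rewrite /ysq /wsq; under [X in _ * X]eq_bigr do rewrite -RintZ//.
rewrite -Rint_sum; last by move=> i _; exact: intbleZ.
rewrite -RintZ//; apply: le_Rint => [||xi].
- exact: intble_wsq bv.
- exact: intbleZ.
have := ler_wpM2l (weight_ge0 m xi) (velH_sqr_le st a xi); move/le_trans; apply.
rewrite mulrCA ler_wpM2l ?sqr_ge0// mulr_sumr; apply: ler_sum => i _.
by rewrite mulrCA.
Qed.

Lemma l2sq_le_wsq (p : V -> R) : bandl rho p -> l2sq p <= wsq m p.
Proof.
move=> bp; have [[_ i2] _] := bp; apply: le_Rint => //; first exact: intble_wsq bp.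
by move=> xi; rewrite ler_peMl ?sqr_ge0// weight_ge1.
Qed.

(** The cutoff can only decrease the weighted norm, so the bound does not involve [eps]. *)
Lemma wsq_momP st a b : (d <= m)%N -> bl st ->
  wsq m (momP st a b) <= 4 * @cnv_cst R d m * (vbound ^+ 4 * ysq st ^+ 2).
Proof.
move=> dm bs; have [b1 b2] := (bandl_velH v w a bs, bandl_velH v w b bs).
have bh := bandl_hconv b1 b2.
apply: (@le_trans _ _ (wsq m (hconv (velH st a) (velH st b)))).
  apply: (wsq_le m bh) => [|xi]; last exact: ballcut_le.
  by apply: measurable_ballcut; exact: intble_measurable (bandl_intble bh).
apply: (le_trans (weighted_hconv dm b1 b2)).
rewrite ler_wpM2l ?mulr_ge0 ?(ltW (cnv_cst_gt0 m))//.
rewrite (_ : vbound ^+ 4 * _ = (vbound ^+ 2 * ysq st) * (vbound ^+ 2 * ysq st)); last by ring.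
by rewrite ler_pM ?wsq_ge0 ?wsq_velH.
Qed.

(** The constant from which [c0] is made, free of [eps] and [nu]. The tensor has d^2 entries,
    counted once by Cauchy-Schwarz and once by the summation of the norms. *)
Definition quad_cst : R :=
  (2 * cs ^+ 4)^-1 ^+ 2 * (d%:R ^+ 4 * tbound ^+ 2 * (4 * @cnv_cst R d m * vbound ^+ 4)).

Lemma quad_cst_gt0 : (0 < d)%N -> 0 < quad_cst.
Proof.
move=> d0; have cs4 : 0 < (2 * cs ^+ 4)^-1 by rewrite invr_gt0 mulr_gt0// exprn_gt0.
have dp : 0 < d%:R :> R by rewrite ltr0n.
apply: mulr_gt0; first exact: exprn_gt0.
apply: mulr_gt0; first by rewrite mulr_gt0// exprn_gt0// tbound_gt0.
by rewrite mulr_gt0 ?exprn_gt0 ?vbound_gt0// mulr_gt0// cnv_cst_gt0.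
Qed.

Lemma quadH_sqr_le s st i xi : quadH s st i xi ^+ 2 <=
  ((2 * cs ^+ 4)^-1 ^+ 2 * (d%:R ^+ 2 * tbound ^+ 2 * s ^+ 2)) * \sum_a \sum_b momP st a b xi ^+ 2.
Proof.
rewrite /quadH exprMn -[leRHS]mulrA; apply: ler_wpM2l; first exact: sqr_ge0.
apply: (le_trans (sqr_sum_le _)).
apply: (@le_trans _ _ (d%:R * \sum_(a < d) (d%:R * \sum_(b < d) tbound ^+ 2 * (s ^+ 2 * momP st a b xi ^+ 2)))).
  apply: ler_wpM2l => //; apply: ler_sum => a _.
  apply: (le_trans (sqr_sum_le _)); apply: ler_wpM2l => //; apply: ler_sum => b _.
  rewrite !exprMn; apply: ler_wpM2r; first by nonneg.
  rewrite -(real_normK (num_real (_ - _))) ler_pXn2r ?nnegrE ?(ltW tbound_gt0)//.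
  exact: normr_tensor_le.
under eq_bigr do rewrite -!mulr_sumr.
by rewrite -!mulr_sumr le_eqVlt; apply/orP; left; apply/eqP; ring.
Qed.

Lemma quad_energy s st : (d <= m)%N -> bl st ->
  \sum_i w i * wsq m (quadH s st i) <= quad_cst * (s * ysq st) ^+ 2.
Proof.
move=> dm bs; set C := (2 * cs ^+ 4)^-1 ^+ 2 * (d%:R ^+ 2 * tbound ^+ 2 * s ^+ 2).
have C0 : 0 <= C by rewrite mulr_ge0 ?sqr_ge0// mulr_ge0 ?sqr_ge0// mulr_ge0 ?sqr_ge0.
have iP a b := intble_wsq m (bandl_momP v w a b bs).
have iPs a : intble mu (fun xi => \sum_b weight m xi * momP st a b xi ^+ 2).
  by apply: intble_sum => b _; exact: iP.
have iPss : intble mu (fun xi => \sum_a \sum_b weight m xi * momP st a b xi ^+ 2).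
  by apply: intble_sum => b _; exact: iPs.
have H i : wsq m (quadH s st i) <= quad_cst * (s * ysq st) ^+ 2.
  apply: (@le_trans _ _ (C * \sum_a \sum_b wsq m (momP st a b))).
    rewrite /wsq; under [X in _ * X]eq_bigr do rewrite -Rint_sum//.
    rewrite -Rint_sum// -RintZ//; apply: le_Rint => [||xi].
    - exact: intble_wsq (bandl_quadH v w cs s i bs).
    - exact: intbleZ.
    have := ler_wpM2l (weight_ge0 m xi) (quadH_sqr_le s st i xi); move/le_trans; apply.
    rewrite -/C mulrCA ler_wpM2l// mulr_sumr; apply: ler_sum => a _.
    by rewrite mulr_sumr.
  apply: (@le_trans _ _ (C * (d%:R * (d%:R * (4 * @cnv_cst R d m * (vbound ^+ 4 * ysq st ^+ 2)))))).
    apply: ler_wpM2l => //; apply: (@le_trans _ _ (\sum_(a < d) (d%:R * (4 * @cnv_cst R d m * (vbound ^+ 4 * ysq st ^+ 2))))).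
      apply: ler_sum => a _.
      apply: (@le_trans _ _ (\sum_(b < d) (4 * @cnv_cst R d m * (vbound ^+ 4 * ysq st ^+ 2)))).
        by apply: ler_sum => b _; exact: wsq_momP.
      by rewrite sumr_const card_ord [leRHS]mulr_natl.
    by rewrite sumr_const card_ord [leRHS]mulr_natl.
  by rewrite le_eqVlt; apply/orP; left; apply/eqP; rewrite /C /quad_cst; ring.
apply: (@le_trans _ _ (\sum_i w i * (quad_cst * (s * ysq st) ^+ 2))).
  by apply: ler_sum => i _; rewrite ler_wpM2l ?(ltW (w0 i)).
by rewrite -mulr_suml w1 mul1r.
Qed.

Lemma blB st st' : bl st -> bl st' -> bl (fun i xi => st i xi - st' i xi).
Proof. by move=> b1 b2 i; exact: bandlB. Qed.

Lemma blZ r st : bl st -> bl (fun i xi => r * st i xi).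
Proof. by move=> b1 i; exact: bandlZ. Qed.

Lemma nrmZ r st : bl st -> nrm (fun i xi => r * st i xi) = `|r| * nrm st.
Proof.
move=> bs; rewrite /nrm -sqrtr_sqr -sqrtrM ?sqr_ge0//; congr Num.sqrt.
by rewrite /ysq mulr_sumr; apply: eq_bigr => i _; rewrite wsqZ// mulrCA.
Qed.

Lemma nrmD st st' : bl st -> bl st' -> nrm (fun i xi => st i xi + st' i xi) <= nrm st + nrm st'.
Proof.
move=> b1 b2; rewrite -(@ler_pXn2r _ 2)// ?nnegrE ?addr_ge0 ?nrm_ge0//.
apply: sqrD_opt; rewrite ?nrm_ge0// => t t0; rewrite !sqr_nrm /ysq !mulr_sumr -big_split/=.
apply: ler_sum => i _; rewrite ![_ * (w i * _)]mulrCA -mulrDr ler_wpM2l ?(ltW (w0 i))//.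
have [i1 i2] := (intble_wsq m (b1 i), intble_wsq m (b2 i)).
rewrite /wsq -!RintZ// -RintD; [|exact: intbleZ..].
apply: le_Rint => [||xi].
- exact: intble_wsq (bandlD (b1 i) (b2 i)).
- by apply: intbleD; exact: intbleZ.
by rewrite ![_ * (weight m xi * _)]mulrCA -mulrDr ler_wpM2l ?weight_ge0// sqrD_split.
Qed.

Lemma nrmB st st' : bl st -> bl st' ->
  `|nrm st - nrm st'| <= nrm (fun i xi => st i xi - st' i xi).
Proof.
move=> b1 b2.
have h1 := nrmD (blB b1 b2) b2.
have h2 := nrmD (blB b2 b1) b1.
rewrite (_ : (fun i xi => _ + _) = st) in h1; last first.
  by apply/funext => i; apply/funext => xi; rewrite subrK.
rewrite (_ : (fun i xi => st' i xi - st i xi + _) = st') in h2; last first.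
  by apply/funext => i; apply/funext => xi; rewrite subrK.
have h3 : nrm (fun i xi => st' i xi - st i xi) = nrm (fun i xi => st i xi - st' i xi).
  rewrite (_ : (fun i xi => st' i xi - st i xi) = fun i xi => -1 * (st i xi - st' i xi)).
    by rewrite nrmZ ?normrN1 ?mul1r//; exact: blB.
  by apply/funext => i; apply/funext => xi; ring.
by rewrite ler_norml; lra.
Qed.

(* Radial truncation at radius [M]: it makes the quadratic term globally Lipschitz. *)
Definition theta (M : R) st : R := M / Num.max M (nrm st).

Section theta.
Variable M : R.
Hypothesis M0 : 0 < M.

Lemma theta_ge0 st : 0 <= theta M st.
Proof. by rewrite divr_ge0 ?ltW// lt_max M0. Qed.

Lemma theta_le1 st : theta M st <= 1.
Proof. by rewrite ler_pdivrMr ?mul1r ?le_max ?lexx// lt_max M0. Qed.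

Lemma theta_nrm st : theta M st * nrm st <= M.
Proof.
rewrite /theta mulrAC ler_pdivrMr ?lt_max ?M0//.
by rewrite ler_wpM2l ?(ltW M0)// le_max lexx orbT.
Qed.

Lemma theta1 st : nrm st <= M -> theta M st = 1.
Proof. by move=> sM; rewrite /theta max_l// divff// gt_eqF. Qed.

(** The map is the radial retraction onto the ball of radius [M]. Splitting off
    [theta M st * (st - st')] leaves a radial part, and each of the two is at most the distance of
    the states. *)
Lemma theta_lip st st' : bl st -> bl st' ->
  nrm (fun i xi => theta M st * st i xi - theta M st' * st' i xi) <=
  2 * nrm (fun i xi => st i xi - st' i xi).
Proof.
move=> b1 b2; set D := nrm (fun i xi => st i xi - st' i xi).
have -> : (fun i xi => theta M st * st i xi - theta M st' * st' i xi) =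
  (fun i xi => theta M st * (st i xi - st' i xi) + (theta M st - theta M st') * st' i xi).
  by apply/funext => i; apply/funext => xi; ring.
have b3 := blB b1 b2.
apply: (le_trans (nrmD (blZ _ b3) (blZ _ b2))).
rewrite !nrmZ// -/D (_ : 2 * D = D + D); last by ring.
apply: lerD.
  by rewrite ger0_norm ?theta_ge0// ler_piMl ?nrm_ge0// theta_le1.
set p := Num.max M (nrm st); set q := Num.max M (nrm st').
have p0 : 0 < p by rewrite lt_max M0.
have q0 : 0 < q by rewrite lt_max M0.
have -> : theta M st - theta M st' = (M / p) * ((q - p) / q).
  by rewrite /theta -/p -/q; field; rewrite !gt_eqF.
have pq : `|q - p| <= D.
  have := nrmB b1 b2; rewrite -/D /p /q ler_norml => /andP[h1 h2].
  have D0 : 0 <= D by exact: nrm_ge0.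
  rewrite ler_norml; apply/andP.
  by case: (leP M (nrm st)) => h3; case: (leP M (nrm st')) => h4; split; lra.
have Mp : `|M / p| <= 1 by rewrite ger0_norm ?ler_pdivrMr ?mul1r ?le_max ?lexx//; nonneg.
have nq : nrm st' / q <= 1 by rewrite ler_pdivrMr// mul1r le_max lexx orbT.
have qV : 0 <= q^-1 by nonneg.
have ns := nrm_ge0 st'.
rewrite normrM [X in _ * X * _]normrM (ger0_norm qV) -!mulrA [q^-1 * _]mulrC.
apply: (@le_trans _ _ (1 * (D * 1))); last by rewrite mul1r mulr1.
by apply: ler_pM => //; [nonneg|apply: ler_pM => //; nonneg].
Qed.

End theta.

Lemma l2sq_velH st a : bl st -> l2sq (velH st a) <= (vbound * nrm st) ^+ 2.
Proof.
move=> bs; rewrite exprMn sqr_nrm.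
exact: le_trans (l2sq_le_wsq (bandl_velH v w a bs)) (wsq_velH a bs).
Qed.

Lemma hconv_nrm st st' a b xi : bl st -> bl st' ->
  `|hconv (velH st a) (velH st' b) xi| <= 2 * vbound ^+ 2 * (nrm st * nrm st').
Proof.
move=> b1 b2; have [[s1 _] [s2 _]] := (bandl_velH v w a b1, bandl_velH v w b b2).
have vb := vbound_gt0.
have [k1 k2] := (nrm_ge0 st, nrm_ge0 st').
rewrite -(@ler_pXn2r _ 2)// ?nnegrE; [|nonneg..]; rewrite real_normK ?num_real//.
apply: (le_trans (hconv_sqr_le xi s1 s2)).
rewrite (_ : (2 * vbound ^+ 2 * (nrm st * nrm st')) ^+ 2 =
  4 * ((vbound * nrm st) ^+ 2 * (vbound * nrm st') ^+ 2)); last by ring.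
by rewrite ler_wpM2l// ler_pM ?l2sq_ge0// l2sq_velH.
Qed.

Lemma velHB r r' st st' a : (fun xi => r * velH st a xi - r' * velH st' a xi) =
  velH (fun i xi => r * st i xi - r' * st' i xi) a.
Proof.
apply/funext => xi; rewrite /Submission.velH !mulr_sumr -sumrB.
by apply: eq_bigr => i _; ring.
Qed.

(** By homogeneity the scalars move into the states, and bilinearity bounds the result by a
    difference times a sum. The bound is uniform in [xi], because a convolution of L^2 functions is
    bounded. *)
Lemma momP_diff r r' st st' a b xi : 0 <= r -> 0 <= r' -> bl st -> bl st' ->
  `|r ^+ 2 * momP st a b xi - r' ^+ 2 * momP st' a b xi| <=
  2 * vbound ^+ 2 * (nrm (fun i xi => r * st i xi - r' * st' i xi) * (r * nrm st + r' * nrm st')).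
Proof.
move=> r0 r0' b1 b2; have vb := vbound_gt0.
rewrite /Submission.momP /ballcut; case: ifP => _; last first.
  by rewrite !mulr0 subrr normr0; nonneg; exact: nrm_ge0.
have bv s st0 c : bl st0 -> sqint mu (fun xi => s * velH st0 c xi).
  by move=> b0; apply: sqintZ; case: (bandl_velH v w c b0).
have bv1 st0 c : bl st0 -> sqint mu (velH st0 c) by move=> b0; case: (bandl_velH v w c b0).
rewrite -(hconvZ r _ (bv1 st a b1) (bv1 st b b1)) -(hconvZ r' _ (bv1 st' a b2) (bv1 st' b b2)).
rewrite (hconvB _ (bv r st a b1) (bv r' st' a b2) (bv r st b b1) (bv r' st' b b2)).
rewrite !velHB; set st2 := (fun i xi => r * st i xi - r' * st' i xi).
have E s st0 c : (fun xi => s * velH st0 c xi) = velH (fun i xi => s * st0 i xi) c.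
  by apply/funext => x; rewrite /Submission.velH mulr_sumr; apply: eq_bigr => i _; ring.
rewrite !E; have b3 : bl st2 by apply: blB; exact: blZ.
apply: (le_trans (ler_normD _ _)).
apply: (le_trans (lerD (hconv_nrm _ _ _ b3 (blZ r b1)) (hconv_nrm _ _ _ (blZ r' b2) b3))).
rewrite !nrmZ// (ger0_norm r0) (ger0_norm r0').
by rewrite le_eqVlt; apply/orP; left; apply/eqP; ring.
Qed.

Definition field_cst : R :=
  (eps * nu)^-1 * (2 + d%:R * (vbound * vbound) / cs ^+ 2 + eps * ((2 * cs ^+ 4)^-1 * tbound))
  + d%:R * (vbound * (2 * pi * rho)).

Lemma field_cst_gt0 : 0 < field_cst.
Proof.
have vb := vbound_gt0; have tb := tbound_gt0.
rewrite ltr_pwDl//; last by nonneg.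
rewrite mulr_gt0 ?invr_gt0 ?mulr_gt0// -addrA ltr_pwDl//.
by have c0 := cs0; nonneg.
Qed.

(** The reflected argument appears because the spectrum of a derivative is taken at [- xi]. The
    momentum terms are kept apart, being nonlocal in [xi]. *)
Lemma field_diff s s' st st' i xi : enorm xi < rho ->
  `|fieldH s st i xi - fieldH s' st' i xi| <= field_cst *
   (\sum_j `|st j xi - st' j xi| + `|st i (- xi) - st' i (- xi)|
    + \sum_a \sum_b `|s * momP st a b xi - s' * momP st' a b xi|).
Proof.
move=> xr; have vb := vbound_gt0; have tb := tbound_gt0.
set D1 := \sum_j `|st j xi - st' j xi|; set D2 := `|st i (- xi) - _|.
set D3 := \sum_a \sum_b `|s * _ - _|.
have D10 : 0 <= D1 by exact: sumr_ge0.
have D20 : 0 <= D2 by exact: normr_ge0.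
have D30 : 0 <= D3 by apply: sumr_ge0 => a _; exact: sumr_ge0.
have di : `|st i xi - st' i xi| <= D1 by rewrite /D1 (bigD1 i)//= lerDl sumr_ge0.
have wD (c : 'I_n.+1 -> R) (B : R) : 0 <= B -> (forall j, `|c j| <= B) ->
    `|\sum_j w j * c j * st j xi - \sum_j w j * c j * st' j xi| <= B * D1.
  move=> B0 cB; rewrite -sumrB (le_trans (ler_norm_sum _ _ _))// mulr_sumr.
  apply: ler_sum => j _; rewrite -mulrBr normrM ler_wpM2r// normrM.
  by rewrite (ger0_norm (ltW (w0 j))) -[leRHS]mul1r ler_pM ?(ltW (w0 j)) ?weight_le1.
have e1 : `|\sum_j w j * st j xi - \sum_j w j * st' j xi| <= D1.
  have := wD (fun=> 1) 1 ler01 (fun=> ltac:(by rewrite normr1)).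
  by rewrite mul1r; under eq_bigr do rewrite mulr1; under [X in _ - X]eq_bigr do rewrite mulr1.
have e2 : `|(\sum_a vc i a * velH st a xi) / cs ^+ 2 - (\sum_a vc i a * velH st' a xi) / cs ^+ 2| <=
    d%:R * (vbound * vbound) / cs ^+ 2 * D1.
  rewrite -mulrBl normrM (ger0_norm (_ : 0 <= (cs ^+ 2)^-1)) ?invr_ge0 ?sqr_ge0//.
  rewrite mulrAC ler_wpM2r ?invr_ge0 ?sqr_ge0// -sumrB -mulrA.
  apply: ler_norm_sum_bound => a; rewrite -mulrBr normrM -mulrA.
  by rewrite ler_pM// ?normr_vc_le// wD// ?(ltW vb)// => j; exact: normr_vc_le.
have e3 : `|quadH s st i xi - quadH s' st' i xi| <= (2 * cs ^+ 4)^-1 * tbound * D3.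
  rewrite /Submission.quadH -mulrBr normrM -mulrA.
  rewrite (ger0_norm (_ : 0 <= (2 * cs ^+ 4)^-1)) ?invr_ge0 ?mulr_ge0 ?exprn_ge0 ?(ltW cs0)//.
  apply: ler_wpM2l; first by rewrite invr_ge0 mulr_ge0// exprn_ge0// ltW.
  rewrite -sumrB (le_trans (ler_norm_sum _ _ _))// mulr_sumr; apply: ler_sum => a _.
  rewrite -sumrB (le_trans (ler_norm_sum _ _ _))// mulr_sumr; apply: ler_sum => b _.
  by rewrite -mulrBr normrM ler_wpM2r// normr_tensor_le.
have e4 : `|transH st i xi - transH st' i xi| <= d%:R * (vbound * (2 * pi * rho)) * D2.
  rewrite /Submission.transH -sumrB -mulrA; apply: ler_norm_sum_bound => a.
  rewrite -mulrBr normrM -mulrA ler_pM ?normr_vc_le//.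
  rewrite /dmult (_ : _ - _ = - (2 * pi * xi ord0 a) * (st i (- xi) - st' i (- xi))); last by ring.
  rewrite normrM normrN ler_wpM2r// normrM (ger0_norm (_ : 0 <= 2 * pi)) ?mulr_ge0 ?pi_ge0//.
  by rewrite ler_wpM2l ?mulr_ge0 ?pi_ge0// (le_trans (coord_le_enorm xi a))// ltW.
have en0 : 0 <= (eps * nu)^-1 by rewrite invr_ge0 mulr_ge0 ?ltW.
have -> : fieldH s st i xi - fieldH s' st' i xi =
   (eps * nu)^-1 * ((\sum_j w j * st j xi - \sum_j w j * st' j xi)
     + ((\sum_a vc i a * velH st a xi) / cs ^+ 2 - (\sum_a vc i a * velH st' a xi) / cs ^+ 2)
     + eps * (quadH s st i xi - quadH s' st' i xi) - (st i xi - st' i xi))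
   - (transH st i xi - transH st' i xi).
  by rewrite /Submission.fieldH /Submission.eqH; ring.
apply: (le_trans (ler_normB _ _)).
rewrite normrM (ger0_norm en0).
move: e1 e2 e3 e4 di.
move: (\sum_j w j * st j xi - _) (_ / cs ^+ 2 - _) (quadH _ _ _ _ - _) (transH _ _ _ - _) (st i xi - _).
move=> x1 x2 x3 x4 x5 e1 e2 e3 e4 e5.
have k1 : 0 <= d%:R * (vbound * vbound) / cs ^+ 2.
  by rewrite divr_ge0 ?sqr_ge0// !mulr_ge0// ltW.
have k3 : 0 <= (2 * cs ^+ 4)^-1 * tbound.
  by rewrite mulr_ge0 ?(ltW tb)// invr_ge0 mulr_ge0// exprn_ge0// ltW.
have k4 : 0 <= d%:R * (vbound * (2 * pi * rho)) by nonneg.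
rewrite /field_cst; move: k1 k3 k4 e2 e3 e4.
move: (d%:R * (vbound * vbound) / cs ^+ 2) ((2 * cs ^+ 4)^-1 * tbound) (d%:R * (vbound * (2 * pi * rho))).
move=> k1 k3 k4 k10 k30 k40 e2 e3 e4.
have h : `|x1 + x2 + eps * x3 - x5| <= (2 + k1 + eps * k3) * (D1 + D3).
  apply: (le_trans (ler_normB _ _)); apply: (le_trans (lerD (ler_normD _ _) (lexx _))).
  apply: (le_trans (lerD (lerD (ler_normD _ _) (lexx _)) (lexx _))).
  rewrite normrM (ger0_norm (ltW eps0)).
  have h3 := ler_wpM2l (ltW eps0) e3.
  have : 0 <= k1 * D3 by rewrite mulr_ge0.
  have : 0 <= eps * k3 * D1 by rewrite !mulr_ge0// ltW.
  by move: h3; rewrite mulrA; move: (eps * `|x3|) => y; lra.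
have h2 := ler_wpM2l en0 h.
have p1 : 0 <= (eps * nu)^-1 * (2 + k1 + eps * k3).
  by rewrite mulr_ge0// !addr_ge0// mulr_ge0// ltW.
move: h2; rewrite mulrA; move: p1; move: (_^-1 * (2 + _ + _)) => q q0 h2.
have : 0 <= q * D2 by rewrite mulr_ge0.
have : 0 <= k4 * (D1 + D3) by rewrite mulr_ge0// addr_ge0.
by move: h2; move: (_^-1 * _) => y; lra.
Qed.

End estimates.

(** * Exchange of time and frequency integrals *)

Section dominated_family.
Context {R : realType} {d0} {T : measurableType d0}.
Variable mu : {sigma_finite_measure set T -> \bar R}.
Local Notation leb := (@lebesgue_measure R).

Lemma tint_indic (f : R -> R) t : tint f t = \int[leb]_s ((0 <= s <= t)%R%:R * f s).
Proof.
rewrite /tint Rintegral_mkcond; apply: eq_Rintegral => s _.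
rewrite patchE mem_setE in_itv/=; case: ifP => _; rewrite ?mul1r ?mul0r//.
Qed.

Lemma measurable_indic_itv (t : R) :
  measurable_fun [set: measurableTypeR R] (fun s : R => (0 <= s <= t)%R%:R : R).
Proof.
apply: measurable_indicR; apply: measurable_and; exact: measurable_fun_ler.
Qed.

Lemma intble_continuous_seg (f : R -> R) (t : R) : continuous f ->
  intble leb (fun s : R => (0 <= s <= t)%R%:R * f s).
Proof.
move=> cf; have mi : measurable (`[0, t] : set (measurableTypeR R)) by exact: measurable_itv.
have h := (integrable_mkcond _ mi).1 (continuous_integrable 0 t cf).
apply: eq_integrable h => //= s _; rewrite /= patchE mem_setE in_itv/=.
by case: ifP; rewrite ?mul1r ?mul0r.
Qed.

Lemma measurable_tint (F : T -> R -> R) t : (forall s, measurable_fun setT (F^~ s)) ->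
  (forall x, continuous (F x)) -> measurable_fun setT (fun x => tint (F x) t).
Proof.
move=> mF cF; under eq_fun do rewrite tint_indic.
apply: (@measurable_Rint_param _ _ _ _ _ leb (fun p : T * R => (0 <= p.2 <= t)%R%:R * F p.1 p.2)).
apply: measurable_funM; last exact: measurable_continuous_R.
exact: (measurableT_comp (measurable_indic_itv t) measurable_snd).
Qed.

Lemma Rint_lincomb n (c : 'I_n -> R) (F : 'I_n -> T -> R) : (forall i, intble mu (F i)) ->
  \sum_i c i * \int[mu]_x F i x = \int[mu]_x \sum_i c i * F i x.
Proof.
move=> iF; rewrite Rint_sum; last by move=> i _; exact: intbleZ.
by apply: eq_bigr => i _; rewrite RintZ.
Qed.

(** Tailored to dominated convergence and Fubini: the majorant may depend on the time horizon [r]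
    but not on the time. *)
Definition dfamily (F : R -> T -> R) : Prop :=
  [/\ forall s, measurable_fun setT (F s), forall x, continuous (F^~ x) &
      forall r : R, exists2 G, intble mu G & forall s x, `|s| <= r -> `|F s x| <= G x].

Lemma dfamily_intble F s : dfamily F -> intble mu (F s).
Proof. by move=> [mF _ /(_ `|s|)[G iG FG]]; apply: (intble_le _ iG) => // x; exact: FG. Qed.

Lemma continuous_Rint F : dfamily F -> continuous (fun s => \int[mu]_x F s x).
Proof.
move=> dF; have [mF cF GF] := dF; move=> s.
have [G iG FG] := GF (`|s| + 1).
have sI : s \in (`](s - 1), (s + 1)[%classic : set R).
  by rewrite inE/= in_itv/=; apply/andP; split; lra.
apply: (@continuity_under_integral R _ T mu F setT measurableT (s - 1) (s + 1) _ _ G) => //.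
- by move=> r _; exact: dfamily_intble.
- by apply: aeW => x _ r _; exact: cF.
- move=> r /=; rewrite in_itv/= => /andP[r1 r2]; apply: aeW => x _; apply: FG.
  rewrite ler_norml; apply/andP; have := ler_norm s; have := ler_norm (- s); rewrite normrN.
  by split; lra.
Qed.

Lemma tint_Rint F t : dfamily F ->
  tint (fun s => \int[mu]_x F s x) t = \int[mu]_x tint (F^~ x) t.
Proof.
move=> dF; have [mF cF GF] := dF; have [G iG FG] := GF `|t|.
rewrite tint_indic.
transitivity (\int[leb]_s \int[mu]_x ((0 <= s <= t)%R%:R * F s x)).
  by apply: eq_Rintegral => s _; rewrite RintZ//; exact: dfamily_intble.
rewrite (@Fubini_dom _ _ _ _ _ leb mu (fun p => (0 <= p.1 <= t)%R%:R * F p.1 p.2)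
  (fun s : R => (0 <= s <= t)%R%:R) G).
- by apply: eq_Rintegral => x _; rewrite tint_indic.
- apply: measurable_funM; first exact: (measurableT_comp (measurable_indic_itv t) measurable_fst).
  have mj := @measurable_continuous_R R _ T (fun x s => F s x) mF cF.
  apply: (measurableT_comp mj (g := fun p : measurableTypeR R * T => (p.2, p.1))).
  by apply: measurable_fun_pair; [exact: measurable_snd|exact: measurable_fst].
- have := intble_continuous_seg t (@continuous_cst_fun R 1).
  by under eq_fun do rewrite mulr1.
- exact: iG.
- move=> s x; rewrite normrM ger0_norm ?ler0n//; case: (boolP (0 <= s <= t)) => [/andP[s0 st]|_].
    by rewrite !mul1r; apply: FG; rewrite ger0_norm// (le_trans st)// ler_norm.
  by rewrite !mul0r.
Qed.

End dominated_family.

Section tint_sum.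
Context {R : realType}.

Lemma continuous_sum_fun n (c : 'I_n -> R) (g : 'I_n -> R -> R) : (forall i, continuous (g i)) ->
  continuous (fun s => \sum_i c i * g i s).
Proof.
move=> cg; elim: (index_enum _) => [|i l IH].
  by under eq_fun do rewrite big_nil; exact: continuous_cst_fun.
under eq_fun do rewrite big_cons; move=> s.
by apply: cvgD (IH s); apply: cvgM; [exact: cvg_cst|exact: cg].
Qed.

Lemma tint_sum n (c : 'I_n -> R) (g : 'I_n -> R -> R) t : (forall i, continuous (g i)) ->
  tint (fun s => \sum_i c i * g i s) t = \sum_i c i * tint (g i) t.
Proof.
move=> cg; rewrite tint_indic; under eq_bigr do rewrite tint_indic.
have ig i := intble_continuous_seg t (cg i).
under [RHS]eq_bigr do rewrite -RintZ//.
rewrite -Rint_sum; last by move=> i _; exact: intbleZ.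
apply: eq_Rintegral => s _; rewrite mulr_sumr; apply: eq_bigr => i _; ring.
Qed.

End tint_sum.

Section energy_rate.
Context {R : realType} {d n : nat}.
Local Notation V := 'rV[R]_d.
Local Notation mu := (@lebesgue_rV R d).
Variables (v : 'I_n.+1 -> V) (w : 'I_n.+1 -> R) (cs nu eps : R) (m : nat).
Hypothesis iso : isotropic_lattice v w cs.
Hypothesis eps0 : 0 < eps.
Hypothesis nu0 : 0 < nu.
Hypothesis dm : (d <= m)%N.
Local Notation rho := (eps^-1).
Implicit Types (st : 'I_n.+1 -> V -> R).
Local Notation bl := (bl eps).

(** For [s] equal to 1, [kinetic_relaxation] identifies it with the squared kinetic norm of the
    distance to equilibrium. *)
Definition defect s st : R := \sum_i w i * wsq m (fun xi => eqH v w cs eps s st i xi - st i xi).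

Lemma intble_weight_mul (p q : V -> R) : bandl rho p -> bandl rho q ->
  intble mu (fun xi => weight m xi * (p xi * q xi)).
Proof.
move=> bp bq; have [[mp _] p0] := bp; have [[mq _] _] := bq.
have ipq := sqint_mul (proj1 bp) (proj1 bq).
apply: (intble_le _ (intbleZ ((1 + rho ^+ 2) ^+ m) (intble_norm ipq))).
  by apply: measurable_funM; [exact: measurable_weight|exact: measurable_funM].
move=> xi; rewrite normrM (ger0_norm (weight_ge0 m xi)).
have [xr|/p0 ->] := ltP (enorm xi) rho; last by rewrite mul0r normr0 !mulr0.
by rewrite ler_wpM2r// weight_bounded.
Qed.

(** The equation is paired with [2 * st] in the weighted space: transport integrates to 0,
    [relaxation_le] is integrated against the weight, and [quad_energy] bounds the remaining
    source. *)
Lemma energy_rate s st : bl st ->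
  \sum_i w i * \int[mu]_xi (weight m xi * (2 * (st i xi * (eps^-1 * fieldH v w cs nu eps s st i xi))))
  <= - ((eps ^+ 2 * nu)^-1 * defect s st) + nu^-1 * (quad_cst v cs m * (s * ysq w m st) ^+ 2).
Proof.
move=> bs.
have be i := bandl_eqH v w cs s i bs.
have bD i : bandl rho (fun xi => eqH v w cs eps s st i xi - st i xi) by exact: bandlB.
have bt i := bandl_transH v i bs.
have bq i := bandl_quadH v w cs s i bs.
have iD i := intble_weight_mul (bs i) (bD i).
have it i := intble_weight_mul (bs i) (bt i).
have E i : \int[mu]_xi (weight m xi * (2 * (st i xi * (eps^-1 * fieldH v w cs nu eps s st i xi)))) =
    (eps ^+ 2 * nu)^-1 * \int[mu]_xi (2 * (weight m xi * (st i xi * (eqH v w cs eps s st i xi - st i xi)))).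
  transitivity (\int[mu]_xi ((eps ^+ 2 * nu)^-1 * (2 * (weight m xi * (st i xi *
      (eqH v w cs eps s st i xi - st i xi)))) - 2 * eps^-1 * (weight m xi * (st i xi * transH v st i xi)))).
    apply: eq_Rintegral => xi _; rewrite /fieldH; by field; rewrite !gt_eqF.
  have iD' := intbleZ 2 (iD i).
  rewrite (RintB (intbleZ _ iD') (intbleZ _ (it i))) (RintZ _ iD').
  by rewrite (RintZ _ (it i)) (transport_integral0 v m i bs) mulr0 subr0.
under eq_bigr do rewrite E mulrCA.
rewrite -mulr_sumr.
have K0 : 0 < (eps ^+ 2 * nu)^-1 by rewrite invr_gt0 mulr_gt0// exprn_gt0.
have iD2 i := intble_wsq m (bD i).
have iq i := intble_wsq m (bq i).
have main : \sum_i w i * \int[mu]_xi (2 * (weight m xi * (st i xi * (eqH v w cs eps s st i xi - st i xi)))) <=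
   - defect s st + eps ^+ 2 * \sum_i w i * wsq m (quadH v w cs eps s st i).
  have iD' i := intbleZ 2 (iD i).
  rewrite /defect /wsq (Rint_lincomb _ iD') (Rint_lincomb _ iD2) (Rint_lincomb _ iq).
  rewrite -RintZ; last by apply: intble_sum => i _; exact: intbleZ.
  rewrite -RintN; last by apply: intble_sum => i _; exact: intbleZ.
  have j1 : intble mu (fun xi => - \sum_i w i * (weight m xi * (eqH v w cs eps s st i xi - st i xi) ^+ 2)).
    by apply: intbleN; apply: intble_sum => i _; exact: intbleZ.
  have j2 : intble mu (fun xi => eps ^+ 2 * \sum_i w i * (weight m xi * quadH v w cs eps s st i xi ^+ 2)).
    by apply: intbleZ; apply: intble_sum => i _; exact: intbleZ.
  rewrite -RintD//; apply: le_Rint => [||xi].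
  - by apply: intble_sum => i _; apply: intbleZ; exact: iD'.
  - exact: intbleD.
  have := ler_wpM2l (weight_ge0 m xi) (@relaxation_le _ _ _ v w cs eps iso s st xi).
  rewrite mulrDr mulrN mulrCA !mulr_sumr.
  under eq_bigr do rewrite mulrCA [weight m xi * (2 * _)]mulrCA.
  under [X in _ <= - X + _ -> _]eq_bigr do rewrite mulrCA.
  by under [X in _ <= _ + X -> _]eq_bigr do rewrite [X in _ * X]mulrCA.
have := ler_wpM2l (ltW K0) main; move/le_trans; apply.
rewrite mulrDr mulrN lerD2l mulrA (_ : (eps ^+ 2 * nu)^-1 * eps ^+ 2 = nu^-1); last by field; rewrite !gt_eqF.
by rewrite ler_wpM2l ?invr_ge0 ?(ltW nu0)// quad_energy.
Qed.

End energy_rate.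

(** * The truncated equation *)

Section existence.
Context {R : realType} {d n : nat}.
Local Notation V := 'rV[R]_d.
Local Notation mu := (@lebesgue_rV R d).
Variables (v : 'I_n.+1 -> V) (w : 'I_n.+1 -> R) (cs nu eps : R) (m : nat).
Hypothesis iso : isotropic_lattice v w cs.
Hypothesis eps0 : 0 < eps.
Hypothesis nu0 : 0 < nu.
Hypothesis dm : (d <= m)%N.
Local Notation rho := (eps^-1).
Implicit Types (st : 'I_n.+1 -> V -> R) (xi : V).
Local Notation bl := (bl eps).
Local Notation nrm := (nrm w m).
Local Notation ysq := (ysq w m).
Local Notation theta := (theta w m).
Local Notation fieldH := (fieldH v w cs nu eps).
Local Notation eqH := (eqH v w cs eps).
Local Notation vbound := (vbound v).

Let w0 i : 0 < w i. Proof. by case: iso. Qed.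

Section majorant.
Variable st0 : 'I_n.+1 -> V -> R.
Hypothesis b0 : bl st0.

(* Solutions stay pointwise bounded by a multiple of this function, so that Picard
   iteration can be run frequency by frequency in a weighted supremum norm. *)
Definition majorant : V -> R :=
  ballcut rho (fun xi => 1 + \sum_i (`|st0 i xi| + `|st0 i (- xi)|)).

Lemma bandl_majorant : bandl rho majorant.
Proof.
have b1 : bandl rho (ballcut rho (fun _ : V => 1)).
  split; last by move=> xi rx; rewrite /ballcut ltNge rx.
  have mb : measurable_fun setT (ballcut rho (fun _ : V => 1 : R)) by exact: measurable_ballcut.
  split => //; apply: (intble_le _ (@intble_ball R d rho)); first exact: measurable_funX.
  move=> xi; rewrite /ballcut; case: ifP => [/ltW -> |_]; first by rewrite expr1n normr1.
  by rewrite expr0n normr0 ler0n.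
have bn p : bandl rho p -> bandl rho (fun xi : V => `|p xi|).
  move=> [ps p0]; split; last by move=> xi /p0 ->; rewrite normr0.
  apply: (sqint_le _ ps) => [|xi]; last by rewrite normr_id.
  by apply: measurableT_comp => //; case: ps.
have bs : bandl rho (fun xi => ballcut rho (fun=> 1) xi + \sum_i (`|st0 i xi| + `|st0 i (- xi)|)).
  apply: bandlD => //; apply: bandl_sum => i; apply: bandlD; first exact: bn.
  by apply: bn; exact: bandl_opp.
congr (bandl _ _): bs; apply/funext => xi; rewrite /majorant /ballcut.
have [//|rx] := ltP; rewrite add0r big1// => i _.
have [_ z] := b0 i; by rewrite !z ?enormN// normr0 addr0.
Qed.

Lemma majorant_ge0 xi : 0 <= majorant xi.
Proof.
rewrite /majorant /ballcut; case: ifP => // _; rewrite addr_ge0//.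
by apply: sumr_ge0 => i _; rewrite addr_ge0.
Qed.

(** Needed because transport couples [xi] with [- xi]. *)
Lemma majorantN xi : majorant (- xi) = majorant xi.
Proof.
rewrite /majorant /ballcut enormN opprK; case: ifP => // _; congr (_ + _).
by apply: eq_bigr => i _; rewrite addrC.
Qed.

(** The nonlocal quadratic term is bounded uniformly in [xi] and not by the state at [xi]; the
    summand 1 in the majorant is there to absorb it. *)
Lemma majorant_ge1 xi : enorm xi < rho -> 1 <= majorant xi.
Proof.
by rewrite /majorant /ballcut => ->; rewrite lerDl; apply: sumr_ge0 => i _; rewrite addr_ge0.
Qed.

Lemma le_majorant i xi : `|st0 i xi| <= majorant xi.
Proof.
have [xr|rx] := ltP (enorm xi) rho; last first.
  by have [_ ->//] := b0 i; rewrite normr0 majorant_ge0.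
rewrite /majorant /ballcut xr (bigD1 i)//= addrCA -!addrA lerDl !addr_ge0//.
by apply: sumr_ge0 => j _; rewrite addr_ge0.
Qed.

End majorant.

(** With it the linear growth of the field follows from its Lipschitz bound. *)
Lemma fieldH0 s i xi : fieldH s (fun _ _ => 0) i xi = 0.
Proof.
have v0 a : velH v w (fun _ _ => 0) a = (fun=> 0 : R).
  by apply/funext => x; rewrite /velH big1// => j _; rewrite mulr0.
have h0 : hconv (fun _ : V => 0 : R) (fun _ : V => 0) = fun=> 0.
  apply/funext => x; rewrite /hconv /cnv.
  by rewrite !Rintegral_cst// !mul0r !addr0 subrr mul0r.
rewrite /Submission.fieldH /Submission.eqH /transH /quadH !big1 ?mul0r ?mulr0 ?addr0 ?subrr ?mulr0//.
- by rewrite subrr.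
- by move=> a _; rewrite /dmult mulr0 oppr0 mulr0.
- by move=> a _; rewrite big1// => b _; rewrite /momP !v0 h0 /ballcut if_same !mulr0.
- by move=> a _; rewrite v0 mulr0.
- by move=> a _; rewrite mulr0.
Qed.

Variables (st0 : 'I_n.+1 -> V -> R) (M : R).
Hypothesis b0 : bl st0.
Hypothesis M0 : 0 < M.

Let J := ('I_n.+1 * V)%type.
Let hh := majorant st0.
Let h (j : J) : R := hh j.2.
Let cur (x : J -> R) : 'I_n.+1 -> V -> R := fun i xi => x (i, xi).
Let P (x : J -> R) : Prop := forall i, measurable_fun [set: V] (cur x i).
Let a0 (j : J) : R := st0 j.1 j.2.

Definition tfield st i xi : R := eps^-1 * fieldH (theta M st ^+ 2) st i xi.

Let Phi (x : J -> R) (j : J) : R := tfield (cur x) j.1 j.2.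

Let bl_dom x : P x -> dominated h x -> bl (cur x).
Proof.
move=> Px [C xC] i; have [hs hz] := bandl_majorant b0.
split; last by move=> xi /hz z; apply/eqP; rewrite -normr_le0 (le_trans (xC (i, xi)))// /h /hh/= z mulr0.
apply: (sqint_le (Px i) (sqintZ C hs)) => xi.
by rewrite (le_trans (xC (i, xi)))// ler_norm.
Qed.

(** The factor 8 collects 2 from [momP_diff], 2 from [theta_lip] and 2 from the sum of two truncated
    norms, each at most [M]. *)
Definition lip_cst : R :=
  eps^-1 * (field_cst v cs nu eps * (n.+1%:R + 1 + d%:R * (d%:R * (8 * vbound ^+ 2 * M * nrm (fun=> hh))))).

Lemma lip_cst_ge0 : 0 <= lip_cst.
Proof.
have vb := vbound_gt0 v; have fc := field_cst_gt0 iso eps0 nu0.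
have nn := nrm_ge0 w m (fun=> hh).
by rewrite /lip_cst; nonneg.
Qed.

Let nrm_dom st (C : R) : 0 <= C -> (forall i, measurable_fun setT (st i)) ->
  (forall i xi, `|st i xi| <= C * hh xi) -> nrm st <= C * nrm (fun=> hh).
Proof.
move=> C0 ms sC; have bh := bandl_majorant b0.
have bhs : bl (fun _ : 'I_n.+1 => hh) by move=> i.
have := nrmZ w m C bhs; rewrite (ger0_norm C0) => <-.
rewrite ler_wsqrtr// /Submission.ysq; apply: ler_sum => i _; rewrite ler_wpM2l ?(ltW (w0 i))//.
apply: (wsq_le m (bandlZ C bh) (ms i)) => xi.
by rewrite (ger0_norm (mulr_ge0 C0 (majorant_ge0 st0 xi))).
Qed.

Let Phi_lip x y (C : R) : P x -> P y -> dominated h x -> dominated h y -> 0 <= C ->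
  (forall j, `|x j - y j| <= C * h j) -> forall j, `|Phi x j - Phi y j| <= (lip_cst + 1) * C * h j.
Proof.
move=> Px Py dx dy C0 xy [i xi].
have bx := bl_dom Px dx; have by_ := bl_dom Py dy.
have hx0 := majorant_ge0 st0 xi.
have vb := vbound_gt0 v; have fc := field_cst_gt0 iso eps0 nu0.
apply: (@le_trans _ _ (lip_cst * (C * hh xi))); last first.
  by rewrite -mulrA ler_wpM2r ?lerDl// mulr_ge0.
have [xr|rx] := ltP (enorm xi) rho; last first.
  have [_ z1] := bandl_fieldH v w cs nu (theta M (cur x) ^+ 2) i bx.
  have [_ z2] := bandl_fieldH v w cs nu (theta M (cur y) ^+ 2) i by_.
  have lc := lip_cst_ge0.
  by rewrite /Phi /tfield/= z1// z2// subrr normr0; nonneg.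
rewrite /Phi /tfield/= -mulrBr normrM (ger0_norm (_ : 0 <= eps^-1)) ?invr_ge0 ?(ltW eps0)//.
rewrite /lip_cst -[leRHS]mulrA ler_wpM2l ?invr_ge0 ?(ltW eps0)//.
apply: (le_trans (field_diff iso eps0 nu0 _ _ _ _ i xr)).
rewrite -mulrA ler_wpM2l ?(ltW fc)//.
rewrite [(n.+1%:R + 1 + _) * _]mulrDl [(n.+1%:R + 1) * _]mulrDl mul1r.
apply: lerD; first apply: lerD.
- apply: (le_trans (ler_norm _)); apply: ler_norm_sum_bound => j.
  by rewrite normr_id; exact: (xy (j, xi)).
- by have := xy (i, - xi); rewrite /h/= /hh majorantN.
have nD : nrm (fun i xi => cur x i xi - cur y i xi) <= C * nrm (fun=> hh).
  apply: nrm_dom => // [j|j z]; last exact: (xy (j, z)).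
  by apply: measurable_funB; [exact: Px|exact: Py].
have mom a b : `|theta M (cur x) ^+ 2 * momP v w eps (cur x) a b xi -
    theta M (cur y) ^+ 2 * momP v w eps (cur y) a b xi| <=
    8 * vbound ^+ 2 * M * nrm (fun=> hh) * (C * hh xi).
  apply: (le_trans (momP_diff m iso a b xi (theta_ge0 w m M0 _) (theta_ge0 w m M0 _) bx by_)).
  have t1 := theta_nrm w m M0 (cur x); have t2 := theta_nrm w m M0 (cur y).
  have t3 := theta_lip m iso M0 bx by_.
  have n0 := nrm_ge0 w m (fun=> hh).
  apply: (@le_trans _ _ (2 * vbound ^+ 2 * ((2 * (C * nrm (fun=> hh))) * (M + M)))).
    apply: ler_wpM2l; first by nonneg.
    apply: ler_pM; [exact: nrm_ge0| |exact: le_trans t3 (ler_wpM2l _ nD)|exact: lerD].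
    by apply: addr_ge0; apply: mulr_ge0; rewrite ?nrm_ge0// theta_ge0.
  have hx1 := majorant_ge1 st0 xr.
  rewrite (_ : 2 * vbound ^+ 2 * _ = 8 * vbound ^+ 2 * M * nrm (fun=> hh) * C * 1); last by ring.
  rewrite [leRHS]mulrA ler_wpM2l//; nonneg.
apply: (le_trans (ler_norm _)); rewrite -[leRHS]mulrA; apply: ler_norm_sum_bound => a.
rewrite -[leRHS]mulrA; apply: ler_norm_sum_bound => b.
by rewrite normr_id; exact: mom.
Qed.

Let dom0 : dominated h (fun=> 0).
Proof. by exists 0 => j; rewrite normr0 mul0r. Qed.

Let Phi_le x (C : R) : P x -> 0 <= C -> (forall j, `|x j| <= C * h j) ->
  forall j, `|Phi x j| <= (lip_cst + 1) * C * h j.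
Proof.
move=> Px C0 xC j; have P0 : P (fun=> 0) by move=> i'; exact: measurable_cst.
have dx : dominated h x by exists C.
have z : Phi (fun=> 0) j = 0 by rewrite /Phi /tfield fieldH0 mulr0.
rewrite -[Phi x j]subr0 -z; apply: Phi_lip => // i; rewrite subr0; exact: xC.
Qed.

Let PPhi x : P x -> dominated h x -> P (Phi x).
Proof.
move=> Px dx i; have bx := bl_dom Px dx.
apply: measurable_funM => //.
exact: intble_measurable (bandl_intble (bandl_fieldH v w cs nu (theta M (cur x) ^+ 2) i bx)).
Qed.

Let E (t : R) : R := expR (2 * (lip_cst + 1) * `|t|).

(** The bounds by [hh] on the state and on its time derivative are exported because they provide the
    dominated families on which the exchanges of integrals rest. *)
Lemma truncated_solution : exists A : R -> 'I_n.+1 -> V -> R,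
  [/\ forall t, bl (A t),
      forall i xi, continuous (fun s => A s i xi),
      forall i xi, continuous (fun s => tfield (A s) i xi),
      forall r : R, exists2 C : R, 0 <= C & forall s i xi, `|s| <= r ->
        `|A s i xi| <= C * hh xi /\ `|tfield (A s) i xi| <= C * hh xi &
      forall t i xi, A t i xi = st0 i xi + tint (fun s => tfield (A s) i xi) t].
Proof.
have L0 : 0 < lip_cst + 1 by rewrite ltr_wpDl// lip_cst_ge0.
have Pa0 : P a0 by move=> i; exact: bl_measurable b0.
have a0h j : `|a0 j| <= h j by exact: le_majorant.
have Ptint (b : R -> J -> R) t : (forall s, P (b s)) -> (forall j, continuous (b^~ j)) ->
    P (fun j => a0 j + tint (b^~ j) t).
  move=> Pb cb i; apply: measurable_funD; first exact: Pa0.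
  apply: (@measurable_tint R _ V (fun xi s => b s (i, xi))) => [s|xi]; last exact: cb.
  exact: Pb.
have Plim (x_ : nat -> J -> R) x : (forall k, P (x_ k)) ->
    (forall j, x_ k j @[k --> \oo] --> x j) -> P x.
  move=> Px xx i; apply: (@measurable_fun_cvg _ _ _ _ (fun k => cur (x_ k) i)) => [k|xi _].
    exact: Px.
  exact: xx.
have h0 j : 0 <= h j by exact: majorant_ge0.
have [a [Pa ah al ca ae]] := @picard_global R J P h a0 Phi (lip_cst + 1) h0 L0 Pa0 a0h PPhi
  Phi_le Phi_lip Ptint Plim.
have da t : dominated h (a t) by exists (E t) => j; exact: ah.
exists (fun t => cur (a t)); split => //.
- by move=> t; exact: bl_dom.
- move=> i xi t; apply/cvgrPdist_lt => e e0.
  set K := (lip_cst + 1) * E (`|t| + 1) * hh xi.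
  have K0 : 0 <= K by rewrite !mulr_ge0 ?expR_ge0 ?majorant_ge0// ltW.
  near=> s.
  have s1 : `|t - s| < 1 by near: s; apply: cvgr_dist_lt.
  apply: (@le_lt_trans _ _ (K * `|t - s|)).
    have := al (`|t| + 1) t s (i, xi); rewrite lerDl ler01 => /(_ isT) H.
    rewrite /K mulrAC; apply: H.
    have := ler_normB t (t - s); rewrite subKr => /le_trans; apply.
    by rewrite lerD2l ltW.
  have : `|t - s| < e / (K + 1).
    by near: s; apply: cvgr_dist_lt => //; rewrite divr_gt0// ltr_wpDl.
  rewrite ltr_pdivlMr ?ltr_wpDl// mulrDr mulr1 => he.
  by apply: (le_lt_trans _ he); rewrite mulrC lerDl.
- by move=> i xi; exact: (ca (i, xi)).
- move=> r; set C := expR (2 * (lip_cst + 1) * `|r|).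
  have C0 : 0 <= C by exact: expR_ge0.
  exists (C + (lip_cst + 1) * C); first by rewrite addr_ge0// mulr_ge0// ltW.
  move=> s i xi sr.
  have EC : E s <= C.
    by rewrite ler_expR ler_wpM2l ?mulr_ge0 ?(ltW L0)// (le_trans sr)// ler_norm.
  have hx := majorant_ge0 st0 xi; have L1 := ltW L0.
  split.
    apply: (le_trans (ah s (i, xi))); rewrite ler_wpM2r// (le_trans EC)// lerDl; nonneg.
  apply: (le_trans (Phi_le (Pa s) (expR_ge0 _) (ah s) (i, xi))).
  rewrite ler_wpM2r// (le_trans (ler_wpM2l L1 EC))// lerDr//.
- by move=> t i xi; exact: (ae t (i, xi)).
Unshelve. all: by end_near. Qed.

End existence.

(** * The energy estimate *)

Lemma tintZ {R : realType} (c : R) (f : R -> R) t : continuous f ->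
  tint (fun s => c * f s) t = c * tint f t.
Proof. by move=> cf; rewrite /tint RintegralZl//; exact: continuous_integrable. Qed.

Section energy.
Context {R : realType} {d n : nat}.
Local Notation V := 'rV[R]_d.
Local Notation mu := (@lebesgue_rV R d).
Variables (v : 'I_n.+1 -> V) (w : 'I_n.+1 -> R) (cs nu eps : R) (m : nat).
Hypothesis iso : isotropic_lattice v w cs.
Hypothesis eps0 : 0 < eps.
Hypothesis nu0 : 0 < nu.
Hypothesis dm : (d <= m)%N.
Local Notation rho := (eps^-1).
Implicit Types (st : 'I_n.+1 -> V -> R) (xi : V).
Local Notation bl := (bl eps).
Local Notation nrm := (nrm w m).
Local Notation ysq := (ysq w m).
Local Notation theta := (theta w m).
Local Notation fieldH := (fieldH v w cs nu eps).
Local Notation eqH := (eqH v w cs eps).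
Local Notation vbound := (vbound v).
Local Notation tfield M := (tfield v w cs nu eps m M).
Local Notation defect := (defect v w cs eps m).

Let w0 i : 0 < w i. Proof. by case: iso. Qed.

Definition growth_cst : R := nu^-1 * quad_cst v cs m.

Section truncated.
Variables (st0 : 'I_n.+1 -> V -> R) (M : R) (A : R -> 'I_n.+1 -> V -> R) (hh : V -> R).
Hypotheses (b0 : bl st0) (M0 : 0 < M) (bhh : bandl rho hh).
Hypotheses (hhN : forall xi, hh (- xi) = hh xi) (hh0 : forall xi, 0 <= hh xi).
Hypothesis bA : forall t, bl (A t).
Hypothesis cA : forall i xi, continuous (fun s => A s i xi).
Hypothesis cB : forall i xi, continuous (fun s => tfield M (A s) i xi).
Hypothesis dAB : forall r : R, exists2 C : R, 0 <= C & forall s i xi, `|s| <= r ->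
  `|A s i xi| <= C * hh xi /\ `|tfield M (A s) i xi| <= C * hh xi.
Hypothesis eA : forall t i xi, A t i xi = st0 i xi + tint (fun s => tfield M (A s) i xi) t.

Let B s i xi := tfield M (A s) i xi.

Let bB s : bl (B s).
Proof. by move=> i; apply: bandlZ; exact: bandl_fieldH. Qed.

Lemma dfamily_solution i : dfamily mu (fun s xi => A s i xi).
Proof.
split=> [s|xi|r]; [exact: bl_measurable (bA s)|exact: cA|].
have [C C0 H] := dAB r; exists (fun xi => C * hh xi); first exact: intbleZ (bandl_intble bhh).
by move=> s xi /(H s i xi)[].
Qed.

Lemma dfamily_field i : dfamily mu (fun s xi => B s i xi).
Proof.
split=> [s|xi|r]; [exact: bl_measurable (bB s)|exact: cB|].
have [C C0 H] := dAB r; exists (fun xi => C * hh xi); first exact: intbleZ (bandl_intble bhh).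
by move=> s xi /(H s i xi)[].
Qed.

Let F i s xi := weight m xi * (2 * (A s i xi * B s i xi)).

Let cAB i xi : continuous (fun s => 2 * (A s i xi * B s i xi)).
Proof.
apply: continuousM_fun; first exact: continuous_cst_fun.
exact: (continuousM_fun (@cA i xi) (@cB i xi)).
Qed.

Let dF i : dfamily mu (F i).
Proof.
split=> [s|xi|r].
- apply: measurable_funM; first exact: measurable_weight.
  by do 2 apply: measurable_funM => //; [exact: bl_measurable (bA s)|exact: bl_measurable (bB s)].
- by apply: continuousM_fun; [exact: continuous_cst_fun|exact: cAB].
have [C C0 H] := dAB r.
exists (fun xi => 2 * C ^+ 2 * (weight m xi * hh xi ^+ 2)).
  by apply: intbleZ; exact: intble_wsq bhh.
move=> s xi /(H s i xi)[h1 h2].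
rewrite /F normrM (ger0_norm (weight_ge0 m xi)) normrM (ger0_norm (_ : 0 <= 2))// (normrM (A s i xi)) [leRHS]mulrCA.
rewrite ler_wpM2l ?weight_ge0// (_ : 2 * C ^+ 2 * hh xi ^+ 2 = 2 * ((C * hh xi) * (C * hh xi))); last by ring.
by rewrite ler_wpM2l// ler_pM.
Qed.

(** [tint_sqr] at each frequency, integrated against the weight with time and frequency
    exchanged. *)
Let wsq_tint i t : 0 <= t -> wsq m (A t i) = wsq m (st0 i) + tint (fun s => \int[mu]_xi F i s xi) t.
Proof.
move=> t0; rewrite (tint_Rint t (dF i)).
have E xi : tint ((F i)^~ xi) t = weight m xi * A t i xi ^+ 2 - weight m xi * st0 i xi ^+ 2.
  rewrite /F tintZ; last exact: cAB.
  rewrite -mulrBr; congr (_ * _); rewrite [in RHS]eA (tint_sqr _ (@cB i xi) t0) addrAC subrr add0r.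
  by congr tint; apply/funext => s; rewrite -eA.
under eq_Rintegral do rewrite E.
by rewrite RintB; [rewrite addrC subrK|exact: intble_wsq (bA t i)|exact: intble_wsq (b0 i)].
Qed.

Let res s i xi := eqH (theta M (A s) ^+ 2) (A s) i xi - A s i xi.

(** Solving the equation for the residual expresses it through the time derivative and transport,
    whose continuity in time and domination are known; the convolutions inside [eqH] need not be
    examined again. *)
Let resE s i xi : res s i xi = eps * nu * (eps * B s i xi + transH v (A s) i xi).
Proof. by rewrite /B /Submission.tfield /Submission.fieldH /res; field; rewrite !gt_eqF. Qed.

Let bres s i : bandl rho (res s i).
Proof. by apply: bandlB => //; [exact: bandl_eqH|exact: bA]. Qed.

Let G i s xi := weight m xi * res s i xi ^+ 2.

Let dG i : dfamily mu (G i).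
Proof.
split=> [s|xi|r].
- apply: measurable_funM; first exact: measurable_weight.
  by apply: measurable_funX; exact: intble_measurable (bandl_intble (bres s i)).
- have cr : continuous (fun s => res s i xi).
    under eq_fun do rewrite resE.
    apply: continuousM_fun; first exact: continuous_cst_fun.
    move=> s; apply: cvgD.
      by apply: cvgM; [exact: cvg_cst|exact: cB].
    apply: (@continuous_sum_fun _ d (fun a => v i ord0 a) (fun a s => dmult a (A s i) xi)) => a.
    move=> {}s; apply: cvgN; apply: cvgM; first exact: cvg_cst.
    exact: cA.
  apply: continuousM_fun; first exact: continuous_cst_fun.
  by move=> s; apply: (cvgM (cr s) (cr s)).
have [C C0 H] := dAB r.
have vb := vbound_gt0 v.
set K := eps * nu * (eps * C + d%:R * (vbound * (2 * pi * rho)) * C).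
have K0 : 0 <= K by rewrite /K; nonneg.
exists (fun xi => K ^+ 2 * (weight m xi * hh xi ^+ 2)).
  by apply: intbleZ; exact: intble_wsq bhh.
move=> s xi sr; rewrite /G [leRHS]mulrCA -exprMn normrM (ger0_norm (weight_ge0 m xi)).
have KH : 0 <= K * hh xi by apply: mulr_ge0.
rewrite ler_wpM2l ?weight_ge0// normrX; apply: lerXn2r; rewrite ?nnegrE//.
have [xr|rx] := ltP (enorm xi) rho; last first.
  by have [_ z] := bres s i; rewrite z// normr0.
have [_ h2] := H s i xi sr.
have h3 (a : 'I_d) : `|v i ord0 a * dmult a (A s i) xi| <= vbound * (2 * pi * rho) * (C * hh xi).
  rewrite normrM -mulrA; apply: ler_pM => //; first exact: normr_vc_le.
  rewrite /dmult normrN !normrM (ger0_norm (_ : 0 <= pi)) ?pi_ge0// (ger0_norm (_ : 0 <= 2))//.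
  have [h1 _] := H s i (- xi) sr; rewrite hhN in h1.
  apply: ler_pM => //; first by nonneg.
  by rewrite ler_wpM2l ?mulr_ge0 ?pi_ge0// (le_trans (coord_le_enorm xi a))// ltW.
rewrite resE normrM (ger0_norm (_ : 0 <= eps * nu)); last by nonneg.
rewrite /K -[leRHS]mulrA; apply: ler_wpM2l; first by nonneg.
rewrite mulrDl; apply: (le_trans (ler_normD _ _)); apply: lerD.
  by rewrite normrM (ger0_norm (ltW eps0)) -mulrA ler_wpM2l// ltW.
apply: (le_trans (ler_norm_sum_bound h3)).
by rewrite le_eqVlt; apply/orP; left; apply/eqP; ring.
Qed.

Lemma continuous_defect : continuous (fun s => defect (theta M (A s) ^+ 2) (A s)).
Proof.
by apply: (@continuous_sum_fun _ _ w (fun i s => \int[mu]_xi G i s xi)) => i; exact: continuous_Rint (dG i).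
Qed.

(** Truncation gives [theta ^+ 2 * ysq <= M ^+ 2], so the source is at most a constant and the
    energy grows at most linearly in time. *)
Lemma truncated_energy t : 0 <= t ->
  ysq (A t) + (eps ^+ 2 * nu)^-1 * tint (fun s => defect (theta M (A s) ^+ 2) (A s)) t
  <= ysq st0 + growth_cst * M ^+ 4 * t.
Proof.
move=> t0; have cD := continuous_defect.
have cF i : continuous (fun s => \int[mu]_xi F i s xi) by exact: continuous_Rint (dF i).
have -> : ysq (A t) = ysq st0 + tint (fun s => \sum_i w i * \int[mu]_xi F i s xi) t.
  rewrite (tint_sum _ _ cF) /Submission.ysq -big_split/=; apply: eq_bigr => i _.
  by rewrite (wsq_tint _ t0) mulrDr.
rewrite -addrA lerD2l -tintZ// -lerBrDr -(tint_cst (growth_cst * M ^+ 4) t0) -tintB.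
- apply: le_tint.
  + exact: continuous_sum_fun.
  + move=> s; apply: cvgB; first exact: cvg_cst.
    by apply: cvgM; [exact: cvg_cst|exact: cD].
  move=> s _; have := energy_rate iso eps0 nu0 dm (theta M (A s) ^+ 2) (bA s).
  move/le_trans; apply; rewrite addrC lerD2r /growth_cst -[leRHS]mulrA.
  have q0 : 0 <= quad_cst v cs m.
    rewrite /quad_cst; have := @cnv_cst_gt0 R d m; have := vbound_gt0 v => ? ?.
    by case: iso => _ _ _ ? _ _ _ _ _; have ? := tbound_gt0 iso; nonneg.
  have tn := theta_nrm w m M0 (A s); have t1 := theta_ge0 w m M0 (A s).
  have n1 := nrm_ge0 w m (A s).
  have key : (theta M (A s) ^+ 2 * ysq (A s)) ^+ 2 <= M ^+ 4.
    rewrite -(sqr_nrm m iso) -exprMn (_ : M ^+ 4 = (M ^+ 2) ^+ 2); last by ring.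
    by apply: lerXn2r; rewrite ?nnegrE ?sqr_ge0//; apply: lerXn2r; rewrite ?nnegrE//; nonneg.
  by apply: ler_wpM2l; [rewrite invr_ge0 ltW|exact: ler_wpM2l].
- exact: continuous_cst_fun.
- by apply: continuousM_fun => //; exact: continuous_cst_fun.
Qed.

End truncated.

(** [D] is the defect of the truncated equation: it is continuous on the whole line and agrees with
    the true defect as long as the truncation is inactive. *)
Theorem hartley_solution st0 (E T : R) : bl st0 -> 0 < E -> ysq st0 <= E -> 0 <= T ->
  4 * growth_cst * T * E < 1 ->
  exists (A B : R -> 'I_n.+1 -> V -> R) (D : R -> R),
  [/\ forall t, bl (A t) /\ bl (B t),
      forall i, dfamily mu (fun s => A s i) /\ dfamily mu (fun s => B s i),
      forall t i xi, A t i xi = st0 i xi + tint (fun s => B s i xi) t,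
      forall s, 0 <= s <= T -> ysq (A s) <= E * (1 + 4 * growth_cst * T * E) /\
        forall i xi, B s i xi = eps^-1 * fieldH 1 (A s) i xi &
      [/\ continuous D, forall s, 0 <= s <= T -> D s = defect 1 (A s) &
        (eps ^+ 2 * nu)^-1 * tint D T <= E * (1 + 4 * growth_cst * T * E)]].
Proof.
(* With M^2 = 2 E the energy grows by at most 4 k T E^2 up to time [T], where k is [growth_cst];
   smallness keeps it below 2 E = M^2, where the truncation is inactive. *)
move=> b0 E0 yE T0 small; pose M : R := Num.sqrt (2 * E).
have M0 : 0 < M by rewrite sqrtr_gt0 mulr_gt0.
have M2 : M ^+ 2 = 2 * E by rewrite sqr_sqrtr// mulr_ge0// ltW.
have M4 : M ^+ 4 = 4 * E ^+ 2 by transitivity ((M ^+ 2) ^+ 2); [ring|rewrite M2; ring].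
have [A [bA cA cB dAB eA]] := truncated_solution m iso eps0 nu0 b0 M0.
have bhh := bandl_majorant b0.
have ener t (t0 : 0 <= t) := truncated_energy b0 M0 bhh (majorantN eps st0) (majorant_ge0 eps st0) bA cA cB dAB eA t0.
have bB s : bl (tfield M (A s)) by move=> i; apply: bandlZ; exact: bandl_fieldH.
have cD := continuous_defect bhh (majorantN eps st0) (majorant_ge0 eps st0) bA cA cB dAB.
have D0 s : 0 <= defect (theta M (A s) ^+ 2) (A s).
  by apply: sumr_ge0 => i _; rewrite mulr_ge0 ?wsq_ge0// ltW.
have K0 : 0 < (eps ^+ 2 * nu)^-1 by rewrite invr_gt0 mulr_gt0// exprn_gt0.
have g0 : 0 <= growth_cst.
  rewrite mulr_ge0 ?invr_ge0 ?(ltW nu0)//.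
  have c1 := @cnv_cst_gt0 R d m; have c2 := vbound_gt0 v; have c3 := tbound_gt0 iso.
  by case: iso => _ _ _ cs0 _ _ _ _ _; rewrite /quad_cst; nonneg.
have yle t : 0 <= t <= T -> ysq (A t) + (eps ^+ 2 * nu)^-1 *
    tint (fun s => defect (theta M (A s) ^+ 2) (A s)) t <= E * (1 + 4 * growth_cst * T * E).
  move=> /andP[t0 tT]; apply: (le_trans (ener t t0)); rewrite M4.
  have : growth_cst * (4 * E ^+ 2) * t <= growth_cst * (4 * E ^+ 2) * T by rewrite ler_wpM2l//; nonneg.
  by move: yE; lra.
have tD t : 0 <= tint (fun s => defect (theta M (A s) ^+ 2) (A s)) t.
  have [t0|/ltW t0] := leP 0 t; last by rewrite tint_lt0.
  by rewrite -(mul0r t) -(tint_cst 0 t0); apply: le_tint => //; exact: continuous_cst_fun.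
have yA t : 0 <= t <= T -> ysq (A t) <= E * (1 + 4 * growth_cst * T * E).
  by move=> tT; apply: le_trans (yle t tT); rewrite lerDl mulr_ge0// ltW.
have th t : 0 <= t <= T -> theta M (A t) = 1.
  move=> tT; apply: theta1 => //; rewrite ler_wsqrtr// (le_trans (yA t tT))//.
  by rewrite mulrC ler_wpM2r ?(ltW E0)//; lra.
exists A, (fun s => tfield M (A s)), (fun s => defect (theta M (A s) ^+ 2) (A s)); split.
- by move=> t; split.
- move=> i; split.
    exact: (dfamily_solution bhh bA cA dAB).
  exact: (dfamily_field bhh bA cB dAB).
- exact: eA.
- move=> s sT; split; first exact: yA.
  by move=> i xi; rewrite /Submission.tfield th// expr1n.
- split => //; first by move=> s sT; rewrite th// expr1n.
  have TT : 0 <= T <= T by rewrite T0 lexx.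
  apply: le_trans (yle T TT); rewrite lerDr; exact: ysq_ge0 m iso _.
Qed.

End energy.

(** * Local solutions *)

Section physical.
Context {R : realType} {d n : nat}.
Local Notation V := 'rV[R]_d.
Local Notation mu := (@lebesgue_rV R d).
Local Notation leb := (@lebesgue_measure R).
Variables (v : 'I_n.+1 -> V) (w : 'I_n.+1 -> R) (cs nu eps : R) (m : nat).
Hypothesis iso : isotropic_lattice v w cs.
Hypothesis eps0 : 0 < eps.
Hypothesis nu0 : 0 < nu.
Hypothesis dm : (d <= m)%N.
Local Notation rho := (eps^-1).
Implicit Types (st : 'I_n.+1 -> V -> R) (xi x : V).
Local Notation bl := (bl eps).
Local Notation nrm := (nrm w m).
Local Notation ysq := (ysq w m).
Local Notation fieldH := (fieldH v w cs nu eps).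
Local Notation eqH := (eqH v w cs eps).
Local Notation vbound := (vbound v).

Let w0 i : 0 < w i. Proof. by case: iso. Qed.

Lemma sobolev_sqnorm_wsq (a : V -> R) : bandl rho a -> sobolev_sqnorm m (hartley a) = (wsq m a)%:E.
Proof.
by move=> ba; rewrite (sobolev_sqnorm_hartley m ba) /wsq (RintE (intble_wsq m ba)).
Qed.

Lemma kinetic_sqnorm_hart st : bl st -> kinetic_sqnorm w m (hart st) = (ysq st)%:E.
Proof.
move=> bs; rewrite /kinetic_sqnorm /Submission.ysq -sumEFin; apply: eq_bigr => i _.
by rewrite /hart sobolev_sqnorm_wsq// EFinM.
Qed.

Lemma kinetic_sobolev_hart st : bl st -> kinetic_sobolev m (hart st).
Proof.
move=> bs i; split; last by rewrite /hart sobolev_sqnorm_wsq// ltry.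
by apply/inL2P; apply: sqint_hartley; [exact: bandl_intble (bs i)|case: (bs i)].
Qed.

Lemma cutoffs_hartP (f : 'I_n.+1 -> V -> R) : exists2 st, bl st & cutoffs eps f = hart st.
Proof.
have /choice[st hst] : forall i, exists a, bandl rho a /\ cutoff eps (f i) = hartley a.
  by move=> i; have [a b1 b2] := cutoff_bandl eps (f i); exists a.
exists st; first by move=> i; case: (hst i).
by apply/funext => i; case: (hst i).
Qed.

Lemma cutoffs_hart st : bl st -> cutoffs eps (hart st) = hart st.
Proof. by move=> bs; apply/funext => i; exact: cutoff_hartley_id. Qed.

Lemma dfamily_cas (F : R -> V -> R) x : dfamily mu F ->
  dfamily mu (fun s xi => F s xi * cas (2 * pi * dotv x xi)).
Proof.
move=> dF; have [mF cF GF] := dF; split=> [s|xi|r].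
- exact: intble_measurable (intble_hartley x (dfamily_intble s dF)).
- by apply: continuousM_fun => //; exact: continuous_cst_fun.
have [G iG FG] := GF r; exists (fun xi => 2 * `|G xi|).
  by apply: intbleZ; exact: intble_norm.
move=> s xi /FG h; rewrite normrM mulrC ler_pM ?cas_le2//.
exact: le_trans (h xi) (ler_norm _).
Qed.

Lemma continuous_hartley_time (F : R -> V -> R) x : dfamily mu F ->
  continuous (fun s => hartley (F s) x).
Proof. by move=> dF; exact: continuous_Rint (dfamily_cas x dF). Qed.

Lemma hartley_tint (F : R -> V -> R) x t : dfamily mu F ->
  hartley (fun xi => tint (F^~ xi) t) x = tint (fun s => hartley (F s) x) t.
Proof.
move=> dF; rewrite /hartley (tint_Rint t (dfamily_cas x dF)); apply: eq_Rintegral => xi _.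
have [_ cF _] := dF; rewrite mulrC -tintZ; last exact: cF.
by congr tint; apply/funext => s; rewrite mulrC.
Qed.

Section solution.
Variables (f0 : 'I_n.+1 -> V -> R) (st0 : 'I_n.+1 -> V -> R) (T M : R).
Variables (A B : R -> 'I_n.+1 -> V -> R).
Hypotheses (b0 : bl st0) (f0E : cutoffs eps f0 = hart st0).
Hypothesis bAB : forall t, bl (A t) /\ bl (B t).
Hypothesis dAB : forall i, dfamily mu (fun s => A s i) /\ dfamily mu (fun s => B s i).
Hypothesis eA : forall t i xi, A t i xi = st0 i xi + tint (fun s => B s i xi) t.
Hypothesis yA : forall s, 0 <= s <= T -> ysq (A s) <= M /\
  forall i xi, B s i xi = eps^-1 * fieldH 1 (A s) i xi.

Let rhsE s i x : 0 <= s <= T ->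
  lbgk_rhs v w cs nu eps (hart (A s)) i x = eps * hartley (B s i) x.
Proof.
move=> sT; have [bA bB] := bAB s; have [_ EB] := yA sT.
rewrite lbgk_rhs_hart// -hartleyZ; last exact: bandl_intble (bB i).
by congr hartley; apply/funext => xi; rewrite EB mulVKf ?gt_eqF.
Qed.

Lemma lbgk_solution_hart : lbgk_solution v w cs nu eps m T f0 (fun t => hart (A t)).
Proof.
have bA t : bl (A t) by case: (bAB t).
have cx i x : continuous (fun s => eps * hartley (B s i) x).
  apply: continuousM_fun; first exact: continuous_cst_fun.
  apply: continuous_hartley_time; exact: (dAB i).2.
split.
- move=> i; apply: measurable_funTS.
  apply: (@measurable_continuous_rV R _ (measurableTypeR R) d (fun s => hartley (A s i))) => [x|s].
    by apply: continuous_measurable_fun; apply: continuous_hartley_time; exact: (dAB i).1.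
  exact: continuous_hartley (bA s i).
- by move=> t _; exact: kinetic_sobolev_hart.
- by exists M => t /yA[h _]; rewrite kinetic_sqnorm_hart// lee_fin.
- by move=> t _; rewrite cutoffs_hart.
- rewrite cutoffs_hart// f0E; congr hart; apply/funext => i; apply/funext => xi.
  by rewrite eA tint_lt0// addr0.
- move=> i x; apply: eq_integrable (continuous_integrable 0 T (cx i x)) => // s.
  by rewrite inE/= in_itv/= => sT; rewrite /= rhsE.
- move=> t /andP[t0 tT] i x.
  have -> : cutoff eps (f0 i) = hartley (st0 i).
    by have := congr1 (fun f => f i) f0E.
  rewrite (cutoff_hart i (bA t)).
  have -> : \int[leb]_(s in `[0, t]) lbgk_rhs v w cs nu eps (hart (A s)) i x =
      tint (fun s => eps * hartley (B s i) x) t.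
    apply: eq_Rintegral => s; rewrite inE/= in_itv/= => /andP[s0 st].
    by rewrite rhsE// s0 (le_trans st).
  rewrite tintZ; last by apply: continuous_hartley_time; exact: (dAB i).2.
  rewrite -(hartley_tint x t (dAB i).2) -hartleyB; first last.
  + exact: bandl_intble (b0 i).
  + exact: bandl_intble (bA t i).
  by congr (_ * hartley _ x); apply/funext => xi; rewrite eA addrAC subrr add0r.
Qed.

End solution.

Definition zsq st : R := \sum_j l2sq (st j).

Definition winv : R := \sum_j (w j)^-1.

Lemma zsq_ge0 st : 0 <= zsq st.
Proof. by apply: sumr_ge0 => i _; exact: l2sq_ge0. Qed.

Lemma winv_ge0 : 0 <= winv.
Proof. by apply: sumr_ge0 => i _; rewrite invr_ge0 ltW. Qed.

Lemma zsq_le_ysq st : bl st -> zsq st <= winv * ysq st.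
Proof.
move=> bs; rewrite mulr_sumr; apply: ler_sum => j _.
apply: (le_trans (l2sq_le_wsq m (bs j))).
rewrite mulrA ler_peMl ?wsq_ge0// -(mulVf (lt0r_neq0 (w0 j))) ler_wpM2r ?(ltW (w0 j))//.
by rewrite /winv (bigD1 j)//= lerDl; apply: sumr_ge0 => i _; rewrite invr_ge0 ltW.
Qed.

(** On a fixed band the weight is bounded, so the H^m norm is controlled by the L^2 norm; the
    constant depends on [eps], which the stability argument allows. *)
Lemma ysq_le_zsq st : bl st -> ysq st <= (1 + rho ^+ 2) ^+ m * zsq st.
Proof.
move=> bs; rewrite mulr_sumr; apply: ler_sum => j _.
have [[_ i2] z] := bs j.
apply: (@le_trans _ _ (wsq m (st j))); first by rewrite ler_piMl ?wsq_ge0// (weight_le1 iso).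
rewrite /wsq /l2sq -RintZ//; apply: le_Rint => [||xi].
- exact: intble_wsq (bs j).
- exact: intbleZ.
have [xr|/z ->] := ltP (enorm xi) rho; last by rewrite expr0n !mulr0.
by rewrite ler_wpM2r ?sqr_ge0// weight_bounded.
Qed.

Lemma sqr3_le (a b c : R) : (a + b + c) ^+ 2 <= 3 * (a ^+ 2 + b ^+ 2 + c ^+ 2).
Proof.
rewrite -subr_ge0.
have -> : 3 * (a ^+ 2 + b ^+ 2 + c ^+ 2) - (a + b + c) ^+ 2 =
  (a - b) ^+ 2 + (a - c) ^+ 2 + (b - c) ^+ 2 by ring.
by rewrite !addr_ge0 ?sqr_ge0.
Qed.

(** The momentum difference is bounded uniformly in [xi], so its L^2 norm is paid for by the volume
    [b] of the band. *)
Lemma l2sq_field_lip (N : R) : 0 <= N -> exists2 C : R, 0 <= C &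
  forall st st', bl st -> bl st' -> nrm st <= N -> nrm st' <= N ->
  forall i, l2sq (fun xi => fieldH 1 st i xi - fieldH 1 st' i xi) <=
    C * zsq (fun j xi => st j xi - st' j xi).
Proof.
move=> N0; have fc0 := field_cst_gt0 iso eps0 nu0; have vb := vbound_gt0 v.
set K := d%:R * (d%:R * (2 * vbound ^+ 2 * (N + N))).
have K0 : 0 <= K by rewrite /K; nonneg.
set b := \int[mu]_xi ((enorm xi <= rho)%R%:R).
have b_ge0 : 0 <= b by apply: Rint_ge0 => xi; rewrite ler0n.
set W := (1 + rho ^+ 2) ^+ m.
have W0 : 0 <= W by rewrite /W; nonneg.
exists (field_cst v cs nu eps ^+ 2 * 3 * (n.+1%:R + 1 + K ^+ 2 * W * b)); first by nonneg.
move=> st st' b1 b2 n1 n2 i; set D := fun j xi => st j xi - st' j xi.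
have bD : bl D by exact: blB.
have z0 := zsq_ge0 D.
have y0 : nrm D ^+ 2 <= W * zsq D by rewrite (sqr_nrm m iso) ysq_le_zsq.
have iD j : intble mu (fun xi => D j xi ^+ 2) by case: (bD j) => -[].
have iDN : intble mu (fun xi => D i (- xi) ^+ 2) by exact: intble_rV_opp (iD i).
have ib := @intble_ball R d rho.
set fc := field_cst v cs nu eps.
have iS : intble mu (fun xi => \sum_j D j xi ^+ 2) by exact: intble_sum.
have bf := bandlB (bandl_fieldH v w cs nu 1 i b1) (bandl_fieldH v w cs nu 1 i b2).
apply: (@le_trans _ _ (\int[mu]_xi (fc ^+ 2 * 3 * (n.+1%:R * (\sum_j D j xi ^+ 2) + D i (- xi) ^+ 2
    + (K * nrm D) ^+ 2 * (enorm xi <= rho)%R%:R)))).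
  apply: le_Rint => [||xi].
  - by case: bf => -[].
  - by apply: intbleZ; apply: intbleD; [apply: intbleD => //; exact: intbleZ|exact: intbleZ].
  have [xr|rx] := ltP (enorm xi) rho; last first.
    have [_ z] := bf; rewrite z// expr0n; apply: mulr_ge0; first by nonneg.
    have := ler0n R (enorm xi <= rho)%R.
    have : 0 <= \sum_j D j xi ^+ 2 by apply: sumr_ge0 => j _; exact: sqr_ge0.
    by move=> ? ?; nonneg.
  rewrite (ltW xr) mulr1.
  have h := field_diff iso eps0 nu0 1 1 st st' i xr.
  have mom : \sum_a \sum_b `|1 * momP v w eps st a b xi - 1 * momP v w eps st' a b xi| <= K * nrm D.
    apply: (le_trans (ler_norm _)); rewrite /K -[leRHS]mulrA; apply: ler_norm_sum_bound => a.
    rewrite -[leRHS]mulrA; apply: (le_trans (ler_norm_sum_bound (M := 2 * vbound ^+ 2 * (N + N) * nrm D) _)) => // c.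
    rewrite normr_id; have := momP_diff m iso a c xi ler01 ler01 b1 b2.
    rewrite !expr1n !mul1r; move/le_trans; apply.
    rewrite (_ : (fun i0 xi0 => 1 * st i0 xi0 - 1 * st' i0 xi0) = D); last first.
      by apply/funext => j; apply/funext => x; rewrite !mul1r.
    rewrite -[leRHS]mulrA; apply: ler_wpM2l; first by nonneg.
    by rewrite mulrC ler_wpM2r ?nrm_ge0// lerD.
  rewrite -(real_normK (num_real (_ - _))).
  have s0 : 0 <= \sum_j `|st j xi - st' j xi| by exact: sumr_ge0.
  have h2 : `|fieldH 1 st i xi - fieldH 1 st' i xi| <=
     fc * (\sum_j `|D j xi| + `|D i (- xi)| + K * nrm D).
    by apply: (le_trans h); rewrite ler_wpM2l ?(ltW fc0)// lerD2l.
  have nD := nrm_ge0 w m D.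
  have h3 : `|fieldH 1 st i xi - fieldH 1 st' i xi| ^+ 2 <=
     (fc * (\sum_j `|D j xi| + `|D i (- xi)| + K * nrm D)) ^+ 2.
    by apply: lerXn2r; rewrite ?nnegrE//; nonneg.
  apply: (le_trans h3); rewrite exprMn -[leRHS]mulrA; apply: ler_wpM2l; first exact: sqr_ge0.
  apply: (le_trans (sqr3_le _ _ _)); rewrite ler_wpM2l// real_normK ?num_real// lerD2r lerD2r.
  apply: (le_trans (sqr_sum_le _)); rewrite ler_wpM2l//; apply: ler_sum => j _.
  by rewrite real_normK ?num_real.
have i1 : intble mu (fun xi => n.+1%:R * (\sum_j D j xi ^+ 2) + D i (- xi) ^+ 2).
  by apply: intbleD => //; exact: intbleZ.
rewrite RintZ; last by apply: intbleD => //; exact: intbleZ.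
rewrite RintD//; last exact: intbleZ.
rewrite RintD//; last exact: intbleZ.
rewrite !RintZ// -/b Rint_sum// -/(zsq D).
rewrite (@Rint_rV_opp _ d (fun xi => D i xi ^+ 2)); last exact: intble_measurable (iD i).
rewrite -[leRHS]mulrA; apply: ler_wpM2l; first by nonneg.
rewrite !mulrDl; apply: lerD; first apply: lerD => //.
  rewrite mul1r /zsq (bigD1 i)//= lerDl; apply: sumr_ge0 => j _; exact: l2sq_ge0.
rewrite exprMn [leRHS]mulrAC; apply: ler_wpM2r => //.
by rewrite -[leRHS]mulrA; apply: ler_wpM2l => //; exact: sqr_ge0.
Qed.

End physical.

(** * Stability and well-posedness *)

Section time_cauchy_schwarz.
Context {R : realType}.
Local Notation leb := (@lebesgue_measure R).

Lemma continuous_expR_mul (k : R) : continuous (fun s : R => expR (k * s)).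
Proof.
move=> s; apply: (@cvg_comp _ _ _ (fun s => k * s) expR _ (nbhs (k * s))).
  by apply: cvgM; [exact: cvg_cst|exact: cvg_id].
by have := @continuous_expR R (k * s).
Qed.

(** Cauchy-Schwarz in time with extended values, since [r] is assumed integrable and its square may
    have infinite integral. *)
Lemma sqr_Rint_seg (r : R -> R) t : 0 <= t -> leb.-integrable `[0, t] (EFin \o r) ->
  (((\int[leb]_(s in `[0%R, t]) r s) ^+ 2)%:E <=
   t%:E * \int[leb]_s (((0 <= s <= t)%R%:R * r s) ^+ 2)%:E)%E.
Proof.
move=> t0 ri; pose u (s : R) : R := (0 <= s <= t)%R%:R; pose f s := u s * r s.
have mi : measurable (`[0, t] : set (measurableTypeR R)) by exact: measurable_itv.
have fi : intble leb f.
  apply: eq_integrable ((integrable_mkcond _ mi).1 ri) => //= s _.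
  by rewrite /f /u /= patchE mem_setE in_itv/=; case: ifP; rewrite ?mul1r ?mul0r.
have mf := intble_measurable fi.
have uu s : u s * f s = f s by rewrite /f mulrA -natrM mulnb andbb.
have rE : \int[leb]_(s in `[0, t]) r s = \int[leb]_s (u s * f s).
  rewrite Rintegral_mkcond; apply: eq_Rintegral => s _; rewrite uu /f /u.
  by rewrite patchE mem_setE in_itv/=; case: ifP; rewrite ?mul1r ?mul0r.
have ui : intble leb u.
  by have := intble_continuous_seg t (@continuous_cst_fun R 1); under eq_fun do rewrite mulr1.
have usq : sqint leb u.
  split; first exact: intble_measurable ui.
  by rewrite (_ : (fun s => u s ^+ 2) = u)//; apply/funext => s; rewrite /u -natrX; case: (_ <= _ <= _).
have It : \int[leb]_s (u s ^+ 2) = t.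
  rewrite -[RHS]mul1r -(tint_cst 1 t0) tint_indic; apply: eq_Rintegral => s _.
  by rewrite /u mulr1 -natrX; case: (_ <= _ <= _).
have [foo|] := ltP (\int[leb]_s ((f s) ^+ 2)%:E)%E +oo%E; last first.
  (* At [t = 0] the convention 0 * oo = 0 makes the right-hand side vanish, and so does the
     left-hand side. *)
  rewrite leye_eq => /eqP ->; move: t0; rewrite le_eqVlt => /predU1P[t0|t0].
    by rewrite -t0 set_itv1 Rintegral_set1 expr0n mul0e.
  by rewrite gt0_muley ?lte_fin// leey.
have fsq : sqint leb f.
  split => //; apply: ge0_intbleP => //; first exact: measurable_funX.
  by move=> s; exact: sqr_ge0.
have [_ f2] := fsq.
rewrite -[X in (_ <= _ * X)%E](RintE f2) -EFinM lee_fin rE -[X in _ <= X * _]It.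
exact: cauchy_schwarz.
Qed.

End time_cauchy_schwarz.

Section stability.
Context {R : realType} {d n : nat}.
Local Notation V := 'rV[R]_d.
Local Notation mu := (@lebesgue_rV R d).
Local Notation leb := (@lebesgue_measure R).
Variables (v : 'I_n.+1 -> V) (w : 'I_n.+1 -> R) (cs nu eps : R) (m : nat).
Hypothesis iso : isotropic_lattice v w cs.
Hypothesis eps0 : 0 < eps.
Hypothesis nu0 : 0 < nu.
Hypothesis dm : (d <= m)%N.
Local Notation rho := (eps^-1).
Implicit Types (st : 'I_n.+1 -> V -> R) (xi x : V).
Local Notation bl := (bl eps).
Local Notation nrm := (nrm w m).
Local Notation ysq := (ysq w m).
Local Notation fieldH := (fieldH v w cs nu eps).
Local Notation rhs := (lbgk_rhs v w cs nu eps).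
Local Notation sol := (lbgk_solution v w cs nu eps m).

Let w0 i : 0 < w i. Proof. by case: iso. Qed.

Lemma lbgk_solution_hartP T f0 g : sol T f0 g -> exists2 G : R -> 'I_n.+1 -> V -> R,
  forall t, bl (G t) & forall t, 0 <= t <= T -> g t = hart (G t).
Proof.
move=> sg; have /choice[G hG] : forall t, exists st, bl st /\ cutoffs eps (g t) = hart st.
  by move=> t; have [st b1 b2] := cutoffs_hartP eps (g t); exists st.
exists G => t; first by case: (hG t).
by move=> tT; rewrite (sol_cutoff sg tT); case: (hG t).
Qed.

Lemma lbgk_solution_init T f0 g : 0 <= T -> sol T f0 g -> g 0 = cutoffs eps f0.
Proof.
by move=> T0 sg; rewrite -(sol_init sg); apply: (sol_cutoff sg); rewrite lexx.
Qed.

Section difference.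
Variables (T N C : R) (f0 f0' : 'I_n.+1 -> V -> R) (g g' : R -> 'I_n.+1 -> V -> R).
Variables (G G' : R -> 'I_n.+1 -> V -> R).
Hypotheses (T0 : 0 <= T) (C0 : 0 <= C) (N0 : 0 <= N).
Hypotheses (sg : sol T f0 g) (sg' : sol T f0' g').
Hypotheses (bG : forall t, bl (G t)) (bG' : forall t, bl (G' t)).
Hypothesis gG : forall t, 0 <= t <= T -> g t = hart (G t).
Hypothesis gG' : forall t, 0 <= t <= T -> g' t = hart (G' t).
Hypothesis nG : forall t, 0 <= t <= T -> nrm (G t) <= N.
Hypothesis nG' : forall t, 0 <= t <= T -> nrm (G' t) <= N.
Hypothesis lipC : forall st st', bl st -> bl st' -> nrm st <= N -> nrm st' <= N ->
  forall i, l2sq (fun xi => fieldH 1 st i xi - fieldH 1 st' i xi) <=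
    C * zsq (fun j xi => st j xi - st' j xi).

Let D t j xi := G t j xi - G' t j xi.
Let bD t : bl (D t). Proof. exact: blB. Qed.
Let z t := zsq (D t).
(** Extended by 0 outside [0, T], so as to be jointly measurable on the whole product. *)
Let r i (p : R * V) : R := if 0 <= p.1 <= T then rhs (g p.1) i p.2 - rhs (g' p.1) i p.2 else 0.

Let diffE t i x : 0 <= t <= T -> g t i x - g' t i x = hartley (D t i) x.
Proof.
move=> tT; rewrite gG// gG'// /hart -hartleyB//.
- exact: bandl_intble (bG t i).
- exact: bandl_intble (bG' t i).
Qed.

Let rE i s x : 0 <= s <= T -> r i (s, x) =
  hartley (fun xi => fieldH 1 (G s) i xi - fieldH 1 (G' s) i xi) x.
Proof.
move=> sT; rewrite /r /= sT gG// gG'// !lbgk_rhs_hart// -hartleyB//.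
- exact: bandl_intble (bandl_fieldH v w cs nu 1 i (bG s)).
- exact: bandl_intble (bandl_fieldH v w cs nu 1 i (bG' s)).
Qed.

Let ir i x t : t <= T -> leb.-integrable `[0, t] (EFin \o (fun s => r i (s, x))).
Proof.
move=> tT; have mt : measurable (`[0, t] : set (measurableTypeR R)) by exact: measurable_itv.
have mT : measurable (`[0, T] : set (measurableTypeR R)) by exact: measurable_itv.
have tTs : `[0, t] `<=` `[0, T] by apply: subset_itvl; rewrite bnd_simp.
have i1 := integrableS mT mt tTs (sol_integrable sg i x).
have i2 := integrableS mT mt tTs (sol_integrable sg' i x).
apply: eq_integrable (integrableB mt i1 i2) => // s.
rewrite inE/= in_itv/= => /andP[s0 st].
by rewrite /r /= s0 (le_trans st tT) EFinB.
Qed.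

(** A Caratheodory function: measurable in time by the integrability clause of a solution,
    continuous in space as a Hartley transform. *)
Let mr i : measurable_fun [set: measurableTypeR R * V] (r i).
Proof.
rewrite (_ : r i = fun p => (fun s x => r i (s, x)) p.1 p.2); last by apply/funext => -[].
apply: (@measurable_continuous_rV R _ (measurableTypeR R) d (fun s x => r i (s, x))) => [x|s].
  have mT : measurable (`[0, T] : set (measurableTypeR R)) by exact: measurable_itv.
  have /integrableP[/measurable_EFinP + _] := ir i x (lexx T).
  move=> /(measurable_restrictT _ mT); apply: eq_measurable_fun => s _.
  by rewrite patchE mem_setE in_itv/=; case: ifP => // sT; rewrite /r/= sT.
case: (boolP (0 <= s <= T)) => sT.
  rewrite (_ : (fun x => _) = hartley (fun xi => fieldH 1 (G s) i xi - fieldH 1 (G' s) i xi)).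
    apply: (@continuous_hartley R d rho); apply: bandlB; exact: bandl_fieldH.
  by apply/funext => x; rewrite rE.
have -> : (fun x => r i (s, x)) = (fun=> 0).
  by apply/funext => x; rewrite /r/= (negbTE sT).
exact: cst_continuous.
Qed.

Let evol t i x : 0 <= t <= T ->
  hartley (D t i) x = hartley (D 0 i) x + eps^-1 * \int[leb]_(s in `[0, t]) r i (s, x).
Proof.
move=> tT; have /andP[t0 tT'] := tT; have zT : (0 : R) <= 0 <= T by rewrite lexx.
rewrite -diffE// -diffE// (lbgk_solution_init T0 sg) (lbgk_solution_init T0 sg').
have e1 := sol_equation sg tT i x; have e2 := sol_equation sg' tT i x.
have c1 : cutoff eps (g t i) = g t i by have := congr1 (fun f => f i) (sol_cutoff sg tT).
have c2 : cutoff eps (g' t i) = g' t i by have := congr1 (fun f => f i) (sol_cutoff sg' tT).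
rewrite c1 in e1; rewrite c2 in e2.
have mt : measurable (`[0, t] : set (measurableTypeR R)) by exact: measurable_itv.
have mT : measurable (`[0, T] : set (measurableTypeR R)) by exact: measurable_itv.
have tTs : `[0, t] `<=` `[0, T] by apply: subset_itvl; rewrite bnd_simp.
have i1 := integrableS mT mt tTs (sol_integrable sg i x).
have i2 := integrableS mT mt tTs (sol_integrable sg' i x).
have -> : \int[leb]_(s in `[0, t]) r i (s, x) =
    \int[leb]_(s in `[0, t]) rhs (g s) i x - \int[leb]_(s in `[0, t]) rhs (g' s) i x.
  apply: etrans (RintegralB mt i1 i2).
  apply: eq_Rintegral => s; rewrite inE/= in_itv/= => /andP[s0 st].
  by rewrite /r/= s0 (le_trans st tT').
have h (a b c c' I J : R) : eps * (a - c) = I -> eps * (b - c') = J ->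
    a - b = c - c' + eps^-1 * (I - J).
  by move=> <- <-; rewrite -mulrBr mulKf ?gt_eqF//; ring.
exact: h e1 e2.
Qed.

Let zE t : (z t)%:E = (\sum_i \int[mu]_x (hartley (D t i) x ^+ 2)%:E)%E.
Proof.
rewrite /z /zsq -sumEFin; apply: eq_bigr => i _.
by rewrite (plancherel_hartley (bandl_intble (bD t i)))//; case: (bD t i).
Qed.

Let z_bound t : 0 <= t <= T -> z t <= winv w * (2 * N) ^+ 2.
Proof.
move=> tT; apply: (le_trans (zsq_le_ysq m iso (bD t))); rewrite ler_wpM2l ?(winv_ge0 iso)//.
rewrite -(sqr_nrm m iso); apply: lerXn2r; rewrite ?nnegrE ?nrm_ge0 ?mulr_ge0//.
rewrite (_ : D t = fun j xi => G t j xi + (-1) * G' t j xi); last first.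
  by apply/funext => j; apply/funext => xi; rewrite /D mulN1r.
apply: (le_trans (nrmD m iso (bG t) (blZ _ (bG' t)))).
rewrite (nrmZ w m _ (bG' t)) normrN1 mul1r.
by have := nG tT; have := nG' tT; lra.
Qed.

Let mHart t i : measurable_fun setT (fun x => hartley (D t i) x ^+ 2).
Proof.
by apply: measurable_funX; apply: measurable_hartley; exact: intble_measurable (bandl_intble (bD t i)).
Qed.

Let K : R := 2 * eps ^- 2 * T.

Let K0 : 0 <= K. Proof. by rewrite /K; nonneg. Qed.

(** Carried out in physical space, where the integrated equation is given, with Plancherel applied
    at each time. Inside the time integral [z] is replaced by its exponential majorant, so that its
    measurability never has to be discussed. *)
Let step (S lambda : R) t i : 0 <= S -> (forall s, 0 <= s <= T -> z s <= S * expR (lambda * s)) ->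
  0 <= t <= T -> (\int[mu]_x (hartley (D t i) x ^+ 2)%:E <= 2%:E * \int[mu]_x (hartley (D 0 i) x ^+ 2)%:E +
   (K * (C * S * tint (fun s => expR (lambda * s)) t))%:E)%E.
Proof.
move=> S0 zS tT; have /andP[t0 tT'] := tT.
pose q (p : R * V) : \bar R := (((0 <= p.1 <= t)%R%:R * r i p) ^+ 2)%:E.
have mq : measurable_fun [set: measurableTypeR R * V] q.
  apply/measurable_EFinP; apply: measurable_funX; apply: measurable_funM; last exact: mr.
  exact: (measurableT_comp (measurable_indic_itv t) measurable_fst).
have q0 p : (0 <= q p)%E by rewrite lee_fin sqr_ge0.
pose qx x : \bar R := (\int[leb]_s q (s, x))%E.
have mqx : measurable_fun setT qx.
  apply: (@measurable_integral_param _ _ V (measurableTypeR R) R leb (fun p => q (p.2, p.1))).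
  apply: (measurableT_comp mq (g := fun p : V * measurableTypeR R => (p.2, p.1))).
  by apply: measurable_fun_pair; [exact: measurable_snd|exact: measurable_fst].
have qx0 x : (0 <= qx x)%E by exact: integral_ge0.
have pt x : ((hartley (D t i) x ^+ 2)%:E <=
    2%:E * (hartley (D 0 i) x ^+ 2)%:E + K%:E * qx x)%E.
  rewrite (evol i x tT); set a := hartley _ x; set b := \int[leb]_(s in _) _.
  have h : (a + rho * b) ^+ 2 <= 2 * a ^+ 2 + 2 * eps ^- 2 * b ^+ 2.
    have := sqr_ge0 (a - rho * b); rewrite -exprVn.
    by rewrite (_ : 2 * rho ^+ 2 * b ^+ 2 = 2 * (rho * b) ^+ 2); [nra|ring].
  apply: (@le_trans _ _ (2 * a ^+ 2 + 2 * eps ^- 2 * b ^+ 2)%:E); first by rewrite lee_fin.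
  rewrite EFinD EFinM leeD2l// [K]/(2 * eps ^- 2 * T) !EFinM -[X in (_ <= X)%E]muleA.
  have e2 : 0 <= 2 * eps ^- 2 by nonneg.
  rewrite -EFinM; apply: lee_wpmul2l; first by rewrite lee_fin.
  apply: (le_trans (sqr_Rint_seg t0 (ir i x tT'))).
  by apply: lee_wpmul2r; [exact: qx0|rewrite lee_fin].
apply: (@le_trans _ _ (\int[mu]_x (2%:E * (hartley (D 0 i) x ^+ 2)%:E + K%:E * qx x))%E).
  apply: ge0_le_integral => //.
  - by move=> x _; rewrite lee_fin sqr_ge0.
  - exact/measurable_EFinP.
  - by apply: emeasurable_funD; apply: measurable_funeM => //; exact/measurable_EFinP.
rewrite ge0_integralD//; first last.
- exact: measurable_funeM.
- by move=> x _; rewrite mule_ge0 ?lee_fin.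
- by apply: measurable_funeM; exact/measurable_EFinP.
- by move=> x _; rewrite mule_ge0 ?lee_fin ?sqr_ge0.
rewrite ge0_integralZl_EFin//; first last.
- exact/measurable_EFinP.
- by move=> x _; rewrite lee_fin sqr_ge0.
rewrite ge0_integralZl_EFin//; apply: leeD2l.
rewrite (EFinM K); apply: lee_wpmul2l; first by rewrite lee_fin.
have -> : (\int[mu]_x qx x = \int[leb]_s \int[mu]_x q (s, x))%E.
  by have := fubini_tonelli (m1 := leb) (m2 := mu) q mq q0 => ->.
have mz : measurable_fun [set: measurableTypeR R] (fun s => \int[mu]_x q (s, x))%E.
  exact: (@measurable_integral_param _ _ (measurableTypeR R) V R mu q).
have ce : continuous (fun s : R => expR (lambda * s)) by exact: continuous_expR_mul.
have ie := intble_continuous_seg t (continuousM_fun (@continuous_cst_fun R (C * S)) ce).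
rewrite -tintZ// tint_indic RintE//; apply: ge0_le_integral => //.
- by move=> s _; exact: integral_ge0.
- by apply/measurable_EFinP; exact: intble_measurable ie.
move=> s _; rewrite /q/=; case: (boolP (0 <= s <= t)) => [/andP[s0 st]|_]; last first.
  by rewrite mul0r; under eq_integral do rewrite mul0r expr0n; rewrite integral0.
have sT : 0 <= s <= T by rewrite s0 (le_trans st tT').
under eq_integral do rewrite mul1r rE//.
have bQ := bandlB (bandl_fieldH v w cs nu 1 i (bG s)) (bandl_fieldH v w cs nu 1 i (bG' s)).
rewrite (plancherel_hartley (bandl_intble bQ)) ?lee_fin; last by case: bQ.
apply: (le_trans (lipC (bG s) (bG' s) (nG sT) (nG' sT) i)).
by rewrite mul1r -mulrA ler_wpM2l// zS.
Qed.

Lemma zsq_gronwall t : 0 <= t <= T ->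
  zsq (D t) <= 4 * zsq (D 0) * expR ((2 * (K * n.+1%:R * C) + 1) * T).
Proof.
set lambda := 2 * (K * n.+1%:R * C) + 1.
have KC : 0 <= K * n.+1%:R * C by apply: mulr_ge0 => //; apply: mulr_ge0 => //; exact: ler0n.
have l0 : 0 < lambda by rewrite /lambda; lra.
(* Weighted in time, the supremum absorbs the integral term: solutions are only known to
   be bounded and to satisfy the integrated equation. *)
pose Z := [set z t * expR (- (lambda * t)) | t in `[0, T]].
have z_ge0 s : 0 <= z s by exact: zsq_ge0.
have hs : has_sup Z.
  split; first by exists (z 0 * expR (- (lambda * 0))), 0 => //=; rewrite in_itv/= lexx.
  exists (winv w * (2 * N) ^+ 2) => _ [s /= + <-]; rewrite in_itv/= => sT.
  rewrite (le_trans _ (z_bound sT))// ler_piMr// -expR0 ler_expR oppr_le0 mulr_ge0 ?(ltW l0)//.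
  by case/andP: sT.
pose S := sup Z.
have zS s : 0 <= s <= T -> z s <= S * expR (lambda * s).
  move=> sT; rewrite -ler_pdivrMr ?expR_gt0// -expRN; apply: sup_upper_bound => //.
  by exists s => //=; rewrite in_itv.
have zT : (0 : R) <= 0 <= T by rewrite lexx.
have S0 : 0 <= S.
  have := zS 0 zT; rewrite mulr0 expR0 mulr1; exact: le_trans.
have bound s : 0 <= s <= T -> z s <= 2 * z 0 + 2^-1 * S * expR (lambda * s).
  move=> sT; have /andP[s0 _] := sT.
  apply: (@le_trans _ _ (2 * z 0 + n.+1%:R * (K * (C * S * tint (fun s => expR (lambda * s)) s)))).
    rewrite -lee_fin zE EFinD EFinM zE.
    rewrite ge0_sume_distrr; last by move=> i _; apply: integral_ge0 => x _; rewrite lee_fin sqr_ge0.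
    rewrite (_ : (n.+1%:R * (K * (C * S * tint (fun s => expR (lambda * s)) s)))%:E =
      (\sum_(i < n.+1) (K * (C * S * tint (fun s => expR (lambda * s)) s))%:E)%E); last first.
      by rewrite sumEFin sumr_const card_ord mulr_natl.
    by rewrite -big_split/=; apply: lee_sum => i _; exact: step.
  (* The time integral of the exponential gains 1 / lambda, and [lambda] was chosen so that the
     product of the constants is at most 1/2. *)
  rewrite lerD2l tint_expR ?gt_eqF//.
  set e := expR (lambda * s); have e1 : 0 <= e by exact: expR_ge0.
  rewrite (_ : _ * _ = (K * n.+1%:R * C) / lambda * (S * (e - 1))); last by ring.
  rewrite -[X in _ <= X]mulrA; apply: ler_pM.
  - by rewrite divr_ge0// ltW.
  - by rewrite mulr_ge0// subr_ge0 /e -expR0 ler_expR mulr_ge0// ltW.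
  - by rewrite ler_pdivrMr// /lambda; lra.
  - by rewrite ler_wpM2l//; lra.
(* Half of [S] is absorbed on the left, which turns the factor 2 into 4. *)
have S4 : S <= 4 * z 0.
  suff : S <= 2 * z 0 + 2^-1 * S by lra.
  apply: sup_le_ub; first by case: hs.
  move=> _ [s /= + <-]; rewrite in_itv/= => sT; have /andP[s0 _] := sT.
  apply: (le_trans (ler_wpM2r (expR_ge0 _) (bound s sT))).
  rewrite mulrDl -[X in _ + X <= _]mulrA -expRD subrr expR0 mulr1 lerD2r.
  by rewrite ler_piMr ?mulr_ge0// -expR0 ler_expR oppr_le0 mulr_ge0 ?(ltW l0)//.
move=> tT; apply: (le_trans (zS t tT)).
apply: (@le_trans _ _ (4 * z 0 * expR (lambda * t))); first by rewrite ler_wpM2r ?expR_ge0.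
rewrite ler_wpM2l ?mulr_ge0// ler_expR ler_wpM2l ?(ltW l0)//; by case/andP: tT.
Qed.

End difference.

Lemma nrm_le_of_kinetic st (N : R) : bl st -> 0 <= N ->
  (kinetic_sqnorm w m (hart st) <= (N ^+ 2)%:E)%E -> nrm st <= N.
Proof.
move=> bs N0; rewrite (kinetic_sqnorm_hart _ _ bs) lee_fin -(sqr_nrm m iso).
by rewrite ler_pXn2r// nnegrE ?nrm_ge0.
Qed.

Lemma hartB st st' : bl st -> bl st' ->
  (fun i x => hart st i x - hart st' i x) = hart (fun i xi => st i xi - st' i xi).
Proof.
move=> b1 b2; apply/funext => i; apply/funext => x; rewrite /hart -hartleyB//.
- exact: bandl_intble (b1 i).
- exact: bandl_intble (b2 i).
Qed.

(** [K] depends on a common bound [N] of both solutions, so uniform bounds must be secured before it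
    is applied. *)
Lemma lbgk_stability (T N : R) : 0 <= T -> 0 <= N -> exists2 K : R, 0 <= K &
  forall f0 f0' g g', sol T f0 g -> sol T f0' g' ->
  (forall t, 0 <= t <= T -> (kinetic_sqnorm w m (g t) <= (N ^+ 2)%:E)%E) ->
  (forall t, 0 <= t <= T -> (kinetic_sqnorm w m (g' t) <= (N ^+ 2)%:E)%E) ->
  forall t, 0 <= t <= T -> (kinetic_sqnorm w m (fun i x => g t i x - g' t i x)%R <=
    K%:E * kinetic_sqnorm w m (fun i x => cutoff eps (f0 i) x - cutoff eps (f0' i) x)%R)%E.
Proof.
move=> T0 N0; have [C C0 lipC] := l2sq_field_lip m iso eps0 nu0 N0.
set L := expR ((2 * (2 * eps ^- 2 * T * n.+1%:R * C) + 1) * T).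
set W := (1 + rho ^+ 2) ^+ m; have W0 : 0 <= W by rewrite /W; nonneg.
have L0 : 0 <= L by exact: expR_ge0.
have wi := winv_ge0 iso.
exists (W * (4 * winv w * L)); first by nonneg.
move=> f0 f0' g g' sg sg' gN g'N t tT.
have [G bG gG] := lbgk_solution_hartP sg; have [G' bG' gG'] := lbgk_solution_hartP sg'.
have T00 : (0 : R) <= 0 <= T by rewrite lexx.
rewrite -[X in (_ <= _ * X)%E]/(kinetic_sqnorm w m (fun i x => cutoffs eps f0 i x - cutoffs eps f0' i x)%R).
rewrite -(lbgk_solution_init T0 sg) -(lbgk_solution_init T0 sg') !gG// !gG'// !hartB//.
rewrite (kinetic_sqnorm_hart _ _ (blB (bG t) (bG' t))) (kinetic_sqnorm_hart _ _ (blB (bG 0) (bG' 0))).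
rewrite -EFinM lee_fin.
have nG s : 0 <= s <= T -> nrm (G s) <= N.
  by move=> sT; apply: nrm_le_of_kinetic => //; rewrite -gG//; exact: gN.
have nG' s : 0 <= s <= T -> nrm (G' s) <= N.
  by move=> sT; apply: nrm_le_of_kinetic => //; rewrite -gG'//; exact: g'N.
have h := zsq_gronwall T0 C0 N0 sg sg' bG bG' gG gG' nG nG' lipC tT.
rewrite -/L in h.
have := ysq_le_zsq m iso (blB (bG t) (bG' t)); move/le_trans; apply.
rewrite -[leRHS]mulrA ler_wpM2l//; apply: (le_trans h).
rewrite [leRHS]mulrAC; apply: ler_wpM2r => //; rewrite -[leRHS]mulrA; apply: ler_wpM2l => //.
exact: (zsq_le_ysq m iso (blB (bG 0) (bG' 0))).
Qed.

Lemma hartley_eq0 (a : V -> R) : bandl rho a -> l2sq a = 0 -> hartley a = fun=> 0.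
Proof.
move=> ba a0; have ia := bandl_intble ba; have [as_ _] := ba.
have hs := sqint_hartley ia as_.
apply: continuous_sqr_int0 => //; first exact: continuous_hartley ba.
move=> N; apply/eqP; rewrite eq_le Rint_ge0 ?andbT; last by move=> x; exact: sqr_ge0.
have [_ hi] := hs; have [_ ci] := sqint_ballcut N%:R hs.
suff <- : \int[mu]_x (hartley a x ^+ 2) = 0.
  apply: le_Rint => // x; rewrite /ballcut; case: ifP => // _.
  by rewrite expr0n sqr_ge0.
by apply: EFin_inj; rewrite (RintE hi) (plancherel_hartley ia as_) -/(l2sq a) a0.
Qed.

Lemma hart_eq0 st : bl st -> kinetic_sqnorm w m (hart st) = 0%E -> hart st = fun=> fun=> 0.
Proof.
move=> bs; rewrite (kinetic_sqnorm_hart _ _ bs) => -[y0]; apply/funext => i; apply: hartley_eq0 => //.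
have := zsq_le_ysq m iso bs; rewrite y0 mulr0 => z0.
apply/eqP; rewrite eq_le l2sq_ge0 andbT; apply: le_trans z0.
by rewrite /zsq (bigD1 i)//= lerDl; apply: sumr_ge0 => j _; exact: l2sq_ge0.
Qed.

End stability.

(** * Existence, uniqueness, continuous dependence and energy *)

Section well_posedness.
Context {R : realType} {d n : nat}.
Local Notation V := 'rV[R]_d.
Local Notation leb := (@lebesgue_measure R).
Variables (v : 'I_n.+1 -> V) (w : 'I_n.+1 -> R) (cs nu eps : R) (m : nat).
Hypothesis iso : isotropic_lattice v w cs.
Hypothesis eps0 : 0 < eps.
Hypothesis nu0 : 0 < nu.
Hypothesis dm : (d <= m)%N.
Implicit Types (st : 'I_n.+1 -> V -> R).
Local Notation bl := (bl eps).
Local Notation ysq := (ysq w m).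
Local Notation nrm := (nrm w m).
Local Notation kin := (kinetic_sqnorm w m).
Local Notation sol := (lbgk_solution v w cs nu eps m).
Local Notation k := (growth_cst v cs nu m).

Lemma kinetic_relaxation st : bl st ->
  kin (fun i x => equilibrium v w cs eps (hart st) i x - hart st i x)%R =
  (defect v w cs eps m 1 st)%:E.
Proof.
move=> bs; rewrite (_ : (fun i x => _) = hart (fun i xi => eqH v w cs eps 1 st i xi - st i xi)).
  by rewrite (@kinetic_sqnorm_hart _ _ _ _ eps)// => i; apply: bandlB => //; exact: bandl_eqH.
apply/funext => i; apply/funext => x; rewrite equilibrium_hart// /hart -hartleyB//.
- exact: bandl_intble (bandl_eqH v w cs 1 i bs).
- exact: bandl_intble (bs i).
Qed.

Lemma lbgk_existence f0 st0 E T : bl st0 -> cutoffs eps f0 = hart st0 -> 0 < E -> ysq st0 <= E ->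
  0 <= T -> 4 * k * T * E < 1 -> exists g, [/\ sol T f0 g,
    forall t, 0 <= t <= T -> (kin (g t) <= (2 * E)%:E)%E &
    ((eps ^- 2)%:E * \int[leb]_(s in `[0%R, T])
       kin (fun i x => equilibrium v w cs eps (g s) i x - g s i x)%R <= (nu * (2 * E))%:E)%E].
Proof.
move=> b0 f0E E0 yE T0 small.
have [A [B [D [bAB dAB eA yA [cD DE eD]]]]] := hartley_solution iso eps0 nu0 dm b0 E0 yE T0 small.
have bA t : bl (A t) by case: (bAB t).
have le2 : E * (1 + 4 * k * T * E) <= 2 * E by rewrite mulrC ler_wpM2r ?(ltW E0)//; lra.
exists (fun t => hart (A t)); split.
- exact: lbgk_solution_hart b0 f0E bAB dAB eA yA.
- move=> t /yA[h _]; rewrite (kinetic_sqnorm_hart _ _ (bA t)) lee_fin; exact: le_trans h le2.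
have -> : (\int[leb]_(s in `[0%R, T])
    kin (fun i x => equilibrium v w cs eps (hart (A s)) i x - hart (A s) i x)%R)%E = (tint D T)%:E.
  rewrite /tint /Rintegral fineK.
    apply: eq_integral => s; rewrite inE/= in_itv/= => sT.
    by rewrite kinetic_relaxation// DE.
  by apply: integrable_fin_num; [exact: measurable_itv|exact: continuous_integrable].
rewrite -EFinM lee_fin -ler_pdivrMl//.
by apply: le_trans le2; apply: le_trans eD; rewrite mulrA -(invfM nu) (mulrC nu).
Qed.

Lemma sol_bound T f0 g : 0 <= T -> sol T f0 g -> exists2 N : R, 0 <= N &
  forall t, 0 <= t <= T -> forall N', N <= N' -> (kin (g t) <= (N' ^+ 2)%:E)%E.
Proof.
move=> T0 sg; have [M gM] := sol_bounded sg.
exists (`|M| + 1); first by rewrite addr_ge0.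
move=> t tT N' MN; apply: (le_trans (gM t tT)); rewrite lee_fin.
by have := ler_norm M; have := normr_ge0 M; nra.
Qed.

(** Stability with equal data: two solutions always have a common bound, and the right-hand side is
    0. *)
Lemma lbgk_unique T f0 g g' : 0 <= T -> sol T f0 g -> sol T f0 g' ->
  forall t, 0 <= t <= T -> g t = g' t.
Proof.
move=> T0 sg sg' t tT.
have [N1 N10 gN] := sol_bound T0 sg; have [N2 N20 gN'] := sol_bound T0 sg'.
have N0 : 0 <= N1 + N2 by rewrite addr_ge0.
have [K K0 stab] := lbgk_stability m iso eps0 nu0 T0 N0.
have [G bG gG] := lbgk_solution_hartP sg; have [G' bG' gG'] := lbgk_solution_hartP sg'.
have := stab _ _ _ _ sg sg' _ _ t tT.
rewrite (gG t tT) (gG' t tT) (hartB (bG t) (bG' t)).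
rewrite (_ : (fun i x => cutoff eps (f0 i) x - cutoff eps (f0 i) x) =
  hart (fun i (xi : V) => G 0 i xi - G 0 i xi)); last first.
  rewrite -(hartB (bG 0) (bG 0)).
  by apply/funext => i; apply/funext => x; rewrite !subrr.
rewrite (_ : kin (hart (fun i xi => G 0 i xi - G 0 i xi)) = 0%E); last first.
  rewrite (kinetic_sqnorm_hart _ _ (blB (bG 0) (bG 0))) /Submission.ysq big1// => i _.
  by rewrite /wsq /Rintegral integral0_eq ?mulr0// => xi _; rewrite subrr expr0n mulr0.
rewrite mule0 => h.
have bD := blB (bG t) (bG' t).
have : hart (fun i xi => G t i xi - G' t i xi) = fun=> fun=> 0.
  apply: (hart_eq0 (m := m) iso bD); apply/eqP; rewrite eq_le h//=.
  - by rewrite (kinetic_sqnorm_hart _ _ bD) lee_fin (ysq_ge0 m iso).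
  - by move=> s sT; apply: gN => //; rewrite lerDl.
  - by move=> s sT; apply: gN' => //; rewrite lerDr.
rewrite -(hartB (bG t) (bG' t)) => e; apply/funext => i; apply/funext => x.
by apply/eqP; rewrite -subr_eq0; apply/eqP; have := congr1 (fun f => f i x) e.
Qed.

Lemma ysq_triangle st st' : bl st -> bl st' ->
  ysq st' <= 2 * ysq st + 2 * ysq (fun i xi => st' i xi - st i xi).
Proof.
move=> b b'; rewrite -!(sqr_nrm m iso).
have := nrmD m iso (blB b' b) b.
rewrite (_ : (fun i xi => _ + _) = st'); last first.
  by apply/funext => i; apply/funext => xi; rewrite subrK.
have := nrm_ge0 w m st'; set a := nrm st'; set p := nrm _; set q := nrm st.
by move=> ? ?; have := sqr_ge0 (p - q); nra.
Qed.

(** Data at squared distance less than [eta0] have energy at most [E], so they admit a solution up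
    to the same time. By uniqueness every perturbed solution obeys the bound of the constructed one,
    which makes the stability constant independent of the perturbation. *)
Lemma lbgk_continuous_dependence T f0 st0 eta0 g :
  bl st0 -> cutoffs eps f0 = hart st0 -> 0 < eta0 -> 0 <= T ->
  4 * k * T * (2 * ysq st0 + 2 * eta0) < 1 -> sol T f0 g ->
  forall e, 0 < e -> exists2 eta, 0 < eta & forall f0',
    (kin (fun i x => cutoff eps (f0' i) x - cutoff eps (f0 i) x)%R < eta%:E)%E ->
    (exists g', sol T f0' g') /\
    forall g', sol T f0' g' -> forall t, 0 <= t <= T ->
      (kin (fun i x => g' t i x - g t i x)%R <= e%:E)%E.
Proof.
move=> b0 f0E eta00 T0; set E := 2 * ysq st0 + 2 * eta0 => small sg e e0.
have y0 : 0 <= ysq st0 by exact: (ysq_ge0 m iso).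
have E0 : 0 < E by rewrite /E; lra.
(* [2 * E + 1] avoids a square root: its square dominates the energy bound [2 * E]. *)
have N0 : 0 <= 2 * E + 1 by lra.
have [K K0 stab] := lbgk_stability m iso eps0 nu0 T0 N0.
have [h [sh hE _]] : exists h, [/\ sol T f0 h,
    forall t, 0 <= t <= T -> (kin (h t) <= (2 * E)%:E)%E & True].
  have yE : ysq st0 <= E by rewrite /E; lra.
  by have [h [? ? _]] := lbgk_existence b0 f0E E0 yE T0 small; exists h.
have N2 : 2 * E <= (2 * E + 1) ^+ 2 by nra.
exists (Num.min eta0 (e / (K + 1))).
  by rewrite lt_min eta00 divr_gt0//; lra.
move=> f0' lt_eta; have [st0' b0' f0E'] := cutoffs_hartP eps f0'.
have dE : (fun i x => cutoff eps (f0' i) x - cutoff eps (f0 i) x) =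
    hart (fun i xi => st0' i xi - st0 i xi).
  by rewrite -(hartB b0' b0) -f0E -f0E'.
have bD := blB b0' b0.
move: lt_eta; rewrite dE (kinetic_sqnorm_hart _ _ bD) lte_fin lt_min => /andP[lt1 lt2].
have yE' : ysq st0' <= E by have := ysq_triangle b0 b0'; rewrite /E; lra.
have [h' [sh' hE' _]] := lbgk_existence b0' f0E' E0 yE' T0 small.
split; first by exists h'.
move=> g' sg' t tT.
have b1 s : 0 <= s <= T -> (kin (g s) <= ((2 * E + 1) ^+ 2)%:E)%E.
  by move=> sT; rewrite (lbgk_unique T0 sg sh sT) (le_trans (hE s sT))// lee_fin.
have b2 s : 0 <= s <= T -> (kin (g' s) <= ((2 * E + 1) ^+ 2)%:E)%E.
  by move=> sT; rewrite (lbgk_unique T0 sg' sh' sT) (le_trans (hE' s sT))// lee_fin.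
apply: (le_trans (stab _ _ _ _ sg' sg b2 b1 t tT)).
rewrite dE (kinetic_sqnorm_hart _ _ bD) -EFinM lee_fin.
move: lt2; rewrite ltr_pdivlMr; last by lra.
have := ysq_ge0 m iso (fun i xi => st0' i xi - st0 i xi); nra.
Qed.

(** Proved for the constructed solution; by uniqueness the norms and the integrands agree at each
    time with those of the given one. *)
Lemma lbgk_energy T f0 st0 E g : bl st0 -> cutoffs eps f0 = hart st0 -> 0 < E ->
  ysq st0 <= E -> 0 <= T -> 4 * k * T * E < 1 -> sol T f0 g ->
  (ereal_sup [set kin (g t) | t in `[0%R, T]] + (eps ^- 2)%:E * \int[leb]_(s in `[0%R, T])
    kin (fun i x => equilibrium v w cs eps (g s) i x - g s i x)%R <=
   ((1 + nu) * (2 * E))%:E)%E.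
Proof.
move=> b0 f0E E0 yE T0 small sg.
have [h [sh hE he]] := lbgk_existence b0 f0E E0 yE T0 small.
rewrite mulrDl mul1r EFinD; apply: leeD.
  apply: ge_ereal_sup => _ [t /= + <-]; rewrite in_itv/= => tT.
  by rewrite (lbgk_unique T0 sg sh tT) hE.
apply: le_trans he; apply: lee_wpmul2l; first by rewrite lee_fin; nonneg.
suff /eqP : (\int[leb]_(s in `[0%R, T]) kin (fun i x => equilibrium v w cs eps (g s) i x - g s i x)%R =
    \int[leb]_(s in `[0%R, T]) kin (fun i x => equilibrium v w cs eps (h s) i x - h s i x)%R)%E.
  rewrite eq_le => /andP[le_gh _]; exact: le_gh.
by apply: eq_integral => s; rewrite inE/= in_itv/= => sT; rewrite (lbgk_unique T0 sg sh sT).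
Qed.

End well_posedness.

(** Supplies the margins by which an energy bound may exceed that of the data without violating the
    smallness condition. *)
Lemma ltr_mul_small (R : realType) (a : R) : 0 < a -> forall e, 0 < e ->
  exists2 x, 0 < x <= e & a * x < 1.
Proof.
move=> a0 e e0; exists (Num.min e (2 * a)^-1).
  by rewrite lt_min e0 invr_gt0 mulr_gt0//= ge_min lexx.
apply: (@le_lt_trans _ _ (a * (2 * a)^-1)); first by rewrite ler_wpM2l ?(ltW a0)// ge_min lexx orbT.
by rewrite invfM mulrCA mulfV ?gt_eqF// mulr1; lra.
Qed.

Unset Implicit Arguments.

Theorem lemma2 (R : realType) (d n m : nat)
    (v : 'I_n.+1 -> 'rV[R]_d) (w : 'I_n.+1 -> R) (cs : R) :
  (2 <= d)%N -> (d < m)%N -> isotropic_lattice v w cs ->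
  exists2 c0 : R, 0 < c0 &
  forall nu : R, 0 < nu ->
  exists2 T_of : ('I_n.+1 -> 'rV[R]_d -> R) -> R, (forall h, 0 < T_of h) &
  forall eps : R, 0 < eps < 1 ->
  forall g0 : 'I_n.+1 -> 'rV[R]_d -> R, kinetic_sobolev m g0 ->
  let T0 := T_of (cutoffs eps g0) in
  let E0 := fine (kinetic_sqnorm w m (cutoffs eps g0)) in
  lbgk_well_posed v w cs nu eps m T0 g0 /\
  (forall g : R -> 'I_n.+1 -> 'rV[R]_d -> R,
    lbgk_solution v w cs nu eps m T0 g0 g ->
    [/\ g 0 = cutoffs eps g0,
        forall t : R, 0 <= t <= T0 -> g t = cutoffs eps (g t),
        0 < nu - c0 * T0 * E0 &
        (ereal_sup [set kinetic_sqnorm w m (g t) | t in `[0%R, T0]]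
         + (eps ^- 2)%:E * \int[lebesgue_measure]_(s in `[0%R, T0])
             kinetic_sqnorm w m (fun i x =>
               equilibrium v w cs eps (g s) i x - g s i x)%R
         <= ((nu + nu ^+ 2) * E0 / (nu - c0 * T0 * E0) - nu * E0)%:E)%E]).
Proof.
move=> d2 dm iso; have d0 : (0 < d)%N by exact: ltn_trans d2.
have qc := quad_cst_gt0 m iso d0; set c := quad_cst v cs m in qc.
have dm' := ltnW dm.
exists (12 * c); first by rewrite mulr_gt0.
move=> nu nu0.
(* With 16, the smallness quantity 4 k T E, where k is [growth_cst], equals 1/4, leaving room for
   the doubled energies of perturbed data. With 12 in [c0], the product c0 T E is 3/4 nu, so the
   denominator of the claim is nu / 4. For zero data any positive time will do. *)
pose T_of (h : 'I_n.+1 -> 'rV[R]_d -> R) : R :=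
  let E := fine (kinetic_sqnorm w m h) in if 0 < E then nu / (16 * c * E) else 1.
have T_of_gt0 h : 0 < T_of h.
  rewrite /T_of; case: ifP => [E0|_]; last exact: ltr01.
  by apply: divr_gt0 => //; apply: mulr_gt0 => //; apply: mulr_gt0.
exists T_of => // eps /andP[eps0 _] g0 _ /=.
have [st b0 gE] := cutoffs_hartP eps g0.
set T := T_of _; set E0 := fine _.
have yE : E0 = ysq w m st by rewrite /E0 gE (kinetic_sqnorm_hart _ _ b0).
have E00 : 0 <= E0 by rewrite yE (ysq_ge0 m iso).
have T0 : 0 < T by exact: T_of_gt0.
have k0 : 0 < 4 * growth_cst v cs nu m * T.
  by apply: mulr_gt0 => //; apply: mulr_gt0 => //; rewrite mulr_gt0 ?invr_gt0.
have kE : 4 * growth_cst v cs nu m * T * E0 <= 4^-1 /\ 12 * c * T * E0 <= 3 / 4 * nu.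
  have [E0'|E0'] := ltP 0 E0.
    have -> : T = nu / (16 * c * E0) by rewrite /T /T_of /= -/E0 E0'.
    rewrite /growth_cst -/c; split; rewrite le_eqVlt; apply/orP; left; apply/eqP; field;
      by rewrite ?gt_eqF.
  by have -> : E0 = 0 by [apply/le_anti/andP]; rewrite !mulr0; split; lra.
have [kE1 kE2] := kE.
have T0' := ltW T0.
split.
  have [eta /andP[eta0 _] small] := ltr_mul_small k0 ltr01.
  split.
  (* [lbgk_existence] asks for a positive energy bound, and [E0] may be 0. *)
  - have [E' /andP[E'0 _] small'] := ltr_mul_small k0 ltr01.
    have [|||g [sg _ _]] := lbgk_existence iso eps0 nu0 dm' b0 gE (E := E0 + E' / 2) _ _ T0'.
    + by lra.
    + by rewrite -yE; lra.
    + by rewrite mulrDr; lra.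
    by exists g.
  - by move=> g g' sg sg' t tT; exact: (lbgk_unique iso eps0 nu0 T0' sg sg' tT).
  move=> g sg e e0.
  (* Doubling [E0] uses at most 1/2 of the smallness condition and the margin [eta / 8] less than
     1/4. *)
  have [||eta' eta'0 H] := lbgk_continuous_dependence iso eps0 nu0 dm' b0 gE
    (eta0 := eta / 8) _ T0' _ sg e0.
  - by lra.
  - by rewrite -yE mulrDr; lra.
  by exists eta' => // f0' _; exact: H.
move=> g sg; split.
- exact: lbgk_solution_init T0' sg.
- by move=> t tT; exact: (sol_cutoff sg tT).
- by lra.
(* For zero data the claimed bound is 0; the energy estimate is applied with arbitrarily small
   [E]. *)
have [E0'|E0'] := ltP 0 E0; last first.
  have -> : E0 = 0 by [apply/le_anti/andP].
  rewrite !mulr0 mul0r subrr; apply/lee_addgt0Pr => e e0; rewrite add0e.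
  have e1 : 0 < e / (2 * (1 + nu)) by rewrite divr_gt0// mulr_gt0//; lra.
  have [E /andP[E'0 Ee] small] := ltr_mul_small k0 e1.
  have yE' : ysq w m st <= E by rewrite -yE; lra.
  apply: (le_trans (lbgk_energy iso eps0 nu0 dm' b0 gE E'0 yE' T0' small sg)).
  by move: Ee; rewrite ler_pdivlMr ?lee_fin; lra.
have yE' : ysq w m st <= E0 by rewrite -yE.
have small : 4 * growth_cst v cs nu m * T * E0 < 1 by lra.
apply: (le_trans (lbgk_energy iso eps0 nu0 dm' b0 gE E0' yE' T0' small sg)).
rewrite lee_fin.
(* The claimed bound becomes 4 (1 + nu) E0 - nu E0, which is at least the bound 2 (1 + nu) E0
   already proved. *)
have -> : 12 * c * T * E0 = 3 / 4 * nu.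
  have -> : T = nu / (16 * c * E0) by rewrite /T /T_of /= -/E0 E0'.
  by field; rewrite ?gt_eqF.
have -> : (nu + nu ^+ 2) * E0 / (nu - 3 / 4 * nu) = 4 * (1 + nu) * E0.
  have -> : nu - 3 / 4 * nu = nu / 4 by field.
  by field; rewrite gt_eqF.
by nra.
Qed.
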